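(* Let $d\ge2$, let $P\in\mathbb{C}[X_1,\dots,X_d]$ be a non-constant elliptic polynomial with $P(0)=0$, let $X\subseteq\mathbb{R}^d$ be open, and let $w\in C(X)$ and $\psi:X\to X$ be continuous such that $w$ does not vanish identically on any connected component of $X$, $\psi$ is locally injective, and $C_{w,\psi}:C_P^\infty(X)\to C_P^\infty(X)$, $f\mapsto w\cdot(f\circ\psi)$, is well-defined. (a) The following are equivalent. (i) $C_{w,\psi}$ is $m$-topologizable on $C_P^\infty(X)$. (ii) $C_{w,\psi}$ is topologizable on $C_P^\infty(X)$. (iii) $\psi$ has stable orbits. (b) The following are equivalent. (i) $C_{w,\psi}$ is power bounded on $C_P^\infty(X)$. (ii) $C_{w,\psi}$ is topologizable on $C_P^\infty(X)$ and $\{C_{w,\psi}^m(w):\ m\in\mathbb{N}\}$ is bounded in $C(X)$.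
   Context: For a polynomial $P(\xi)=\sum_{|\alpha|\le k}a_\alpha\xi^\alpha$ of degree $k$, $P(\partial)=\sum_{|\alpha|\le k}a_\alpha\partial^\alpha$; its principal part is $P_k(\xi)=\sum_{|\alpha|=k}a_\alpha\xi^\alpha$, and $P$ is elliptic if $P_k(\xi)\ne0$ for all $\xi\in\mathbb{R}^d\setminus\{0\}$. $C_P^\infty(X)=\{f\in C^\infty(X):\ P(\partial)f=0\text{ in }X\}$ (complex-valued functions), endowed with the topology induced by $C^\infty(X)$ (uniform convergence on compact sets of all partial derivatives); for elliptic $P$ this coincides with the compact-open topology. $C(X)$ is the space of continuous functions on $X$ with the compact-open topology (uniform convergence on compact sets). $\psi^m$ is the $m$-fold iterate of $\psi$. $\psi$ has stable orbits if for every compact $K\subseteq X$ there is a compact $L\subseteq X$ with $\psi^m(K)\subseteq L$ for all $m\in\mathbb{N}$. A continuous linear operator $T$ on a locally convex space $E$ is topologizable if for every continuous seminorm $p$ on $E$ there is a continuous seminorm $q$ on $E$ such that for every $m\in\mathbb{N}$ there is $\gamma_m>0$ with $p(T^m x)\le\gamma_m q(x)$ for all $x\in E$; $m$-topologizable if for every $p$ there are $q$ and $\gamma>0$ such that $p(T^m x)\le\gamma^m q(x)$ for all $m\in\mathbb{N}$, $x\in E$; power bounded if for every $p$ there is $q$ such that $p(T^m x)\le q(x)$ for all $m\in\mathbb{N}$, $x\in E$. *)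

(* Defs.v *)
From HB Require Import structures.
From mathcomp Require Import all_boot all_order all_algebra.
From mathcomp Require Import all_classical all_reals all_analysis.
From mathcomp Require Import complex.
(* The notations of mpoly clash with those of mathcomp-analysis:
   [mpoly n K] is the type written {mpoly K[n]} in multinomials. *)
From mathcomp Require Import -(notations) mpoly.

Set Implicit Arguments.
Unset Strict Implicit.
Unset Printing Implicit Defensive.

Import Order.TTheory GRing.Theory Num.Theory.
Import numFieldNormedType.Exports.

Local Open Scope classical_set_scope.
Local Open Scope ring_scope.
Local Open Scope complex_scope.

(** * Operators on locally convex spaces

    These notions only involve the linear structure and the topology of E, so
    local convexity of E is not recorded in its type. *)

Section Operators.
Context (R : realType) (E : preTopologicalLmodType R[i]).
Implicit Types (p q : E -> R) (T : E -> E) (B : set E).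

Definition continuous_seminorm p :=
  [/\ forall x y, p (x + y) <= p x + p y,
      forall (a : R[i]) x, p (a *: x) = ComplexField.Normc.normc a * p x
    & continuous p].

Definition topologizable T :=
  forall p, continuous_seminorm p -> exists2 q, continuous_seminorm q &
    forall m : nat, exists2 g : R, 0 < g &
      forall x, p (iter m T x) <= g * q x.

Definition m_topologizable T :=
  forall p, continuous_seminorm p -> exists2 q, continuous_seminorm q &
    exists2 g : R, 0 < g &
      forall (m : nat) x, p (iter m T x) <= g ^+ m * q x.

Definition power_bounded T :=
  forall p, continuous_seminorm p -> exists2 q, continuous_seminorm q &
    forall (m : nat) x, p (iter m T x) <= q x.

Definition tvs_bounded B :=
  forall U : set E, nbhs 0 U -> exists2 r : R, 0 < r &
    forall a : R[i], r <= ComplexField.Normc.normc a ->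
      B `<=` [set a *: x | x in U].

End Operators.

(** * Partial differential operators with constant coefficients *)

Section Differential.
Context (R : realType) (d : nat).
Implicit Types (f g : 'rV[R]_d -> R[i]) (X : set 'rV[R]_d) (P : mpoly d R[i]).

Definition partial (i : 'I_d) f : 'rV[R]_d -> R[i] := fun x =>
  'D_(delta_mx 0 i) (fun y => complex.Re (f y)) x +i*
  'D_(delta_mx 0 i) (fun y => complex.Im (f y)) x.

Definition partial_derivable f x (i : 'I_d) :=
  derivable (fun y => complex.Re (f y)) x (delta_mx 0 i) /\
  derivable (fun y => complex.Im (f y)) x (delta_mx 0 i).

Definition partials (s : seq 'I_d) f := foldr partial f s.

Definition partial_multi (al : multinom d) f :=
  partials (flatten [seq nseq (al i) i | i <- enum 'I_d]) f.

Definition diff_op P f : 'rV[R]_d -> R[i] := fun x =>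
  \sum_(al <- msupp P) mcoeff al P * partial_multi al f x.

Definition principal_part P := pihomog mdeg (msize P).-1 P.

Definition elliptic P := forall xi : 'rV[R]_d, xi != 0 ->
  meval (fun i => (xi 0 i)%:C) (principal_part P) != 0.

(* For X open, continuity and derivability at the points of X only involve
   the restriction of f to X. *)
Definition smooth_on X f := forall (s : seq 'I_d) x, X x ->
  {for x, continuous (partials s f : 'rV[R]_d -> R[i]^o)} /\
  forall i, partial_derivable (partials s f) x i.

(* A function on X is represented by its extension by 0 outside of X. *)
Definition supported X f := forall x, ~ X x -> f x = 0.

Definition in_CP P X f :=
  [/\ smooth_on X f, forall x, X x -> diff_op P f x = 0 & supported X f].

Definition in_C X f :=
  {within X, continuous (f : 'rV[R]_d -> R[i]^o)} /\ supported X f.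

End Differential.

Section ComplexLimits.
Context (R : realType) (T : Type) (F : set_system T) (FF : Filter F).
Implicit Types (f g : T -> R[i]^o).

Lemma cvg_clin (a : R[i]) f g (u v : R[i]^o) : f @ F --> u -> g @ F --> v ->
  (fun y => a * f y + g y : R[i]^o) @ F --> (a * u + v : R[i]^o).
Proof.
move=> fu gv.
have h := @cvgMl_tmp R[i] T F FF f a u fu.
exact: (@cvgD R[i] R[i]^o T F FF _ g _ v h gv).
Qed.

Lemma cvg_cmul f g (u v : R[i]^o) : f @ F --> u -> g @ F --> v ->
  (fun y => f y * g y : R[i]^o) @ F --> (u * v : R[i]^o).
Proof. exact: (@cvgM R[i] T F FF). Qed.

End ComplexLimits.

(** * The space of zero solutions of P(D) on X *)

Section ZeroSolutions.
Context (R : realType) (d : nat) (P : mpoly d R[i]).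
Context (X : set 'rV[R]_d) (oX : open X).
Implicit Types (f g : 'rV[R]_d -> R[i]).

Let e (i : 'I_d) : 'rV[R]_d := delta_mx 0 i.

Let lin_Re (a z w : R[i]) : complex.Re (a * z + w) =
  complex.Re a * complex.Re z - complex.Im a * complex.Im z + complex.Re w.
Proof. by case: a z w => [? ?] [? ?] [? ?]. Qed.

Let lin_Im (a z w : R[i]) : complex.Im (a * z + w) =
  complex.Re a * complex.Im z + complex.Im a * complex.Re z + complex.Im w.
Proof. by case: a z w => [? ?] [? ?] [? ?]. Qed.

Let fun_Re (a : R[i]) f g : (fun y => complex.Re (a * f y + g y)) =
  ((complex.Re a \*: (fun y => complex.Re (f y))) +
   (- complex.Im a \*: (fun y => complex.Im (f y))) +
   (fun y => complex.Re (g y)) : 'rV[R]_d -> R).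
Proof.
by apply/funext => y; rewrite lin_Re !fctE/= /GRing.scale/= mulNr.
Qed.

Let fun_Im (a : R[i]) f g : (fun y => complex.Im (a * f y + g y)) =
  ((complex.Re a \*: (fun y => complex.Im (f y))) +
   (complex.Im a \*: (fun y => complex.Re (f y))) +
   (fun y => complex.Im (g y)) : 'rV[R]_d -> R).
Proof. by apply/funext => y; rewrite lin_Im !fctE. Qed.

Let lin_der (a b : R) (u v h : 'rV[R]_d -> R) x i :
  derivable u x (e i) -> derivable v x (e i) -> derivable h x (e i) ->
  derivable (a \*: u + b \*: v + h) x (e i) /\
  'D_(e i) (a \*: u + b \*: v + h) x =
  a * 'D_(e i) u x + b * 'D_(e i) v x + 'D_(e i) h x.
Proof.
move=> du dv dh.
have dau : derivable (a \*: u) x (e i) := derivableZ (k := a) du.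
have dbv : derivable (b \*: v) x (e i) := derivableZ (k := b) dv.
have dab := derivableD dau dbv.
split; first exact: derivableD dab dh.
rewrite (deriveD dab dh) (deriveD dau dbv).
by rewrite (@deriveZ _ _ _ u a x _ du) (@deriveZ _ _ _ v b x _ dv).
Qed.

Let partial_lin (a : R[i]) f g x i :
  partial_derivable f x i -> partial_derivable g x i ->
  partial_derivable (fun y => a * f y + g y) x i /\
  partial i (fun y => a * f y + g y) x = a * partial i f x + partial i g x.
Proof.
move=> [fR fI] [gR gI].
have [dR eR] := lin_der (complex.Re a) (- complex.Im a) fR fI gR.
have [dI eI] := lin_der (complex.Re a) (complex.Im a) fI fR gI.
rewrite /partial_derivable /partial fun_Re fun_Im; split=> //.
rewrite eR eI; apply/eqP; rewrite eq_complex lin_Re lin_Im/= mulNr.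
by rewrite !eqxx.
Qed.

Let near_partial i f g x : (\forall y \near x, f y = g y) ->
  partial i f x = partial i g x.
Proof.
move=> fg; rewrite /partial; congr (_ +i* _); apply: near_eq_derive;
  by apply: filterS fg => y ->.
Qed.

Let near_partial_derivable i f g x : (\forall y \near x, f y = g y) ->
  partial_derivable f x i -> partial_derivable g x i.
Proof.
move=> fg [fR fI]; split; [apply: near_eq_derivable fR|apply: near_eq_derivable fI];
  by apply: filterS fg => y ->.
Qed.

Let partials_lin (a : R[i]) f g s x : smooth_on X f -> smooth_on X g -> X x ->
  partials s (fun y => a * f y + g y) x = a * partials s f x + partials s g x.
Proof.
move=> fX gX; elim: s x => [//|i s IHs] x Xx /=.
have [_ /(_ i) df] := fX s _ Xx; have [_ /(_ i) dg] := gX s _ Xx.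
have [_ <-] := partial_lin a df dg.
by apply: near_partial; apply: filterS (open_nbhs_nbhs (conj oX Xx)).
Qed.

Lemma smooth_on_lin (a : R[i]) f g : smooth_on X f -> smooth_on X g ->
  smooth_on X (fun y => a * f y + g y).
Proof.
move=> fX gX s x Xx.
have E : \forall y \near x, a * partials s f y + partials s g y =
    partials s (fun y => a * f y + g y) y.
  apply: filterS (open_nbhs_nbhs (conj oX Xx)) => y Xy.
  by rewrite partials_lin.
have [fc df] := fX s _ Xx; have [gc dg] := gX s _ Xx; split=> [|i].
  rewrite /continuous_at /prop_for /= (partials_lin a s fX gX Xx).
  apply: cvg_trans (near_eq_cvg E) _.
  have h := @cvg_clin R _ (nbhs x) _ a (partials s f) (partials s g) _ _ fc gc.
  exact: h.
by apply: near_partial_derivable E _; have [] := partial_lin a (df i) (dg i).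
Qed.

Lemma diff_op_lin (a : R[i]) f g x : smooth_on X f -> smooth_on X g -> X x ->
  diff_op P (fun y => a * f y + g y) x = a * diff_op P f x + diff_op P g x.
Proof.
move=> fX gX Xx; rewrite /diff_op mulr_sumr -big_split/=.
apply: eq_bigr => al _; rewrite /partial_multi partials_lin//.
by rewrite mulrDr mulrCA.
Qed.

Lemma smooth_on0 : smooth_on X (0 : 'rV[R]_d -> R[i]).
Proof.
move=> s; have E : partials s (0 : 'rV[R]_d -> R[i]) = 0.
  elim: s => [//|i s /= ->]; apply/funext => x.
  by rewrite /partial !derive_cst.
move=> x Xx; rewrite E; split=> [|i]; first exact: (@cst_continuous _ R[i]^o).
by split; apply: derivable_cst.
Qed.

(* The argument oX is there because [in_CP P X] is only known to be a
   subspace when X is open. *)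
Definition CP_pred of open X : {pred 'rV[R]_d -> R[i]} :=
  fun f => `[< in_CP P X f >].

Lemma CP_submod_closed : submod_closed (CP_pred oX).
Proof.
split=> [|a f g /asboolP[fX fP f0] /asboolP[gX gP g0]]; apply/asboolP; split.
- exact: smooth_on0.
- move=> x Xx; have := diff_op_lin (- 1) smooth_on0 smooth_on0 Xx.
  rewrite mulN1r addNr => <-; congr (diff_op _ _ x).
  by apply/funext => y; rewrite mulN1r addNr.
- by [].
- exact: smooth_on_lin.
- by move=> x Xx; rewrite [LHS]diff_op_lin// fP// gP// mulr0 addr0.
- by move=> x nXx; rewrite !fctE f0// g0// scaler0 addr0.
Qed.

HB.instance Definition _ := GRing.isSubmodClosed.Build _ _ (CP_pred oX)
  CP_submod_closed.

Record CP := MkCP {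
  CP_val :> 'rV[R]_d -> R[i];
  CP_valP : CP_val \in CP_pred oX
}.

HB.instance Definition _ := [isSub for CP_val].
HB.instance Definition _ := [Choice of CP by <:].
HB.instance Definition _ := [SubChoice_isSubLmodule of CP by <:].

(* The topology of C^oo(X): the coarsest one for which every partial
   derivative is continuous for uniform convergence on the compact subsets
   of X. *)
Definition CP_jet (f : CP) : prod_topology (fun s : seq 'I_d =>
    {family [set K : set 'rV[R]_d | compact K /\ K `<=` X],
      'rV[R]_d -> R[i]^o}) :=
  fun s => partials s f.

HB.instance Definition _ := Topological.copy CP (initial_topology CP_jet).

End ZeroSolutions.

(** * The space C(X) *)

Section Continuous.
Context (R : realType) (d : nat) (X : set 'rV[R]_d).

Definition CX_pred : {pred 'rV[R]_d -> R[i]} := fun f => `[< in_C X f >].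

Lemma CX_submod_closed : submod_closed CX_pred.
Proof.
split=> [|a f g /asboolP[fX f0] /asboolP[gX g0]]; apply/asboolP; split.
- by move=> x; exact: (@cst_continuous _ R[i]^o).
- by [].
- move=> x.
  have h :=
    @cvg_clin R _ (nbhs (x : subspace X)) _ a f g _ _ (fX x) (gX x).
  exact: h.
- by move=> x nXx; rewrite !fctE f0// g0// scaler0 addr0.
Qed.

HB.instance Definition _ := GRing.isSubmodClosed.Build _ _ CX_pred
  CX_submod_closed.

Record CX := MkCX { CX_val :> 'rV[R]_d -> R[i]; CX_valP : CX_val \in CX_pred }.

HB.instance Definition _ := [isSub for CX_val].
HB.instance Definition _ := [Choice of CX by <:].
HB.instance Definition _ := [SubChoice_isSubLmodule of CX by <:].

Definition CX_fun (f : CX) :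
    {family [set K : set 'rV[R]_d | compact K /\ K `<=` X],
      'rV[R]_d -> R[i]^o} := f.

HB.instance Definition _ := Topological.copy CX (initial_topology CX_fun).

End Continuous.

(** * Weighted composition operators *)

Section Composition.
Context (R : realType) (d : nat) (P : mpoly d R[i]).
Context (X : set 'rV[R]_d) (oX : open X).

Definition wcomp (w : 'rV[R]_d -> R[i]) (psi : 'rV[R]_d -> 'rV[R]_d)
    (f : 'rV[R]_d -> R[i]) : 'rV[R]_d -> R[i] :=
  fun x => if x \in X then w x * f (psi x) else 0.

Definition wcomp_CP w psi
    (hC : forall f, in_CP P X f -> in_CP P X (wcomp w psi f))
    (f : CP P oX) : CP P oX :=
  MkCP (asboolT (hC f (asboolW (CP_valP f)))).

Lemma wcomp_in_C (w : CX X) psi (f : CX X) :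
  (forall x, X x -> X (psi x)) -> {within X, continuous psi} ->
  wcomp w psi f \in CX_pred X.
Proof.
move=> psiX psic; apply/asboolP; split; last first.
  by move=> x nXx; rewrite /wcomp memNset.
have /asboolP[/subspace_continuousP wc _] := CX_valP w.
have /asboolP[/subspace_continuousP fc _] := CX_valP f.
move/subspace_continuousP : psic => psic.
apply/subspace_continuousP => x Xx.
rewrite /from_subspace/=.
have -> : wcomp w psi f x = w x * f (psi x) by rewrite /wcomp mem_set.
have E : \forall y \near within X (nbhs x), w y * f (psi y) = wcomp w psi f y.
  rewrite near_withinE; apply: filterE => y Xy.
  by rewrite /wcomp mem_set.
apply: cvg_trans (near_eq_cvg E) _.
have psiw : psi @ within X (nbhs x) --> within X (nbhs (psi x)).
  move=> A nA; have := psic _ Xx _ nA.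
  rewrite /from_subspace /nbhs/= /within/= => H.
  by apply: filterS H => y h Xy; exact: h Xy (psiX _ Xy).
apply: cvg_cmul; first exact: wc.
exact: cvg_comp psiw (fc _ (psiX _ Xx)).
Qed.

Definition wcomp_CX (w : CX X) psi (hX : forall x, X x -> X (psi x))
    (hc : {within X, continuous psi}) (f : CX X) : CX X :=
  MkCX (wcomp_in_C w f hX hc).

(* psi is only meaningful on X; its values outside of X are irrelevant. *)
Definition locally_injective (psi : 'rV[R]_d -> 'rV[R]_d) :=
  forall x, X x -> exists2 U, nbhs x U & {in X `&` U &, injective psi}.

Definition stable_orbits (psi : 'rV[R]_d -> 'rV[R]_d) :=
  forall K, compact K -> K `<=` X ->
  exists L, [/\ compact L, L `<=` X & forall m : nat, iter m psi @` K `<=` L].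

End Composition.

Arguments wcomp_CP [R d P X oX w psi] hC f.

(* Main.v *)
Require Import Defs.
From mathcomp Require Import all_boot all_order all_algebra.
From mathcomp Require Import all_classical all_reals all_analysis.
From mathcomp Require Import perm complex ring lra zify.
From mathcomp Require Import -(notations) mpoly.
Set Implicit Arguments.
Unset Strict Implicit.
Unset Printing Implicit Defensive.
Import Order.TTheory GRing.Theory Num.Theory.
Import numFieldNormedType.Exports.
Local Open Scope classical_set_scope.
Local Open Scope ring_scope.
Local Open Scope complex_scope.

(** The iterates are C_{w,psi}^m f = w_m (f o psi^m).  If the operator is topologizable and K is
    compact, there is a compact K' such that every solution f satisfies |f(y)| <= C sup_{K'} |f|
    at y = psi^m(x) for all x near K with w_m(x) != 0.  Exponential solutions, taken along complex
    zeros of the symbol, confine such y to a fixed box; solutions singular at a single point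
    outside X keep them at a fixed distance from the complement of X.  As w_m vanishes nowhere to
    infinite order, these x are dense near K, so that psi^m(K) lies in a fixed compact set.
    Conversely, continuous seminorms on solutions are dominated by suprema over compact sets, so
    for stable orbits everything is controlled by the weights w_m.

    The weights are nowhere flat because where w != 0 the map psi is smooth (recovered from the
    solutions w exp(zeta.psi)), with a Jacobian that ellipticity forces to be zero or injective and
    that local injectivity prevents from vanishing on an open set.

    Regularity is obtained from Fourier coefficients over a cube: cutting off a solution f, its
    coefficients decay because the symbol is large at high frequencies, and a positive
    trigonometric kernel recovers f at the centre.  Iterating the resulting gradient estimate gives
    analyticity.  The singular solution is an ultralimit of trigonometric sums divided by a power
    of the symbol, where an average over complex shifts of the frequencies avoids its zeros. *)

(** The obstacle is that the domination constant C at y is uncontrolled: it contains the unknown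
    factor attached to the m-th iterate and the inverse of |w_m(x)|. The region confining y must
    therefore not depend on C. Exponentials allow this because their rate can be taken arbitrarily
    large. Near the complement of X, values of solutions do not suffice; the solution with a pole at
    z is compared through all its derivatives at once. On K' they grow at a rate fixed by the
    distance to the complement of X, domination transfers this rate to y whatever C is, and close to
    its pole the singular solution violates it.

    The singularity is detected without a formula. Bounded derivatives of order at most k near 0
    would make the mean of the right-hand side over a cube of half-side a of order 1/a, by a flux
    argument, whereas a concentrated right-hand side has mean of order a^-d; here d >= 2 matters. It
    matters again for joining points of a punctured cube and for finding zeros of the symbol with
    nonzero real part. As P(0) = 0, constants are solutions, hence so are w and all w_m. *)

Notation N := ComplexField.Normc.normc.

(** * The modulus of complex numbers *)

Section ComplexNorm.
Context (R : realType).
Implicit Types (z w : R[i]) (a : R).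

Lemma N0 : N (0 : R[i]) = 0. Proof. exact: ComplexField.Normc.normc0. Qed.

Lemma N1 : N (1 : R[i]) = 1. Proof. exact: ComplexField.Normc.normc1. Qed.

Lemma NM z w : N (z * w) = N z * N w. Proof. exact: ComplexField.Normc.normcM. Qed.

Lemma NN z : N (- z) = N z. Proof. exact: (@normcN R z). Qed.

Lemma ND z w : N (z + w) <= N z + N w. Proof. exact: (@le_normcD R z w). Qed.

Lemma NB z w : N (z - w) <= N z + N w. Proof. by rewrite -(NN w) ND. Qed.

Lemma NBC z w : N (z - w) = N (w - z). Proof. by rewrite -NN opprB. Qed.

Lemma NV z : N z^-1 = (N z)^-1. Proof. exact: ComplexField.Normc.normcV. Qed.

Lemma N_ge0 z : 0 <= N z. Proof. by case: z => x y; rewrite sqrtr_ge0. Qed.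

Lemma N_eq0 z : (N z == 0) = (z == 0).
Proof.
by apply/eqP/eqP => [/ComplexField.Normc.eq0_normc //|->]; rewrite N0.
Qed.

Lemma N_gt0 z : (0 < N z) = (z != 0).
Proof. by rewrite lt_def N_eq0 N_ge0 andbT. Qed.

Lemma N_real a : N a%:C = `|a|.
Proof. by rewrite /= expr0n addr0 sqrtr_sqr. Qed.

Lemma N_i : N ('i : R[i]) = 1.
Proof. by rewrite /= expr0n add0r expr1n sqrtr1. Qed.

Lemma NX z n : N (z ^+ n) = N z ^+ n.
Proof. by elim: n => [|n IH]; rewrite ?expr0 ?N1// !exprS NM IH. Qed.

Lemma Nsqr z : N z ^+ 2 = complex.Re z ^+ 2 + complex.Im z ^+ 2.
Proof. by case: z => x y /=; rewrite sqr_sqrtr// addr_ge0// sqr_ge0. Qed.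

Lemma Re_le z : `|complex.Re z| <= N z.
Proof.
by rewrite -(ler_pXn2r (n:=2))// ?nnegrE ?N_ge0// Nsqr -normrX ger0_norm ?sqr_ge0// lerDl sqr_ge0.
Qed.

Lemma Im_le z : `|complex.Im z| <= N z.
Proof.
by rewrite -(ler_pXn2r (n:=2))// ?nnegrE ?N_ge0// Nsqr -normrX ger0_norm ?sqr_ge0// lerDr sqr_ge0.
Qed.

Lemma N_le z : N z <= `|complex.Re z| + `|complex.Im z|.
Proof.
rewrite -(ler_pXn2r (n:=2))// ?nnegrE ?N_ge0// ?addr_ge0// Nsqr.
rewrite -(real_normK (num_real (complex.Re z))) -(real_normK (num_real (complex.Im z))).
have := normr_ge0 (complex.Re z); have := normr_ge0 (complex.Im z); nra.
Qed.

Lemma N_nat n : N (n%:R : R[i]) = n%:R.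
Proof. by rewrite -(rmorph_nat (real_complex R)) N_real normr_nat. Qed.

Lemma normE z : `|z| = (N z)%:C. Proof. by case: z. Qed.

Lemma N_sum (I : Type) (r : seq I) (Q : pred I) (F : I -> R[i]) :
  N (\sum_(i <- r | Q i) F i) <= \sum_(i <- r | Q i) N (F i).
Proof.
elim/big_ind2: _ => //; first by rewrite N0.
by move=> a b c d h1 h2; apply: le_trans (ND _ _) _; exact: lerD.
Qed.

Lemma N_prod (I : Type) (r : seq I) (Q : pred I) (F : I -> R[i]) :
  N (\prod_(i <- r | Q i) F i) = \prod_(i <- r | Q i) N (F i).
Proof. exact: (big_morph _ NM N1). Qed.

Lemma N_unit z : exists2 c, N c = 1 & c * z = (N z)%:C.
Proof.
have [->|z0] := eqVneq z 0; first by exists 1; rewrite ?N1// mulr0 N0.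
exists ((N z)%:C / z); first by rewrite NM NV N_real ger0_norm ?N_ge0// divff ?N_eq0.
by rewrite divfK.
Qed.

Lemma ReM_real a z : complex.Re (a%:C * z) = a * complex.Re z.
Proof. by case: z => x y /=; rewrite mul0r subr0. Qed.

Lemma ImM_real a z : complex.Im (a%:C * z) = a * complex.Im z.
Proof. by case: z => x y /=; rewrite mul0r addr0. Qed.

Lemma le_N z w : N z - N w <= N (z - w).
Proof. by rewrite lerBlDr -{1}(subrK w z) ND. Qed.

Lemma ReD z w : complex.Re (z + w) = complex.Re z + complex.Re w.
Proof. by case: z; case: w. Qed.

Lemma ImD z w : complex.Im (z + w) = complex.Im z + complex.Im w.
Proof. by case: z; case: w. Qed.

Lemma ReN z : complex.Re (- z) = - complex.Re z. Proof. by case: z. Qed.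

Lemma ImN z : complex.Im (- z) = - complex.Im z. Proof. by case: z. Qed.

Lemma eqC z w : complex.Re z = complex.Re w -> complex.Im z = complex.Im w -> z = w.
Proof. by case: z; case: w => /= ? ? ? ? -> ->. Qed.

End ComplexNorm.

(** * Continuity of complex-valued functions with real epsilons *)

Section Continuity.
Context (R : realType).

(** The norm of [R[i]^o] takes its values in [R[i]], so its filters come with complex epsilons. This
    form keeps all radii and errors in [R], where the linear arithmetic tactics apply. *)
Definition cont {W : normedModType R} (f : W -> R[i]) (x : W) :=
  forall e : R, 0 < e -> exists2 r : R, 0 < r &
    forall y, `|y - x| < r -> N (f y - f x) < e.

Lemma contE (W : normedModType R) (f : W -> R[i]) x :
  cont f x <-> {for x, continuous (f : W -> R[i]^o)}.
Proof.
split=> [H|fx e e0].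
  apply/(@cvgrPdist_lt R[i] R[i]^o) => e e0.
  have e1 : e = (complex.Re e)%:C by case: e e0 => a b /=; rewrite ltcE/= => /andP[/eqP ->].
  have e2 : 0 < complex.Re e by rewrite e1 ltcR in e0.
  have [r r0 h] := H _ e2; apply/nbhs_normP; exists r => //= y yx.
  by rewrite normE e1 ltcR NBC; apply: h; rewrite distrC.
have e0' : (0 : R[i]) < e%:C by rewrite ltcR.
have /= := @cvgrPdist_lt R[i] R[i]^o _ (nbhs x) _ (f : W -> R[i]^o) (f x).
case=> /(_ fx) /(_ _ e0') /nbhs_normP [r /= r0 h] _.
exists r => // y yx; have := h y; rewrite /ball_/= distrC => /(_ yx).
by rewrite normE ltcR NBC.
Qed.

Section Closure.
Context {W : normedModType R}.
Implicit Types (f g : W -> R[i]) (x : W).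

Lemma cont_cst (a : R[i]) x : cont (fun _ : W => a) x.
Proof. by apply/contE; exact: (@cst_continuous _ R[i]^o). Qed.

Lemma contM f g x : cont f x -> cont g x -> cont (fun y => f y * g y) x.
Proof. by move=> /contE fx /contE gx; apply/contE; exact: cvg_cmul fx gx. Qed.

Lemma contD f g x : cont f x -> cont g x -> cont (fun y => f y + g y) x.
Proof.
move=> /contE fx /contE gx; apply/contE.
exact: (@cvgD R[i] R[i]^o W (nbhs x) _ _ _ _ _ fx gx).
Qed.

Lemma contV f x : f x != 0 -> cont f x -> cont (fun y => (f y)^-1) x.
Proof.
move=> f0 /contE fx; apply/contE.
exact: (@cvgV R[i] W (nbhs x) _ f _ f0 fx).
Qed.

Lemma contN f x : cont f x -> cont (fun y => - f y) x.
Proof.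
by move=> fx e /fx [r r0 h]; exists r => // y /h; rewrite -opprD NN.
Qed.

Lemma cont_near f g x (r : R) : 0 < r ->
  (forall y, `|y - x| < r -> f y = g y) -> cont f x -> cont g x.
Proof.
move=> r0 fg fx e /fx [r1 r10 h].
exists (Num.min r r1); first by rewrite lt_min r0.
move=> y; rewrite lt_min => /andP[h1 h2].
by rewrite -!fg ?subrr ?normr0// h.
Qed.
End Closure.

Lemma cont_comp (V W : normedModType R) (f : W -> R[i]) (h : V -> W) x :
  {for x, continuous h} -> cont f (h x) -> cont (fun y => f (h y)) x.
Proof.
move=> hx /contE fx; apply/contE.
exact: (@continuous_comp _ _ _ h (f : W -> R[i]^o) x hx fx).
Qed.

End Continuity.

(** * Directional derivatives *)

Section Derivative.
Context (R : realType).

(* Caratheodory's form of the derivative of f at x along v. *)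
Definition cder {W : normedModType R} (f : W -> R[i]) (x v : W) (l : R[i]) :=
  exists q : R -> R[i], [/\ cont (q : R^o -> _) 0, q 0 = l &
    forall t, f (x + t *: v) = f x + t%:C * q t].

Section General.
Context {W : normedModType R}.
Implicit Types (f g : W -> R[i]) (x v : W) (l m : R[i]).

Lemma cderP f x v l : cder f x v l <-> forall e : R, 0 < e ->
  exists2 r : R, 0 < r & forall t : R, `|t| < r ->
    N (f (x + t *: v) - f x - t%:C * l) <= e * `|t|.
Proof.
split=> [[q [qc q0 fq]] e /qc [r r0 h]|H].
  exists r => // t tr; rewrite fq [f x + _]addrC addrK -mulrBr NM N_real mulrC.
  by rewrite ler_wpM2r// ltW// -q0 h// subr0.
exists (fun t => if t == 0 then l else (t%:C)^-1 * (f (x + t *: v) - f x)).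
rewrite eqxx; split=> // [|t]; last first.
  have [->|t0] := eqVneq t 0; first by rewrite scale0r addr0 mul0r addr0.
  by rewrite mulrA divff ?mul1r ?subrKC// -N_eq0 N_real normr_eq0.
move=> e e0; have [|r r0 h] := H (e / 2); first by rewrite divr_gt0.
exists r => // t; rewrite subr0 eqxx => tr; move: (t : R) tr => {}t tr.
case: ifPn => [_|tn0]; first by rewrite subrr N0.
have t0 : t != 0 := tn0.
have tC : t%:C != 0 by rewrite -N_eq0 N_real normr_eq0.
have -> : (t%:C)^-1 * (f (x + t *: v) - f x) - l =
   (t%:C)^-1 * (f (x + t *: v) - f x - t%:C * l) by rewrite [in RHS]mulrBr mulKf.
rewrite NM NV N_real mulrC ltr_pdivrMr ?normr_gt0//.
apply: le_lt_trans (h _ tr) _; rewrite ltr_pM2r ?normr_gt0//.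
by rewrite ltr_pdivrMr// ltr_pMr// ltr1n.
Qed.

Lemma cder_cst (a : R[i]) x v : cder (fun=> a) x v 0.
Proof.
by exists (fun=> 0); split=> // [|t]; [exact: cont_cst|rewrite mulr0 addr0].
Qed.

Lemma cderD f g x v l m : cder f x v l -> cder g x v m ->
  cder (fun y => f y + g y) x v (l + m).
Proof.
move=> [q [qc <- fq]] [p [pc <- gp]]; exists (fun t => q t + p t); split=> // [|t].
  exact: contD.
by rewrite fq gp mulrDr addrACA.
Qed.

Lemma cderM f g x v l m : cder f x v l -> cder g x v m ->
  cder (fun y => f y * g y) x v (l * g x + f x * m).
Proof.
move=> [q [qc <- fq]] [p [pc <- gp]].
exists (fun t => q t * g x + f x * p t + t%:C * (q t * p t)); split=> [||t].
- apply: contD; first by apply: contD; apply: contM => //; exact: cont_cst.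
  apply: contM; last exact: contM.
  move=> e e0; exists e => // y; rewrite subr0.
  by rewrite -(N_real y) subr0.
- by rewrite mul0r addr0.
- by rewrite fq gp; ring.
Qed.

Lemma cderZ (a : R[i]) f x v l : cder f x v l ->
  cder (fun y => a * f y) x v (a * l).
Proof.
by move=> fl; have := cderM (cder_cst a x v) fl; rewrite mul0r add0r.
Qed.

Lemma cderN f x v l : cder f x v l -> cder (fun y => - f y) x v (- l).
Proof.
move=> /(cderZ (-1)); rewrite mulN1r; congr (cder _ _ _ _).
by apply/funext => y; rewrite mulN1r.
Qed.

Lemma cderB f g x v l m : cder f x v l -> cder g x v m ->
  cder (fun y => f y - g y) x v (l - m).
Proof. by move=> fl gm; exact: cderD fl (cderN gm). Qed.

Lemma cder_sum (I : Type) (r : seq I) (F : I -> W -> R[i]) (L : I -> R[i]) x v :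
  (forall i, cder (F i) x v (L i)) ->
  cder (fun y => \sum_(i <- r) F i y) x v (\sum_(i <- r) L i).
Proof.
move=> H; elim: r => [|i r IH].
  rewrite big_nil; have := cder_cst 0 x v; congr (cder _ _ _ _).
  by apply/funext => y; rewrite big_nil.
rewrite big_cons; have := cderD (H i) IH; congr (cder _ _ _ _).
by apply/funext => y; rewrite big_cons.
Qed.

Lemma cder_uniq f x v l m : cder f x v l -> cder f x v m -> l = m.
Proof.
move=> /cderP fl /cderP fm; apply/eqP; rewrite -subr_eq0 -N_eq0.
rewrite -[_ == 0]negbK; apply/negP; rewrite N_eq0 -N_gt0 => h0.
have e0 : 0 < N (l - m) / 4 by rewrite divr_gt0.
have [r r0 h1] := fl _ e0; have [s s0 h2] := fm _ e0.
pose t := Num.min r s / 2.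
have t0 : 0 < t by rewrite divr_gt0// lt_min r0.
have tr : `|t| < r.
  rewrite gtr0_norm//; have : Num.min r s <= r by rewrite ge_min lexx.
  by move: t0; rewrite /t; lra.
have ts : `|t| < s.
  rewrite gtr0_norm//; have : Num.min r s <= s by rewrite ge_min lexx orbT.
  by move: t0; rewrite /t; lra.
have := h1 _ tr; have := h2 _ ts.
set A := f _ - f x => H2 H1.
have : `|t| * N (l - m) <= N (A - t%:C * m) + N (A - t%:C * l).
  rewrite -N_real -NM; have -> : t%:C * (l - m) = (A - t%:C * m) - (A - t%:C * l) by ring.
  exact: NB.
have : 0 < `|t| by rewrite gtr0_norm.
nra.
Qed.

Lemma cder_near f g x v l r : 0 < r -> (forall y, `|y - x| < r -> f y = g y) ->
  cder f x v l -> cder g x v l.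
Proof.
move=> r0 fg /cderP fl; apply/cderP => e /fl [s s0 h].
have v1 : 0 < `|v| + 1 by rewrite ltr_wpDl.
exists (Num.min s (r / (`|v| + 1))); first by rewrite lt_min s0 divr_gt0.
move=> t; rewrite lt_min => /andP[ts]; rewrite ltr_pdivlMr// => tr.
rewrite -!fg ?subrr ?normr0//; first exact: h.
rewrite addrC addKr normrZ; apply: le_lt_trans tr.
by rewrite ler_wpM2l// lerDl.
Qed.

Lemma cder_line f x v t l :
  cder f (x + t *: v) v l <-> cder (fun s : R^o => f (x + s *: v)) t (1 : R^o) l.
Proof.
split=> -[q [qc q0 fq]]; exists q; split=> // s.
  by rewrite /= -fq scalerDl addrA [_ *: 1]mulr1.
by have := fq s; rewrite /= scalerDl addrA [_ *: 1]mulr1.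
Qed.

Lemma cderV f x v l : (exists2 r, 0 < r & forall y, `|y - x| < r -> f y != 0) ->
  cont f x -> cder f x v l -> cder (fun y => (f y)^-1) x v (- l * (f x)^-1 ^+ 2).
Proof.
move=> [r r0 fn] fc [q [qc <- fq]].
have fx0 : f x != 0 by apply: fn; rewrite subrr normr0.
have lin : {for (0 : R^o), continuous (fun t : R^o => x + t *: v)}.
  by apply: cvgD; [exact: cvg_cst|apply: cvgZr_tmp; exact: cvg_id].
have H : cder (fun y => (f x)^-1 + ((f y)^-1 - (f x)^-1)) x v (- q 0 * (f x)^-1 ^+ 2).
  pose p (t : R) := - q t * ((f x)^-1 * (f (x + t *: v))^-1).
  apply/cderP => e e0.
  have pc : cont (p : R^o -> _) 0.
    apply: contM; first exact: contN.
    apply: contM; first exact: cont_cst.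
    have fc' : cont f (x + (0 : R) *: v) by rewrite scale0r addr0.
    apply: contV; first by rewrite scale0r addr0.
    exact: (@cont_comp R R^o W f (fun t : R^o => x + t *: v) 0 lin fc').
  have [s s0 h] := pc _ e0.
  have v1 : 0 < `|v| + 1 by rewrite ltr_wpDl.
  exists (Num.min s (r / (`|v| + 1))); first by rewrite lt_min s0 divr_gt0.
  move=> t; rewrite lt_min => /andP[ts]; rewrite ltr_pdivlMr// => tr.
  have ft0 : f (x + t *: v) != 0.
    apply: fn; rewrite addrC addKr normrZ; apply: le_lt_trans tr.
    by rewrite ler_wpM2l// lerDl.
  rewrite !subrKC.
  have p0 : p 0 = - q 0 * (f x)^-1 ^+ 2 by rewrite /p scale0r addr0 expr2.
  have -> : (f (x + t *: v))^-1 - (f x)^-1 - t%:C * (- q 0 * (f x)^-1 ^+ 2) = t%:C * (p t - p 0).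
    rewrite p0 mulrBr; congr (_ - _).
    have E : t%:C * q t = f (x + t *: v) - f x by rewrite fq addrC addKr.
    rewrite /p mulNr mulrN mulrA E; move: ft0 fx0; set a := f _; set b := f _ => a0 b0.
    by field; rewrite a0 b0.
  rewrite NM N_real mulrC ler_wpM2r// ltW//; apply: h; by rewrite subr0.
move: H; congr (cder _ _ _ _); by apply/funext => y; rewrite subrKC.
Qed.

End General.

Lemma cder_cont1 (g : R^o -> R[i]) t l : cder g t (1 : R^o) l -> cont g t.
Proof.
move=> /cderP /(_ 1 ltr01)[r r0 h]; move=> e e0.
have l1 : 0 < N l + 1 by rewrite ltr_wpDl ?N_ge0.
exists (Num.min r (e / (N l + 1))); first by rewrite lt_min r0 divr_gt0.
move=> y; rewrite lt_min => /andP[yr]; rewrite ltr_pdivlMr// => ye.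
apply: le_lt_trans ye; have := h _ yr.
rewrite /= [_ *: 1]mulr1 subrKC mul1r => H.
rewrite -[X in N X](subrK ((y - t)%:C * l)); apply: le_trans (ND _ _) _.
rewrite NM N_real mulrDr mulr1 addrC lerD//.
Qed.

Lemma is_deriveP (W : normedModType R) (F : W -> R) (x v : W) (a : R) :
  is_derive x v F a <-> forall e : R, 0 < e -> exists2 r : R, 0 < r & forall t : R, `|t| < r ->
    `|F (x + t *: v) - F x - t * a| <= e * `|t|.
Proof.
split=> [[dF <-] e e0|H].
  have := dF; rewrite /derivable => /cvgrPdist_lt /(_ _ e0).
  rewrite near_withinE => /nbhs_normP[r /= r0 h]; exists r => // t tr.
  have [->|t0] := eqVneq t 0.
    by rewrite scale0r addr0 subrr mul0r subr0 normr0 mulr0.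
  have /= := h t; rewrite sub0r normrN => /(_ tr t0).
  rewrite /derive; set D := lim _; rewrite /GRing.scale/= [t *: v + x]addrC => H.
  have -> : F (x + t *: v) - F x - t * D = - (t * (D - t^-1 * (F (x + t *: v) - F x))).
    by rewrite mulrBr mulrA divff// mul1r opprB.
  by rewrite normrN normrM mulrC ler_wpM2r// ltW.
have C : (fun h => h^-1 *: (F (h *: v + x) - F x)) @ 0^' --> a.
  apply/cvgrPdist_lt => e e0; have [|r r0 h] := H (e / 2); first by rewrite divr_gt0.
  rewrite near_withinE; apply/nbhs_normP; exists r => // t /=; rewrite ?sub0r ?normrN => tr t0.
  rewrite /GRing.scale/= [t *: v + x]addrC.
  have -> : a - t^-1 * (F (x + t *: v) - F x) = - (t^-1 * (F (x + t *: v) - F x - t * a)).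
    by rewrite [in RHS]mulrBr mulKf// opprB.
  rewrite normrN normrM normfV mulrC ltr_pdivrMr ?normr_gt0//.
  apply: le_lt_trans (h _ tr) _; rewrite ltr_pM2r ?normr_gt0//.
  by rewrite ltr_pdivrMr// ltr_pMr// ltr1n.
by apply: DeriveDef; [apply/cvg_ex; exists a|exact: cvg_lim C].
Qed.

Lemma cder_ReIm (W : normedModType R) (f : W -> R[i]) (x v : W) l : cder f x v l <->
  is_derive x v (fun y => complex.Re (f y)) (complex.Re l) /\
  is_derive x v (fun y => complex.Im (f y)) (complex.Im l).
Proof.
have ER t : complex.Re (f (x + t *: v)) - complex.Re (f x) - t * complex.Re l =
   complex.Re (f (x + t *: v) - f x - t%:C * l) by rewrite !ReD !ReN ReM_real.
have EI t : complex.Im (f (x + t *: v)) - complex.Im (f x) - t * complex.Im l =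
   complex.Im (f (x + t *: v) - f x - t%:C * l) by rewrite !ImD !ImN ImM_real.
split=> [/cderP H|[/is_deriveP HR /is_deriveP HI]].
  split; apply/is_deriveP => e /H [r r0 h]; exists r => // t /h; apply: le_trans.
    by rewrite ER Re_le.
  by rewrite EI Im_le.
apply/cderP => e e0; have e1 : 0 < e / 2 by rewrite divr_gt0.
have [r r0 h] := HR _ e1; have [s s0 k] := HI _ e1.
exists (Num.min r s); first by rewrite lt_min r0.
move=> t; rewrite lt_min => /andP[tr ts].
apply: le_trans (N_le _) _; rewrite -ER -EI.
by have := h _ tr; have := k _ ts; lra.
Qed.

Lemma cder_real (F : R -> R) t a : is_derive (t : R^o) (1 : R^o) (F : R^o -> R^o) a ->
  cder (fun s : R^o => (F s)%:C) t (1 : R^o) a%:C.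
Proof.
move=> H; apply/cder_ReIm; split=> //=.
by have := is_derive_cst (0 : R) (t : R^o) (1 : R^o).
Qed.

(** The mean value equality fails for complex values. A unit factor [c] rotates [g T - g 0] onto the
    positive axis; the real mean value theorem then applies to [Re (c * g) - h], whose derivative is
    nonpositive. *)
Lemma mvt_major (g : R -> R[i]) (h : R -> R) (g' : R -> R[i]) (h' : R -> R) T :
  0 <= T ->
  (forall t, 0 <= t <= T -> cder (g : R^o -> _) t (1 : R^o) (g' t)) ->
  (forall t, 0 <= t <= T -> is_derive (t : R^o) (1 : R^o) (h : R^o -> R^o) (h' t)) ->
  (forall t, 0 <= t <= T -> N (g' t) <= h' t) ->
  N (g T - g 0) <= h T - h 0.
Proof.
rewrite le_eqVlt => /predU1P[<-|T0] dg dh le; first by rewrite !subrr N0.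
have [c c1 cE] := N_unit (g T - g 0).
pose r t := complex.Re (c * g t) - h t.
have dr (t : R) : 0 <= t <= T ->
    is_derive (t : R^o) (1 : R^o) (r : R^o -> R^o) (complex.Re (c * g' t) - h' t).
  move=> tT; have /cder_ReIm[H _] := cderZ c (dg _ tT).
  have H2 := dh _ tT; exact: is_deriveB.
have [||x xT] := @MVT R r (fun t => complex.Re (c * g' t) - h' t) _ _ T0.
- by move=> x; rewrite in_itv/= => /andP[/ltW x0 /ltW xT]; apply: dr; rewrite x0.
- apply: continuous_in_subspaceT => x; rewrite inE/= in_itv/= => xT.
  have [dx _] := dr _ xT.
  apply: differentiable_continuous; exact/derivable1_diffP.
move=> E; have x1 : 0 <= x <= T by move: xT; rewrite in_itv/= => /andP[/ltW -> /ltW ->].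
have : r T - r 0 <= 0.
  rewrite E subr0; apply: mulr_le0_ge0; last exact: ltW.
  rewrite subr_le0; apply: le_trans (le _ x1); apply: le_trans (ler_norm _) _.
  by apply: le_trans (Re_le _) _; rewrite NM c1 mul1r.
have -> : N (g T - g 0) = complex.Re (c * (g T - g 0)) by rewrite cE.
by rewrite mulrBr ReD ReN /r; lra.
Qed.

Lemma mvt_bound (W : normedModType R) (f : W -> R[i]) (g : W -> R[i]) x v M :
  (forall t, 0 <= t <= 1 -> cder f (x + t *: v) v (g (x + t *: v))) ->
  (forall t, 0 <= t <= 1 -> N (g (x + t *: v)) <= M) -> N (f (x + v) - f x) <= M.
Proof.
move=> df gM.
have := @mvt_major (fun t => f (x + t *: v)) (fun t => M * t)
   (fun t => g (x + t *: v)) (fun=> M) 1 ler01.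
rewrite !mulr0 mulr1 subr0 scale0r addr0 scale1r; apply=> // t tT.
  by apply/cder_line; exact: df.
apply/is_deriveP => e e0; exists 1 => // s _.
rewrite [_ *: 1]mulr1 [X in `|X|](_ : _ = 0) ?normr0 ?mulr_ge0// ?ltW//.
by rewrite /=; ring.
Qed.

End Derivative.

Lemma continuous_affine_gen (R : realType) (W : normedModType R) (x0 : W) (r : R) :
  continuous (fun h : W => x0 + r *: h).
Proof.
move=> x; apply/cvgrPdist_lt => e e0; apply/nbhs_normP.
have r1 : 0 < `|r| + 1 by rewrite ltr_wpDl.
exists (e / (`|r| + 1)); first exact: divr_gt0.
move=> y /=; rewrite ltr_pdivlMr// opprD addrACA subrr add0r -scalerBr normrZ.
by apply: le_lt_trans; rewrite mulrC ler_wpM2l// lerDl.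
Qed.

(** * Smooth functions *)

Section Smooth.
Context (R : realType) (d : nat).
Notation V := 'rV[R]_d.
Implicit Types (f g : V -> R[i]) (X : set V) (x y : V).

Definition ee (i : 'I_d) : V := delta_mx 0 i.

Lemma rv_leP x (r : R) : 0 <= r ->
  reflect (forall i, `|x 0 i| <= r) (`|x| <= r).
Proof.
move=> r0; have -> : `|x| = \big[Num.max/0]_ij `|x ij.1 ij.2| by exact: mx_normrE.
apply: (iffP (bigmax_leP _ _ _ _)) => [[_ h] i|h]; first exact: (h (0, i)).
by split=> // -[j i] _ /=; rewrite ord1.
Qed.

Lemma rv_coord x i : `|x 0 i| <= `|x|.
Proof. by have /rv_leP : `|x| <= `|x| by []; apply. Qed.

Lemma ee_coord i j : ee i 0 j = (j == i)%:R.
Proof. by rewrite /ee mxE eqxx. Qed.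

Lemma norm_ee i : `|ee i| = 1.
Proof.
apply/le_anti/andP; split.
  by apply/rv_leP => // j; rewrite ee_coord; case: eqP; rewrite ?normr1 ?normr0.
by have := rv_coord (ee i) i; rewrite ee_coord eqxx normr1.
Qed.

Lemma open_ball X x : open X -> X x ->
  exists2 r : R, 0 < r & forall y, `|y - x| < r -> X y.
Proof.
move=> oX Xx; have := open_nbhs_nbhs (conj oX Xx).
case/nbhs_normP => r /= r0 h; exists r => // y yx; apply: h.
by rewrite /= distrC.
Qed.

Lemma cder_partial f x i l : cder f x (ee i) l ->
  partial_derivable f x i /\ partial i f x = l.
Proof.
move=> /cder_ReIm[[dR eR] [dI eI]]; split; first by split.
by rewrite /partial -/(ee i) eR eI; case: (l).
Qed.

Lemma partial_cder f x i : partial_derivable f x i ->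
  cder f x (ee i) (partial i f x).
Proof. by move=> [dR dI]; apply/cder_ReIm; split; apply: DeriveDef. Qed.

Lemma cder_scale f x v (a : R) l : cder f x v l -> cder f x (a *: v) (a%:C * l).
Proof.
move=> [q [qc <- fq]]; exists (fun t => a%:C * q (t * a)); split=> [||t].
- apply: contM; first exact: cont_cst.
  have h : {for (0 : R^o), continuous (fun t : R^o => t * a : R^o)}.
    by apply: cvgM; [exact: cvg_id|exact: cvg_cst].
  have qc' : cont q (0 * a) by rewrite mul0r.
  exact: (@cont_comp R R^o R^o q _ (0 : R^o) h qc').
- by rewrite mul0r.
- by rewrite scalerA fq; congr (_ + _); rewrite rmorphM/= mulrA.
Qed.

Lemma cder_axis f y v (u h : R) l : cder f (y + (u * h) *: v) v l ->
  cder (fun z : R^o => f (y + (z * h) *: v)) u (1 : R^o) (h%:C * l).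
Proof.
rewrite -(scalerA u) => H; have K := proj1 (cder_line f y (h *: v) u _) (cder_scale h H).
have -> : (fun z : R^o => f (y + (z * h) *: v)) = (fun z : R^o => f (y + z *: (h *: v))).
  by apply/funext => z; rewrite scalerA.
exact: K.
Qed.

(** Derivatives are given as witnesses instead of through [partial]. Closure under products,
    inverses or limits then only requires a formula for the derivative, and [smoothP] identifies the
    functions that are [Cn] for all [n] on an open set with the smooth ones. *)
Fixpoint Cn n X f := match n with
  | 0 => forall x, X x -> cont f x
  | n.+1 => (forall x, X x -> cont f x) /\
     forall i, exists g, Cn n X g /\ forall x, X x -> cder f x (ee i) (g x)
  end.

Lemma Cn_eq n X f g : open X -> (forall x, X x -> f x = g x) -> Cn n X f -> Cn n X g.
Proof.
move=> oX fg; have C : (forall x, X x -> cont f x) -> (forall x, X x -> cont g x).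
  move=> fc x Xx; have [r r0 h] := open_ball oX Xx.
  by apply: cont_near r0 _ (fc _ Xx) => y /h; exact: fg.
case: n => [//|n] [/C gc H]; split=> // i; have [h [hn fh]] := H i.
exists h; split=> // x Xx; have [r r0 k] := open_ball oX Xx.
by apply: cder_near r0 _ (fh _ Xx) => y /k; exact: fg.
Qed.

Lemma CnS n X f : Cn n.+1 X f -> Cn n X f.
Proof.
elim: n f => [f [] //|n IH f [fc H]]; split=> // i.
by have [g [/IH gn fg]] := H i; exists g.
Qed.

Lemma Cn_cont n X f x : Cn n X f -> X x -> cont f x.
Proof. by case: n => [h|n [h _]]; exact: h. Qed.

Lemma CnD n X f g : Cn n X f -> Cn n X g -> Cn n X (fun x => f x + g x).
Proof.
elim: n f g => [f g fc gc x Xx|n IH f g [fc fH] [gc gH]].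
  by apply: contD; auto.
split=> [x Xx|i]; first by apply: contD; auto.
have [f' [fn ff]] := fH i; have [g' [gn gg]] := gH i.
exists (fun x => f' x + g' x); split; first exact: IH.
by move=> x Xx; apply: cderD; auto.
Qed.

Lemma CnM n X f g : Cn n X f -> Cn n X g -> Cn n X (fun x => f x * g x).
Proof.
elim: n f g => [f g fc gc x Xx|n IH f g [fc fH] [gc gH]].
  by apply: contM; auto.
split=> [x Xx|i]; first by apply: contM; auto.
have [f' [fn ff]] := fH i; have [g' [gn gg]] := gH i.
exists (fun x => f' x * g x + f x * g' x); split.
  by apply: CnD; apply: IH => //; apply: CnS; split.
by move=> x Xx; apply: cderM; auto.
Qed.

Lemma Cn_cst n X (a : R[i]) : Cn n X (fun=> a).
Proof.
elim: n a => [a x _|n IH a]; first exact: cont_cst.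
split=> [x _|i]; first exact: cont_cst.
by exists (fun=> 0); split=> // x _; exact: cder_cst.
Qed.

Lemma CnV n X f : open X -> (forall x, X x -> f x != 0) ->
  Cn n X f -> Cn n X (fun x => (f x)^-1).
Proof.
move=> oX f0; elim: n => [fc x Xx|n IH fn].
  by apply: contV; auto.
have fc x : X x -> cont f x by exact: Cn_cont fn.
split=> [x Xx|i]; first by apply: contV; auto.
have [_ /(_ i)[f' [f'n ff]]] := fn.
exists (fun x => - f' x * (f x)^-1 ^+ 2); split.
  have I := IH (CnS fn); apply: CnM.
    have := CnM (Cn_cst n X (-1)) f'n; congr (Cn _ _ _).
    by apply/funext => x; rewrite mulN1r.
  have := CnM I I; congr (Cn _ _ _); by apply/funext => x; rewrite expr2.
move=> x Xx; apply: cderV; auto.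
have [r r0 h] := open_ball oX Xx; exists r => // y /h; exact: f0.
Qed.

Lemma contRe (f : V -> R[i]) x : cont f x -> cont (fun y => (complex.Re (f y))%:C) x.
Proof.
move=> fc e /fc [r r0 h]; exists r => // y /h; apply: le_lt_trans.
by rewrite -(rmorphB (real_complex R)) N_real -ReN -ReD Re_le.
Qed.

Lemma cderRe f x v l : cder f x v l ->
  cder (fun y => (complex.Re (f y))%:C) x v (complex.Re l)%:C.
Proof.
move=> /cder_ReIm[fR _]; apply/cder_ReIm; split=> //=.
exact: is_derive_cst.
Qed.

Lemma CnRe n X f : Cn n X f -> Cn n X (fun x => (complex.Re (f x))%:C).
Proof.
elim: n f => [f fc x Xx|n IH f [fc fH]]; first by apply: contRe; auto.
split=> [x Xx|i]; first by apply: contRe; auto.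
have [f' [fn ff]] := fH i; exists (fun x => (complex.Re (f' x))%:C); split.
  exact: IH.
by move=> x Xx; apply: cderRe; auto.
Qed.

Section OnOpen.
Context (X : set V) (oX : open X).

Lemma partials_eq s f g : (forall x, X x -> f x = g x) ->
  forall x, X x -> partials s f x = partials s g x.
Proof.
elim: s f g => [//|i s IH] f g fg x Xx /=; have E := IH _ _ fg.
have [r r0 h] := open_ball oX Xx.
have H : \forall y \near x, partials s f y = partials s g y.
  by apply/nbhs_normP; exists r => // y yx; apply: E; apply: h; rewrite distrC.
rewrite /partial; congr (_ +i* _); apply: near_eq_derive;
  by apply: filterS H => y ->.
Qed.

Lemma partial_eq i f g : (forall x, X x -> f x = g x) ->
  forall x, X x -> partial i f x = partial i g x.
Proof. exact: (@partials_eq [:: i]). Qed.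

Lemma sm_partials s f : smooth_on X f -> smooth_on X (partials s f).
Proof. by move=> fs t x Xx; rewrite /partials -foldr_cat; exact: (fs (t ++ s)). Qed.

Lemma sm_partial i f : smooth_on X f -> smooth_on X (partial i f).
Proof. exact: (@sm_partials [:: i]). Qed.

Lemma sm_cont f x : smooth_on X f -> X x -> cont f x.
Proof. by move=> /(_ [::]) fs /fs[/contE]. Qed.

Lemma sm_cder f x i : smooth_on X f -> X x -> cder f x (ee i) (partial i f x).
Proof. by move=> /(_ [::]) fs /fs[_ /(_ i)] /partial_cder. Qed.

Lemma Cn_partial n i f : Cn n.+1 X f -> Cn n X (partial i f).
Proof.
move=> [_ /(_ i)[g [gn fg]]]; apply: Cn_eq gn => // x /fg.
by case/cder_partial.
Qed.

Lemma smoothP f : smooth_on X f <-> forall n, Cn n X f.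
Proof.
split=> [fs n|fn s].
  elim: n f fs => [f fs x Xx|n IH f fs]; first exact: sm_cont fs Xx.
  split=> [x|i]; first exact: sm_cont.
  exists (partial i f); split; first by apply: IH; exact: sm_partial.
  by move=> x; exact: sm_cder.
have {}fn : forall n, Cn n X (partials s f).
  by elim: s f fn => [//|i s IH] f fn n; apply: Cn_partial; exact: IH.
move=> x Xx; split; first by apply/contE; exact: (Cn_cont (fn 0)).
by move=> i; have [_ /(_ i)[g [_ /(_ _ Xx)/cder_partial[]]]] := fn 1%N.
Qed.

Lemma sm_eq f g : (forall x, X x -> f x = g x) -> smooth_on X f -> smooth_on X g.
Proof. by move=> fg /smoothP fs; apply/smoothP => n; apply: Cn_eq fg _. Qed.

Lemma sm_cst a : smooth_on X (fun=> a).
Proof. by apply/smoothP => n; exact: Cn_cst. Qed.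

Lemma smD f g : smooth_on X f -> smooth_on X g -> smooth_on X (fun x => f x + g x).
Proof. by move=> /smoothP fs /smoothP gs; apply/smoothP => n; apply: CnD. Qed.

Lemma smM f g : smooth_on X f -> smooth_on X g -> smooth_on X (fun x => f x * g x).
Proof. by move=> /smoothP fs /smoothP gs; apply/smoothP => n; apply: CnM. Qed.

Lemma smZ a f : smooth_on X f -> smooth_on X (fun x => a * f x).
Proof. by move=> fs; apply: smM fs; exact: sm_cst. Qed.

Lemma smN f : smooth_on X f -> smooth_on X (fun x => - f x).
Proof. by move=> /(smZ (-1)); apply: sm_eq => x _; rewrite mulN1r. Qed.

Lemma smB f g : smooth_on X f -> smooth_on X g -> smooth_on X (fun x => f x - g x).
Proof. by move=> fs gs; apply: smD fs _; exact: smN. Qed.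

Lemma smV f : (forall x, X x -> f x != 0) -> smooth_on X f ->
  smooth_on X (fun x => (f x)^-1).
Proof. by move=> f0 /smoothP fs; apply/smoothP => n; apply: CnV. Qed.

Lemma smRe f : smooth_on X f -> smooth_on X (fun x => (complex.Re (f x))%:C).
Proof. by move=> /smoothP fs; apply/smoothP => n; apply: CnRe. Qed.

Lemma sm_sum (I : Type) (r : seq I) (F : I -> V -> R[i]) :
  (forall i, smooth_on X (F i)) -> smooth_on X (fun x => \sum_(i <- r) F i x).
Proof.
move=> Fs; elim: r => [|i r IH].
  by apply: sm_eq (sm_cst 0) => x _; rewrite big_nil.
by apply: sm_eq (smD (Fs i) IH) => x _; rewrite big_cons.
Qed.

Lemma smX n f : smooth_on X f -> smooth_on X (fun x => f x ^+ n).
Proof.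
move=> fs; elim: n => [|n IH].
  by apply: sm_eq (sm_cst 1) => x _; rewrite expr0.
by apply: sm_eq (smM fs IH) => x _; rewrite exprS.
Qed.

Lemma partialM i f g x : smooth_on X f -> smooth_on X g -> X x ->
  partial i (fun x => f x * g x) x = partial i f x * g x + f x * partial i g x.
Proof.
move=> fs gs Xx; have := cderM (sm_cder i fs Xx) (sm_cder i gs Xx).
by case/cder_partial.
Qed.

Lemma partialD i f g x : smooth_on X f -> smooth_on X g -> X x ->
  partial i (fun x => f x + g x) x = partial i f x + partial i g x.
Proof.
move=> fs gs Xx; have := cderD (sm_cder i fs Xx) (sm_cder i gs Xx).
by case/cder_partial.
Qed.

Lemma partialsZ s a f x : smooth_on X f -> X x ->
  partials s (fun x => a * f x) x = a * partials s f x.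
Proof.
move=> fs; elim: s x => [//|i s IH] x Xx /=.
rewrite (@partial_eq i _ (fun x => a * partials s f x))//.
by have /cder_partial[] := cderZ a (sm_cder i (@sm_partials s _ fs) Xx).
Qed.

Lemma partialsD s f g x : smooth_on X f -> smooth_on X g -> X x ->
  partials s (fun x => f x + g x) x = partials s f x + partials s g x.
Proof.
move=> fs gs; elim: s x => [//|i s IH] x Xx /=.
rewrite (@partial_eq i _ (fun x => partials s f x + partials s g x))//.
exact: (partialD _ (@sm_partials s _ fs) (@sm_partials s _ gs)).
Qed.

Lemma partials_cst0 s x : X x -> partials s (fun=> 0 : R[i]) x = 0.
Proof.
by move=> Xx; have := @partialsZ s 0 (fun=> 0) x (sm_cst 0) Xx; rewrite !mul0r.
Qed.

Lemma partials_sum s (I : Type) (r : seq I) (F : I -> V -> R[i]) x :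
  (forall i, smooth_on X (F i)) -> X x ->
  partials s (fun x => \sum_(i <- r) F i x) x = \sum_(i <- r) partials s (F i) x.
Proof.
move=> Fs Xx; elim: r => [|i r IH].
  rewrite [RHS]big_nil -[RHS](partials_cst0 s Xx); apply: partials_eq => // y _.
  by rewrite big_nil.
rewrite big_cons -IH -partialsD//; last exact: sm_sum.
by apply: partials_eq => // y _; rewrite big_cons.
Qed.

End OnOpen.

Lemma smS X Y f : X `<=` Y -> smooth_on Y f -> smooth_on X f.
Proof. by move=> XY fs s x /XY; exact: fs. Qed.

Lemma cder_affine f x0 (r : R) x v l : cder f (x0 + r *: x) v l ->
  cder (fun h => f (x0 + r *: h)) x v (r%:C * l).
Proof.
move=> /(cder_scale r) [q [qc q0 fq]]; exists q; split=> // t.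
by rewrite /= scalerDr addrA scalerA mulrC -scalerA fq.
Qed.

Lemma continuous_affine x0 (r : R) : continuous (fun h : V => x0 + r *: h).
Proof. exact: continuous_affine_gen. Qed.

Lemma open_affine X x0 (r : R) : open X -> open [set h : V | X (x0 + r *: h)].
Proof.
by move=> oX; apply: (open_comp (f := fun h : V => x0 + r *: h)) oX => x _; exact: continuous_affine.
Qed.

Lemma sm_affine X f x0 (r : R) : open X -> smooth_on X f ->
  smooth_on [set h | X (x0 + r *: h)] (fun h => f (x0 + r *: h)).
Proof.
move=> oX /(smoothP oX) fs; apply/(smoothP (@open_affine X x0 r oX)) => n.
elim: n f {fs}(fs n) => [f fc x Xx|n IH f [fc fH]].
  exact: (cont_comp (h := fun h : V => x0 + r *: h)) (@continuous_affine _ _ x) (fc _ Xx).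
split=> [x Xx|i].
  exact: (cont_comp (h := fun h : V => x0 + r *: h)) (@continuous_affine _ _ x) (fc _ Xx).
have [g [gn fg]] := fH i; exists (fun h => r%:C * g (x0 + r *: h)); split.
  by apply: CnM; [exact: Cn_cst|exact: IH].
by move=> x Xx; apply: cder_affine; exact: fg.
Qed.

Lemma partials_affine X f x0 (r : R) s x : open X -> smooth_on X f -> X (x0 + r *: x) ->
  partials s (fun h => f (x0 + r *: h)) x =
  r%:C ^+ size s * partials s f (x0 + r *: x).
Proof.
move=> oX fs; elim: s x => [|i s IH] x Xx /=; first by rewrite expr0 mul1r.
rewrite (@partial_eq _ (@open_affine X x0 r oX) i _
  (fun h => r%:C ^+ size s * partials s f (x0 + r *: h)))//=.
have := cder_affine (sm_cder i (@sm_partials X s _ fs) Xx).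
by move=> /(cderZ (r%:C ^+ size s)) /cder_partial[_ ->]; rewrite exprS; ring.
Qed.

Lemma partial_mvt f x i (t M : R) X : open X -> smooth_on X f ->
  (forall s : R, 0 <= s <= 1 -> X (x + (s * t) *: ee i) /\
     N (partial i f (x + (s * t) *: ee i)) <= M) ->
  N (f (x + t *: ee i) - f x) <= `|t| * M.
Proof.
move=> oX fs H; apply: (@mvt_bound R _ f (fun y => t%:C * partial i f y)).
  move=> s /H[]; rewrite scalerA => Xs _; apply: cder_scale; exact: sm_cder fs Xs.
by move=> s /H[_ le]; rewrite scalerA NM N_real ler_wpM2l.
Qed.

Lemma partials_swap X f i j x : open X -> smooth_on X f -> X x ->
  partial i (partial j f) x = partial j (partial i f) x.
Proof.
move=> oX fs Xx; have [r r0 Xr] := open_ball oX Xx.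
(* Both mixed derivatives are limits of the second difference quotient *)
have H a b : forall e : R, 0 < e -> exists2 s : R, 0 < s & forall h, 0 < h < s ->
    N (f (x + h *: ee a + h *: ee b) - f (x + h *: ee a) - (f (x + h *: ee b) - f x)
      - (h ^+ 2)%:C * partial b (partial a f) x) <= e * h ^+ 2.
  move=> e e0; set c := partial b _ x.
  have [s s0 hs] := sm_cont (@sm_partials X [:: b; a] _ fs) Xx e0.
  exists (Num.min s r / 2); first by rewrite divr_gt0// lt_min s0.
  move=> h /andP[h0 hsr].
  have close u v : 0 <= u <= 1 -> 0 <= v <= 1 ->
      `|x + (u * h) *: ee a + (v * h) *: ee b - x| < Num.min s r.
    move=> /andP[u0 u1] /andP[v0 v1]; rewrite -[x + _ + _]addrA [x + _]addrC addrK.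
    apply: le_lt_trans (ler_normD _ _) _; rewrite !normrZ !norm_ee !mulr1.
    rewrite !ger0_norm ?mulr_ge0 ?(ltW h0)//.
    by move: hsr; rewrite ltr_pdivlMr//; nra.
  pose G y := f (y + h *: ee b) - f y.
  pose k (y : V) := (h%:C * c * ((y - x) 0 a)%:C : R[i]).
  have -> : f (x + h *: ee a + h *: ee b) - f (x + h *: ee a) - (f (x + h *: ee b) - f x)
      - (h ^+ 2)%:C * c = (G (x + h *: ee a) - h%:C * c * h%:C) - (G x - 0).
    by rewrite /G rmorphXn/=; ring.
  have -> : e * h ^+ 2 = h * (e * h) by ring.
  have := @mvt_bound R _ (fun t : R^o => G (x + (t * h) *: ee a) - h%:C * c * (t * h)%:C)
    (fun t => h%:C * (partial a f (x + (t * h) *: ee a + h *: ee b) - partial a f (x + (t * h) *: ee a) - h%:C * c)) 0 1 (h * (e * h)).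
  rewrite !add0r [(1 : R^o) * h]mul1r [(0 : R^o) * h]mul0r scale0r addr0 mulr0.
  apply=> t t01; rewrite add0r [t *: 1]mulr1.
    have t1 : (0 <= (1 : R) <= 1) by rewrite ler01 lexx.
    have t0 : (0 <= (0 : R) <= 1) by rewrite ler01 lexx.
    have A1 : X (x + (t * h) *: ee a + h *: ee b).
      by apply: Xr; have := close _ _ t01 t1; rewrite mul1r lt_min => /andP[].
    have A0 : X (x + (t * h) *: ee a).
      by apply: Xr; have := close _ _ t01 t0; rewrite mul0r scale0r addr0 lt_min => /andP[].
    have L y : X (x + (t * h) *: ee a + y) ->
       cder (fun t : R^o => f (x + (t * h) *: ee a + y)) t (1 : R^o) (h%:C * partial a f (x + (t * h) *: ee a + y)).
      move=> Xy; rewrite addrAC in Xy *.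
      have := @cder_axis _ (x + y) (ee a) t h _ (sm_cder a fs Xy).
      rewrite -[X in cder X](_ : (fun t : R^o => f (x + (t * h) *: ee a + y)) = _)//.
      by apply/funext => z; rewrite addrAC.
    rewrite mulrBr mulrBr; apply: cderB; first apply: cderB.
    - exact: L.
    - by have := L 0; rewrite addr0 => /(_ A0); congr (cder _ _ _ _); apply/funext => u; rewrite addr0.
    - rewrite [X in cder _ _ _ X](_ : _ = h%:C * c * h%:C); last by ring.
      exists (fun=> h%:C * c * h%:C); split=> //; first exact: cont_cst.
      by move=> u; rewrite /= [u *: 1]mulr1 mulrDl rmorphD/= rmorphM/=; ring.
  rewrite NM N_real gtr0_norm// ler_pM2l//.
  have := @mvt_bound R _ (fun u : R^o => partial a f (x + (t * h) *: ee a + (u * h) *: ee b) - h%:C * c * u%:C)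
    (fun u => h%:C * (partial b (partial a f) (x + (t * h) *: ee a + (u * h) *: ee b) - c)) 0 1 (e * h).
  rewrite !add0r [(1 : R^o) * h]mul1r [(0 : R^o) * h]mul0r scale0r addr0 mulr0 mulr1 subr0 addrAC.
  apply=> u u01; rewrite add0r [u *: 1]mulr1.
    rewrite mulrBr; apply: cderB.
      have A1 : X (x + (t * h) *: ee a + (u * h) *: ee b).
        by apply: Xr; have := close _ _ t01 u01; rewrite lt_min => /andP[].
      exact: cder_axis (sm_cder b (@sm_partial X a _ fs) A1).
    exists (fun=> h%:C * c); split=> //; first exact: cont_cst.
    by move=> z; rewrite /= [z *: 1]mulr1 rmorphD/=; ring.
  rewrite NM N_real gtr0_norm// mulrC ler_wpM2r ?(ltW h0)// ltW//.
  by apply: hs; have := close _ _ t01 u01; rewrite lt_min => /andP[].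
apply/eqP; rewrite -subr_eq0 -N_eq0 -[_ == 0]negbK; apply/negP; rewrite N_eq0 -N_gt0 => h0.
set c := N _ in h0; have e0 : 0 < c / 4 by rewrite divr_gt0.
have [s1 s10 H1] := H i j _ e0; have [s2 s20 H2] := H j i _ e0.
pose h := Num.min s1 s2 / 2.
have m0 : 0 < Num.min s1 s2 by rewrite lt_min s10.
have h1 : 0 < h < s1.
  have : Num.min s1 s2 <= s1 by rewrite ge_min lexx.
  by rewrite /h; move: m0; lra.
have h2 : 0 < h < s2.
  have : Num.min s1 s2 <= s2 by rewrite ge_min lexx orbT.
  by rewrite /h; move: m0; lra.
have := H1 _ h1; have := H2 _ h2; rewrite [x + _ + _]addrAC.
set A := f (x + _ + _); set B := f (x + _); set D := f (x + _) => K2 K1.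
have : h ^+ 2 * c <= c / 4 * h ^+ 2 + c / 4 * h ^+ 2.
  rewrite -[X in X * c](ger0_norm (x := h ^+ 2)) ?sqr_ge0// -N_real /c -NM.
  apply: le_trans (lerD K1 K2); apply: le_trans (NB _ _).
  have key (A' B' D' z p q u : R[i]) :
    u * (p - q) = (A' - D' - (B' - z) - u * q) - (A' - B' - (D' - z) - u * p) by ring.
  by rewrite (key A B D (f x)).
have : 0 < h ^+ 2 by rewrite exprn_gt0//; case/andP: h1.
by move: (h ^+ 2) (c) h0 => u v; clear; nra.
Qed.

Lemma partials_perm X f s t x : open X -> smooth_on X f -> perm_eq s t -> X x ->
  partials s f x = partials t f x.
Proof.
move=> oX fs; elim: s t x => [|i s IH] t x st Xx.
  by have := perm_size st; case: t {st}.
have it : i \in t by rewrite -(perm_mem st) mem_head.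
have st' : perm_eq s (rem i t) by rewrite -(perm_cons i) (perm_trans st)// perm_to_rem.
have -> : partials t f x = partials (i :: rem i t) f x; last first.
  by rewrite /=; apply: (@partial_eq _ oX i) => // y Xy; exact: IH.
elim: t it x Xx {st st' IH} => [//|j t IH]; rewrite inE /=.
have [->//|ij] := eqVneq i j.
move=> it x Xx /=.
rewrite (partials_swap i j oX (@sm_partials X (rem i t) _ fs) Xx).
by apply: (@partial_eq _ oX j) => // y Xy; exact: IH.
Qed.

End Smooth.

(** * A free ultrafilter on the natural numbers *)

Lemma ultra_nat_exists : exists F : set_system nat, UltraFilter F /\ \oo `<=` F.
Proof. exact: ultraFilterLemma. Qed.

(** One ultrafilter is fixed for the whole development. Every bounded sequence has a limit along it,
    linearly in the sequence, so subsequences and diagonal arguments are avoided. *)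
Definition UU : set_system nat := projT1 (cid ultra_nat_exists).

Lemma UU_ultra : UltraFilter UU.
Proof. by rewrite /UU; case: cid => F []. Qed.

#[global] Instance UU_proper : ProperFilter UU.
Proof. exact: (@ultra_proper _ _ UU_ultra). Qed.

Lemma UU_ge n : UU [set j | (n <= j)%N].
Proof. by rewrite /UU; case: cid => F [/= _]; apply; exists n. Qed.

Lemma UU_ex A : UU A -> exists j, A j.
Proof. by move=> /filter_ex[j]; exists j. Qed.

Lemma UU_all (A : set nat) : (forall j, A j) -> UU A.
Proof. by move=> H; apply: filterS filterT. Qed.

Lemma UUnot A : ~ UU A -> UU (~` A).
Proof. by move=> nA; have [] := in_ultra_setVsetC A UU_ultra. Qed.

(** * Ultralimits and means over cubes *)

Section UltraLimit.
Context (R : realType).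

(** The limit is the supremum of the numbers lying below [a j] for almost all [j]; for an
    ultrafilter, a lower bound that fails is an upper bound almost everywhere. *)
Lemma ultra_real (a : nat -> R) (M : R) : UU [set j | `|a j| <= M] ->
  exists l, forall e, 0 < e -> UU [set j | `|a j - l| < e].
Proof.
move=> aM; pose S := [set x : R | UU [set j | x <= a j]].
have S0 : S (- M) by apply: filterS aM => j /=; rewrite ler_norml => /andP[].
have SM : ubound S M.
  move=> x Sx; have [j [/= xj]] := UU_ex (filterI Sx aM).
  by rewrite ler_norml => /andP[_]; exact: le_trans.
have hS : has_sup S by split; [exists (- M)|exists M].
exists (sup S) => e e0; have [x Sx xS] := sup_adherent e0 hS.
have : ~ S (sup S + e).
  by move=> /(ub_le_sup hS.2); rewrite gerDl leNgt e0.
move=> /UUnot H; apply: filterS (filterI Sx H) => j [/= xj /negP].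
by rewrite -ltNge ltr_norml => h; lra.
Qed.

Definition ul (a : nat -> R[i]) l := forall e : R, 0 < e -> UU [set j | N (a j - l) < e].

(** The value is 0 when no limit exists; all uses come with a bound that excludes this case. *)
Definition ulim (a : nat -> R[i]) := xget 0 [set l | ul a l].

Lemma ul_ulim (a : nat -> R[i]) (M : R) : UU [set j | N (a j) <= M] -> ul a (ulim a).
Proof.
move=> aM; apply: (@xgetPex _ 0 [set l | ul a l]).
have [|x hx] := @ultra_real (fun j => complex.Re (a j)) M.
  by apply: filterS aM => j /=; apply: le_trans; exact: Re_le.
have [|y hy] := @ultra_real (fun j => complex.Im (a j)) M.
  by apply: filterS aM => j /=; apply: le_trans; exact: Im_le.
exists (x +i* y) => e e0; have e2 : 0 < e / 2 by rewrite divr_gt0.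
apply: filterS (filterI (hx _ e2) (hy _ e2)) => j [/= h1 h2].
apply: le_lt_trans (N_le _) _; rewrite ReD ImD ReN ImN /=.
by move: h1 h2; lra.
Qed.

Lemma ul_uniq a l m : ul a l -> ul a m -> l = m.
Proof.
move=> al am; apply/eqP; rewrite -subr_eq0 -[_ == _]negbK -N_gt0; apply/negP => h.
have e0 : 0 < N (l - m) / 2 by rewrite divr_gt0.
have [j [/= h1 h2]] := UU_ex (filterI (al _ e0) (am _ e0)).
have : N (l - m) <= N (a j - m) + N (a j - l).
  have -> : l - m = (a j - m) - (a j - l) by ring.
  exact: NB.
by move: h1 h2; lra.
Qed.

Lemma ulimE a l : ul a l -> ulim a = l.
Proof.
move=> al; have H : ul a (ulim a).
  by apply: (@xgetPex _ 0 [set l | ul a l]); exists l.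
exact: ul_uniq H al.
Qed.

Lemma ul_cst (c : R[i]) : ul (fun=> c) c.
Proof. by move=> e e0; apply: UU_all => j /=; rewrite subrr N0. Qed.

Lemma ulD a b l m : ul a l -> ul b m -> ul (fun j => a j + b j) (l + m).
Proof.
move=> al bm e e0; have e2 : 0 < e / 2 by rewrite divr_gt0.
apply: filterS (filterI (al _ e2) (bm _ e2)) => j [/= h1 h2].
rewrite opprD addrACA; apply: le_lt_trans (ND _ _) _; by move: h1 h2; lra.
Qed.

Lemma ulZ c a l : ul a l -> ul (fun j => c * a j) (c * l).
Proof.
move=> al e e0; have c1 : 0 < N c + 1 by rewrite ltr_wpDl ?N_ge0.
have e2 : 0 < e / (N c + 1) by rewrite divr_gt0.
apply: filterS (al _ e2) => j /=; rewrite ltr_pdivlMr// -mulrBr NM.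
by apply: le_lt_trans; rewrite mulrC ler_wpM2l ?N_ge0// lerDl.
Qed.

Lemma ul_eq a b l : UU [set j | a j = b j] -> ul a l -> ul b l.
Proof.
by move=> ab al e /al H; apply: filterS (filterI ab H) => j [/= ->].
Qed.

Lemma ul_le a l (M : R) : ul a l -> UU [set j | N (a j) <= M] -> N l <= M.
Proof.
move=> al aM; rewrite leNgt; apply/negP => h.
have e0 : 0 < N l - M by rewrite subr_gt0.
have [j [/= h1 h2]] := UU_ex (filterI (al _ e0) aM).
have := le_N l (a j); rewrite NBC; by move: h1 h2; lra.
Qed.

End UltraLimit.

(** * Mean values over cubes as ultralimits of grid averages *)

Section Mean.
Context (R : realType) (d : nat).
Notation V := 'rV[R]_d.
Implicit Types (F G : V -> R[i]) (a : R) (x y : V).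

Lemma UU_forall (T : finType) (P : T -> set nat) :
  (forall i, UU (P i)) -> UU [set n | forall i, P i n].
Proof.
move=> H; suff : forall s : seq T, UU [set n | forall i, i \in s -> P i n].
  by move=> /(_ (enum T)); apply: filterS => n h i; apply: h; rewrite mem_enum.
elim=> [|i s IH]; first exact: UU_all.
apply: filterS (filterI (H i) IH) => n [h1 h2] j; rewrite inE => /predU1P[->//|].
exact: h2.
Qed.

(** The cluster point is the coordinatewise ultralimit; the whole sequence tends to it along [UU],
    which can be intersected with other events of [UU]. *)
Lemma cube_cluster (x : nat -> V) a : (forall n, `|x n| <= a) ->
  exists2 y, `|y| <= a & forall r : R, 0 < r -> UU [set n | `|x n - y| < r].
Proof.
move=> xa; have a0 : 0 <= a by apply: le_trans (xa 0%N).
have H (i : 'I_d) : exists l, forall e, 0 < e -> UU [set j | `|x j 0 i - l| < e].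
  by apply: (@ultra_real _ _ a); apply: UU_all => j /=; apply: le_trans (rv_coord _ _) _.
have [y hy] := choice H.
have yE r : 0 < r -> UU [set n | `|x n - \row_i y i| < r].
  move=> r0; have r2 : 0 < r / 2 by rewrite divr_gt0.
  have := UU_forall (fun i => hy i _ r2); apply: filterS => n /= h.
  have : `|x n - \row_i y i| <= r / 2.
    by apply/rv_leP => [|i]; [exact: ltW|rewrite !mxE ltW].
  lra.
exists (\row_i y i) => //; rewrite leNgt; apply/negP => h.
have h0 : 0 < `|\row_i y i| - a by rewrite subr_gt0.
have [n /=] := UU_ex (yE _ h0); rewrite ltNge => /negP; apply.
by rewrite distrC; apply: le_trans (lerB_dist _ _); rewrite lerB.
Qed.

Definition bd a F (K : R) := forall x, `|x| <= a -> N (F x) <= K.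

Lemma cube_bounded a F : (forall x, `|x| <= a -> cont F x) -> exists2 K, 0 < K & bd a F K.
Proof.
move=> Fc; apply: contrapT => H.
have /choice[x hx] : forall n : nat, exists x : V, `|x| <= a /\ n.+1%:R < N (F x).
  move=> n; apply: contrapT => nx; apply: H; exists n.+1%:R => // y ya.
  by rewrite leNgt; apply/negP => h; apply: nx; exists y.
have [y ya hy] := cube_cluster (fun n => (hx n).1).
have [r r0 hr] := Fc _ ya _ ltr01.
have /archi_boundP := N_ge0 (F y); set m := Num.bound _ => hm.
have [n [/= h1 h2]] := UU_ex (filterI (hy _ r0) (UU_ge m)).
have := hr _ h1; have := (hx n).2; have := le_N (F (x n)) (F y).
have : (m%:R : R) <= n%:R by rewrite ler_nat.
rewrite -natr1; move: hm; lra.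
Qed.

Section Grid.
Variables (a : R) (M : nat).
Implicit Types (g : {ffun 'I_d -> 'I_M.+1}).

Definition step := 2 * a / M.+1%:R.
Definition pt g : V := \row_i (step * (g i)%:R - a).
(** The Riemann sum over the lower corners of the cells of the cube [|x| <= a], normalized to total
    mass 1. *)
Definition avg F : R[i] :=
  (#|{ffun 'I_d -> 'I_M.+1}|%:R)^-1 * \sum_g F (pt g).

Lemma grid_card_gt0 : 0 < #|{ffun 'I_d -> 'I_M.+1}|%:R :> R.
Proof. by rewrite ltr0n card_ffun !card_ord expn_gt0. Qed.

Lemma stepM : step * M.+1%:R = 2 * a. Proof. by rewrite /step divfK. Qed.

Hypothesis a0 : 0 < a.

Lemma step_gt0 : 0 < step. Proof. by rewrite divr_gt0// mulr_gt0. Qed.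

Lemma pt_cube g j (t : R) : 0 <= t <= step -> `|pt g + t *: ee R j| <= a.
Proof.
move=> /andP[t0 ts]; apply/rv_leP => [|i]; first exact: ltW.
rewrite /pt !mxE eqxx/=; have s0 := step_gt0; have := stepM.
have gi0 : (0 : R) <= (g i)%:R by rewrite ler0n.
have : (g i)%:R + 1 <= M.+1%:R :> R by rewrite natr1 ler_nat ltn_ord.
rewrite ler_norml; move: gi0; set u := _%:R; set m := M.+1%:R.
have [_|_] := eqVneq i j; rewrite ?mulr1 ?mulr0 => h0 h1 h2; apply/andP; split; nra.
Qed.

Lemma pt_cube0 g : (0 < d)%N -> `|pt g| <= a.
Proof.
move=> d0; have := @pt_cube g (Ordinal d0) 0; rewrite scale0r addr0; apply.
by rewrite lexx ltW// step_gt0.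
Qed.

End Grid.

(** This mean stands in for the integral over the cube. Only linearity, monotonicity and the
    one-directional divergence theorem [II_flux] are used, and these survive an ultralimit of
    Riemann sums. *)
Definition II a F := ulim (fun M => avg a M F).

Section Props.
Context (d0 : (0 < d)%N) (a : R) (a0 : 0 < a).

Lemma avg_le M F (G : V -> R) : (forall x, `|x| <= a -> N (F x) <= G x) ->
  N (avg a M F) <= complex.Re (avg a M (fun x => (G x)%:C)).
Proof.
move=> FG; rewrite /avg NM NV N_nat -(rmorph_nat (real_complex R)) -fmorphV ReM_real.
rewrite -rmorph_sum /= ler_wpM2l ?invr_ge0 ?ler0n//.
apply: le_trans (N_sum _ _ _) _; apply: ler_sum => g _.
by apply: FG; exact: pt_cube0.
Qed.

Lemma avg_cst M c : avg a M (fun=> c) = c.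
Proof.
rewrite /avg sumr_const -[c *+ _]mulr_natl mulKf// -(rmorph_nat (real_complex R)).
by rewrite -N_eq0 N_real normr_nat lt0r_neq0// grid_card_gt0.
Qed.

Lemma avg_bd M F K : bd a F K -> N (avg a M F) <= K.
Proof. by move=> /(@avg_le M F (fun=> K)); rewrite avg_cst. Qed.

Lemma II_ul F K : bd a F K -> ul (fun M => avg a M F) (II a F).
Proof.
by move=> FK; apply: (@ul_ulim _ _ K); apply: UU_all => M /=; exact: avg_bd.
Qed.

Lemma II_le F K : bd a F K -> N (II a F) <= K.
Proof.
move=> FK; apply: ul_le (II_ul FK) _; apply: UU_all => M /=; exact: avg_bd.
Qed.

Lemma II_mono F (G : V -> R) K l : (forall x, `|x| <= a -> N (F x) <= G x) ->
  bd a (fun x => (G x)%:C) K -> II a (fun x => (G x)%:C) = l -> N (II a F) <= N l.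
Proof.
move=> FG GK <-; have FK : bd a F K.
  move=> x xa; apply: le_trans (FG _ xa) _; apply: le_trans (GK _ xa).
  by rewrite N_real ler_norm.
rewrite leNgt; apply/negP => h.
have e0 : 0 < (N (II a F) - N (II a (fun x => (G x)%:C))) / 2 by rewrite divr_gt0// subr_gt0.
have [M [/= h1 h2]] := UU_ex (filterI (II_ul FK e0) (II_ul GK e0)).
have := avg_le M FG; have := Re_le (avg a M (fun x => (G x)%:C)).
have := le_N (II a F) (avg a M F); rewrite NBC.
have := le_N (avg a M (fun x => (G x)%:C)) (II a (fun x => (G x)%:C)).
have := ler_norm (complex.Re (avg a M (fun x => (G x)%:C))).
by move: h1 h2; lra.
Qed.

Lemma avgD M F G : avg a M (fun x => F x + G x) = avg a M F + avg a M G.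
Proof. by rewrite /avg big_split mulrDr. Qed.

Lemma avgZ M c F : avg a M (fun x => c * F x) = c * avg a M F.
Proof. by rewrite /avg -mulr_sumr mulrCA. Qed.

Lemma IID F G K L : bd a F K -> bd a G L ->
  II a (fun x => F x + G x) = II a F + II a G.
Proof.
move=> FK GL; apply: ulimE; apply: ul_eq (ulD (II_ul FK) (II_ul GL)).
by apply: UU_all => M /=; rewrite avgD.
Qed.

Lemma IIZ c F K : bd a F K -> II a (fun x => c * F x) = c * II a F.
Proof.
move=> FK; apply: ulimE; apply: ul_eq (ulZ c (II_ul FK)).
by apply: UU_all => M /=; rewrite avgZ.
Qed.

Lemma II_cst c : II a (fun=> c) = c.
Proof.
apply: ulimE; apply: ul_eq (ul_cst c); by apply: UU_all => M /=; rewrite avg_cst.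
Qed.

Lemma II_eq F G : (forall x, `|x| <= a -> F x = G x) -> II a F = II a G.
Proof.
move=> FG; rewrite /II; congr ulim; apply/funext => M; rewrite /avg; congr (_ * _).
by apply: eq_bigr => g _; apply: FG; exact: pt_cube0.
Qed.

Lemma bdD F G K L : bd a F K -> bd a G L -> bd a (fun x => F x + G x) (K + L).
Proof. by move=> FK GL x xa; apply: le_trans (ND _ _) _; apply: lerD; auto. Qed.

Lemma bdM F G K L : bd a F K -> bd a G L -> bd a (fun x => F x * G x) (K * L).
Proof. by move=> FK GL x xa; rewrite NM ler_pM ?N_ge0//; auto. Qed.

Lemma II_sum (T : Type) (r : seq T) (F : T -> V -> R[i]) K :
  (forall i, bd a (F i) K) ->
  II a (fun x => \sum_(i <- r) F i x) = \sum_(i <- r) II a (F i).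
Proof.
move=> FK; have B (s : seq T) : exists L, bd a (fun x => \sum_(i <- s) F i x) L.
  elim: s => [|i s [L H]].
    by exists 0 => x xa; rewrite big_nil N0.
  by exists (K + L) => x xa; rewrite big_cons; exact: (bdD (FK i) H xa).
elim: r => [|i r IH].
  rewrite big_nil -[RHS](II_cst 0); apply: II_eq => x _; by rewrite big_nil.
rewrite big_cons -IH; have [L H] := B r; rewrite -(IID (FK i) H).
by apply: II_eq => x _; rewrite big_cons.
Qed.

(* The grid average of d_j F telescopes along the j-th coordinate up to O(step). *)
Lemma II_flux X j F (D : R) : open X -> (forall x, `|x| <= a -> X x) -> smooth_on X F ->
  (forall x y, `|x| <= a -> `|y| <= a -> x 0 j = a -> y 0 j = - a ->
     (forall i, i != j -> x 0 i = y 0 i) -> N (F x - F y) <= D) ->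
  N (II a (partial j F)) <= D / (2 * a).
Proof.
move=> oX QX Fs FD.
have [B B0 hB] : exists2 K, 0 < K & bd a (partials [:: j; j] F) K.
  by apply: cube_bounded => x /QX; apply: sm_cont; exact: sm_partials.
have [K K0 hK] : exists2 K, 0 < K & bd a (partial j F) K.
  by apply: cube_bounded => x /QX; apply: sm_cont; exact: sm_partial.
have main M : N (avg a M (partial j F)) <= D / (2 * a) + step a M * B.
  set h := step a M; have h0 : 0 < h by exact: step_gt0.
  have T (g : {ffun 'I_d -> 'I_M.+1}) :
      N (F (pt a g + h *: ee R j) - F (pt a g) - h%:C * partial j F (pt a g)) <= h * (h * B).
    have := @mvt_bound R _ (fun t : R^o => F (pt a g + (t * h) *: ee R j) - h%:C * partial j F (pt a g) * t%:C)
      (fun t => h%:C * (partial j F (pt a g + (t * h) *: ee R j) - partial j F (pt a g))) 0 1 (h * (h * B)).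
    rewrite !add0r [(1 : R^o) * h]mul1r [(0 : R^o) * h]mul0r scale0r addr0 mulr0 mulr1 subr0 addrAC.
    have C (t u : R) : 0 <= t <= 1 -> 0 <= u <= 1 -> `|pt a g + (u * (t * h)) *: ee R j| <= a.
      move=> /andP[t0 t1] /andP[u0 u1]; apply: pt_cube => //; rewrite -/h.
      have tu0 : 0 <= u * t by rewrite mulr_ge0.
      have tu1 : u * t <= 1 by rewrite mulr_ile1.
      by rewrite mulrA mulr_ge0 ?(ltW h0)//= ler_piMl ?(ltW h0).
    apply=> t t01; rewrite add0r [t *: 1]mulr1.
      have t1 : 0 <= (1 : R) <= 1 by rewrite ler01 lexx.
      rewrite mulrBr; apply: cderB.
        have Xt : X (pt a g + (t * h) *: ee R j).
          by apply: QX; have := C _ _ t01 t1; rewrite mul1r.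
        exact: cder_axis (sm_cder j Fs Xt).
      exists (fun=> h%:C * partial j F (pt a g)); split=> //; first exact: cont_cst.
      by move=> z; rewrite /= [z *: 1]mulr1 rmorphD/=; ring.
    rewrite NM N_real gtr0_norm// ler_pM2l//.
    have [t0 t1] := andP t01.
    apply: le_trans (@partial_mvt _ _ (partial j F) (pt a g) j (t * h) B X oX _ _) _.
    - exact: sm_partial.
    - by move=> u u01; have Q := C _ _ t01 u01; split; [exact: QX|exact: hB].
    - have th : 0 <= t * h by rewrite mulr_ge0 ?(ltW h0).
      rewrite (ger0_norm th); apply: ler_wpM2r; first exact: ltW.
      by rewrite ler_piMl ?(ltW h0).
  (* [sg] shifts the grid cyclically in direction [j]. Replacing the unshifted sum by the sum over
     the shifted grid cancels every difference except on the last layer, where the jump back to the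
     first layer remains. *)
  pose sg (g : {ffun 'I_d -> 'I_M.+1}) : {ffun 'I_d -> 'I_M.+1} :=
    [ffun i => if i == j then ordS (g i) else g i].
  have sgI : injective sg.
    move=> g1 g2 /ffunP E; apply/ffunP => i; have := E i; rewrite !ffunE.
    by case: eqP => // _ /ordS_inj.
  set n := #|{ffun 'I_d -> 'I_M.+1}|.
  have TE : \sum_(g : {ffun 'I_d -> 'I_M.+1}) (F (pt a g + h *: ee R j) - F (pt a g)) =
     \sum_(g : {ffun 'I_d -> 'I_M.+1} | g j == ord_max) (F (pt a g + h *: ee R j) - F (pt a (sg g))).
    rewrite sumrB [X in _ - X](reindex_inj sgI) -sumrB [LHS](bigID (fun g : {ffun 'I_d -> 'I_M.+1} => g j == ord_max)) /=.
    rewrite [X in _ + X]big1 ?addr0// => g gj; apply/eqP; rewrite subr_eq0; apply/eqP; congr F.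
    apply/rowP => i; rewrite /pt !mxE ffunE eqxx /=.
    have [->|_] := eqVneq i j; rewrite ?mulr1 ?mulr0 ?addr0//.
    have gM : (g j < M)%N.
      by rewrite ltn_neqAle -ltnS ltn_ord andbT; apply: contra gj => /eqP E; apply/eqP/val_inj.
    have -> : nat_of_ord (ordS (g j)) = (g j).+1.
      by rewrite -[nat_of_ord _]/((g j).+1 %% M.+1)%N modn_small ?ltnS.
    by rewrite -natr1 -/h; ring.
  (* The last layer is the fraction 1/(M+1) of the grid: transposing [k] and [ord_max] in the [j]-th
     coordinate carries layer [k] onto it. *)
  have cardE : (#|[pred g : {ffun 'I_d -> 'I_M.+1} | g j == ord_max]| * M.+1 = n)%N.
    rewrite /n -[in RHS](sum1_card {ffun 'I_d -> 'I_M.+1}).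
    rewrite (partition_big (fun g : {ffun 'I_d -> 'I_M.+1} => g j) xpredT)//=.
    have E k : (\sum_(g : {ffun 'I_d -> 'I_M.+1} | g j == k) 1 =
      #|[pred g : {ffun 'I_d -> 'I_M.+1} | g j == ord_max]|)%N.
      pose tr (g : {ffun 'I_d -> 'I_M.+1}) : {ffun 'I_d -> 'I_M.+1} :=
        [ffun i => if i == j then tperm k ord_max (g i) else g i].
      have trK : involutive tr.
        by move=> g; apply/ffunP => i; rewrite !ffunE; case: eqP => // ->; rewrite tpermK.
      rewrite (reindex_inj (inv_inj trK)) -sum1_card; apply: eq_bigl => g.
      by rewrite inE ffunE eqxx -(inj_eq (@perm_inj _ (tperm k ord_max))) tpermK tpermL.
    rewrite (eq_bigr (fun=> #|[pred g : {ffun 'I_d -> 'I_M.+1} | g j == ord_max]|)) => [|k _].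
      by rewrite sum_nat_const card_ord mulnC.
    exact: E.
  have n0 : (0 : R) < n%:R by exact: grid_card_gt0.
  have S1 : N (\sum_(g : {ffun 'I_d -> 'I_M.+1}) (F (pt a g + h *: ee R j) - F (pt a g)))
      <= n%:R / M.+1%:R * D.
    rewrite TE; apply: le_trans (N_sum _ _ _) _.
    apply: le_trans (ler_sum _ (G := fun=> D) _) _.
      move=> g /eqP gj; apply: FD.
      - by apply: pt_cube; rewrite // lexx andbT ltW.
      - exact: pt_cube0.
      - rewrite /pt !mxE !eqxx gj /= mulr1 -/h.
        have := stepM a M; rewrite -/h -natr1; lra.
      - rewrite /pt !mxE !ffunE eqxx gj.
        have -> : nat_of_ord (ordS (ord_max : 'I_M.+1)) = 0%N.
          by rewrite -[nat_of_ord _]/(M.+1 %% M.+1)%N modnn.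
        by rewrite mulr0 add0r.
      - move=> i ij; rewrite /pt !mxE !ffunE eqxx (negbTE ij)/=.
        by rewrite mulr0 addr0.
    have -> : \sum_(g : {ffun 'I_d -> 'I_M.+1} | g j == ord_max) D =
        D *+ #|[pred g : {ffun 'I_d -> 'I_M.+1} | g j == ord_max]|.
      by rewrite -sumr_const; apply: eq_bigl => g; rewrite inE.
    rewrite -[leLHS]mulr_natl -cardE natrM mulfK ?pnatr_eq0//.
  have S2 : N (h%:C * \sum_(g : {ffun 'I_d -> 'I_M.+1}) partial j F (pt a g)) <=
     n%:R / M.+1%:R * D + n%:R * (h * (h * B)).
    rewrite mulr_sumr -[X in N X](subrK (\sum_(g : {ffun 'I_d -> 'I_M.+1}) (F (pt a g + h *: ee R j) - F (pt a g)))).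
    apply: le_trans (ND _ _) _; rewrite [leLHS]addrC; apply: lerD => //.
    rewrite NBC -sumrB; apply: le_trans (N_sum _ _ _) _.
    by apply: le_trans (ler_sum _ (fun g _ => T g)) _; rewrite sumr_const -[leLHS]mulr_natl.
  rewrite /avg NM NV N_nat -/n; move: S2; rewrite NM N_real gtr0_norm//.
  set S := N _ => S2; rewrite ler_pdivrMl//.
  have -> : n%:R * (D / (2 * a) + h * B) = h^-1 * (n%:R / M.+1%:R * D + n%:R * (h * (h * B))).
    rewrite -(stepM a M) -/h; field; rewrite ?pnatr_eq0 ?lt0r_neq0//.
  by rewrite ler_pdivlMl.
rewrite leNgt; apply/negP => hlt.
have e0 : 0 < (N (II a (partial j F)) - D / (2 * a)) / 2 by rewrite divr_gt0// subr_gt0.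
have /archi_boundP := ltW (divr_gt0 (mulr_gt0 (mulr_gt0 (ltr0Sn R 1) a0) B0) e0); set m := Num.bound _ => hm.
have [M [/= h1 h2]] := UU_ex (filterI (II_ul hK e0) (UU_ge m)).
have : step a M * B < (N (II a (partial j F)) - D / (2 * a)) / 2.
  rewrite /step mulrAC ltr_pdivrMr// [ltRHS]mulrC -ltr_pdivrMr//; apply: lt_le_trans hm _.
  by rewrite ler_nat (leq_trans h2).
have := main M; have := le_N (II a (partial j F)) (avg a M (partial j F)); rewrite NBC.
by move: h1; lra.
Qed.

End Props.

End Mean.

(** * Exponentials *)

Section Exponential.
Context (R : realType).

Definition cexp (z : R[i]) : R[i] :=
  (expR (complex.Re z))%:C * (cos (complex.Im z) +i* sin (complex.Im z)).

Lemma cexpD z w : cexp (z + w) = cexp z * cexp w.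
Proof.
rewrite /cexp ReD ImD expRD cosD sinD; apply: eqC => /=; ring.
Qed.

Lemma cexp0 : cexp 0 = 1.
Proof. by rewrite /cexp /= expR0 cos0 sin0 mul1r. Qed.

Lemma N_cexp z : N (cexp z) = expR (complex.Re z).
Proof.
rewrite /cexp NM N_real ger0_norm ?expR_ge0// [X in _ * X](_ : _ = 1) ?mulr1//.
by rewrite /= cos2Dsin2 sqrtr1.
Qed.

Lemma cexp_neq0 z : cexp z != 0.
Proof. by rewrite -N_gt0 N_cexp expR_gt0. Qed.

Lemma cexpN z : cexp (- z) = (cexp z)^-1.
Proof.
by apply: (mulIf (cexp_neq0 z)); rewrite mulVf ?cexp_neq0// -cexpD addNr cexp0.
Qed.

Lemma cexp_sum (I : Type) (r : seq I) (F : I -> R[i]) :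
  cexp (\sum_(i <- r) F i) = \prod_(i <- r) cexp (F i).
Proof. exact: (big_morph cexp cexpD cexp0). Qed.

Lemma cexp_mulrn z n : cexp (z *+ n) = cexp z ^+ n.
Proof. by elim: n => [|n IH]; rewrite ?cexp0// mulrS cexpD IH exprS. Qed.

Lemma cexp_2pi (k : int) : cexp ('i * k%:~R * (2 * pi)%:C) = 1.
Proof.
have E : cexp ('i * (2 * pi)%:C) = 1.
  have -> : 'i * (2 * pi)%:C = 0 +i* (pi *+ 2) :> R[i].
    by rewrite mulr_natl; apply: eqC => /=; ring.
  rewrite /cexp /= expR0 mul1r cos2pi; congr (_ +i* _).
  by rewrite -[pi *+ 2]add0r (sinD2pi 0) sin0.
have P n : cexp ('i * (n%:Z)%:~R * (2 * pi)%:C) = 1.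
  have -> : 'i * (n%:Z)%:~R * (2 * pi)%:C = ('i * (2 * pi)%:C) *+ n :> R[i].
    by rewrite -mulr_natr -pmulrn; ring.
  by rewrite cexp_mulrn E expr1n.
case: k => n; first exact: P.
by rewrite NegzE rmorphN/= mulrN mulNr cexpN P invr1.
Qed.

Lemma is_derive_lin (c t : R) : is_derive (t : R^o) (1 : R^o) (fun s : R => s * c) c.
Proof.
apply/is_deriveP => e e0; exists 1 => // s _.
rewrite [_ *: 1]mulr1 [X in `|X|](_ : _ = 0) ?normr0 ?mulr_ge0// ?ltW//.
by rewrite /=; ring.
Qed.

Lemma cder_cexp (w : R[i]) : cder (fun t : R^o => cexp (t%:C * w)) 0 (1 : R^o) w.
Proof.
pose a := complex.Re w; pose b := complex.Im w.
have dE := @is_derive1_comp R expR (fun t => t * a) 0 _ _ (is_derive_expR _) (is_derive_lin a 0).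
have dC := @is_derive1_comp R cos (fun t => t * b) 0 _ _ (is_derive_cos _) (is_derive_lin b 0).
have dS := @is_derive1_comp R sin (fun t => t * b) 0 _ _ (is_derive_sin _) (is_derive_lin b 0).
apply/cder_ReIm; split.
  have := is_deriveM dE dC; rewrite /= !mul0r expR0 cos0 sin0 [X in is_derive _ _ _ X](_ : _ = a); last first.
    by rewrite /GRing.scale/=; ring.
  rewrite [X in is_derive _ _ X](_ : _ = (fun y : R^o => complex.Re (cexp (y%:C * w))))//.
  by apply/funext => t; rewrite /cexp !ReM_real !ImM_real /=.
have := is_deriveM dE dS; rewrite /= !mul0r expR0 cos0 sin0 [X in is_derive _ _ _ X](_ : _ = b); last first.
  by rewrite /GRing.scale/=; ring.
rewrite [X in is_derive _ _ X](_ : _ = (fun y : R^o => complex.Im (cexp (y%:C * w))))//.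
by apply/funext => t; rewrite /cexp !ImM_real !ReM_real /=.
Qed.

Section Vect.
Context (d : nat).
Notation V := 'rV[R]_d.
Implicit Types (z : 'I_d -> R[i]) (x : V).

(** Bilinear, without conjugation, so that [ex z] is an eigenfunction of each [partial i] with
    eigenvalue [z i]. *)
Definition dotc z x : R[i] := \sum_i z i * (x 0 i)%:C.
Definition ex z x := cexp (dotc z x).

Lemma dotc_ee z x (t : R) j : dotc z (x + t *: ee R j) = dotc z x + t%:C * z j.
Proof.
rewrite /dotc -[z j](_ : \sum_i (i == j)%:R * z i = _); last first.
  rewrite (bigD1 j)//= eqxx mul1r big1 ?addr0// => i /negbTE ->.
  by rewrite mul0r.
rewrite mulr_sumr -big_split; apply: eq_bigr => i _ /=.
rewrite !mxE eqxx /= rmorphD rmorphM /= rmorph_nat; ring.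
Qed.

Lemma exD z w x : ex (fun i => z i + w i) x = ex z x * ex w x.
Proof.
rewrite /ex -cexpD /dotc -big_split; congr cexp; apply: eq_bigr => i _.
by rewrite mulrDl.
Qed.

Lemma ex_prod z x : ex z x = \prod_i cexp (z i * (x 0 i)%:C).
Proof. by rewrite /ex cexp_sum. Qed.

Lemma ex0 x : ex (fun=> 0) x = 1.
Proof. by rewrite /ex /dotc big1 ?cexp0// => i _; rewrite mul0r. Qed.

Lemma N_ex z x : N (ex z x) = expR (\sum_i complex.Re (z i) * x 0 i).
Proof.
rewrite /ex N_cexp; congr expR; rewrite /dotc (big_morph (@complex.Re R) (@ReD R) (erefl _)).
by apply: eq_bigr => i _; rewrite mulrC ReM_real mulrC.
Qed.

Lemma cder_ex z x j : cder (ex z) x (ee R j) (z j * ex z x).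
Proof.
have [q [qc q0 qE]] := cder_cexp (z j).
exists (fun t => q t * ex z x); split=> [||t]; [exact: contM qc (cont_cst _ _)|by rewrite q0|].
rewrite /ex dotc_ee cexpD; have := qE t; rewrite /= add0r [t *: 1]mulr1 mul0r cexp0 => ->.
ring.
Qed.

Lemma cont_ex z x : cont (ex z) x.
Proof.
have lin (y : V) : cont (dotc z) y.
  rewrite /dotc => e e0; pose K := \sum_i N (z i).
  have K0 : 0 <= K by apply: sumr_ge0 => i _; exact: N_ge0.
  have K1 : 0 < K + 1 by rewrite ltr_wpDl.
  exists (e / (K + 1)) => [|u]; first by rewrite divr_gt0.
  rewrite ltr_pdivlMr// -sumrB => h; apply: le_lt_trans h.
  apply: le_trans (N_sum _ _ _) _; apply: (@le_trans _ _ (`|u - y| * K)).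
    rewrite mulr_sumr; apply: ler_sum => i _; rewrite -mulrBr NM mulrC ler_wpM2r ?N_ge0//.
    rewrite -(rmorphB (real_complex R)) N_real.
    by have := rv_coord (u - y) i; rewrite !mxE.
  by rewrite ler_wpM2l// lerDl.
rewrite /ex.
have ce w : forall e : R, 0 < e -> exists2 r : R, 0 < r & forall u, N u < r -> N (cexp (w + u) - cexp w) < e.
  move=> e e0; have E0 : 0 < N (cexp w) by rewrite N_cexp expR_gt0.
  have e1 : 0 < e / N (cexp w) / 3 by rewrite !divr_gt0.
  have cE : cont (fun t : R^o => (expR t)%:C) (0 : R^o).
    by apply: cder_cont1; apply: cder_real; exact: is_derive_expR.
  have cC : cont (fun t : R^o => (cos t)%:C) (0 : R^o).
    by apply: cder_cont1; apply: cder_real; exact: is_derive_cos.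
  have cS : cont (fun t : R^o => (sin t)%:C) (0 : R^o).
    by apply: cder_cont1; apply: cder_real; exact: is_derive_sin.
  have e2 : 0 < Num.min (e / N (cexp w) / 6) 1 by rewrite lt_min ltr01 andbT !divr_gt0.
  have [r1 r10 h1] := cE _ e2; have [r2 r20 h2] := cC _ e2; have [r3 r30 h3] := cS _ e2.
  exists (Num.min r1 (Num.min r2 r3)); first by rewrite !lt_min r10 r20.
  move=> u; rewrite !lt_min => /and3P[u1 u2 u3].
  have -> : cexp (w + u) - cexp w = cexp w * (cexp u - 1) by rewrite cexpD mulrBr mulr1.
  rewrite NM mulrC -ltr_pdivlMr//.
  have a1 := h1 (complex.Re u); have a2 := h2 (complex.Im u); have a3 := h3 (complex.Im u).
  rewrite !subr0 -!(rmorphB (real_complex R)) !N_real expR0 in a1.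
  rewrite !subr0 -!(rmorphB (real_complex R)) !N_real cos0 in a2.
  rewrite !subr0 -!(rmorphB (real_complex R)) !N_real sin0 subr0 in a3.
  have {a1} := a1 (le_lt_trans (Re_le _) u1).
  have {a2} := a2 (le_lt_trans (Im_le _) u2).
  have {a3} := a3 (le_lt_trans (Im_le _) u3).
  rewrite !lt_min; move: (e / N (cexp w)) => f => /andP[s1 _] /andP[c1 _] /andP[x1 x2].
  apply: le_lt_trans (N_le _) _; rewrite ReD ImD ReN ImN /cexp ReM_real ImM_real /= subr0.
  set E := expR _ in x1 x2 *; set c := cos _ in c1 *; set s := sin _ in s1 *.
  have E2 : `|E| < 2.
    have -> : E = (E - 1) + 1 by ring.
    by apply: le_lt_trans (ler_normD _ _) _; rewrite normr1 -ltrBrDr (_ : 2 - 1 = 1 :> R)//; ring.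
  have -> : E * c - 1 = E * (c - 1) + (E - 1) by ring.
  have := ler_normD (E * (c - 1)) (E - 1); rewrite !normrM.
  have := normr_ge0 E; have := normr_ge0 s; have := normr_ge0 (c - 1).
  move: (`|_ + (E - 1)|) (`|E|) (`|s|) (`|c - 1|) (`|E - 1|) E2 s1 c1 x1; clear.
  move=> Z A B C D A2 B1 C1 D1 C0 B0 A0.
  have h : A * C <= 2 * C by rewrite ler_wpM2r// ltW.
  have h' : A * B <= 2 * B by rewrite ler_wpM2r// ltW.
  lra.
move=> e /(ce (dotc z x)) [r r0 h]; have [r' r'0 h'] := lin x _ r0.
exists r' => // y /h' /h; by rewrite [dotc z x + _]addrC subrK.
Qed.

Lemma sm_ex z : smooth_on setT (ex z).
Proof.
apply/smoothP; first exact: openT.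
move=> n; have H : forall c, Cn n setT (fun x => c * ex z x).
  elim: n => [c x _|n IH c]; first by apply: contM (cont_cst _ _) (cont_ex _ _).
  split=> [x _|i]; first by apply: contM (cont_cst _ _) (cont_ex _ _).
  exists (fun x => (c * z i) * ex z x); split; first exact: IH.
  by move=> x _; rewrite -mulrA; apply: cderZ; exact: cder_ex.
by have := H 1; congr (Cn _ _ _); apply/funext => x; rewrite mul1r.
Qed.

Lemma partials_ex s z x : partials s (ex z) x = (\prod_(i <- s) z i) * ex z x.
Proof.
elim: s x => [|i s IH] x; first by rewrite big_nil mul1r.
rewrite /= (@partial_eq _ _ setT openT i _ (fun x => (\prod_(i <- s) z i) * ex z x))//.
have /cder_partial[_ ->] := cderZ (\prod_(i <- s) z i) (cder_ex z x i).
by rewrite big_cons; ring.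
Qed.

Lemma sm_prod X (I : Type) (r : seq I) (F : I -> V -> R[i]) : open X ->
  (forall i, smooth_on X (F i)) -> smooth_on X (fun x => \prod_(i <- r) F i x).
Proof.
move=> oX Fs; elim: r => [|i r IH].
  by apply: (sm_eq oX _ (sm_cst oX 1)) => x _; rewrite big_nil.
by apply: (sm_eq oX _ (smM oX (Fs i) IH)) => x _; rewrite big_cons.
Qed.

End Vect.
End Exponential.

(** * Geometric decay, binomial coefficients and sums of inverse squares *)

Section RealFacts.
Context (R : realType).

(** With [n = p + 1], the inequality exp y >= y taken to the power [n] gives th^-j >= (j dl / n)^n,
    one power of [j] more than the polynomial factor. The factor 2j + 1 is the one bounding the
    normalization [bkn j] of the kernel. *)
Lemma poly_geom (p : nat) (th e : R) : 0 <= th -> th < 1 -> 0 < e ->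
  exists J, forall j, (J <= j)%N -> (2 * j%:R + 1) ^+ p * th ^+ j <= e.
Proof.
move=> th0 th1 e0; pose t := Num.max th (1 / 2).
have t0 : 0 < t by rewrite lt_max divr_gt0 ?orbT.
have t1 : t < 1 by rewrite gt_max th1 ltr_pdivrMr// mul1r ltr1n.
pose dl := - ln t.
have dl0 : 0 < dl by rewrite oppr_gt0 ln_lt0// t0.
pose n := p.+1; pose K := 3 ^+ p * (n%:R / dl) ^+ n / e.
have nd : 0 <= n%:R / dl by rewrite divr_ge0// ltW.
have K0 : 0 <= K by apply: divr_ge0 (ltW e0); apply: mulr_ge0; apply: exprn_ge0.
have /archi_boundP := K0; set m := Num.bound _ => hm.
exists m.+1 => j mj; have j0 : (0 < j)%N by apply: leq_trans mj.
have jR : (0 : R) < j%:R by rewrite ltr0n.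
have thj : th ^+ j <= t ^+ j by rewrite lerXn2r ?nnegrE ?(ltW t0)// le_max lexx.
have tE : t ^+ j = (expR (j%:R * dl))^-1.
  by rewrite -expRN /dl mulrN opprK expRM_natl lnK// posrE.
have yn : (j%:R * dl / n%:R) ^+ n <= expR (j%:R * dl).
  have E : expR (j%:R * dl) = expR (j%:R * dl / n%:R) ^+ n.
    by rewrite -expRM_natl [n%:R * _]mulrC divfK// pnatr_eq0.
  rewrite E lerXn2r ?nnegrE ?expR_ge0//.
    by rewrite divr_ge0// mulr_ge0// ltW.
  by apply: le_trans (expR_ge1Dx _); rewrite lerDr.
have pos : 0 < (j%:R * dl / n%:R) ^+ n by rewrite exprn_gt0// divr_gt0 ?mulr_gt0// ltr0n.
apply: (@le_trans _ _ ((3 * j%:R) ^+ p * ((j%:R * dl / n%:R) ^+ n)^-1)).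
  apply: ler_pM; rewrite ?exprn_ge0 ?addr_ge0 ?mulr_ge0//.
    rewrite lerXn2r ?nnegrE ?addr_ge0 ?mulr_ge0//.
    have : (1 : R) <= j%:R by rewrite ler1n.
    lra.
  by apply: le_trans thj _; rewrite tE lef_pV2// posrE expR_gt0.
have -> : (3 * j%:R) ^+ p * ((j%:R * dl / n%:R) ^+ n)^-1 = 3 ^+ p * (n%:R / dl) ^+ n / j%:R.
  rewrite exprMn -exprVn invfM invrK invfM !exprMn {1}/n [j%:R^-1 ^+ _]exprS !exprVn.
  field; rewrite !expf_neq0 ?lt0r_neq0//=.
rewrite ler_pdivrMr// [leRHS]mulrC -ler_pdivrMr//; apply: le_trans (ltW hm) _.
by rewrite ler_nat ltnW.
Qed.

Lemma bin_max j l : ('C(2 * j, l) <= 'C(2 * j, j))%N.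
Proof.
have H k : (k <= j)%N -> ('C(2 * j, j - k) <= 'C(2 * j, j))%N.
  elim: k => [|k IH] kj; first by rewrite subn0.
  apply: leq_trans (IH (ltnW kj)).
  have -> : (j - k = (j - k.+1).+1)%N by lia.
  set m := (j - k.+1)%N; have := mul_bin_left (2 * j) m.
  have mj : (m.+1 <= 2 * j - m)%N by rewrite /m; lia.
  move=> E; rewrite -(leq_pmul2l (ltn0Sn m)) E leq_mul2r mj orbT//.
have [lj|jl] := leqP l j; first by have := H _ (leq_subr l j); rewrite subKn.
have [l2|l2] := leqP l (2 * j); last by rewrite bin_small.
rewrite -bin_sub//; have -> : (2 * j - l = j - (l - j))%N by lia.
by apply: H; lia.
Qed.

(** The Fourier coefficients of a multiple of ((1 + cos t)/2)^j, index [l] standing for frequency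
    [l - j]. The normalization makes the constant coefficient 1, and [bkn j] is the resulting factor
    in front of the power. *)
Definition bk j l : R := 'C(2 * j, l)%:R / 'C(2 * j, j)%:R.

Lemma bc_gt0 j : (0 : R) < 'C(2 * j, j)%:R.
Proof. by rewrite ltr0n bin_gt0; lia. Qed.

Lemma bk_ge0 j l : 0 <= bk j l. Proof. by rewrite divr_ge0. Qed.

Lemma bk_le1 j l : bk j l <= 1.
Proof. by rewrite ler_pdivrMr ?bc_gt0// mul1r ler_nat bin_max. Qed.

Lemma bkjj j : bk j j = 1. Proof. by rewrite /bk divff// lt0r_neq0// bc_gt0. Qed.

Definition bkn j : R := 4 ^+ j / 'C(2 * j, j)%:R.

Lemma bkn_le j : bkn j <= 2 * j%:R + 1.
Proof.
rewrite /bkn ler_pdivrMr ?bc_gt0//.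
have -> : 2 * j%:R + 1 = (2 * j).+1%:R :> R by rewrite [in RHS]mulrSr natrM.
have -> : (4 : R) ^+ j = (\sum_(l < (2 * j).+1) 'C(2 * j, l))%:R.
  have := expnDn 1 1 (2 * j); rewrite addn1 => E.
  have E4 : (4 ^ j = 2 ^ (2 * j))%N by rewrite expnM.
  rewrite -[LHS](natrX R 4 j) E4 E; congr (_%:R).
  by apply: eq_bigr => l _; rewrite !exp1n !muln1.
rewrite -natrM ler_nat; apply: (@leq_trans (\sum_(l < (2 * j).+1) 'C(2 * j, j))).
  by apply: leq_sum => l _; exact: bin_max.
by rewrite sum_nat_const card_ord.
Qed.

Lemma bkn_ge0 j : 0 <= bkn j.
Proof. by rewrite divr_ge0 ?exprn_ge0. Qed.

(** Both halves telescope, since 1/x - 1/(x+1) exceeds 1/(x+1)^2. The case [La = 1] serves Fourier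
    inversion; large [La] bounds Riemann sums of mesh 1/La uniformly in the mesh. *)
Lemma sum_inv_sqr (La : R) (j m : nat) : 1 <= La ->
  \sum_(l < m) ((La + `|(l%:Z - j%:Z)%:~R| : R) ^+ 2)^-1 <= 3 / La.
Proof.
move=> La1; have La0 : 0 < La by apply: lt_le_trans La1.
have P t : 0 < La + t%:R by rewrite ltr_wpDr.
have A n t : (n + t = j)%N ->
    \sum_(l < n) ((La + `|(l%:Z - j%:Z)%:~R| : R) ^+ 2)^-1 <= (La + t%:R)^-1.
  elim: n t => [|n IH] t E; first by rewrite big_ord0 invr_ge0 ltW.
  rewrite big_ord_recr /=; have /IH H : (n + t.+1 = j)%N by rewrite -E addSnnS.
  have -> : (n%:Z - j%:Z)%:~R = - (t.+1%:R : R).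
    have -> : n%:Z - j%:Z = - (t.+1)%:Z by rewrite -E; lia.
    by rewrite rmorphN.
  rewrite normrN normr_nat; apply: le_trans (lerD H (lexx _)) _.
  rewrite -[t.+1%:R]natr1 addrA; move: (La + t%:R) (P t) => x x0.
  have x1 : 0 < x + 1 by rewrite addr_gt0.
  rewrite -subr_ge0.
  have -> : x^-1 - ((x + 1)^-1 + ((x + 1) ^+ 2)^-1) = (x * (x + 1) ^+ 2)^-1.
    by field; rewrite !lt0r_neq0.
  by rewrite invr_ge0 mulr_ge0 ?exprn_ge0 ?ltW.
have B k : \sum_(l < (j + k).+1) ((La + `|(l%:Z - j%:Z)%:~R| : R) ^+ 2)^-1 <= 3 / La - (La + k%:R)^-1.
  elim: k => [|k IH].
    rewrite addn0 big_ord_recr /= subrr normr0 !addr0.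
    have h1 := A j 0%N (addn0 _); rewrite addr0 in h1.
    have : (La ^+ 2)^-1 <= La^-1 by rewrite lef_pV2 ?posrE ?exprn_gt0// expr2 ler_peMl// ltW.
    by move: h1; move: (La ^- 2) (La^-1) => y z; lra.
  rewrite addnS big_ord_recr /=.
  have -> : ((j + k).+1%:Z - j%:Z)%:~R = (k.+1%:R : R).
    by have -> : (j + k).+1%:Z - j%:Z = (k.+1)%:Z by lia.
  rewrite normr_nat; apply: le_trans (lerD IH (lexx _)) _.
  rewrite -[k.+1%:R]natr1 addrA; move: (La + k%:R) (P k) => x x0.
  have x1 : 0 < x + 1 by rewrite addr_gt0.
  rewrite -subr_ge0.
  have -> : 3 / La - (x + 1)^-1 - (3 / La - x^-1 + ((x + 1) ^+ 2)^-1) = (x * (x + 1) ^+ 2)^-1.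
    by field; rewrite !lt0r_neq0.
  by rewrite invr_ge0 mulr_ge0 ?exprn_ge0 ?ltW.
have [mj|jm] := leqP m j.
  apply: le_trans (A m _ (subnKC mj)) _; apply: (@le_trans _ _ La^-1); last first.
    by rewrite ler_pMl ?invr_gt0// ler1n.
  by rewrite lef_pV2 ?posrE// lerDl.
have := B (m - j.+1)%N; have -> : (j + (m - j.+1)).+1 = m by lia.
by move=> H; apply: le_trans H _; rewrite gerBl invr_ge0 ltW.
Qed.

End RealFacts.

(** * A positive trigonometric kernel *)

Section Kernel.
Context (R : realType) (d : nat) (d0 : (0 < d)%N).
Notation V := 'rV[R]_d.
Notation Pi := (@pi R).
Implicit Types (n : 'I_d -> int) (x y : V) (F : V -> R[i]).

Definition en n : V -> R[i] := ex (fun i => 'i * (n i)%:~R).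

Lemma N_en n x : N (en n x) = 1.
Proof.
rewrite /en N_ex big1 ?expR0// => i _.
by rewrite -(rmorph_int (real_complex R)) ['i * _]mulrC ReM_real /= mulr0 mul0r.
Qed.

Lemma en_face n j x y : x 0 j = Pi -> y 0 j = - Pi ->
  (forall i, i != j -> x 0 i = y 0 i) -> en n x = en n y.
Proof.
move=> xj yj xy; rewrite /en !ex_prod; apply: eq_bigr => i _.
have [->|/xy ->//] := eqVneq i j; rewrite xj yj.
have -> : 'i * (n j)%:~R * Pi%:C = 'i * (n j)%:~R * (- Pi)%:C + 'i * (n j)%:~R * (2 * Pi)%:C.
  by rewrite -mulrDr -(rmorphD (real_complex R)); congr (_ * _%:C); ring.
by rewrite cexpD cexp_2pi mulr1.
Qed.

Lemma partial_en n i x : partial i (en n) x = 'i * (n i)%:~R * en n x.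
Proof. by have /cder_partial[] := cder_ex (fun i => 'i * (n i)%:~R) x i. Qed.

Lemma sm_en n X : smooth_on X (en n).
Proof. exact: smS (@subsetT _ X) (sm_ex _). Qed.

Lemma bd_en n a : bd a (en n) 1.
Proof. by move=> x _; rewrite N_en. Qed.

(** By periodicity the values on opposite faces cancel, so [partial i (en n)], which is ['i * n i]
    times [en n], has mean zero. *)
Lemma II_en0 n i : n i != 0 -> II Pi (en n) = 0.
Proof.
move=> ni; have : N (II Pi (partial i (en n))) <= 0 / (2 * Pi).
  apply: (@II_flux _ _ d0 _ (pi_gt0 R) setT) => //; first exact: openT.
    exact: sm_en.
  by move=> x y _ _ xi yi xy; rewrite (en_face n xi yi xy) subrr N0.
rewrite mul0r (@II_eq _ _ d0 _ (pi_gt0 R) _ (fun x => 'i * (n i)%:~R * en n x)); last first.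
  by move=> x _; rewrite partial_en.
rewrite (IIZ d0 (pi_gt0 R) _ (@bd_en n Pi)) => h.
have /eqP : N ('i * (n i)%:~R * II Pi (en n)) = 0 by apply/le_anti; rewrite h N_ge0.
rewrite N_eq0 mulf_eq0 mulf_eq0 intr_eq0 (negbTE ni) orbF => /orP[|/eqP//].
by rewrite -N_eq0 N_i oner_eq0.
Qed.

Lemma II_en1 n : (forall i, n i = 0) -> II Pi (en n) = 1.
Proof.
move=> n0; rewrite -[RHS](II_cst d Pi); apply: (II_eq d0 (pi_gt0 R)) => x _.
rewrite -[RHS](ex0 x) /en; congr (ex _ x); apply/funext => i.
by rewrite n0 mulr0.
Qed.

(** A tensor product of one-dimensional kernels. As a trigonometric polynomial it shows its
    coefficients, which lie in [0, 1]; the closed form [kerE] shows its positivity and its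
    concentration at 0. *)
Definition ker j : V -> R[i] := fun x =>
  \sum_(g : {ffun 'I_d -> 'I_(2 * j).+1})
    (\prod_i bk R j (g i))%:C * en (fun i => (g i)%:Z - j%:Z) x.

Definition Wr x : R := \prod_i ((1 + cos (x 0 i)) / 2).

Lemma Wr_fac x i : 0 <= (1 + cos (x 0 i)) / 2 <= 1.
Proof.
have := cos_geN1 (x 0 i); have := cos_le1 (x 0 i) => h1 h2; apply/andP; split; lra.
Qed.

Lemma Wr_ge0 x : 0 <= Wr x.
Proof. by apply: prodr_ge0 => i _; case/andP: (Wr_fac x i). Qed.

Lemma Wr_le x i : Wr x <= (1 + cos (x 0 i)) / 2.
Proof.
rewrite /Wr (bigD1 i)//=; case/andP: (Wr_fac x i) => h0 _.
by rewrite ler_piMr// prodr_ile1// => k _; exact: Wr_fac.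
Qed.

(** With u = exp(i t) the sum is (1 + u)^(2j) u^-j divided by the central binomial coefficient, and
    (1 + u)^2 / u = 2 + u + 1/u = 2 + 2 cos t. *)
Lemma ker1 j (t : R) : \sum_(l < (2 * j).+1) (bk R j l)%:C * cexp ('i * (l%:Z - j%:Z)%:~R * t%:C)
  = (bkn R j * ((1 + cos t) / 2) ^+ j)%:C.
Proof.
pose u := cexp ('i * t%:C); have u0 : u != 0 by exact: cexp_neq0.
have uE : u = cos t +i* sin t by rewrite /u /cexp; apply: eqC => /=; rewrite !(mul0r, mul1r, subr0, addr0, sub0r, add0r, oppr0, expR0).
have uV : u^-1 = cos t -i* sin t.
  by rewrite -cexpN /cexp; apply: eqC => /=; rewrite !(mul0r, mul1r, subr0, addr0, sub0r, add0r, oppr0, expR0, cosN, sinN).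
have T (l : nat) : cexp ('i * (l%:Z - j%:Z)%:~R * t%:C) = u ^+ l * u^-1 ^+ j.
  have -> : 'i * (l%:Z - j%:Z)%:~R * t%:C = ('i * t%:C) *+ l + (- ('i * t%:C)) *+ j.
    have key (I A B C : R[i]) : I * (A - B) * C = I * C * A + - (I * C) * B by ring.
    by rewrite intrB -!pmulrn -['i * t%:C *+ l]mulr_natr -[- ('i * t%:C) *+ j]mulr_natr; exact: key.
  by rewrite cexpD !cexp_mulrn cexpN.
have -> : \sum_(l < (2 * j).+1) (bk R j l)%:C * cexp ('i * (l%:Z - j%:Z)%:~R * t%:C) =
   (('C(2 * j, j)%:R : R)^-1)%:C * ((1 + u) ^+ (2 * j) * u^-1 ^+ j).
  rewrite exprDn mulr_suml mulr_sumr; apply: eq_bigr => l _.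
  rewrite T /bk expr1n mul1r rmorphM /= rmorph_nat -mulr_natr; ring.
have -> : (1 + u) ^+ (2 * j) * u^-1 ^+ j = ((4 * ((1 + cos t) / 2)) ^+ j)%:C.
  rewrite exprM -exprMn rmorphXn /=; congr (_ ^+ j).
  have -> : (1 + u) ^+ 2 * u^-1 = 2 + u + u^-1 by field.
  by rewrite uV uE; apply: eqC => /=; field.
by rewrite -rmorphM /= /bkn exprMn; congr (_%:C); ring.
Qed.

Lemma kerE j x : ker j x = (bkn R j ^+ d * Wr x ^+ j)%:C.
Proof.
have -> : bkn R j ^+ d * Wr x ^+ j = \prod_(i < d) (bkn R j * ((1 + cos (x 0 i)) / 2) ^+ j).
  by rewrite big_split /= prodr_const card_ord prodrXl.
rewrite rmorph_prod /=; under [RHS]eq_bigr do rewrite -ker1.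
rewrite bigA_distr_bigA; apply: eq_bigr => g _.
by rewrite rmorph_prod /= /en ex_prod -big_split.
Qed.

Lemma ker_ge0 j x : ker j x = (complex.Re (ker j x))%:C /\ 0 <= complex.Re (ker j x).
Proof.
by rewrite kerE /=; split=> //; rewrite mulr_ge0 ?exprn_ge0 ?bkn_ge0 ?Wr_ge0.
Qed.

Lemma prod_bk_bound j (g : {ffun 'I_d -> 'I_(2 * j).+1}) : 0 <= \prod_i bk R j (g i) <= 1.
Proof.
by rewrite prodr_ge0 ?prodr_ile1//= => i _; rewrite bk_ge0 ?bk_le1.
Qed.

Lemma II_ker_sum j F K : bd Pi F K ->
  II Pi (fun x => F x * ker j x) = \sum_(g : {ffun 'I_d -> 'I_(2 * j).+1})
    (\prod_i bk R j (g i))%:C * II Pi (fun x => F x * en (fun i => (g i)%:Z - j%:Z) x).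
Proof.
move=> FK; have FK' n : bd Pi (fun x => F x * en n x) K.
  by move=> x xa; rewrite NM N_en mulr1; exact: FK.
rewrite (@II_eq _ _ d0 _ (pi_gt0 R) _ (fun x => \sum_(g : {ffun 'I_d -> 'I_(2 * j).+1})
    (\prod_i bk R j (g i))%:C * (F x * en (fun i => (g i)%:Z - j%:Z) x))); last first.
  by move=> x _; rewrite /ker mulr_sumr; apply: eq_bigr => g _; ring.
rewrite (@II_sum _ _ d0 _ (pi_gt0 R) _ _ _ K).
  by apply: eq_bigr => g _; rewrite (IIZ d0 (pi_gt0 R) _ (FK' _)).
move=> g x xa; rewrite NM N_real; have /andP[p0 p1] := prod_bk_bound g.
rewrite ger0_norm//; apply: le_trans (FK' (fun i => (g i)%:Z - j%:Z) _ xa).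
by rewrite /= ler_piMl ?N_ge0.
Qed.

Lemma II_ker j : II Pi (ker j) = 1.
Proof.
have B1 : bd Pi (fun _ : V => 1 : R[i]) 1 by move=> x _; rewrite N1.
rewrite (@II_eq _ _ d0 _ (pi_gt0 R) _ (fun x => 1 * ker j x)) => [|x _]; last by rewrite mul1r.
have jj : (j < (2 * j).+1)%N by lia.
rewrite (II_ker_sum j B1) (bigD1 [ffun=> Ordinal jj]) //=.
rewrite [X in _ + X]big1 ?addr0 => [|g gj].
  rewrite (II_eq d0 (pi_gt0 R) (G := en (fun i => ([ffun=> Ordinal jj] i : 'I_(2 * j).+1)%:Z - j%:Z))).
    rewrite II_en1 => [|i]; last by rewrite ffunE subrr.
    by rewrite mulr1 big1 // => i _; rewrite ffunE /= bkjj.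
  by move=> x _; rewrite mul1r.
have [i gi] : exists i, g i != Ordinal jj.
  apply/existsP; rewrite -negb_forall; apply: contra gj => /forallP H.
  by apply/eqP/ffunP => i; rewrite ffunE; exact/eqP.
rewrite (II_eq d0 (pi_gt0 R) (G := en (fun i => (g i)%:Z - j%:Z))) => [|x _]; last by rewrite mul1r.
rewrite (@II_en0 _ i) ?mulr0// subr_eq0 eqz_nat.
by apply: contra gi => /eqP E; apply/eqP/val_inj.
Qed.

(** In the maximum norm some coordinate has modulus at least [r], and the cosine decreases on
    [0, pi], so that single factor is bounded away from 1. For [r > pi] the claim is void and
    [th = 0] is taken. *)
Lemma Wr_off (r : R) : 0 < r -> exists2 th, 0 <= th < 1 &
  forall x, `|x| <= Pi -> r <= `|x| -> Wr x <= th.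
Proof.
move=> r0; have [rpi|rpi] := ltP Pi r.
  by exists 0; rewrite ?lexx ?ltr01// => x xp rx; move: (lt_le_trans rpi rx); rewrite ltNge xp.
pose th := (1 + cos r) / 2 : R.
have th1 : th < 1.
  have : cos r < cos 0.
    by rewrite ltr_cos ?in_itv//= ?lexx ?pi_ge0 ?(ltW r0).
  by rewrite cos0 /th; lra.
have th0 : 0 <= th by rewrite /th; have := cos_geN1 r; lra.
exists th => [|x xp rx]; first by rewrite th0.
have [i ri] : exists i, r <= `|x 0 i|.
  apply: contrapT => H; move: rx; rewrite leNgt => /negP; apply.
  have : `|x| = \big[Num.max/0]_ij `|x ij.1 ij.2| by exact: mx_normrE.
  move=> ->; apply/bigmax_ltP; split=> // -[k i] _ /=; rewrite ord1 ltNge; apply/negP => h.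
  by apply: H; exists i.
apply: le_trans (Wr_le x i) _.
have xi : `|x 0 i| <= Pi by apply: le_trans (rv_coord _ _) xp.
have -> : cos (x 0 i) = cos `|x 0 i| by case: (ler0P (x 0 i)); rewrite ?cosN.
have : cos `|x 0 i| <= cos r.
  have [->//|ne] := eqVneq `|x 0 i| r.
  apply: ltW; rewrite ltr_cos ?in_itv/= ?normr_ge0 ?xi ?(ltW r0) ?rpi//.
  by rewrite lt_neqAle eq_sym ne.
by rewrite /th; lra.
Qed.

Lemma ker_off (r e : R) : 0 < r -> 0 < e -> exists J, forall j x, (J <= j)%N ->
  `|x| <= Pi -> r <= `|x| -> complex.Re (ker j x) <= e.
Proof.
move=> r0 e0; have [th /andP[th0 th1] hth] := Wr_off r0.
have [J hJ] := poly_geom d th0 th1 e0; exists J => j x Jj xp rx.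
apply: le_trans (hJ _ Jj); rewrite kerE /=; apply: ler_pM.
- by rewrite exprn_ge0 ?bkn_ge0.
- by rewrite exprn_ge0 ?Wr_ge0.
- by rewrite lerXn2r ?nnegrE ?bkn_ge0 ?bkn_le// addr_ge0// mulr_ge0.
- by rewrite lerXn2r ?nnegrE ?Wr_ge0//; exact: hth.
Qed.

Definition wt n : R := \prod_i ((1 + `|(n i)%:~R|) ^+ 2)^-1.

(** Pairing [F] with the kernel uses coefficients at most 1, so it costs at most B times the sum of
    the weights. The kernel is positive, has mean 1 and concentrates at 0, so the pairings approach
    [F 0]. Neither periodicity of [F] nor convergence of its Fourier series enters. *)
Lemma inversion F B : (forall x, `|x| <= Pi -> cont F x) -> 0 <= B ->
  (forall n, N (II Pi (fun x => F x * en n x)) <= B * wt n) -> N (F 0) <= B * 3 ^+ d.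
Proof.
move=> Fc B0 H; have [M M0 FM] := cube_bounded Fc.
have z0 : `|0 : V| <= Pi by rewrite normr0 pi_ge0.
have main j : N (II Pi (fun x => F x * ker j x)) <= B * 3 ^+ d.
  rewrite (II_ker_sum j FM); apply: le_trans (N_sum _ _ _) _.
  apply: (@le_trans _ _ (\sum_(g : {ffun 'I_d -> 'I_(2 * j).+1}) B * wt (fun i => (g i)%:Z - j%:Z))).
    apply: ler_sum => g _; rewrite NM N_real; have /andP[p0 p1] := prod_bk_bound g.
    by rewrite ger0_norm//; apply: le_trans (H _); rewrite ler_piMl ?N_ge0.
  rewrite -mulr_sumr ler_wpM2l// /wt.
  rewrite -(bigA_distr_bigA (fun (i : 'I_d) (l : 'I_(2 * j).+1) => ((1 + `|(l%:Z - j%:Z)%:~R| : R) ^+ 2)^-1)).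
  rewrite -[X in 3 ^+ X]card_ord -prodr_const; apply: ler_prod => i _.
  by have := @sum_inv_sqr R 1 j (2 * j).+1 (lexx _); rewrite divr1 => ->; rewrite sumr_ge0// => l _; rewrite invr_ge0 exprn_ge0// addr_ge0.
rewrite leNgt; apply/negP => hlt; pose e := (N (F 0) - B * 3 ^+ d) / 4.
have e0 : 0 < e by rewrite divr_gt0// subr_gt0.
have [r r0 hr] := Fc _ z0 _ e0.
have e1 : 0 < e / (2 * M) by rewrite divr_gt0// mulr_gt0.
have [J hJ] := ker_off r0 e1.
have [K K0 kK] : exists2 K, 0 < K & bd Pi (ker J) K.
  by apply: cube_bounded => x _; apply: (@sm_cont _ _ setT) => //; apply: sm_sum; [exact: openT|move=> g; apply: smZ; [exact: openT|exact: sm_en]].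
have D : N (II Pi (fun x => (F x - F 0) * ker J x)) <= e + e.
  pose G x := e * complex.Re (ker J x) + e.
  have Geq x : (G x)%:C = e%:C * ker J x + e%:C.
    by rewrite (ker_ge0 J x).1 /G rmorphD rmorphM.
  have Gb1 : bd Pi (fun x => e%:C * ker J x) (N e%:C * K).
    by move=> x xa; rewrite NM ler_wpM2l ?N_ge0//; exact: kK.
  have Gb2 : bd Pi (fun _ : V => e%:C) (N e%:C) by [].
  have Gb : bd Pi (fun x => (G x)%:C) (N e%:C * K + N e%:C).
    by move=> x xa; rewrite Geq; exact: (bdD Gb1 Gb2 xa).
  have -> : e + e = N (e%:C + e%:C) by rewrite -rmorphD N_real ger0_norm// addr_ge0// ltW.
  apply: (II_mono d0 (pi_gt0 R) (G := G) _ Gb) => [x xa|]; last first.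
    rewrite (II_eq d0 (pi_gt0 R) (G := fun x => e%:C * ker J x + e%:C)) => [|x _]; last exact: Geq.
    by rewrite (IID d0 (pi_gt0 R) Gb1 Gb2) (IIZ d0 (pi_gt0 R) _ kK) II_ker mulr1 II_cst.
  have [kR k0] := ker_ge0 J x; rewrite NM [in N (ker J x)]kR N_real ger0_norm// /G.
  have [xr|xr] := ltP `|x| r.
    rewrite -[leLHS]addr0 lerD ?(ltW e0)// ler_wpM2r// ltW//; apply: hr.
    by rewrite subr0.
  rewrite -[leLHS]add0r; apply: lerD; first by apply: mulr_ge0 => //; exact: ltW.
  have k1 := hJ J x (leqnn _) xa xr.
  have F2 : N (F x - F 0) <= 2 * M.
    by apply: le_trans (NB _ _) _; have := FM _ xa; have := FM _ z0; lra.
  apply: (@le_trans _ _ (2 * M * (e / (2 * M)))); first by rewrite ler_pM ?N_ge0.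
  by rewrite mulrCA divff ?mulr1// lt0r_neq0// mulr_gt0.
have FKb : bd Pi (fun x => F x * ker J x) (M * K) by exact: bdM.
have FKb0 : bd Pi (fun x => F 0 * ker J x) (M * K).
  by move=> x xa; rewrite NM ler_pM ?N_ge0//; [exact: FM|exact: kK].
have E : II Pi (fun x => (F x - F 0) * ker J x) = II Pi (fun x => F x * ker J x) - F 0.
  rewrite (II_eq d0 (pi_gt0 R) (G := fun x => F x * ker J x + (-1) * (F 0 * ker J x))) => [|x _].
    rewrite (IID d0 (pi_gt0 R) FKb (L := M * K)); last first.
      by move=> x xa; rewrite mulN1r NN; exact: FKb0.
    rewrite (IIZ d0 (pi_gt0 R) _ FKb0) (IIZ d0 (pi_gt0 R) _ kK) II_ker mulr1.
    by rewrite mulN1r.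
  by rewrite mulrBl mulN1r.
have := main J; have := D; rewrite E NBC; have := le_N (F 0) (II Pi (fun x => F x * ker J x)).
by rewrite /e in e0 *; lra.
Qed.

End Kernel.

Lemma fin_unif (R : realType) (T : finType) (Q : T -> R -> Prop) :
  (forall t, exists2 C, 0 <= C & Q t C) ->
  (forall t C C', C <= C' -> Q t C -> Q t C') -> exists2 C, 0 <= C & forall t, Q t C.
Proof.
move=> H mono; have /choice[c hc] : forall t, exists C, 0 <= C /\ Q t C.
  by move=> t; have [C C0 QC] := H t; exists C.
exists (\sum_t c t) => [|t]; first by apply: sumr_ge0 => t _; case: (hc t).
apply: mono (hc t).2; rewrite (bigD1 t)//= lerDl.
by apply: sumr_ge0 => u _; case: (hc u).
Qed.

Lemma sum_le_size (R : realType) (T : eqType) (r : seq T) (F : T -> R) (K : R) :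
  (forall t, t \in r -> F t <= K) -> \sum_(t <- r) F t <= (size r)%:R * K.
Proof.
elim: r => [|t r IH] H; first by rewrite big_nil mul0r.
rewrite big_cons /= -natr1 mulrDl mul1r addrC; apply: lerD; last by apply: H; rewrite mem_head.
by apply: IH => u ur; apply: H; rewrite inE ur orbT.
Qed.

(** * Interior estimates for elliptic operators *)

Section Estimates.
Context (R : realType) (d : nat) (d0 : (0 < d)%N).
Notation V := 'rV[R]_d.
Notation Pi := (@pi R).
Implicit Types (n : 'I_d -> int) (x y : V) (f g h chi : V -> R[i]) (X : set V).
Implicit Types (s : seq 'I_d) (L : seq (R[i] * seq 'I_d)).

Let Pi0 : 0 < Pi := pi_gt0 R.

Definition Wf : V -> R[i] := fun x => (Wr x)%:C.

Lemma sm_ker j : smooth_on setT (@ker R d j).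
Proof.
apply: sm_sum; first exact: openT.
by move=> g; apply: smZ; [exact: openT|exact: sm_en].
Qed.

Lemma sm_Wf : smooth_on setT Wf.
Proof.
have E x : (bkn R 1 ^+ d)^-1%:C * ker 1 x = Wf x.
  have b0 : bkn R 1 != 0 by rewrite /bkn mulf_neq0 ?invr_neq0 ?lt0r_neq0// ?bc_gt0.
  by rewrite kerE -rmorphM /= /Wf expr1 mulKf// expf_neq0.
apply: (sm_eq openT) (smZ openT _ (sm_ker 1)) => x _; exact: E.
Qed.

Lemma Wf_face x i : `|x 0 i| = Pi -> Wf x = 0.
Proof.
move=> xi; rewrite /Wf /Wr (bigD1 i)//=.
have -> : cos (x 0 i) = -1.
  by rewrite -(cospi R) -xi; case: (ler0P (x 0 i)); rewrite ?cosN.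
by rewrite subrr !mul0r.
Qed.

Lemma Wf0 : Wf 0 = 1.
Proof.
rewrite /Wf /Wr big1 // => i _; rewrite mxE cos0 divff//.
Qed.

(** Divisibility by [Wf ^+ m] encodes vanishing to order at least [m] on the faces of the cube. Each
    differentiation costs one order, and [Wf ^+ m] itself has value 1 at the centre. *)
Definition cut m chi := exists F, smooth_on setT F /\ forall x, chi x = F x * Wf x ^+ m.

Lemma cut_sm m chi : cut m chi -> smooth_on setT chi.
Proof.
move=> [F [Fs E]]; apply: (sm_eq openT) (smM openT Fs (smX openT m sm_Wf)) => x _.
by rewrite E.
Qed.

Lemma cutS m chi : cut m.+1 chi -> cut m chi.
Proof.
move=> [F [Fs E]]; exists (fun x => F x * Wf x); split; first exact: (@smM _ _ setT openT _ _ Fs sm_Wf).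
by move=> x; rewrite E exprS mulrA.
Qed.

Lemma cut_leq m p chi : (m <= p)%N -> cut p chi -> cut m chi.
Proof.
move=> /subnKC <-; elim: (p - m)%N => [|l IH]; first by rewrite addn0.
by rewrite addnS => /cutS.
Qed.

Lemma cut_partial m i chi : cut m.+1 chi -> cut m (partial i chi).
Proof.
move=> [F [Fs E]]; have Ws := smX openT m.+1 sm_Wf.
exists (fun x => partial i F x * Wf x + F x * (m.+1%:R * partial i Wf x)); split.
  apply: (@smD _ _ setT openT); first exact: (@smM _ _ setT openT _ _ (sm_partial i Fs) sm_Wf).
  exact: (@smM _ _ setT openT _ _ Fs (@smZ _ _ setT openT _ _ (sm_partial i sm_Wf))).
move=> x; rewrite (@partial_eq _ _ setT openT i _ (fun x => F x * Wf x ^+ m.+1))//.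
rewrite (partialM _ Fs Ws)//.
have -> : partial i (fun x => Wf x ^+ m.+1) x = m.+1%:R * partial i Wf x * Wf x ^+ m.
  elim: m {E Ws} => [|m IH].
    by rewrite expr0 mulr1 mul1r; congr partial; apply/funext => y; rewrite expr1.
  have -> : (fun x => Wf x ^+ m.+2) = (fun x => Wf x * Wf x ^+ m.+1).
    by apply/funext => y; rewrite exprS.
  rewrite (partialM _ sm_Wf (smX openT m.+1 sm_Wf))// IH -[m.+2%:R]natr1 !exprS; ring.
by rewrite exprS; ring.
Qed.

Lemma cut_partials m s chi : cut (size s + m) chi -> cut m (partials s chi).
Proof.
elim: s m => [//|i s IH] m H /=; apply: cut_partial; apply: IH.
by rewrite addnS.
Qed.

Lemma cut_face m chi x i : cut m.+1 chi -> `|x 0 i| = Pi -> chi x = 0.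
Proof. by move=> [F [_ ->]] xi; rewrite (Wf_face xi) exprS mul0r mulr0. Qed.

Lemma cutW m : cut m (fun x => Wf x ^+ m).
Proof. by exists (fun=> 1); split=> [|x]; [exact: sm_cst openT _|rewrite mul1r]. Qed.

Lemma cut_bd m chi : cut m chi -> exists2 K, 0 < K & bd Pi chi K.
Proof. by move=> /cut_sm cs; apply: cube_bounded => x _; exact: sm_cont cs _. Qed.

Definition JJ chi g n := II Pi (fun x => chi x * g x * en n x).

Definition nu n : R := 1 + \sum_i `|(n i)%:~R|.

Lemma nu_ge1 n : 1 <= nu n.
Proof. by rewrite lerDl sumr_ge0. Qed.

Lemma nu_coord n i : 1 + `|(n i)%:~R| <= nu n.
Proof. by rewrite lerD2l (bigD1 i)//= lerDl sumr_ge0. Qed.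

Lemma nu_X n m : 0 < nu n ^+ m.
Proof. by rewrite exprn_gt0// (lt_le_trans ltr01)// nu_ge1. Qed.

Section OnCube.
Context (X : set V) (oX : open X) (QX : forall x, `|x| <= Pi -> X x).

Lemma JJ_bd chi g n : smooth_on setT chi -> smooth_on X g ->
  exists K, bd Pi (fun x => chi x * g x * en n x) K.
Proof.
move=> cs gs; have [K _ H] : exists2 K, 0 < K & bd Pi (fun x => chi x * g x * en n x) K.
  have ss := smM oX (smM oX (smS (@subsetT _ X) cs) gs) (@sm_en R d n X).
  by apply: cube_bounded => x /QX Xx; exact: (sm_cont ss Xx).
by exists K.
Qed.

Lemma JJ_le chi g n K M : bd Pi chi K -> bd Pi g M -> N (JJ chi g n) <= K * M.
Proof.
move=> cK gM; have H : bd Pi (fun x => chi x * g x * en n x) (K * M).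
  move=> x xa; rewrite NM N_en mulr1 NM.
  by apply: ler_pM; rewrite ?N_ge0//; [exact: cK|exact: gM].
exact: (II_le d0 Pi0 H).
Qed.

(** Integration by parts: the product [chi * g * en n] vanishes on the two faces orthogonal to
    direction [i], so its derivative in that direction has mean zero. *)
Lemma JJ_rec chi g n i : cut 1 chi -> smooth_on X g ->
  JJ chi (partial i g) n = - ('i * (n i)%:~R) * JJ chi g n - JJ (partial i chi) g n.
Proof.
move=> cc gs; have cs := cut_sm cc; have csX : smooth_on X chi := smS (@subsetT _ X) cs.
have es := @sm_en R d n X.
have [K1 B1] := JJ_bd n (sm_partial i cs) gs.
have [K2 B2] := JJ_bd n cs (sm_partial i gs).
have [K3 B3] := JJ_bd n cs gs.
have E x : `|x| <= Pi -> partial i (fun x => chi x * g x * en n x) x =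
   partial i chi x * g x * en n x +
   (chi x * partial i g x * en n x + ('i * (n i)%:~R) * (chi x * g x * en n x)).
  move=> /QX Xx; rewrite (partialM _ (smM oX csX gs) es)// (partialM _ csX gs)//.
  by rewrite partial_en; ring.
have B4 : bd Pi (fun x => ('i * (n i)%:~R) * (chi x * g x * en n x)) (N ('i * (n i)%:~R) * K3).
  by move=> x xa; rewrite NM ler_wpM2l ?N_ge0//; exact: B3.
have : N (II Pi (partial i (fun x => chi x * g x * en n x))) <= 0 / (2 * Pi).
  apply: (II_flux d0 Pi0 oX QX (smM oX (smM oX csX gs) es)) => x y _ _ xi yi _; have xf : `|x 0 i| = Pi by rewrite xi ger0_norm ?pi_ge0.
  have yf : `|y 0 i| = Pi by rewrite yi normrN ger0_norm ?pi_ge0.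
  by rewrite (cut_face cc xf) (cut_face cc yf) !mul0r subrr N0.
rewrite (II_eq d0 Pi0 E) (IID d0 Pi0 B1 (bdD B2 B4)) (IID d0 Pi0 B2 B4) (IIZ d0 Pi0 _ B3).
rewrite mul0r -!/(JJ _ _ _) => h.
have /eqP : N (JJ (partial i chi) g n + (JJ chi (partial i g) n + 'i * (n i)%:~R * JJ chi g n)) = 0.
  by apply/le_anti; rewrite h N_ge0.
rewrite N_eq0; move: (JJ _ _ _) (JJ _ _ _) (JJ _ _ _) => a b c /eqP e.
have -> : b = c + (b + 'i * (n i)%:~R * a) - 'i * (n i)%:~R * a - c by ring.
by rewrite e; ring.
Qed.

Lemma Nin n i : N (- ('i * (n i)%:~R) : R[i]) <= nu n.
Proof.
rewrite NN NM N_i mul1r -(rmorph_int (real_complex R)) N_real.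
by apply: le_trans (nu_coord n i); rewrite lerDr.
Qed.

Lemma JJ_partials_le chi f n s B : cut (size s) chi -> smooth_on X f -> 0 <= B ->
  (forall t, (size t <= size s)%N -> N (JJ (partials t chi) f n) <= B) ->
  N (JJ chi (partials s f) n) <= 2 ^+ size s * nu n ^+ size s * B.
Proof.
move=> + fs B0; elim: s chi => [|i s IH] chi cc H.
  by rewrite !mul1r; exact: (H [::]).
rewrite /= JJ_rec; [|exact: cut_leq cc|exact: sm_partials].
apply: le_trans (NB _ _) _; rewrite NM.
have h1 : N (JJ chi (partials s f) n) <= 2 ^+ size s * nu n ^+ size s * B.
  by apply: IH => [|t ts]; [exact: cutS cc|apply: H; exact: leqW].
have h2 : N (JJ (partial i chi) (partials s f) n) <= 2 ^+ size s * nu n ^+ size s * B.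
  apply: IH => [|t ts]; first exact: cut_partial.
  by have := H (rcons t i); rewrite /partials foldr_rcons size_rcons; apply.
have := Nin n i; have := nu_ge1 n; have := N_ge0 (- ('i * (n i)%:~R) : R[i]).
move: (N (- _)) (nu n) (N _) (N _) h1 h2 => a v J1 J2 h1 h2 a0 v1 av.
have z0 : 0 <= 2 ^+ size s * v ^+ size s * B.
  by rewrite !mulr_ge0 ?exprn_ge0// (le_trans ler01).
apply: (@le_trans _ _ (v * (2 ^+ size s * v ^+ size s * B) + v * (2 ^+ size s * v ^+ size s * B))).
  apply: lerD; last by apply: le_trans h2 _; rewrite ler_peMl.
  apply: le_trans (ler_wpM2l a0 h1) _; by rewrite ler_wpM2r.
by rewrite le_eqVlt; apply/orP; left; apply/eqP; rewrite !exprS; ring.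
Qed.

(** If all derivatives fall on the exponential, the symbol appears. Every other term has at least
    one derivative on [chi], hence at most [size s - 1] factors of frequency; there are
    [2 ^ size s - 1] such terms. *)
Lemma JJ_partials chi f n s B : cut (size s) chi -> smooth_on X f -> 0 <= B ->
  (forall t, (0 < size t <= size s)%N -> N (JJ (partials t chi) f n) <= B) ->
  N (JJ chi (partials s f) n - (\prod_(i <- s) - ('i * (n i)%:~R)) * JJ chi f n)
    <= (2 ^+ size s - 1) * nu n ^+ (size s).-1 * B.
Proof.
move=> + fs B0; elim: s chi => [|i s IH] chi cc H.
  by rewrite big_nil mul1r subrr N0 expr0 subrr !mul0r.
rewrite /= JJ_rec; [|exact: cut_leq cc|exact: sm_partials].
rewrite big_cons.
have h1 : N (JJ chi (partials s f) n - (\prod_(i <- s) - ('i * (n i)%:~R)) * JJ chi f n)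
    <= (2 ^+ size s - 1) * nu n ^+ (size s).-1 * B.
  by apply: IH => [|t /andP[t0 ts]]; [exact: cutS cc|apply: H; rewrite t0 leqW].
have h2 : N (JJ (partial i chi) (partials s f) n) <= 2 ^+ size s * nu n ^+ size s * B.
  apply: JJ_partials_le => // [|t ts]; first exact: cut_partial.
  by have := H (rcons t i); rewrite /partials foldr_rcons size_rcons; apply.
set a := - ('i * (n i)%:~R) in h1 *.
have -> : a * JJ chi (partials s f) n - JJ (partial i chi) (partials s f) n -
   a * (\prod_(j <- s) - ('i * (n j)%:~R)) * JJ chi f n =
   a * (JJ chi (partials s f) n - (\prod_(j <- s) - ('i * (n j)%:~R)) * JJ chi f n)
   - JJ (partial i chi) (partials s f) n by ring.
apply: le_trans (NB _ _) _; rewrite NM.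
have av : N a <= nu n := Nin n i.
apply: (@le_trans _ _ ((2 ^+ size s - 1) * nu n ^+ size s * B + 2 ^+ size s * nu n ^+ size s * B)).
  apply: lerD => //; apply: (@le_trans _ _ (nu n * ((2 ^+ size s - 1) * nu n ^+ (size s).-1 * B))).
    by rewrite ler_pM ?N_ge0.
  case: (size s) => [|m]; first by rewrite expr0 subrr !mul0r mulr0.
  by rewrite le_eqVlt; apply/orP; left; apply/eqP; rewrite /= !exprS; ring.
by rewrite le_eqVlt; apply/orP; left; apply/eqP; rewrite !exprS; ring.
Qed.

End OnCube.

(* m integrations by parts: chi and its derivatives of order < m vanish on the faces of the cube. *)
Lemma JJ_decay m chi : cut m chi -> exists2 C, 0 <= C & forall X h M n,
  open X -> (forall x, `|x| <= Pi -> X x) -> smooth_on X h ->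
  (forall s, (size s <= m)%N -> bd Pi (partials s h) M) ->
  N (JJ chi h n) * nu n ^+ m <= C * M.
Proof.
elim: m chi => [|m IH] chi cc.
  have [K K0 cK] := cut_bd cc; exists K; first exact: ltW.
  move=> X h M n oX QX hs hM; rewrite expr0 mulr1; apply: JJ_le => //.
  exact: (hM [::]).
have [C0 C00 H0] := IH chi (cutS cc).
have [C1 C10 H1] : exists2 C, 0 <= C & forall i X h M n,
  open X -> (forall x, `|x| <= Pi -> X x) -> smooth_on X h ->
  (forall s, (size s <= m)%N -> bd Pi (partials s h) M) ->
  N (JJ (partial i chi) h n) * nu n ^+ m <= C * M.
  apply: fin_unif => [i|i C C' CC' H X h M n oX QX hs hM]; first exact: IH _ (cut_partial i cc).
  apply: le_trans (H X h M n oX QX hs hM) _; rewrite ler_wpM2r//.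
  by apply: le_trans (N_ge0 (h 0)) (hM [::] _ 0 _); rewrite // normr0 pi_ge0.
exists (C0 + d%:R * (C0 + C1)).
  by rewrite addr_ge0// mulr_ge0// addr_ge0.
move=> X h M n oX QX hs hM.
have hM' s : (size s <= m)%N -> bd Pi (partials s h) M by move=> /leqW; exact: hM.
have v0 := nu_X n m.
have S i : `|(n i)%:~R| * N (JJ chi h n) * nu n ^+ m <= (C0 + C1) * M.
  have -> : `|(n i)%:~R| * N (JJ chi h n) = N (JJ chi (partial i h) n + JJ (partial i chi) h n).
    rewrite (JJ_rec oX QX n i (cut_leq (ltn0Sn m) cc) hs) subrK NM NN NM N_i mul1r.
    by rewrite -(rmorph_int (real_complex R)) N_real.
  rewrite mulrDl; apply: (@le_trans _ _ (N (JJ chi (partial i h) n) * nu n ^+ m + N (JJ (partial i chi) h n) * nu n ^+ m)).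
    by rewrite -mulrDl ler_wpM2r ?ND// ltW.
  apply: lerD; last exact: (H1 i X).
  apply: (H0 X _ _ _ oX QX (sm_partial i hs)) => s sm.
  by have := hM (rcons s i); rewrite /partials foldr_rcons size_rcons; apply.
have -> : N (JJ chi h n) * nu n ^+ m.+1 =
  N (JJ chi h n) * nu n ^+ m + \sum_i (`|(n i)%:~R| * N (JJ chi h n) * nu n ^+ m).
  by rewrite -!mulr_suml exprS {1}/nu; ring.
rewrite mulrDl; apply: lerD; first exact: (H0 X).
apply: le_trans (ler_sum _ (fun i _ => S i)) _.
by rewrite sumr_const card_ord -[leLHS]mulr_natl mulrA.
Qed.

(** Operators are lists of coefficients with index words, not polynomials: rescaling, composition
    and removal of lower order terms are then plain list operations, and words may be differentiated
    one letter at a time. *)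
Definition opL L f : V -> R[i] := fun x => \sum_(t <- L) t.1 * partials t.2 f x.
Definition sym L (z : 'I_d -> R[i]) : R[i] := \sum_(t <- L) t.1 * \prod_(i <- t.2) z i.

Lemma sm_opL X L f : open X -> smooth_on X f -> smooth_on X (opL L f).
Proof.
by move=> oX fs; apply: (sm_sum oX) => t; apply: (smZ oX); exact: sm_partials.
Qed.

(** Ellipticity at integer frequencies, with every quantity on which later constants depend made
    explicit. All rescalings of one operator satisfy it with the same parameters, which is what
    makes the estimates scale correctly. *)
Definition ell k (A c v0 : R) (sl : seq (seq 'I_d)) L :=
  [/\ map snd L = sl, forall t, t \in L -> N t.1 <= A &
   forall n, v0 <= nu n -> c * nu n ^+ k <= N (sym L (fun i => - ('i * (n i)%:~R)))].

Section Elliptic.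
Context (k : nat) (A c v0 : R) (sl : seq (seq 'I_d)).
Context (k0 : (0 < k)%N) (A0 : 0 <= A) (c0 : 0 < c) (v00 : 0 <= v0).
Context (slk : forall s, s \in sl -> (size s <= k)%N).

Lemma JJ_sum X chi f n L : open X -> (forall x, `|x| <= Pi -> X x) ->
  smooth_on setT chi -> smooth_on X f ->
  JJ chi (opL L f) n = \sum_(t <- L) t.1 * JJ chi (partials t.2 f) n.
Proof.
move=> oX QX cs fs; elim: L => [|t L IH].
  rewrite big_nil -[RHS](II_cst d Pi); apply: (II_eq d0 Pi0) => x _.
  by rewrite /opL big_nil mulr0 mul0r.
rewrite big_cons -IH; have [K1 B1] := JJ_bd oX QX n cs (@sm_partials _ _ X t.2 _ fs).
have [K2 B2] := JJ_bd oX QX n cs (sm_opL L oX fs).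
have B3 : bd Pi (fun x => t.1 * (chi x * partials t.2 f x * en n x)) (N t.1 * K1).
  by move=> x xa; rewrite NM ler_wpM2l ?N_ge0//; exact: B1.
rewrite /JJ -(IIZ d0 Pi0 _ B1) -(IID d0 Pi0 B3 B2); apply: (II_eq d0 Pi0) => x _.
by rewrite {1}/opL big_cons -/(opL L f x); ring.
Qed.

(** The symbol times the coefficient of [chi * f] is the coefficient of [chi * opL L f] up to
    commutators, which contain derivatives of [chi] and at most k - 1 powers of frequency. Dividing
    by the symbol gains one power. Each such gain differentiates [chi] up to [k] times, whence the
    vanishing order [m * k]. *)
Lemma sol_decay m chi : cut (m * k) chi -> exists2 C, 0 <= C & forall L X f M n,
  ell k A c v0 sl L ->
  open X -> (forall x, `|x| <= Pi -> X x) -> smooth_on X f -> bd Pi f M ->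
  (forall s, (size s <= m)%N -> bd Pi (partials s (opL L f)) M) ->
  N (JJ chi f n) * nu n ^+ m <= C * M.
Proof.
elim: m chi => [|m IH] chi cc.
  have [K K0 cK] := cut_bd cc; exists K; first exact: ltW.
  by move=> L X f M n _ oX QX fs fM _; rewrite expr0 mulr1; exact: JJ_le.
have [K K0 cK] := cut_bd cc.
have [C1 C10 H1] : exists2 C, 0 <= C & forall (t : {bseq k of 'I_d}) L X f M n,
  ell k A c v0 sl L ->
  open X -> (forall x, `|x| <= Pi -> X x) -> smooth_on X f -> bd Pi f M ->
  (forall s, (size s <= m)%N -> bd Pi (partials s (opL L f)) M) ->
  N (JJ (partials t chi) f n) * nu n ^+ m <= C * M.
  apply: fin_unif => [t|t C C' CC' H L X f M n eL oX QX fs fM hM].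
    apply: IH; apply: cut_partials; apply: cut_leq cc.
    by rewrite mulSn leq_add2r size_bseq.
  apply: le_trans (H L X f M n eL oX QX fs fM hM) _; rewrite ler_wpM2r//.
  by apply: le_trans (N_ge0 (f 0)) (fM 0 _); rewrite normr0 pi_ge0.
have mk : (m.+1 <= m.+1 * k)%N by rewrite leq_pmulr.
have [C2 C20 H2] := JJ_decay (cut_leq mk cc).
pose D : R := (size sl)%:R * A * (2 ^+ k - 1) * C1.
have D0 : 0 <= D.
  by rewrite !mulr_ge0// subr_ge0 exprn_ege1// ler1n.
exists (K * v0 ^+ m.+1 + c^-1 * (C2 + D)).
  by rewrite addr_ge0 ?mulr_ge0 ?exprn_ge0 ?invr_ge0 ?addr_ge0 ?(ltW c0) ?(ltW K0).
move=> L X f M n eL oX QX fs fM hM.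
have M0 : 0 <= M by apply: le_trans (N_ge0 (f 0)) (fM 0 _); rewrite normr0 pi_ge0.
have v1 := nu_ge1 n; have vp : 0 < nu n by rewrite (lt_le_trans ltr01).
(* At low frequencies the symbol may vanish; the trivial bound is enough there, at the price of the
   constant [v0 ^+ m.+1]. *)
have [vlt|vge] := ltP (nu n) v0.
  rewrite mulrDl; apply: ler_wpDr.
    by rewrite !mulr_ge0 ?invr_ge0 ?addr_ge0 ?(ltW c0).
  rewrite mulrAC; apply: ler_pM; rewrite ?N_ge0 ?exprn_ge0 ?(ltW vp)//.
    exact: JJ_le cK fM.
  by rewrite lerXn2r ?nnegrE ?(ltW vp)// ltW.
have [Lsl LA Lc] := eL.
set B := C1 * M / nu n ^+ m.
have B0 : 0 <= B by rewrite divr_ge0 ?mulr_ge0 ?exprn_ge0 ?(ltW vp).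
have JB t : (0 < size t <= k)%N -> N (JJ (partials t chi) f n) <= B.
  move=> /andP[_ tk]; rewrite /B ler_pdivlMr ?nu_X//; apply: (H1 (Bseq tk) L X) => // s sm.
  by apply: hM; exact: leqW.
have cs := cut_sm cc.
have E : N (JJ chi (opL L f) n - sym L (fun i => - ('i * (n i)%:~R)) * JJ chi f n) <=
   (size sl)%:R * (A * ((2 ^+ k - 1) * nu n ^+ k.-1 * B)).
  rewrite (JJ_sum n L oX QX cs fs) /sym mulr_suml -sumrB.
  apply: le_trans (N_sum _ _ _) _.
  rewrite -Lsl size_map; apply: sum_le_size => t tL.
  rewrite -mulrA -mulrBr NM; apply: ler_pM; rewrite ?N_ge0 ?LA//.
  have tk : (size t.2 <= k)%N by apply: slk; rewrite -Lsl; apply/mapP; exists t.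
  apply: le_trans (JJ_partials oX QX (n := n) (s := t.2) (B := B) _ fs B0 _) _.
  - by apply: cut_leq cc; apply: leq_trans tk _; rewrite mulSn leq_addr.
  - by move=> u /andP[u0 us]; apply: JB; rewrite u0 (leq_trans us).
  - apply: ler_wpM2r => //; apply: ler_pM.
    + by rewrite subr_ge0 exprn_ege1// ler1n.
    + by rewrite exprn_ge0// ltW.
    + by rewrite lerD2r ler_weXn2l// ler1n.
    + by rewrite ler_weXn2l// -!subn1 leq_sub2r.
have F : N (JJ chi (opL L f) n) * nu n ^+ m.+1 <= C2 * M.
  exact: (H2 X _ _ _ oX QX (sm_opL L oX fs) hM).
have G : c * nu n ^+ k * N (JJ chi f n) <= N (JJ chi (opL L f) n) +
   (size sl)%:R * (A * ((2 ^+ k - 1) * nu n ^+ k.-1 * B)).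
  apply: (@le_trans _ _ (N (sym L (fun i => - ('i * (n i)%:~R)) * JJ chi f n))).
    by rewrite NM ler_wpM2r ?N_ge0//; exact: Lc.
  rewrite -lerBlDl; apply: le_trans E; by rewrite NBC le_N.
rewrite mulrDl; apply: ler_wpDl; first by rewrite !mulr_ge0 ?exprn_ge0 ?(ltW K0).
rewrite -mulrA ler_pdivlMl// -(ler_pM2r (nu_X n k.-1)).
have kE : nu n ^+ k = nu n ^+ k.-1 * nu n by rewrite -exprSr prednK.
have -> : c * (N (JJ chi f n) * nu n ^+ m.+1) * nu n ^+ k.-1 = (c * nu n ^+ k * N (JJ chi f n)) * nu n ^+ m.
  by rewrite kE exprS; ring.
apply: le_trans (ler_wpM2r (ltW (nu_X n m)) G) _.
have -> : (C2 + D) * M * nu n ^+ k.-1 = C2 * M * nu n ^+ k.-1 + D * M * nu n ^+ k.-1 by ring.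
rewrite mulrDl; apply: lerD.
  apply: (@le_trans _ _ (N (JJ chi (opL L f) n) * nu n ^+ m.+1 * nu n ^+ k.-1)); last first.
    by rewrite ler_wpM2r// ltW// nu_X.
  rewrite -mulrA ler_wpM2l ?N_ge0// exprS mulrAC ler_peMl ?exprn_ge0 ?(ltW vp)//.
  by rewrite mulr_ege1// exprn_ege1.
rewrite le_eqVlt; apply/orP; left; apply/eqP; rewrite /D /B.
by field; rewrite expf_neq0// lt0r_neq0.
Qed.

Lemma wt_nu n : 1 <= wt R n * nu n ^+ (2 * d).
Proof.
have E : nu n ^+ (2 * d) = \prod_(i < d) nu n ^+ 2 by rewrite prodr_const card_ord exprM.
have P : 0 < \prod_i (1 + `|(n i)%:~R| : R) ^+ 2.
  by apply: prodr_gt0 => i _; rewrite exprn_gt0// ltr_pwDl.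
rewrite /wt prodfV mulrC ler_pdivlMr// mul1r E; apply: ler_prod => i _.
rewrite exprn_ge0 ?addr_ge0//= lerXn2r ?nnegrE ?addr_ge0 ?nu_coord//.
by rewrite sumr_ge0.
Qed.

(** Fourier inversion is applied to [chi * partial i f]. Of the 2d + 1 powers of decay, one pays for
    the derivative and 2d make the coefficients summable through [wt_nu]. The extra factor [Wf] in
    [chi] allows one derivative to fall on [chi]. *)
Lemma gradient_unit : exists2 C, 0 <= C & forall L X f M i,
  ell k A c v0 sl L ->
  open X -> (forall x, `|x| <= Pi -> X x) -> smooth_on X f -> bd Pi f M ->
  (forall s, (size s <= (2 * d).+1)%N -> bd Pi (partials s (opL L f)) M) ->
  N (partial i f 0) <= C * M.
Proof.
set m := (2 * d).+1; pose chi x := Wf x ^+ (m * k).+1.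
have cc : cut (m * k).+1 chi by exact: cutW.
have [C1 C10 H1] := sol_decay (cutS cc).
have [C2 C20 H2] : exists2 C, 0 <= C & forall i L X f M n,
  ell k A c v0 sl L ->
  open X -> (forall x, `|x| <= Pi -> X x) -> smooth_on X f -> bd Pi f M ->
  (forall s, (size s <= m)%N -> bd Pi (partials s (opL L f)) M) ->
  N (JJ (partial i chi) f n) * nu n ^+ m <= C * M.
  apply: fin_unif => [i|i C C' CC' H L X f M n eL oX QX fs fM hM].
    exact: sol_decay (cut_partial i cc).
  apply: le_trans (H L X f M n eL oX QX fs fM hM) _; rewrite ler_wpM2r//.
  by apply: le_trans (N_ge0 (f 0)) (fM 0 _); rewrite normr0 pi_ge0.
exists ((C1 + C2) * 3 ^+ d).
  by rewrite mulr_ge0 ?exprn_ge0// addr_ge0.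
move=> L X f M i eL oX QX fs fM hM.
have M0 : 0 <= M by apply: le_trans (N_ge0 (f 0)) (fM 0 _); rewrite normr0 pi_ge0.
have c1 : cut 1 chi by apply: cut_leq cc.
have gs := smM oX (smS (@subsetT _ X) (cut_sm cc)) (sm_partial i fs).
rewrite mulrAC; have -> : partial i f 0 = chi 0 * partial i f 0.
  by rewrite /chi Wf0 expr1n mul1r.
apply: (inversion d0 (F := fun x => chi x * partial i f x)).
- by move=> x /QX Xx; exact: sm_cont gs Xx.
- by rewrite mulr_ge0// addr_ge0.
move=> n; rewrite -/(JJ chi (partial i f) n) (JJ_rec oX QX n i c1 fs).
have v1 := nu_ge1 n; have vd := nu_X n (2 * d).
rewrite -(ler_pM2r vd) -mulrA -[leLHS]mulr1.
apply: (@le_trans _ _ ((C1 + C2) * M)); last first.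
  by rewrite ler_peMr ?wt_nu// mulr_ge0// addr_ge0.
rewrite mulr1; apply: (@le_trans _ _ (N (JJ chi f n) * nu n ^+ m + N (JJ (partial i chi) f n) * nu n ^+ m)).
  rewrite -mulrDl /m exprS mulrA; apply: ler_wpM2r; first exact: ltW.
  apply: le_trans (NB _ _) _; rewrite NM mulrDl; apply: lerD.
    by rewrite mulrC ler_wpM2l ?N_ge0// Nin.
  by rewrite ler_peMr ?N_ge0.
rewrite mulrDl; apply: lerD; first exact: (H1 L X f M n eL oX QX fs fM hM).
exact: (H2 i L X f M n eL oX QX fs fM hM).
Qed.

End Elliptic.
End Estimates.

(** * Sequences in compact sets and an elementary factorial bound *)

Lemma nbhs_ball_norm (R : realType) (W : normedModType R) (x : W) (r : R) : 0 < r ->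
  nbhs x [set y | `|y - x| < r].
Proof.
by move=> r0; apply/nbhs_normP; exists r => // y /=; rewrite distrC.
Qed.

Lemma compact_seq (R : realType) (d : nat) (K : set 'rV[R]_d) (x : nat -> 'rV[R]_d) :
  compact K -> (forall n, K (x n)) ->
  exists2 p, K p & forall (r : R) m, 0 < r -> exists2 n, (m <= n)%N & `|x n - p| < r.
Proof.
move=> cK xK; have FK : (x @ \oo) K by exists 0%N => // n _; exact: xK.
have [p [Kp cl]] := cK _ _ FK; exists p => // r m r0.
have A : (x @ \oo) [set x n | n in [set n | (m <= n)%N]].
  by exists m => // n /= mn; exists n.
have B : nbhs p [set y | `|y - p| < r].
  exact: (nbhs_ball_norm (p : 'rV[R]_d) r0).
by have [_ [[n mn <-] /= xp]] := cl _ _ A B; exists n.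
Qed.

Lemma compact_bounded_fun (R : realType) (d : nat) (K : set 'rV[R]_d) (f : 'rV[R]_d -> R[i]) :
  compact K -> (forall x, K x -> cont f x) -> exists2 M, 0 < M & forall x, K x -> N (f x) <= M.
Proof.
move=> cK fc; apply: contrapT => H.
have /choice[x hx] : forall n : nat, exists x, K x /\ n.+1%:R < N (f x).
  move=> n; apply: contrapT => nx; apply: H; exists n.+1%:R => // y Ky.
  by rewrite leNgt; apply/negP => h; apply: nx; exists y.
have [p Kp hp] := compact_seq cK (fun n => (hx n).1).
have [r r0 hr] := fc _ Kp _ ltr01.
have /archi_boundP := N_ge0 (f p); set m := Num.bound _ => hm.
have [n mn xp] := hp r m r0.
have := hr _ xp; have := (hx n).2; have := le_N (f (x n)) (f p).
have : (m%:R : R) <= n%:R by rewrite ler_nat.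
by rewrite -natr1; move: hm; lra.
Qed.

(** Replaces Stirling's formula: the falling factorial of 2m of length m is at least m^m and equals
    m! times a binomial coefficient, which is at most 4^m. *)
Lemma expn_fact m : (m ^ m <= m`! * 4 ^ m)%N.
Proof.
have H : ('C(2 * m, m) * m`! = (2 * m) ^_ m)%N by rewrite bin_ffact.
have H2 j : (j <= m -> m ^ j <= (2 * m) ^_ j)%N.
  elim: j => [//|j IH] jm; rewrite expnSr ffactnSr leq_mul// ?IH 1?ltnW//.
  by lia.
apply: leq_trans (H2 m (leqnn _)) _; rewrite -H mulnC leq_mul2l; apply/orP; right.
have := expnDn 1 1 (2 * m); rewrite addn1 expnM => ->.
have mm : (m < (2 * m).+1)%N by lia.
by rewrite (bigD1 (Ordinal mm))//= !exp1n !muln1 leq_addr.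
Qed.

(** * Taylor expansion with remainder and the negative binomial series *)

Section Taylor.
Context (R : realType).

Lemma is_derive_monomial (m : nat) (M t : R) :
  is_derive (t : R^o) (1 : R^o) (fun u : R => u ^+ m.+1 / m.+1`!%:R * M) (t ^+ m / m`!%:R * M).
Proof.
have D := is_deriveX m.+1 (is_derive_id (t : R^o) (1 : R^o)).
have := is_deriveZ (M / m.+1`!%:R) D; rewrite /=.
rewrite [X in is_derive _ _ X](_ : _ = (fun u : R => u ^+ m.+1 / m.+1`!%:R * M)); last first.
  apply/funext => u; rewrite /GRing.scale /=.
  have E k : ((@id R : R^o -> R^o) ^+ k) u = u ^+ k.
    by elim: k => [//|k IH]; rewrite !exprS -IH.
  by rewrite E /GRing.scale /=; ring.
rewrite [X in is_derive _ _ _ X](_ : _ = t ^+ m / m`!%:R * M)// /GRing.scale/= mulr1 factS natrM.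
have h1 : m.+1%:R != 0 :> R by rewrite pnatr_eq0.
have h2 : m`!%:R != 0 :> R by rewrite pnatr_eq0 -lt0n fact_gt0.
by move: (m.+1%:R) (m`!%:R) h1 h2 => a b a0 b0; field; rewrite a0 b0.
Qed.

(** [phi k] plays the role of the [k]-th derivative. The derivative of the remainder of order
    [m + 1] is the remainder of order [m] of the shifted sequence, so [mvt_major] carries the
    induction. *)
Lemma taylor_seq (phi : nat -> R -> R[i]) (M : R) m :
  (forall k t, 0 <= t <= 1 -> cder (phi k : R^o -> _) t (1 : R^o) (phi k.+1 t)) ->
  (forall t, 0 <= t <= 1 -> N (phi m t) <= M) ->
  forall T, 0 <= T <= 1 ->
  N (phi 0%N T - \sum_(k < m) (T ^+ k / k`!%:R)%:C * phi k 0) <= T ^+ m / m`!%:R * M.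
Proof.
elim: m phi => [|m IH] phi dphi phiM T T01.
  by rewrite big_ord0 subr0 expr0 fact0 invr1 !mul1r; exact: phiM.
have [T0 T1] := andP T01.
have mono k t : cder (fun u : R^o => (u ^+ k.+1 / k.+1`!%:R)%:C) t (1 : R^o) (t ^+ k / k`!%:R)%:C.
  by apply: cder_real; have := is_derive_monomial k 1 t; rewrite mulr1;
     congr (is_derive _ _ _); apply/funext => u; rewrite mulr1.
pose g (t : R) := phi 0%N t - \sum_(k < m.+1) (t ^+ k / k`!%:R)%:C * phi k 0.
have := @mvt_major R g (fun t => t ^+ m.+1 / m.+1`!%:R * M)
  (fun t => phi 1%N t - \sum_(k < m) (t ^+ k / k`!%:R)%:C * phi k.+1 0)
  (fun t => t ^+ m / m`!%:R * M) T T0.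
have g0 : g 0 = 0.
  rewrite /g big_ord_recl /= expr0 fact0 invr1 mulr1 mul1r big1 => [|k _].
    by rewrite addr0 subrr.
  by rewrite expr0n /= !mul0r.
rewrite g0 expr0n /= !mul0r !subr0; apply=> t /andP[t0 tT].
- have t01 : 0 <= t <= 1 by rewrite t0 (le_trans tT).
  have -> : g = fun t => phi 0%N t - (phi 0%N 0 + \sum_(k < m) (t ^+ k.+1 / k.+1`!%:R)%:C * phi k.+1 0).
    by apply/funext => u; rewrite /g big_ord_recl /= expr0 fact0 invr1 mul1r mul1r.
  apply: cderB; first exact: dphi.
  rewrite -[X in cder _ _ _ X]add0r; apply: cderD; first exact: cder_cst.
  apply: (@cder_sum R R^o 'I_m (index_enum 'I_m)
    (fun k (u : R^o) => (u ^+ k.+1 / k.+1`!%:R)%:C * phi k.+1 0)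
    (fun k => (t ^+ k / k`!%:R)%:C * phi k.+1 0) t (1 : R^o)) => k.
  by have := cderM (mono k t) (cder_cst (phi k.+1 0) (t : R^o) (1 : R^o)); rewrite mulr0 addr0.
- exact: is_derive_monomial.
- apply: (IH (fun k => phi k.+1)) => //; last by rewrite t0 (le_trans tT).
  by move=> k u u01; exact: dphi.
Qed.

(** Partial sums of the series of (1 - x)^-(n+1), by a double induction along Pascal's rule. It
    resums Taylor series whose derivatives obey the bounds [geo]. *)
Lemma negbin (n m : nat) (x : R) : 0 <= x <= 1 ->
  (1 - x) ^+ n.+1 * \sum_(k < m) 'C(n + k, k)%:R * x ^+ k <= 1.
Proof.
move=> /andP[x0 x1]; have y0 : 0 <= 1 - x by rewrite subr_ge0.
elim: n m => [|n IHn] m.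
  rewrite expr1; elim: m => [|m IH]; first by rewrite big_ord0 mulr0.
  have E k : \sum_(i < k) 'C(0 + i, i)%:R * x ^+ i = \sum_(i < k) x ^+ i.
    by apply: eq_bigr => i _; rewrite add0n binn mul1r.
  by rewrite E -opprB mulNr -subrX1 opprB gerBl exprn_ge0.
elim: m => [|m IHm]; first by rewrite big_ord0 mulr0.
have -> : \sum_(k < m.+1) 'C(n.+1 + k, k)%:R * x ^+ k =
  \sum_(k < m.+1) 'C(n + k, k)%:R * x ^+ k + x * \sum_(k < m) 'C(n.+1 + k, k)%:R * x ^+ k.
  rewrite big_ord_recl [X in _ = X + _]big_ord_recl /= !bin0 -addrA; congr (_ + _).
  rewrite mulr_sumr -big_split /=; apply: eq_bigr => k _.
  rewrite /bump /= !add1n addSn binS natrD addnS addSn exprS; ring.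
rewrite mulrDr; have H1 := IHn m.+1; rewrite exprS.
apply: (@le_trans _ _ ((1 - x) * 1 + x * 1)); last by rewrite !mulr1 subrK.
apply: lerD; first by rewrite -mulrA ler_wpM2l.
by rewrite mulrCA -exprS ler_wpM2l.
Qed.

End Taylor.

(** * Axis-parallel paths and rescaled operators *)

Section Local.
Context (R : realType) (d : nat).
Notation V := 'rV[R]_d.
Implicit Types (x y : V) (f g : V -> R[i]) (X : set V).

Lemma axis_taylor X f x i (t M : R) m : open X -> smooth_on X f ->
  (forall u : R, 0 <= u <= 1 -> X (x + (u * t) *: ee R i) /\
      N (partials (nseq m i) f (x + (u * t) *: ee R i)) <= M) ->
  N (f (x + t *: ee R i) - \sum_(k < m) (t ^+ k / k`!%:R)%:C * partials (nseq k i) f x)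
   <= `|t| ^+ m / m`!%:R * M.
Proof.
move=> oX fs H.
pose phi k (u : R) := (t ^+ k)%:C * partials (nseq k i) f (x + (u * t) *: ee R i).
have D k u : 0 <= u <= 1 -> cder (phi k : R^o -> _) u (1 : R^o) (phi k.+1 u).
  move=> /H[Xu _]; have := cder_axis (sm_cder i (sm_partials (nseq k i) fs) Xu).
  move=> /(cderZ (t ^+ k)%:C); rewrite /phi exprSr rmorphM /= -mulrA; exact.
have B u : 0 <= u <= 1 -> N (phi m u) <= `|t| ^+ m * M.
  by move=> /H[_ le]; rewrite NM N_real normrX ler_wpM2l// exprn_ge0.
have := taylor_seq D B (T := 1); rewrite lexx ler01 => /(_ isT).
rewrite {1}/phi expr0 mul1r expr1n mul1r mul1r.
rewrite (eq_bigr (fun k : 'I_m => (t ^+ k / k`!%:R)%:C * partials (nseq k i) f x)) => [h|k _].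
  by apply: le_trans h _; rewrite mulrA [_^-1 * _]mulrC.
rewrite /phi mul0r scale0r addr0 expr1n mul1r mulrA; congr (_ * _).
by rewrite -rmorphM mulrC.
Qed.

Definition mix x y (l : seq 'I_d) : V := \row_i (if i \in l then y 0 i else x 0 i).

Lemma mix_nil x y : mix x y [::] = x.
Proof. by apply/rowP => i; rewrite mxE. Qed.

Lemma mix_enum x y : mix x y (enum 'I_d) = y.
Proof. by apply/rowP => i; rewrite mxE mem_enum. Qed.

Lemma mix_cons x y i l : i \notin l ->
  mix x y (i :: l) = mix x y l + (y 0 i - x 0 i) *: ee R i.
Proof.
move=> il; apply/rowP => j; rewrite !mxE inE.
have [->|ji] := eqVneq j i; first by rewrite (negbTE il) eqxx mulr1 subrKC.
by rewrite andbF mulr0 addr0.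
Qed.

(** Derivatives are controlled along the axes only, so a cube is crossed by changing one coordinate
    at a time. In the maximum norm the whole path stays in the cube. *)
Lemma axis_path (Q : V -> Prop) x y (r : R) : `|y - x| <= r ->
  (forall z i (t : R), (forall u : R, 0 <= u <= 1 -> `|z + (u * t) *: ee R i - x| <= r) ->
    `|t| <= r -> Q z -> Q (z + t *: ee R i)) -> Q x -> Q y.
Proof.
move=> yx H Qx; have r0 : 0 <= r by apply: le_trans yx.
have yj j : `|y 0 j - x 0 j| <= r.
  by have := rv_coord (y - x) j; rewrite !mxE => h; apply: le_trans h yx.
rewrite -(mix_enum x y); have := enum_uniq 'I_d.
elim: (enum 'I_d) => [_|i l IH /= /andP[il ul]]; first by rewrite mix_nil.
rewrite mix_cons//; apply: H => //; last exact: IH.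
move=> u /andP[u0 u1]; apply/rv_leP => // j; rewrite !mxE.
have [->|ji] := eqVneq j i.
  rewrite (negbTE il) eqxx mulr1 addrC addKr normrM ger0_norm//.
  by apply: le_trans (yj i); rewrite ler_piMl.
rewrite andbF mulr0 addr0; case: ifP => _; first exact: yj.
by rewrite subrr normr0.
Qed.

Lemma lip_cube X f x y (r B : R) : open X -> (forall z, `|z - x| <= r -> X z) ->
  smooth_on X f -> (forall i z, `|z - x| <= r -> N (partial i f z) <= B) ->
  `|y - x| <= r -> N (f y - f x) <= d%:R * B * `|y - x|.
Proof.
move=> oX QX fs fB yx; have r0 : 0 <= r by apply: le_trans yx.
have yj j : `|y 0 j - x 0 j| <= `|y - x|.
  by have := rv_coord (y - x) j; rewrite !mxE.
suff : N (f (mix x y (enum 'I_d)) - f x) <= (size (enum 'I_d))%:R * B * `|y - x|.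
  by rewrite mix_enum size_enum_ord.
have := enum_uniq 'I_d; elim: (enum 'I_d) => [_|i l IH /= /andP[il ul]].
  by rewrite mix_nil subrr N0 !mul0r.
rewrite mix_cons//; set z := mix x y l in IH *; set t := y 0 i - x 0 i.
have H u : 0 <= u <= 1 -> `|z + (u * t) *: ee R i - x| <= r.
  move=> /andP[u0 u1]; apply/rv_leP => // j; rewrite !mxE.
  have [->|ji] := eqVneq j i.
    rewrite (negbTE il) eqxx mulr1 addrC addKr normrM ger0_norm//.
    by apply: le_trans (le_trans (yj i) yx); rewrite ler_piMl.
  rewrite andbF mulr0 addr0; case: ifP => _; first exact: le_trans (yj j) yx.
  by rewrite subrr normr0.
have M := @partial_mvt _ _ f z i t B X oX fs (fun u u01 => conj (QX _ (H u u01)) (fB i _ (H u u01))).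
have -> : f (z + t *: ee R i) - f x = (f (z + t *: ee R i) - f z) + (f z - f x) by ring.
apply: le_trans (ND _ _) _; rewrite -natr1 mulrDl mul1r mulrDl addrC; apply: lerD; first exact: IH.
apply: le_trans M _; rewrite mulrC ler_wpM2l//; last exact: yj.
by apply: le_trans (N_ge0 _) (fB i x _); rewrite subrr normr0.
Qed.

Definition ellL k (c R0 : R) (L : seq (R[i] * seq 'I_d)) :=
  (forall t, t \in L -> (size t.2 <= k)%N) /\
  forall xi : 'I_d -> R, R0 <= \sum_i `|xi i| ->
    c * (\sum_i `|xi i|) ^+ k <= N (sym L (fun i => 'i * (xi i)%:C)).

(** The operator acting on [f (x0 + r *: h)] as a function of [h], multiplied by r^k: the principal
    part is unchanged and a term of order j acquires the factor r^(k-j). *)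
Definition scL k (r : R) (L : seq (R[i] * seq 'I_d)) :=
  [seq ((r ^+ (k - size t.2))%:C * t.1, t.2) | t <- L].

(** The rescaled symbol at frequency [n] is r^k times the original one at -n/r; for [r <= 1] this
    only moves frequencies further out. The loss 2^k and the threshold [R0 + 2] come from passing
    from the sum s of the |n_i| to 1 + s <= 2 s. *)
Lemma ell_scL k c R0 L (r : R) : 0 < c -> 0 <= R0 -> ellL k c R0 L -> 0 < r <= 1 ->
  ell k (\sum_(t <- L) N t.1) (c / 2 ^+ k) (R0 + 2) (map snd L) (scL k r L).
Proof.
move=> c0 R00 [Lk Lc] /andP[r0 r1]; split=> [|t /mapP[u uL ->]|n nn].
- by rewrite -map_comp.
- rewrite /= NM N_real ger0_norm ?exprn_ge0 ?(ltW r0)//.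
  apply: (@le_trans _ _ (N u.1)).
    by rewrite ler_piMl ?N_ge0// exprn_ile1// ltW.
  by rewrite (big_rem u)//= lerDl sumr_ge0// => v _; exact: N_ge0.
- pose xi i : R := - (n i)%:~R / r.
  have S : \sum_i `|xi i| = (\sum_i `|(n i)%:~R|) / r.
    by rewrite mulr_suml; apply: eq_bigr => i _; rewrite /xi normrM normrN normfV (gtr0_norm r0).
  have E : sym (scL k r L) (fun i => - ('i * (n i)%:~R)) = (r ^+ k)%:C * sym L (fun i => 'i * (xi i)%:C).
    rewrite /sym big_map mulr_sumr; apply: eq_big_seq => t tL /=.
    have -> : \prod_(i <- t.2) - ('i * (n i)%:~R) = (r ^+ size t.2)%:C * \prod_(i <- t.2) ('i * (xi i)%:C) :> R[i].
      elim: (t.2) => [|i s IH]; first by rewrite !big_nil expr0 mulr1.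
      rewrite !big_cons IH /= exprS rmorphM /= /xi.
      have -> : - ('i * (n i)%:~R) = r%:C * ('i * (- (n i)%:~R / r)%:C) :> R[i].
        rewrite mulrCA -rmorphM /= mulrCA divff ?lt0r_neq0// mulr1 rmorphN /= rmorph_int.
        by rewrite mulrN.
      by ring.
    by rewrite -[in RHS](subnK (Lk _ tL)) exprD rmorphM /=; ring.
  rewrite E NM N_real ger0_norm ?exprn_ge0 ?(ltW r0)//.
  set s := \sum_i `|(n i)%:~R| in S.
  have s1 : R0 + 1 <= s by move: nn; rewrite /nu -/s; lra.
  have sr : s <= s / r by rewrite ler_pdivlMr// ler_piMr// (le_trans _ s1)// addr_ge0.
  have := Lc xi; rewrite S => /(_ _) H.
  apply: (@le_trans _ _ (r ^+ k * (c * (s / r) ^+ k))); last first.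
    rewrite ler_wpM2l ?exprn_ge0 ?(ltW r0)//; apply: H.
    by apply: le_trans sr; apply: le_trans s1; rewrite lerDl.
  have -> : r ^+ k * (c * (s / r) ^+ k) = c * s ^+ k.
    by rewrite mulrCA -exprMn mulrCA divff ?mulr1// lt0r_neq0.
  rewrite -mulrA ler_wpM2l ?(ltW c0)// mulrC -expr_div_n.
  apply: lerXn2r; rewrite ?nnegrE /nu -/s; lra.
Qed.

Lemma opL_scL k L X f x0 (r : R) s x : (forall t, t \in L -> (size t.2 <= k)%N) ->
  open X -> smooth_on X f -> X (x0 + r *: x) ->
  partials s (opL (scL k r L) (fun h => f (x0 + r *: h))) x =
  (r ^+ k)%:C * (r ^+ size s)%:C * partials s (opL L f) (x0 + r *: x).
Proof.
move=> Lk oX fs Xx; have oY := @open_affine R d X x0 r oX.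
have ls := sm_opL L oX fs.
have E y : X (x0 + r *: y) -> opL (scL k r L) (fun h => f (x0 + r *: h)) y =
   (r ^+ k)%:C * opL L f (x0 + r *: y).
  move=> Xy; rewrite /opL big_map mulr_sumr; apply: eq_big_seq => t tL /=.
  rewrite (partials_affine _ oX fs Xy) -rmorphXn /= -[in RHS](subnK (Lk _ tL)) exprD rmorphM /=.
  ring.
rewrite (partials_eq oY s E Xx) (partialsZ oY s _ (@sm_affine _ _ X _ x0 r oX ls) Xx).
by rewrite (partials_affine _ oX ls Xx) -rmorphXn /= mulrA.
Qed.

(** * Analyticity of solutions *)

Section Gradient.
Context (d0 : (0 < d)%N) (k : nat) (k0 : (0 < k)%N) (c R0 : R) (c0 : 0 < c) (R00 : 0 <= R0).
Context (L : seq (R[i] * seq 'I_d)) (eL : ellL k c R0 L).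

(** The cube of half-side [r] around [x] is stretched onto the cube of half-side pi by the factor
    [rho = r / pi]. As [rho <= 1], the derivatives of the right-hand side only shrink, and undoing
    the scaling produces the factor 1/r. *)
Lemma gradient_est : exists2 C, 1 <= C & forall X f x (r M : R) i,
  0 < r <= 1 -> open X -> (forall y, `|y - x| <= r -> X y) -> smooth_on X f ->
  (forall y, `|y - x| <= r -> N (f y) <= M) ->
  (forall s y, (size s <= (2 * d).+1)%N -> `|y - x| <= r -> N (partials s (opL L f) y) <= M) ->
  N (partial i f x) <= C / r * M.
Proof.
have A0 : 0 <= \sum_(t <- L) N t.1 by apply: sumr_ge0 => t _; exact: N_ge0.
have c20 : 0 < c / 2 ^+ k by rewrite divr_gt0// exprn_gt0.
have R20 : 0 <= R0 + 2 by rewrite addr_ge0.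
have slk s : s \in map snd L -> (size s <= k)%N.
  by move=> /mapP[t tL ->]; exact: eL.1.
have [C C0 H] := gradient_unit d0 k0 A0 c20 R20 slk.
have Pi1 : 1 <= (pi : R) by have := pi_ge2 R; lra.
have Pi0 := pi_gt0 R.
exists (pi * (C + 1)).
  by rewrite mulr_ege1// lerDr.
move=> X f x r M i /andP[r0 r1] oX QX fs fM hM.
have M0 : 0 <= M by apply: le_trans (N_ge0 (f x)) (fM x _); rewrite subrr normr0 ltW.
pose rho := r / pi; have rho0 : 0 < rho by rewrite divr_gt0.
have rho1 : rho <= 1 by rewrite ler_pdivrMr// mul1r; lra.
have near h : `|h| <= pi -> `|x + rho *: h - x| <= r.
  move=> hp; rewrite addrC addKr normrZ gtr0_norm//.
  by rewrite /rho mulrAC ler_pdivrMr// ler_wpM2l// ltW.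
have oY := @open_affine R d X x rho oX.
have rr : 0 < rho <= 1 by rewrite rho0.
have G := H (scL k rho L) _ (fun h => f (x + rho *: h)) M i (ell_scL c0 R00 eL rr) oY
  (fun h hp => QX _ (near h hp)) (@sm_affine _ _ X _ x rho oX fs) (fun h hp => fM _ (near h hp)).
have X0 : X (x + rho *: 0) by rewrite scaler0 addr0; apply: QX; rewrite subrr normr0 ltW.
have {G} : N (partial i (fun h => f (x + rho *: h)) 0) <= C * M.
  apply: G => s sd h hp; rewrite (opL_scL s eL.1 oX fs (QX _ (near h hp))).
  rewrite !NM !N_real !ger0_norm ?exprn_ge0 ?(ltW rho0)// -exprD.
  apply: le_trans (hM s _ sd (near h hp)); rewrite ler_piMl ?N_ge0//.
  by rewrite exprn_ile1// ltW.
have PE : partial i (fun h => f (x + rho *: h)) 0 = rho%:C ^+ 1 * partial i f (x + rho *: 0).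
  exact: (@partials_affine R d X f x rho [:: i] 0 oX fs X0).
rewrite PE.
rewrite expr1 scaler0 addr0 NM N_real gtr0_norm// -ler_pdivlMl// => h.
apply: le_trans h _; rewrite /rho invf_div mulrA ler_wpM2r//.
by rewrite -!mulrA ler_wpM2l ?pi_ge0// mulrC ler_wpM2r ?invr_ge0 ?(ltW r0)// lerDl.
Qed.

Lemma opL_partial X f x i : open X -> smooth_on X f -> X x ->
  partial i (opL L f) x = opL L (partial i f) x.
Proof.
move=> oX fs Xx; have := @partials_sum _ _ X oX [:: i] _ L (fun t x => t.1 * partials t.2 f x) x.
rewrite /= => -> ; [|by move=> t; exact: (smZ oX _ (sm_partials t.2 fs))|exact: Xx].
apply: eq_bigr => t _.
have := partialsZ oX [:: i] t.1 (sm_partials t.2 fs) Xx; rewrite /= => ->.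
congr (_ * _); have := @partials_perm _ _ X f (i :: t.2) (rcons t.2 i) x oX fs.
rewrite perm_sym perm_rcons perm_refl => /(_ isT Xx) /= ->.
by rewrite /partials foldr_rcons.
Qed.

Lemma opL_partials X f x s : open X -> smooth_on X f -> X x ->
  partials s (opL L f) x = opL L (partials s f) x.
Proof.
move=> oX fs; elim: s x => [//|i s IH] x Xx /=.
by rewrite (partial_eq oX i IH)// (opL_partial i oX (sm_partials s fs)).
Qed.

Definition sol X f := smooth_on X f /\ forall x, X x -> opL L f x = 0.

Lemma sol_partials X f s : open X -> sol X f -> sol X (partials s f).
Proof.
move=> oX [fs f0]; split; first exact: sm_partials.
by move=> x Xx; rewrite -(opL_partials s oX fs Xx) (partials_eq oX s f0 Xx) (partials_cst0 oX).
Qed.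

(* Bounds on all derivatives by iterating the gradient estimate on |s| nested cubes. *)
Lemma analytic_est : exists2 C, 1 <= C & forall X f x (r M : R) s,
  0 < r <= 1 -> open X -> (forall y, `|y - x| <= r -> X y) -> sol X f ->
  (forall y, `|y - x| <= r -> N (f y) <= M) ->
  N (partials s f x) <= (size s)`!%:R * (C / r) ^+ size s * M.
Proof.
(* With m cubes of size r/m the iterated estimate gives (m C / r)^m, and m^m <= 4^m m! turns this
   into the analytic form. *)
have [C C1 H] := gradient_est; exists (4 * C); first by rewrite mulr_ege1// ler1n.
have C0 : 0 <= C by apply: le_trans C1.
have step X f (rho M : R) s x : 0 < rho <= 1 -> open X -> (forall y, `|y - x| <= (size s)%:R * rho -> X y) ->
    sol X f -> (forall y, `|y - x| <= (size s)%:R * rho -> N (f y) <= M) ->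
    N (partials s f x) <= (C / rho) ^+ size s * M.
  move=> rr oX QX fsol fM; have [rho0 rho1] := andP rr.
  have M0 : 0 <= M.
    by apply: le_trans (N_ge0 (f x)) (fM x _); rewrite subrr normr0 mulr_ge0// ltW.
  elim: s x QX fM => [|i s IH] x QX fM.
    by rewrite mul1r; apply: fM; rewrite subrr normr0 mul0r.
  have tri y z : `|y - x| <= rho -> `|z - y| <= (size s)%:R * rho -> `|z - x| <= (size s).+1%:R * rho.
    move=> yx zy; have -> : z - x = (z - y) + (y - x) by rewrite addrA subrK.
    by apply: le_trans (ler_normD _ _) _; rewrite -natr1 mulrDl mul1r lerD.
  have yx0 y : `|y - x| <= rho -> `|y - x| <= (size s).+1%:R * rho.
    by move=> h; apply: (tri y y h); rewrite subrr normr0 mulr_ge0// ltW.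
  have [gs g0] := sol_partials s oX fsol.
  rewrite /=; have -> : (C / rho) ^+ (size s).+1 * M = C / rho * ((C / rho) ^+ size s * M).
    by rewrite exprS; ring.
  apply: (H X _ _ _ _ _ rr oX) => //.
  - by move=> y yx; apply: QX; exact: yx0.
  - by move=> y yx; apply: IH => z zy; [apply: QX|apply: fM]; exact: tri yx zy.
  - move=> t y _ yx; have Xy : X y by apply: QX; exact: yx0.
    rewrite (partials_eq oX t g0 Xy) (partials_cst0 oX _ Xy) N0 mulr_ge0// exprn_ge0//.
    by rewrite divr_ge0// ltW.
move=> X f x r M s /andP[r0 r1] oX QX fsol fM.
have M0 : 0 <= M by apply: le_trans (N_ge0 (f x)) (fM x _); rewrite subrr normr0 ltW.
case: (posnP (size s)) => [s0|s0].
  by rewrite (size0nil s0) /= fact0 expr0 !mul1r; apply: fM; rewrite subrr normr0 ltW.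
set m := size s in s0 *; have mR : (0 : R) < m%:R by rewrite ltr0n.
have rm : m%:R * (r / m%:R) = r by rewrite mulrCA divff ?mulr1// lt0r_neq0.
have m1 : (1 : R) <= m%:R by rewrite ler1n.
have rr : 0 < r / m%:R <= 1.
  by rewrite divr_gt0//= ler_pdivrMr// mul1r (le_trans r1).
have := step X f _ M s x rr oX; rewrite -/m rm => /(_ QX fsol fM) h.
apply: le_trans h _; apply: ler_wpM2r => //.
have -> : C / (r / m%:R) = m%:R * (C / r) by rewrite invf_div; ring.
have -> : (m%:R * (C / r)) ^+ m = m%:R ^+ m * (C / r) ^+ m by rewrite exprMn.
have -> : (4 * C / r) ^+ m = 4 ^+ m * (C / r) ^+ m by rewrite -exprMn mulrA.
rewrite mulrA; apply: ler_wpM2r; first by rewrite exprn_ge0// divr_ge0// ltW.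
by rewrite -!natrX -natrM ler_nat expn_fact.
Qed.

Lemma partials_cat s t f : partials (s ++ t) f = partials s (partials t f).
Proof. by rewrite /partials foldr_cat. Qed.

(** At a flat point the Taylor polynomials vanish, and the analytic bounds make the remainders tend
    to 0 on a cube whose size is a fixed proportion of [r]. The statement includes all derivatives
    so that it can be carried from one axis-parallel segment to the next. *)
Lemma flat_local : exists2 e : R, 0 < e <= 1 / 2 & forall X f x (r : R), 0 < r <= 1 -> open X ->
  (forall y, `|y - x| <= r -> X y) -> sol X f -> (forall s, partials s f x = 0) ->
  forall y, `|y - x| <= e * r -> forall s, partials s f y = 0.
Proof.
have [K K1 A] := analytic_est; have K0 : 0 < K by apply: lt_le_trans K1.
(* On the cube of half-side r/2 the m-th derivatives grow like m! (2K/r)^m, and splitting (m + |s|)!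
   costs another 2^m; a step of length r/(16K) makes the ratio 1/4. *)
exists (1 / (16 * K)).
  rewrite divr_gt0 ?mulr_gt0//= ler_pdivrMr ?mulr_gt0//; lra.
move=> X f x r /andP[r0 r1] oX QX fsol fl y yx.
have e1 : 1 / (16 * K) * r <= r / 2.
  have : 1 / (16 * K) <= 1 / 2 by rewrite ler_pdivrMr ?mulr_gt0//; lra.
  by move=> h; apply: le_trans (ler_wpM2r (ltW r0) h) _; lra.
have [M M0 fM] : exists2 M, 0 < M & forall z, `|z - x| <= r -> N (f z) <= M.
  have fc h : `|h| <= r -> cont (fun h => f (x + 1 *: h)) h.
    move=> hr; have Xh : X (x + 1 *: h) by apply: QX; rewrite scale1r addrC addKr.
    exact: sm_cont (@sm_affine _ _ X _ x 1 oX fsol.1) Xh.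
  have [M M0 H] := cube_bounded fc.
  exists M => // z zr; have := H _ zr; by rewrite scale1r subrKC.
have rr2 : 0 < r / 2 <= 1 by rewrite divr_gt0//=; lra.
have B z s : `|z - x| <= r / 2 -> N (partials s f z) <= (size s)`!%:R * (K / (r / 2)) ^+ size s * M.
  have near w : `|z - x| <= r / 2 -> `|w - z| <= r / 2 -> `|w - x| <= r.
    move=> h1 h2; have -> : w - x = (w - z) + (z - x) by rewrite addrA subrK.
    by apply: le_trans (ler_normD _ _) _; lra.
  move=> zx; apply: (A X f z _ M s rr2 oX) => // w wz; [apply: QX|apply: fM]; exact: near zx wz.
apply: (@axis_path (fun z => forall s, partials s f z = 0) x y (1 / (16 * K) * r)) => //.
move=> z i t H tr Hz s; apply/eqP; rewrite -N_eq0 -[_ == 0]negbK; apply/negP; rewrite N_eq0 -N_gt0 => pos.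
have LB m : N (partials s f (z + t *: ee R i)) <= (size s)`!%:R * (K / (r / 2)) ^+ size s * M * 2 ^+ size s * (1 / 4) ^+ m.
  have := @axis_taylor X (partials s f) z i t ((m + size s)`!%:R * (K / (r / 2)) ^+ (m + size s) * M) m oX (sm_partials s fsol.1).
  rewrite big1 => [|j _]; last by rewrite -partials_cat Hz mulr0.
  rewrite subr0 => h; apply: le_trans (h _) _.
    move=> u u01; have zu : `|z + (u * t) *: ee R i - x| <= r / 2 by apply: le_trans (H u u01) e1.
    split; first by apply: QX; apply: le_trans zu _; lra.
    by rewrite -partials_cat; have := B _ (nseq m i ++ s) zu; rewrite size_cat size_nseq.
  have b2 : ((m + size s)`! <= 2 ^ (m + size s) * (m`! * (size s)`!))%N.
    rewrite -(bin_fact (leq_addr (size s) m)) addKn leq_mul2r; apply/orP; right.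
    have := expnDn 1 1 (m + size s); rewrite addn1 => ->.
    have mm : (m < (m + size s).+1)%N by rewrite ltnS leq_addr.
    by rewrite (bigD1 (Ordinal mm))//= !exp1n !muln1 leq_addr.
  have b2R : (m + size s)`!%:R <= 2 ^+ (m + size s) * (m`!%:R * (size s)`!%:R) :> R.
    by rewrite -natrX -!natrM ler_nat.
  have m0 : 0 < m`!%:R :> R by rewrite ltr0n fact_gt0.
  set q := K / (r / 2); have q0 : 0 <= q by rewrite divr_ge0// ?ltW//; lra.
  have qt : 0 <= `|t| * q * 2 <= 1 / 4.
    apply/andP; split; first by apply: mulr_ge0 => //; apply: mulr_ge0.
    have : `|t| * q <= 1 / 8.
      apply: le_trans (ler_wpM2r q0 tr) _; rewrite /q.
      by have -> : 1 / (16 * K) * r * (K / (r / 2)) = 1 / 8 by field; rewrite !lt0r_neq0.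
    lra.
  have -> : `|t| ^+ m / m`!%:R * ((m + size s)`!%:R * q ^+ (m + size s) * M) =
    (m + size s)`!%:R * (`|t| ^+ m * q ^+ (m + size s) * M / m`!%:R) by ring.
  apply: (@le_trans _ _ (2 ^+ (m + size s) * (m`!%:R * (size s)`!%:R) * (`|t| ^+ m * q ^+ (m + size s) * M / m`!%:R))).
    by apply: ler_wpM2r => //; rewrite divr_ge0 ?mulr_ge0 ?exprn_ge0// ltW.
  have -> : 2 ^+ (m + size s) * (m`!%:R * (size s)`!%:R) * (`|t| ^+ m * q ^+ (m + size s) * M / m`!%:R)
    = (size s)`!%:R * q ^+ size s * M * 2 ^+ size s * (`|t| * q * 2) ^+ m.
    by rewrite !exprD !exprMn; field; rewrite lt0r_neq0.
  apply: ler_wpM2l; first by rewrite !mulr_ge0 ?exprn_ge0// ltW.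
  by case/andP: qt => q1 q2; rewrite lerXn2r ?nnegrE//; lra.
set D := _ * 2 ^+ size s in LB; have D0 : 0 <= D.
  by rewrite !mulr_ge0 ?exprn_ge0 ?divr_ge0 ?(ltW M0)// ?(ltW K0)//; lra.
have p0 : 0 < N (partials s f (z + t *: ee R i)) / (D + 1) / 2 by rewrite !divr_gt0// ltr_wpDl.
have q1 : (1 / 4 : R) < 1 by lra.
have q0 : (0 : R) <= 1 / 4 by lra.
have [J hJ] := poly_geom 0 q0 q1 p0.
have := hJ J (leqnn _); rewrite expr0 mul1r => h.
have := le_trans (LB J) (ler_wpM2l D0 h).
have D1 : D / (D + 1) <= 1 by rewrite ler_pdivrMr ?ltr_wpDl// mul1r lerDl.
have -> : D * (N (partials s f (z + t *: ee R i)) / (D + 1) / 2) =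
  D / (D + 1) * N (partials s f (z + t *: ee R i)) / 2 by ring.
have := ler_wpM2r (ltW pos) D1; rewrite mul1r; move: pos; lra.
Qed.

(** The flat points form an open set by [flat_local] and a relatively closed one by continuity of
    the derivatives, so they fill the connected component. *)
Lemma flat_component X f x y : open X -> sol X f -> (forall s, partials s f x = 0) ->
  connected_component X x y -> f y = 0.
Proof.
move=> oX fsol fl xy; have [e /andP[e0 e1] H] := flat_local.
have Xx : X x.
  by apply: contrapT => nX; move: xy; rewrite connected_component_out.
pose Z := [set z | X z /\ forall s, partials s f z = 0].
have oZ : open Z.
  rewrite openE => z [Xz zf]; have [r r0 hr] := open_ball oX Xz.
  pose r' := Num.min r 1 / 2.
  have m0 : 0 < Num.min r 1 by rewrite lt_min r0 ltr01.
  have r'0 : 0 < r' by rewrite divr_gt0.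
  have rlt : r' < r /\ r' <= 1.
    have : Num.min r 1 <= r by rewrite ge_min lexx.
    have : Num.min r 1 <= 1 by rewrite ge_min lexx orbT.
    by rewrite /r'; split; lra.
  have rr : 0 < r' <= 1 by rewrite r'0 rlt.2.
  have Q w : `|w - z| <= r' -> X w by move=> h; apply: hr; apply: le_lt_trans h rlt.1.
  have er : 0 < e * r' by rewrite mulr_gt0.
  apply: filterS (nbhs_ball_norm (z : V) er) => w /= /ltW wz; split.
    by apply: Q; apply: le_trans wz _; rewrite ler_piMl ?(ltW r'0)//; lra.
  exact: H X f z r' rr oX Q fsol zf w wz.
pose Y := [set z | X z /\ exists s, partials s f z != 0].
have oY : open Y.
  rewrite openE => z [Xz [s zs]]; have [r r0 hr] := open_ball oX Xz.
  have e2 : 0 < N (partials s f z) by rewrite N_gt0.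
  have [r' r'0 hr'] := sm_cont (sm_partials s fsol.1) Xz e2.
  have m0 : 0 < Num.min r r' by rewrite lt_min r0.
  apply: filterS (nbhs_ball_norm (z : V) m0) => w /=; rewrite lt_min => /andP[h1 h2].
  split; first exact: hr.
  by exists s; rewrite -N_gt0; have := hr' _ h2; have := le_N (partials s f z) (partials s f w); rewrite NBC; lra.
have cA := @component_connected _ X x.
pose A := connected_component X x.
have AX : A `<=` X by exact: connected_component_sub.
have E : A `&` Z = A.
  apply: cA; first by exists x; split; [exact: connected_component_refl|].
    by exists Z.
  exists (~` Y); first exact: open_closedC.
  apply/seteqP; split=> z [Az h]; split=> //.
    by move=> [_ [s]]; rewrite h.2 eqxx.
  split; first exact: AX.
  move=> s; apply/eqP; apply: contrapT => /negP ns; apply: h; split; [exact: AX|by exists s].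
have : (A `&` Z) y by rewrite E.
by case=> _ [_ /(_ [::])].
Qed.

(* Such bounds at a point deteriorate in a controlled way along the axes, wherever f stays analytic. *)
Definition geo (D beta : R) f x :=
  forall s, N (partials s f x) <= D * (size s)`!%:R / beta ^+ (size s).+1.

(** The Taylor series at [x] is bounded term by term and summed by [negbin]; with the exponent
    [(size s).+1] in [geo] the sum has again the form [geo], with the same [D] and radius
    [beta - |t|]. The bound [M] on [f] enters only to show that the remainder tends to 0, and it
    disappears from the conclusion. *)
Lemma geo_move_small : exists2 K, 1 <= K & forall X f x i (t r M D beta : R),
  open X -> sol X f -> 0 < r <= 1 -> 0 <= D -> 0 < beta ->
  (forall u, 0 <= u <= 1 -> forall y, `|y - (x + (u * t) *: ee R i)| <= r -> X y /\ N (f y) <= M) ->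
  `|t| * K <= r -> `|t| < beta -> geo D beta f x -> geo D (beta - `|t|) f (x + t *: ee R i).
Proof.
have [K1 K11 A] := analytic_est; exists (4 * K1); first by rewrite mulr_ege1// ler1n.
move=> X f x i t r M D beta oX fsol rr D0 b0 HX tK tb H s.
have [r0 r1] := andP rr; have K0 : 0 < K1 by apply: lt_le_trans K11.
have M0 : 0 <= M.
  apply: le_trans (N_ge0 (f x)) _; apply: (HX 0 _ x _).2; first by rewrite lexx ler01.
  by rewrite mul0r scale0r addr0 subrr normr0 ltW.
have B u s' : 0 <= u <= 1 -> X (x + (u * t) *: ee R i) /\
    N (partials s' f (x + (u * t) *: ee R i)) <= (size s')`!%:R * (K1 / r) ^+ size s' * M.
  move=> u01; have HU := HX u u01; split; first by apply: (HU _ _).1; rewrite subrr normr0 ltW.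
  by apply: (A X f _ r M s' rr oX) => // y yr; [exact: (HU y yr).1|exact: (HU y yr).2].
set n := size s; pose x1 := `|t| / beta.
have x01 : 0 <= x1 <= 1 by rewrite divr_ge0 ?(ltW b0)//= ler_pdivrMr// mul1r ltW.
have bt : 0 < beta - `|t| by rewrite subr_gt0.
pose E := n`!%:R * (K1 / r) ^+ n * M * 2 ^+ n.
have LB m : N (partials s f (x + t *: ee R i)) <= D * n`!%:R / (beta - `|t|) ^+ n.+1 + E * (1 / 2) ^+ m.
  have := @axis_taylor X (partials s f) x i t ((m + n)`!%:R * (K1 / r) ^+ (m + n) * M) m oX (sm_partials s fsol.1).
  set S := \sum_(_ < m) _ => /(_ _) T.
  have {}T : N (partials s f (x + t *: ee R i) - S) <= `|t| ^+ m / m`!%:R * ((m + n)`!%:R * (K1 / r) ^+ (m + n) * M).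
    apply: T => u u01; have := B u (nseq m i ++ s) u01.
    by rewrite partials_cat size_cat size_nseq.
  rewrite -[X in N X](subrK S); apply: le_trans (ND _ _) _; rewrite addrC; apply: lerD.
    apply: le_trans (N_sum _ _ _) _.
    apply: (@le_trans _ _ (\sum_(j < m) D * n`!%:R / beta ^+ n.+1 * ('C(n + j, j)%:R * x1 ^+ j))).
      apply: ler_sum => j _; rewrite NM N_real -partials_cat.
      have := H (nseq j i ++ s); rewrite size_cat size_nseq -/n => h.
      apply: le_trans (ler_wpM2l (normr_ge0 _) h) _.
      have j0 : 0 < j`!%:R :> R by rewrite ltr0n fact_gt0.
      rewrite normrM normrX normfV (gtr0_norm j0).
      have -> : (j + n)`!%:R = 'C(n + j, j)%:R * (j`!%:R * n`!%:R) :> R.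
        by rewrite [(j + n)%N]addnC -!natrM -(bin_fact (leq_addl n j)) addnK.
      rewrite /x1 expr_div_n -addnS exprD le_eqVlt; apply/orP; left; apply/eqP.
      by field; rewrite !lt0r_neq0 ?exprn_gt0.
    rewrite -mulr_sumr; have := negbin n m x01 => nb.
    have y0 : 0 < 1 - x1 by rewrite subr_gt0 ltr_pdivrMr// mul1r.
    have -> : D * n`!%:R / (beta - `|t|) ^+ n.+1 = D * n`!%:R / beta ^+ n.+1 * ((1 - x1) ^+ n.+1)^-1.
      have -> : beta - `|t| = beta * (1 - x1) by rewrite mulrBr mulr1 /x1 mulrCA divff ?mulr1// lt0r_neq0.
      by rewrite exprMn invfM mulrA.
    apply: ler_wpM2l; first by rewrite divr_ge0 ?mulr_ge0 ?exprn_ge0// ltW.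
    by rewrite -[leRHS]mulr1 ler_pdivlMl ?exprn_gt0.
  apply: le_trans T _.
  have b2 : ((m + n)`! <= 2 ^ (m + n) * (m`! * n`!))%N.
    rewrite -(bin_fact (leq_addr n m)) addKn leq_mul2r; apply/orP; right.
    have := expnDn 1 1 (m + n); rewrite addn1 => ->.
    have mm : (m < (m + n).+1)%N by rewrite ltnS leq_addr.
    by rewrite (bigD1 (Ordinal mm))//= !exp1n !muln1 leq_addr.
  have b2R : (m + n)`!%:R <= 2 ^+ (m + n) * (m`!%:R * n`!%:R) :> R.
    by rewrite -natrX -!natrM ler_nat.
  have m0 : 0 < m`!%:R :> R by rewrite ltr0n fact_gt0.
  set q := K1 / r; have q0 : 0 <= q by rewrite divr_ge0// ltW.
  have qt : 0 <= `|t| * q * 2 <= 1 / 2.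
    apply/andP; split; first by apply: mulr_ge0 => //; apply: mulr_ge0.
    have : `|t| * q <= 1 / 4 by rewrite /q mulrA ler_pdivrMr//; move: tK; lra.
    lra.
  have -> : `|t| ^+ m / m`!%:R * ((m + n)`!%:R * q ^+ (m + n) * M) =
    (m + n)`!%:R * (`|t| ^+ m * q ^+ (m + n) * M / m`!%:R) by ring.
  apply: (@le_trans _ _ (2 ^+ (m + n) * (m`!%:R * n`!%:R) * (`|t| ^+ m * q ^+ (m + n) * M / m`!%:R))).
    by apply: ler_wpM2r => //; rewrite divr_ge0 ?mulr_ge0 ?exprn_ge0// ltW.
  have -> : 2 ^+ (m + n) * (m`!%:R * n`!%:R) * (`|t| ^+ m * q ^+ (m + n) * M / m`!%:R)
    = n`!%:R * q ^+ n * M * 2 ^+ n * (`|t| * q * 2) ^+ m.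
    by rewrite !exprD !exprMn; field; rewrite lt0r_neq0.
  apply: ler_wpM2l; first by rewrite !mulr_ge0 ?exprn_ge0// ltW.
  by case/andP: qt => q1 q2; rewrite lerXn2r ?nnegrE//; lra.
rewrite leNgt; apply/negP => hlt.
have E0 : 0 <= E by rewrite !mulr_ge0 ?exprn_ge0 ?divr_ge0 ?(ltW r0) ?(ltW K0).
set D' := D * n`!%:R / _ in LB hlt.
have p0 : 0 < (N (partials s f (x + t *: ee R i)) - D') / (E + 1) / 2.
  by rewrite !divr_gt0// ?subr_gt0// ltr_wpDl.
have q1 : (1 / 2 : R) < 1 by lra.
have q0 : (0 : R) <= 1 / 2 by lra.
have [J hJ] := poly_geom 0 q0 q1 p0.
have := hJ J (leqnn _); rewrite expr0 mul1r => h.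
have := le_trans (LB J) (lerD (lexx D') (ler_wpM2l E0 h)).
have D1 : E / (E + 1) <= 1 by rewrite ler_pdivrMr ?ltr_wpDl// mul1r lerDl.
have -> : E * ((N (partials s f (x + t *: ee R i)) - D') / (E + 1) / 2) =
  E / (E + 1) * (N (partials s f (x + t *: ee R i)) - D') / 2 by ring.
have pos : 0 <= N (partials s f (x + t *: ee R i)) - D' by rewrite subr_ge0 ltW.
have := ler_wpM2r pos D1; rewrite mul1r; move: hlt; lra.
Qed.

(** The segment is cut into pieces short enough for [geo_move_small]. Since [D] is kept and the
    losses of radius add up to [|t|], the number of pieces does not affect the result. *)
Lemma geo_move X f x i (t r M D beta : R) :
  open X -> sol X f -> 0 < r <= 1 -> 0 <= D -> 0 < beta ->
  (forall u, 0 <= u <= 1 -> forall y, `|y - (x + (u * t) *: ee R i)| <= r -> X y /\ N (f y) <= M) ->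
  `|t| < beta -> geo D beta f x -> geo D (beta - `|t|) f (x + t *: ee R i).
Proof.
move=> oX fsol rr D0 b0 HX tb H; have [K K1 S] := geo_move_small.
have K0 : 0 < K by apply: lt_le_trans K1.
have [r0 r1] := andP rr.
have /archi_boundP : 0 <= `|t| * K / r by rewrite divr_ge0 ?mulr_ge0 ?(ltW K0) ?(ltW r0).
set m := Num.bound _ => hm; pose n := m.+1; have nR : (0 : R) < n%:R by rewrite ltr0n.
pose h := t / n%:R.
have hE : `|h| = `|t| / n%:R by rewrite normrM normfV (gtr0_norm nR).
suff P j : (j <= n)%N -> geo D (beta - j%:R * `|h|) f (x + (j%:R * h) *: ee R i).
  have := P n (leqnn _); rewrite hE mulrCA divff ?lt0r_neq0// mulr1.
  by rewrite /h mulrCA divff ?lt0r_neq0// mulr1.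
elim: j => [_|j IH jn]; first by rewrite !mul0r subr0 scale0r addr0.
have jR : (j%:R : R) + 1 <= n%:R by rewrite natr1 ler_nat.
have := S X f (x + (j%:R * h) *: ee R i) i h r M D (beta - j%:R * `|h|) oX fsol rr D0.
have -> : x + (j%:R * h) *: ee R i + h *: ee R i = x + (j.+1%:R * h) *: ee R i.
  by rewrite -addrA -scalerDl -natr1 mulrDl mul1r.
have -> : beta - j%:R * `|h| - `|h| = beta - j.+1%:R * `|h| by rewrite -natr1; ring.
have jh : (j%:R + 1) * `|h| <= `|t|.
  by rewrite hE mulrA ler_pdivrMr// mulrC ler_wpM2l.
have h0 : 0 <= `|h| by [].
apply=> //; try by move: jh; rewrite mulrDl mul1r; lra.
- move=> u /andP[u0 u1] y; have -> : x + (j%:R * h) *: ee R i + (u * h) *: ee R i =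
     x + (((j%:R + u) / n%:R) * t) *: ee R i.
    by rewrite -addrA -scalerDl; congr (_ + _ *: _); rewrite /h; ring.
  apply: HX; apply/andP; split; first by apply: divr_ge0; [exact: addr_ge0|exact: ltW].
  rewrite ler_pdivrMr// mul1r; by apply: le_trans jR; rewrite lerD2l.
- rewrite hE mulrAC ler_pdivrMr//; have : `|t| * K / r < n%:R.
    by apply: lt_trans hm _; rewrite ltr_nat.
  by rewrite ltr_pdivrMr// [r * _]mulrC => /ltW.
- by apply: IH; exact: ltnW.
Qed.

End Gradient.

End Local.

(** * Smoothness of ultralimits of locally bounded families *)

Section UltraSmooth.
Context (R : realType) (d : nat).
Notation V := 'rV[R]_d.
Implicit Types (x y : V) (X : set V).
Context (X : set V) (oX : open X) (u : nat -> V -> R[i]).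
Context (us : forall j, smooth_on X (u j)).
Context (ub : forall x, X x -> exists2 r : R, 0 < r & (forall y, `|y - x| <= r -> X y) /\
  forall s, exists B : R, UU [set j | forall y, `|y - x| <= r -> N (partials s (u j) y) <= B]).

Definition usm s : V -> R[i] := fun x => ulim (fun j => partials s (u j) x).

Lemma usm_ul s x : X x -> ul (fun j => partials s (u j) x) (usm s x).
Proof.
move=> Xx; have [r r0 [_ /(_ s)[B hB]]] := ub Xx.
apply: (@ul_ulim _ _ B); apply: filterS hB => j /=; apply.
by rewrite subrr normr0 ltW.
Qed.

(** The Lipschitz bound is kept for the approximants as well as for the limit, because later the
    approximants have to be compared at moving points. *)
Lemma usm_lip s x : X x -> exists r B : R, [/\ 0 < r, forall y, `|y - x| <= r -> X y,
  UU [set j | forall y, `|y - x| <= r -> N (partials s (u j) y - partials s (u j) x) <= B * `|y - x|] &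
  forall y, `|y - x| <= r -> N (usm s y - usm s x) <= B * `|y - x|].
Proof.
move=> Xx; have [r r0 [Xr H]] := ub Xx.
have [B hB] : exists B, UU [set j | forall i y, `|y - x| <= r -> N (partials (i :: s) (u j) y) <= B].
  have /choice[B hB] : forall i, exists B, UU [set j | forall y, `|y - x| <= r -> N (partials (i :: s) (u j) y) <= B].
    by move=> i; exact: H.
  exists (\sum_i `|B i|); apply: filterS (UU_forall hB) => j /= h i y yr.
  apply: le_trans (h i y yr) _; apply: le_trans (ler_norm _) _.
  by rewrite (bigD1 i)//= lerDl sumr_ge0.
have L : UU [set j | forall y, `|y - x| <= r ->
    N (partials s (u j) y - partials s (u j) x) <= d%:R * B * `|y - x|].
  apply: filterS hB => j /= h y yr.
  by apply: (lip_cube oX Xr (sm_partials s (us j)) _ yr) => i z zr; exact: h.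
exists r, (d%:R * B); split=> // y yr.
have := ulD (usm_ul s (Xr _ yr)) (ulZ (-1) (usm_ul s Xx)); rewrite mulN1r => /ul_le; apply.
by apply: filterS L => j /= h; rewrite mulN1r; exact: h.
Qed.

Lemma usm_cont s x : X x -> cont (usm s) x.
Proof.
move=> Xx e e0; have [r [B [r0 Xr _ H]]] := usm_lip s Xx.
have B1 : 0 < `|B| + 1 by rewrite ltr_wpDl.
exists (Num.min r (e / (`|B| + 1))); first by rewrite lt_min r0 divr_gt0.
move=> y; rewrite lt_min => /andP[yr]; rewrite ltr_pdivlMr// => ye.
apply: le_lt_trans (H y (ltW yr)) _; apply: le_lt_trans ye.
rewrite mulrC; apply: ler_wpM2l => //; apply: le_trans (ler_norm B) _.
by rewrite lerDl.
Qed.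

(** The second order Taylor remainder is uniform over almost all [j], so it passes to the limit; the
    limit of the derivatives is thus the derivative of the limit. *)
Lemma usm_cder s x i : X x -> cder (usm s) x (ee R i) (usm (i :: s) x).
Proof.
move=> Xx; have [r r0 [Xr H]] := ub Xx.
have [B hB] := H (i :: i :: s).
apply/cderP => e e0; have B1 : 0 < `|B| + 1 by rewrite ltr_wpDl.
exists (Num.min r (e / (`|B| + 1))); first by rewrite lt_min r0 divr_gt0.
move=> t; rewrite lt_min => /andP[tr]; rewrite ltr_pdivlMr// => te.
have near v : 0 <= v <= 1 -> `|x + (v * t) *: ee R i - x| <= r.
  move=> /andP[v0 v1]; rewrite addrC addKr normrZ norm_ee mulr1 normrM ger0_norm//.
  by apply: le_trans (ltW tr); rewrite ler_piMl.
have Xt : X (x + t *: ee R i).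
  by apply: Xr; have := near 1; rewrite mul1r => -> //; rewrite ler01 lexx.
have K := ulD (ulD (usm_ul s Xt) (ulZ (-1) (usm_ul s Xx))) (ulZ (- t%:C) (usm_ul (i :: s) Xx)).
rewrite mulN1r mulNr in K; apply: ul_le K _; apply: filterS hB => j /= h.
have := @axis_taylor R d X (partials s (u j)) x i t B 2 oX (sm_partials s (us j)).
rewrite !big_ord_recr big_ord0 /= add0r expr0 fact0 divr1 mul1r expr1 divr1.
rewrite mulN1r mulNr -!addrA -opprD => T; apply: le_trans (T _) _.
  by move=> v v01; split; [exact: Xr (near v v01)|exact: h _ (near v v01)].
have t0 := normr_ge0 t; have -> : `|t| ^+ 2 / 2`!%:R * B = (`|t| * B) / 2 * `|t| by rewrite !factS fact0; field.
apply: ler_wpM2r => //.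
have : `|t| * B <= `|t| * (`|B| + 1).
  by apply: ler_wpM2l => //; apply: le_trans (ler_norm B) _; rewrite lerDl.
have : 0 <= `|t| * (`|B| + 1) by rewrite mulr_ge0// ltW.
lra.
Qed.

Lemma usm_smooth s : smooth_on X (usm s).
Proof.
apply/(smoothP oX) => n; elim: n s => [|n IH] s; first by move=> x; exact: usm_cont.
split=> [x|i]; first exact: usm_cont.
by exists (usm (i :: s)); split=> // x; exact: usm_cder.
Qed.

Lemma usm_partials s t x : X x -> partials s (usm t) x = usm (s ++ t) x.
Proof.
elim: s x => [//|i s IH] x Xx /=; rewrite (partial_eq oX i IH)//.
by have /cder_partial[] := usm_cder (s ++ t) i Xx.
Qed.

End UltraSmooth.

(** * Symbols and their zeros *)

Section Symbols.
Context (R : realType) (d : nat).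
Notation V := 'rV[R]_d.
Notation C := R[i].
Implicit Types (L : seq (C * seq 'I_d)) (z w : 'I_d -> C) (s : seq 'I_d).

Definition mono_seq (al : multinom d) : seq 'I_d := flatten [seq nseq (al i) i | i <- enum 'I_d].
Definition opP (P : mpoly d C) := [seq (mcoeff al P, mono_seq al) | al <- msupp P].

Lemma diff_opE (P : mpoly d C) f x : diff_op P f x = opL (opP P) f x.
Proof. by rewrite /opL big_map. Qed.

Lemma prod_mono_seq (al : multinom d) z : \prod_(i <- mono_seq al) z i = \prod_i z i ^+ al i.
Proof.
rewrite /mono_seq big_flatten big_map big_enum /=; apply: eq_bigr => i _.
by rewrite big_nseq iter_mulr_1.
Qed.

Lemma size_mono_seq (al : multinom d) : size (mono_seq al) = mdeg al.
Proof.
rewrite /mono_seq size_flatten /shape -map_comp sumnE big_map big_enum /= mdegE.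
by apply: eq_bigr => i _ /=; rewrite size_nseq.
Qed.

Definition topL k L := [seq t <- L | size t.2 == k].

Lemma sym_principal (P : mpoly d C) z : sym (topL (msize P).-1 (opP P)) z = meval z (principal_part P).
Proof.
rewrite /principal_part pihomogE raddf_sum /= /sym big_filter big_map /=.
apply: eq_big => [al|al _]; first by rewrite size_mono_seq.
by rewrite mevalZ mevalX prod_mono_seq.
Qed.

Lemma opP_size (P : mpoly d C) t : t \in opP P -> (size t.2 <= (msize P).-1)%N.
Proof.
move=> /mapP[al alP ->] /=; rewrite size_mono_seq.
by have := msize_mdeg_lt alP; case: (msize P).
Qed.

Lemma topL_size k L t : t \in topL k L -> size t.2 = k.
Proof. by rewrite mem_filter => /andP[/eqP]. Qed.

Lemma topLZ k L (a : C) z : sym (topL k L) (fun i => a * z i) = a ^+ k * sym (topL k L) z.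
Proof.
rewrite /sym mulr_sumr; apply: eq_big_seq => t /topL_size tk.
have -> : \prod_(i <- t.2) (a * z i) = a ^+ k * \prod_(i <- t.2) z i.
  rewrite -tk; elim: (t.2) => [|i s IH]; first by rewrite !big_nil mul1r.
  by rewrite !big_cons IH /= exprS; ring.
by ring.
Qed.

Lemma prod_le z s (a : R) : (forall i, N (z i) <= a) -> N (\prod_(i <- s) z i) <= a ^+ size s.
Proof.
move=> H; elim: s => [|i s IH]; first by rewrite big_nil N1.
rewrite big_cons NM /= exprS; apply: ler_pM; rewrite ?N_ge0//.
Qed.

Lemma prod_pert z w s (a b : R) : (forall i, N (z i) <= a) -> (forall i, N (w i) <= b) ->
  0 <= a -> 0 <= b ->
  N (\prod_(i <- s) (z i + w i) - \prod_(i <- s) z i) <=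
    (size s)%:R * ((1 + b) ^+ size s * (1 + a) ^+ (size s).-1).
Proof.
move=> za wb a0 b0; elim: s => [|i s IH]; first by rewrite !big_nil subrr N0 mul0r.
rewrite !big_cons; set A := \prod_(_ <- _) _ in IH *; set B := \prod_(_ <- _) _ in IH *.
have -> : (z i + w i) * A - z i * B = w i * A + z i * (A - B) by ring.
apply: le_trans (ND _ _) _; rewrite !NM /=.
have AB : N A <= ((1 + b) * (1 + a)) ^+ size s.
  apply: prod_le => j; apply: le_trans (ND _ _) _.
  by have := za j; have := wb j; have : 0 <= b * a by [exact: mulr_ge0]; lra.
have h1 : N (w i) * N A <= (1 + b) ^+ (size s).+1 * (1 + a) ^+ size s.
  rewrite exprS -mulrA -exprMn; apply: ler_pM; rewrite ?N_ge0//.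
  by apply: le_trans (wb i) _; rewrite lerDr.
have h2 : N (z i) * N (A - B) <= (size s)%:R * ((1 + b) ^+ (size s).+1 * (1 + a) ^+ size s).
  apply: (@le_trans _ _ ((1 + a) * ((size s)%:R * ((1 + b) ^+ size s * (1 + a) ^+ (size s).-1)))).
    by apply: ler_pM; rewrite ?N_ge0//; apply: le_trans (za i) _; rewrite lerDr.
  case: (size s) => [|m]; first by rewrite !mul0r mulr0.
  have -> : (1 + a) * (m.+1%:R * ((1 + b) ^+ m.+1 * (1 + a) ^+ m.+1.-1)) = m.+1%:R * ((1 + b) ^+ m.+1 * (1 + a) ^+ m.+1).
    by rewrite [(1 + a) ^+ m.+1]exprS /=; ring.
  apply: ler_wpM2l => //; apply: ler_wpM2r; first by rewrite exprn_ge0// addr_ge0.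
  by rewrite [leRHS]exprS ler_peMl ?exprn_ge0 ?addr_ge0// lerDl.
by rewrite -natr1 mulrDl mul1r addrC lerD.
Qed.

(** A bounded shift [w] and the terms of lower order each cost one power of the size [a] of [z], so
    both are negligible against a principal part of order a^k. *)
Lemma sym_pert k L : (0 < k)%N -> (forall t, t \in L -> (size t.2 <= k)%N) ->
  exists2 A, 0 <= A & forall z w (a b : R), 0 <= a -> 0 <= b ->
    (forall i, N (z i) <= a) -> (forall i, N (w i) <= b) ->
    N (sym L (fun i => z i + w i) - sym (topL k L) z) <= A * ((1 + b) ^+ k * (1 + a) ^+ k.-1).
Proof.
move=> k0 Lk; exists ((\sum_(t <- L) N t.1) * k%:R).
  by rewrite mulr_ge0// sumr_ge0// => t _; exact: N_ge0.
move=> z w a b a0 b0 za wb.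
have a1 : 1 <= 1 + a by rewrite lerDl.
have b1 : 1 <= 1 + b by rewrite lerDl.
have E0 : 0 <= (1 + b) ^+ k * (1 + a) ^+ k.-1 by rewrite mulr_ge0 ?exprn_ge0// (le_trans ler01).
elim: L Lk => [_|t L IH Lk]; first by rewrite /sym !big_nil subrr N0 !mul0r.
have {}IH := IH (fun u uL => Lk u (mem_behead (s := t :: L) uL)).
rewrite /sym /topL /= !big_cons -!/(sym _ _) !mulrDl -/(topL k L).
have tk : (size t.2 <= k)%N by apply: Lk; rewrite mem_head.
have T : N (t.1 * \prod_(i <- t.2) (z i + w i) -
   (if size t.2 == k then t.1 * \prod_(i <- t.2) z i else 0)) <= N t.1 * k%:R * ((1 + b) ^+ k * (1 + a) ^+ k.-1).
  case: eqP => [tE|/eqP tE].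
    rewrite -mulrBr NM -mulrA ler_wpM2l ?N_ge0//.
    by have := prod_pert t.2 za wb a0 b0; rewrite tE.
  rewrite subr0 NM -mulrA ler_wpM2l ?N_ge0//.
  have lt : (size t.2 < k)%N by rewrite ltn_neqAle tE.
  apply: (@le_trans _ _ (((1 + b) * (1 + a)) ^+ size t.2)).
    apply: prod_le => j; apply: le_trans (ND _ _) _.
    by have := za j; have := wb j; have : 0 <= b * a by [exact: mulr_ge0]; lra.
  rewrite exprMn; apply: (@le_trans _ _ ((1 + b) ^+ k * (1 + a) ^+ k.-1)).
    apply: ler_pM; rewrite ?exprn_ge0 ?(le_trans ler01)//; rewrite ler_weXn2l//.
    by rewrite -ltnS prednK.
  by rewrite ler_peMl// ler1n.
have -> : sym (if size t.2 == k then t :: topL k L else topL k L) z =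
   (if size t.2 == k then t.1 * \prod_(i <- t.2) z i else 0) + sym (topL k L) z.
  by case: eqP; rewrite ?add0r// /sym big_cons.
rewrite opprD addrACA; apply: le_trans (ND _ _) _; exact: lerD.
Qed.

Lemma cont_coord i (x : V) : cont (fun y : V => (y 0 i)%:C) x.
Proof.
move=> e e0; exists e => // y; apply: le_lt_trans.
rewrite -(rmorphB (real_complex R)) N_real.
by have := rv_coord (y - x) i; rewrite !mxE.
Qed.

Lemma cont_sym L (a : C) (x : V) : cont (fun y : V => sym L (fun i => a * (y 0 i)%:C)) x.
Proof.
have P s : cont (fun y : V => \prod_(i <- s) (a * (y 0 i)%:C)) x.
  elim: s => [|i s IH].
    apply: (cont_near ltr01) (cont_cst 1 x) => y _; by rewrite big_nil.
  apply: (cont_near ltr01) (contM (contM (cont_cst a x) (cont_coord i x)) IH) => y _.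
  by rewrite big_cons.
rewrite /sym; elim: L => [|t L IH].
  apply: (cont_near ltr01) (cont_cst 0 x) => y _; by rewrite big_nil.
apply: (cont_near ltr01) (contD (contM (cont_cst t.1 x) (P t.2)) IH) => y _.
by rewrite big_cons.
Qed.

Lemma sum_abs_le (x : V) : \sum_i `|x 0 i| <= d%:R * `|x|.
Proof.
apply: le_trans (ler_sum _ (fun i _ => rv_coord x i)) _.
by rewrite sumr_const card_ord -[leLHS]mulr_natl.
Qed.

(** Compactness of the unit sphere of the sum norm bounds the principal part below there, and
    homogeneity extends the bound to all frequencies. *)
Lemma top_lower k L : (0 < k)%N -> (forall x : V, x != 0 -> sym (topL k L) (fun i => 'i * (x 0 i)%:C) != 0) ->
  exists2 c, 0 < c & forall xi : 'I_d -> R,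
    c * (\sum_i `|xi i|) ^+ k <= N (sym (topL k L) (fun i => 'i * (xi i)%:C)).
Proof.
move=> k0 H; pose F (x : V) := sym (topL k L) (fun i => 'i * (x 0 i)%:C).
have [c c0 hc] : exists2 c, 0 < c & forall x : V, \sum_i `|x 0 i| = 1 -> c <= N (F x).
  apply: contrapT => nH.
  have /choice[x hx] : forall n : nat, exists x : V, \sum_i `|x 0 i| = 1 /\ N (F x) < n.+1%:R^-1.
    move=> n; apply: contrapT => nx; apply: nH; exists n.+1%:R^-1; first by rewrite invr_gt0.
    by move=> y y1; rewrite leNgt; apply/negP => h; apply: nx; exists y.
  have x1 n : `|x n| <= 1.
    apply/rv_leP => // i; rewrite -(hx n).1 (bigD1 i)//= lerDl; exact: sumr_ge0.
  have [y _ hy] := cube_cluster x1.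
  have y0 : y != 0.
    apply/eqP => y0; have r0 : (0 : R) < d.+1%:R^-1 by rewrite invr_gt0.
    have [n /=] := UU_ex (hy _ r0); rewrite y0 subr0 -[_^-1]mul1r ltr_pdivlMr// => h.
    have := sum_abs_le (x n); rewrite (hx n).1; move: h; rewrite -natr1.
    by have := normr_ge0 (x n); lra.
  have e0 : 0 < N (F y) / 2 by rewrite divr_gt0// N_gt0; exact: H.
  have [r r0 hr] := cont_sym (topL k L) 'i y e0.
  have /archi_boundP : 0 <= (N (F y) / 2)^-1 by rewrite invr_ge0 ltW.
  set m := Num.bound _ => hm.
  have [n [/= h1 h2]] := UU_ex (filterI (hy _ r0) (UU_ge m)).
  have := hr _ h1; rewrite -!/(F _); have := (hx n).2; have := le_N (F y) (F (x n)); rewrite NBC.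
  have : n.+1%:R^-1 <= N (F y) / 2.
    rewrite invf_ple ?posrE// ltW//; apply: lt_trans hm _.
    by rewrite ltr_nat ltnS.
  move=> q1 q2 q3 q4; suff : N (F y) < N (F y) by rewrite ltxx.
  move: (N (F y)) (N (F (x n))) (N (F (x n) - F y)) (n.+1%:R^-1 : R) q1 q2 q3 q4 => A B E D; lra.
exists c => // xi; set S := \sum_i `|xi i|.
have S0 : 0 <= S by apply: sumr_ge0.
have [SE|Sn] := eqVneq S 0.
  by rewrite SE expr0n gtn_eqF// mulr0 N_ge0.
have Sp : 0 < S by rewrite lt_def Sn.
pose x : V := \row_i (xi i / S).
have x1 : \sum_i `|x 0 i| = 1.
  rewrite (eq_bigr (fun i => `|xi i| / S)) => [|i _].
    by rewrite -mulr_suml divff.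
  by rewrite mxE normrM normfV (gtr0_norm Sp).
have -> : sym (topL k L) (fun i => 'i * (xi i)%:C) = (S ^+ k)%:C * F x.
  rewrite /F rmorphXn /= -topLZ; congr sym; apply/funext => i.
  by rewrite mxE mulrCA -rmorphM /= mulrCA divff// mulr1.
by rewrite NM N_real ger0_norm ?exprn_ge0// mulrC ler_wpM2l ?exprn_ge0// hc.
Qed.

Definition nondeg k L := forall x : V, x != 0 -> sym (topL k L) (fun i => (x 0 i)%:C) != 0.

Lemma ellL_ex k L : (0 < k)%N -> (forall t, t \in L -> (size t.2 <= k)%N) -> nondeg k L ->
  exists c R0, [/\ 0 < c, 0 <= R0 & ellL k c R0 L].
Proof.
move=> k0 Lk H.
have [c c0 hc] : exists2 c, 0 < c & forall xi : 'I_d -> R,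
    c * (\sum_i `|xi i|) ^+ k <= N (sym (topL k L) (fun i => 'i * (xi i)%:C)).
  apply: top_lower => // x x0; rewrite topLZ mulf_neq0 ?H// expf_neq0//.
  by rewrite -N_eq0 N_i oner_eq0.
have [A A0 hA] := sym_pert k0 Lk.
(* Beyond this threshold the lower order terms, at most A (2S)^(k-1), are at most half of c S^k. *)
exists (c / 2), (1 + (2 ^+ k * A) / c); split.
- by rewrite divr_gt0.
- by rewrite addr_ge0// divr_ge0 ?mulr_ge0 ?exprn_ge0// ltW.
split=> // xi hxi; set S := \sum_i _ in hxi *.
have h0 : 0 <= 2 ^+ k * A / c by rewrite divr_ge0 ?mulr_ge0 ?exprn_ge0// ltW.
have S1 : 1 <= S by apply: le_trans hxi; rewrite lerDl.
have S0 : 0 <= S by apply: le_trans S1.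
have xS i : N ('i * (xi i)%:C) <= S.
  rewrite NM N_i mul1r N_real /S (bigD1 i)//= lerDl; exact: sumr_ge0.
have w0 (i : 'I_d) : N (0 : C) <= 0 by rewrite N0.
have := hA _ _ _ _ S0 (lexx 0) xS w0.
rewrite addr0 expr1n mul1r.
have -> : (fun i : 'I_d => 'i * (xi i)%:C + 0) = (fun i => 'i * (xi i)%:C).
  by apply/funext => i; rewrite addr0.
move=> h; have := hc xi; rewrite -/S => hx.
have := le_N (sym (topL k L) (fun i => 'i * (xi i)%:C)) (sym L (fun i => 'i * (xi i)%:C)).
rewrite NBC => h3.
have h4 : A * (1 + S) ^+ k.-1 <= c / 2 * S ^+ k.
  apply: (@le_trans _ _ (A * (2 * S) ^+ k.-1)).
    apply: ler_wpM2l => //; apply: lerXn2r; rewrite ?nnegrE ?addr_ge0 ?mulr_ge0//.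
    by clear -S1; lra.
  rewrite exprMn -[in leRHS](prednK k0) exprS !mulrA; apply: ler_wpM2r; first exact: exprn_ge0.
  have : 2 ^+ k * A / c <= S by apply: le_trans hxi; rewrite lerDr.
  rewrite ler_pdivrMr// -[in X in X -> _](prednK k0) exprS.
  by move=> hh; rewrite mulrAC ler_pdivlMr// [c * S]mulrC; apply: le_trans hh; rewrite mulrC mulrA mulrAC -mulrA mulrCA mulrA.
have := le_trans h3 (le_trans h h4); rewrite lerBlDr => h5; move: (le_trans hx h5); clear.
by move: (S ^+ k) (N _) => u1 u2; lra.
Qed.

Definition compL L1 L2 : seq (C * seq 'I_d) :=
  [seq (t1.1 * t2.1, t1.2 ++ t2.2) | t1 <- L1, t2 <- L2].
Definition powL n L := iter n (compL L) [:: (1, [::])].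

Lemma opL_comp X L1 L2 f x : open X -> smooth_on X f -> X x ->
  opL (compL L1 L2) f x = opL L1 (opL L2 f) x.
Proof.
move=> oX fs Xx; rewrite /opL /compL; elim: L1 => [|t1 L1 IH]; first by rewrite !big_nil.
rewrite [LHS]big_cat big_cons -IH /= big_map; congr (_ + _).
rewrite (partials_sum oX) => [|t|//]; last by apply: (smZ oX); exact: sm_partials.
rewrite mulr_sumr; apply: eq_bigr => t _ /=.
by rewrite (partialsZ oX _ _ (sm_partials t.2 fs) Xx) partials_cat mulrA.
Qed.

Lemma sym_comp L1 L2 z : sym (compL L1 L2) z = sym L1 z * sym L2 z.
Proof.
rewrite /sym /compL; elim: L1 => [|t1 L1 IH]; first by rewrite !big_nil mul0r.
rewrite [LHS]big_cat big_cons mulrDl -IH /= big_map; congr (_ + _).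
by rewrite mulr_sumr; apply: eq_bigr => t _ /=; rewrite big_cat /=; ring.
Qed.

Lemma ellL_comp k1 k2 c1 c2 R0 L1 L2 : 0 <= c1 -> 0 <= c2 ->
  ellL k1 c1 R0 L1 -> ellL k2 c2 R0 L2 -> ellL (k1 + k2) (c1 * c2) R0 (compL L1 L2).
Proof.
move=> c10 c20 [h1 e1] [h2 e2]; split=> [t /allpairsP[[t1 t2] /= [i1 i2 ->]] /=|xi hxi].
  by rewrite size_cat leq_add ?h1 ?h2.
rewrite sym_comp NM exprD mulrACA; apply: ler_pM; rewrite ?mulr_ge0 ?exprn_ge0 ?sumr_ge0 ?e1 ?e2//.
Qed.

Lemma ellL_pow k c R0 L n : 0 < c -> ellL k c R0 L ->
  exists2 c', 0 < c' & ellL (n * k) c' R0 (powL n L).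
Proof.
move=> c0 eL; elim: n => [|n [c' c'0 IH]].
  exists 1 => //; split=> [t|xi _]; first by rewrite inE => /eqP ->.
  by rewrite /sym big_seq1 big_nil mul0n expr0 !mulr1 N1.
exists (c * c'); first exact: mulr_gt0.
by rewrite mulSn; apply: ellL_comp => //; exact: ltW.
Qed.

(** The symbol restricted to the complex line through [z] in direction [w]; its coefficient of
    degree [k] is the principal part at [w], independently of [z]. *)
Definition line_poly L z w : {poly C} :=
  \sum_(t <- L) t.1 *: \prod_(i <- t.2) ((z i)%:P + w i *: 'X).

Lemma line_polyE L z w x : (line_poly L z w).[x] = sym L (fun i => z i + x * w i).
Proof.
rewrite horner_sum; apply: eq_bigr => t _; rewrite hornerZ horner_prod; congr (_ * _).
by apply: eq_bigr => i _; rewrite !hornerE mulrC.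
Qed.

Lemma line_prod z w s : (size (\prod_(i <- s) ((z i)%:P + w i *: 'X) : {poly C})%R <= (size s).+1)%N /\
  (\prod_(i <- s) ((z i)%:P + w i *: 'X))`_(size s) = \prod_(i <- s) w i.
Proof.
elim: s => [|i s [IH1 IH2]]; first by rewrite !big_nil size_poly1 coef1.
rewrite !big_cons /=; set p := \prod_(_ <- _) _ in IH1 IH2 *; split.
  rewrite mulrDl -scalerAl mul_polyC; apply: leq_trans (size_polyD _ _) _.
  rewrite geq_max; apply/andP; split.
    by apply: leq_trans (size_scale_leq _ _) _; exact: leqW.
  apply: leq_trans (size_scale_leq _ _) _; rewrite mulrC; apply: leq_trans (size_polyMleq _ _) _.
  by rewrite size_polyX addn2.
rewrite mulrDl -scalerAl mul_polyC coefD !coefZ coefXM /= IH2.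
by rewrite (nth_default _ IH1) mulr0 add0r.
Qed.

Lemma line_poly_lead k L z w : (forall t, t \in L -> (size t.2 <= k)%N) ->
  (size (line_poly L z w) <= k.+1)%N /\ (line_poly L z w)`_k = sym (topL k L) w.
Proof.
move=> Lk; split.
  apply/leq_sizeP => j kj; rewrite coef_sum big_seq big1// => t tL; rewrite coefZ nth_default ?mulr0//.
  have [h _] := line_prod z w t.2; apply: leq_trans h _; apply: leq_trans kj.
  by rewrite ltnS; exact: Lk.
rewrite coef_sum /sym big_filter [RHS]big_mkcond /= big_seq [RHS]big_seq; apply: eq_bigr => t tL.
rewrite coefZ; have [h1 h2] := line_prod z w t.2.
case: eqP => [<-|/eqP ne]; first by rewrite h2.
by rewrite nth_default ?mulr0//; apply: leq_trans h1 _; rewrite ltn_neqAle ne Lk.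
Qed.

(** The modulus of [p.[x]] is |a| times the product of the distances from [x] to the [k] roots; not
    all of these distances can exceed the geometric mean. *)
Lemma small_root k (p : {poly C}) (a x : C) : (0 < k)%N -> (size p <= k.+1)%N -> p`_k = a -> a != 0 ->
  exists2 y, root p y & N a * N (x - y) ^+ k <= N p.[x].
Proof.
move=> k0 ps pa a0.
have sp : size p = k.+1.
  apply/eqP; rewrite eqn_leq ps ltnNge; apply/negP => h.
  by move: a0; rewrite -pa nth_default ?eqxx.
have lp : lead_coef p = a by rewrite lead_coefE sp.
have [r rE] := closed_field_poly_normal p.
have rs : size r = k.
  have := congr1 (fun q : {poly C} => size q) rE; rewrite sp lp size_scale// size_prod_XsubC.
  by case.
apply: contrapT => nH.
have H y : y \in r -> N p.[x] < N a * N (x - y) ^+ k.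
  move=> yr; rewrite ltNge; apply/negP => h; apply: nH; exists y => //.
  by rewrite rE rootZ ?lp// root_prod_XsubC.
have px : N p.[x] = N a * \prod_(y <- r) N (x - y).
  rewrite {1}rE hornerZ NM lp horner_prod N_prod; congr (_ * _).
  by apply: eq_bigr => y _; rewrite !hornerE.
have Na : 0 < N a by rewrite N_gt0.
have G : forall r' : seq C, {subset r' <= r} -> (0 < size r')%N ->
   (\prod_(y <- r) N (x - y)) ^+ size r' < \prod_(y <- r') N (x - y) ^+ k.
  elim=> // y r' IH sub _; rewrite big_cons /= exprS.
  have hy : \prod_(y <- r) N (x - y) < N (x - y) ^+ k.
    by rewrite -(ltr_pM2l Na) -px; apply: H; apply: sub; rewrite mem_head.
  have p0 : 0 <= \prod_(y <- r) N (x - y) by apply: prodr_ge0 => z _; exact: N_ge0.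
  case: r' IH sub => [|z r'] IH sub; first by rewrite expr0 big_nil !mulr1.
  apply: ltr_pM => //; first exact: exprn_ge0.
  by apply: IH => // u ur; apply: sub; rewrite inE ur orbT.
have := G r (fun _ => id); rewrite rs => /(_ k0); rewrite prodrXl ltxx//.
Qed.

(** [tau] is a root of the principal part along i v + tau n. Were it imaginary, the root would be i
    times a nonzero real vector, against ellipticity. At q (i v + tau n) the full symbol is only of
    order |q|^(k-1), so [small_root] finds a genuine zero at distance o(|q|), for either sign of
    [q]. *)
Lemma zero_dir k L (v n : V) : (0 < k)%N -> (forall t, t \in L -> (size t.2 <= k)%N) -> nondeg k L ->
  n != 0 -> (forall a : R, v + a *: n != 0) ->
  exists tau : C, [/\ complex.Re tau != 0,
    sym (topL k L) (fun i => 'i * (v 0 i)%:C + tau * (n 0 i)%:C) = 0 &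
    forall e : R, 0 < e -> exists q0 : R, forall q : R, q0 <= `|q| -> exists2 rho,
      N (rho - q%:C * tau) <= e * `|q| &
      sym L (fun i => 'i * (q * v 0 i)%:C + rho * (n 0 i)%:C) = 0].
Proof.
move=> k0 Lk H n0 vn.
have Tk t : t \in topL k L -> (size t.2 <= k)%N by move/topL_size => ->.
have TT : topL k (topL k L) = topL k L by rewrite /topL -filter_predI; apply: eq_filter => t /=; rewrite andbb.
have a0 := H _ n0; set a := sym _ _ in a0.
have [h1 h2] := line_poly_lead (fun i => 'i * (v 0 i)%:C) (fun i => (n 0 i)%:C) Tk.
rewrite TT in h2.
have [tau rt _] := small_root 0 k0 h1 h2 a0.
move: rt => /eqP; rewrite line_polyE => rt.
exists tau; split=> //.
  apply: contraNneq (H (v + complex.Im tau *: n) (vn _)) => t0.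
  have i0 : 'i ^+ k != 0 :> C by rewrite expf_neq0// -N_eq0 N_i oner_eq0.
  apply/eqP/(mulfI i0); rewrite mulr0 -topLZ -[RHS]rt; congr sym; apply/funext => i.
  have -> : tau = 'i * (complex.Im tau)%:C.
    by case: (tau) t0 => x y /= ->; apply: eqC => /=; ring.
  by rewrite !mxE rmorphD rmorphM /=; ring.
move=> e e0.
pose M := \sum_i N ('i * (v 0 i)%:C + tau * (n 0 i)%:C).
have M0 : 0 <= M by apply: sumr_ge0 => i _; exact: N_ge0.
have [A A0 hA] := sym_pert k0 Lk.
have Na : 0 < N a by rewrite N_gt0.
have ea : 0 < e ^+ k * N a by rewrite mulr_gt0// exprn_gt0.
exists (1 + A * (1 + M) ^+ k.-1 / (e ^+ k * N a)) => q hq.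
have B0 : 0 <= A * (1 + M) ^+ k.-1 by rewrite mulr_ge0 ?exprn_ge0// addr_ge0.
have s1 : 1 <= `|q| by apply: le_trans hq; rewrite lerDl divr_ge0// ltW.
have s0 : 0 <= `|q| by apply: le_trans s1.
have [q1 q2] := line_poly_lead (fun i => 'i * (q * v 0 i)%:C) (fun i => (n 0 i)%:C) Lk.
have [rho rr hr] := small_root (q%:C * tau) k0 q1 q2 a0.
exists rho; last by rewrite -line_polyE; apply/eqP.
rewrite line_polyE in hr.
have zs i : N (q%:C * ('i * (v 0 i)%:C + tau * (n 0 i)%:C)) <= `|q| * M.
  rewrite NM N_real ler_wpM2l// /M (bigD1 i)//= lerDl; apply: sumr_ge0 => j _; exact: N_ge0.
have sM : 0 <= `|q| * M by exact: mulr_ge0.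
have w0 (i : 'I_d) : N (0 : C) <= 0 by rewrite N0.
have := hA _ (fun=> 0) _ 0 sM (lexx 0) zs w0.
rewrite topLZ rt mulr0 subr0 addr0 expr1n mul1r.
have -> : (fun i => q%:C * ('i * (v 0 i)%:C + tau * (n 0 i)%:C) + 0) =
   (fun i => 'i * (q * v 0 i)%:C + q%:C * tau * (n 0 i)%:C).
  by apply/funext => i; rewrite rmorphM /=; ring.
move=> hp; rewrite -(ler_pXn2r k0) ?nnegrE ?N_ge0 ?mulr_ge0//; last exact: ltW.
rewrite -(ler_pM2l Na) NBC; apply: le_trans hr _; apply: le_trans hp _.
apply: (@le_trans _ _ (A * (`|q| * (1 + M)) ^+ k.-1)).
  apply: ler_wpM2l => //; apply: lerXn2r; rewrite ?nnegrE ?addr_ge0 ?mulr_ge0 ?addr_ge0//.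
  by rewrite mulrDr mulr1 lerD2r.
rewrite !exprMn [in leLHS]mulrCA.
have -> : `|q| ^+ k = `|q| ^+ k.-1 * `|q| by rewrite -exprSr prednK.
have -> : N a * (e ^+ k * (`|q| ^+ k.-1 * `|q|)) = `|q| ^+ k.-1 * (e ^+ k * N a * `|q|).
  by move: (N a) (e ^+ k) (`|q| ^+ k.-1) => z1 z2 z3; ring.
apply: ler_wpM2l; first exact: exprn_ge0.
have : A * (1 + M) ^+ k.-1 / (e ^+ k * N a) <= `|q| by apply: le_trans hq; rewrite lerDr.
by rewrite ler_pdivrMr// [_ * `|q|]mulrC.
Qed.

End Symbols.

(** * The singular solution *)

Section RootsOfUnity.
Context (R : realType).
Notation C := R[i].

Lemma cexp_2pi_neq1 (J m : nat) : (0 < m < J)%N ->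
  cexp ('i * (2 * pi * (m%:R / J%:R) : R)%:C) != 1 :> C.
Proof.
move=> /andP[m0 mJ]; have J0 : (0 < J)%N by apply: leq_trans mJ.
set th := pi * (m%:R / J%:R) : R.
have -> : 'i * (2 * pi * (m%:R / J%:R) : R)%:C = ('i * th%:C) *+ 2.
  by rewrite -mulr_natl /th !rmorphM /= rmorph_nat; ring.
rewrite cexp_mulrn; apply/negP => /eqP h.
have q0 : 0 < m%:R / J%:R :> R by rewrite divr_gt0 ?ltr0n.
have q1 : m%:R / J%:R < 1 :> R by rewrite ltr_pdivrMr ?ltr0n// mul1r ltr_nat.
have p0 := pi_gt0 R.
have th0 : 0 < sin th.
  by apply: sin_gt0_pi; rewrite mulr_gt0 ?gtr_pMr.
have E : cexp ('i * th%:C) = cos th +i* sin th.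
  by rewrite /cexp; apply: eqC => /=; rewrite !(mul0r, mul1r, subr0, addr0, sub0r, add0r, oppr0, expR0).
move: h => /eqP; rewrite sqrf_eq1 E => /orP[] /eqP /(congr1 (@complex.Im R)) /=.
  by move=> e; move: th0; rewrite e ltxx.
by rewrite oppr0 => e; move: th0; rewrite e ltxx.
Qed.

(** The points are the [J]-th roots of unity: averaging over them kills the powers 1, ..., J - 1, so
    the mean value property is exact for polynomials of degree below [J]. *)
Lemma circle_mean (J : nat) : (0 < J)%N -> exists ws : 'I_J -> C,
  (forall a, N (ws a) = 1) /\
  forall p : {poly C}, (size p <= J)%N -> (J%:R)^-1 * \sum_a p.[ws a] = p.[0].
Proof.
move=> J0; pose u : C := cexp ('i * (2 * pi * (1 / J%:R) : R)%:C).
have JR : J%:R != 0 :> R by rewrite pnatr_eq0 -lt0n.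
have JC : J%:R != 0 :> C by rewrite pnatr_eq0 -lt0n.
have uX m : u ^+ m = cexp ('i * (2 * pi * (m%:R / J%:R) : R)%:C).
  rewrite /u -cexp_mulrn; congr cexp.
  by rewrite -mulrnAr -(rmorphMn (real_complex R)); congr (_ * _%:C); rewrite -mulr_natr; ring.
have uJ : u ^+ J = 1.
  rewrite uX divff// mulr1; have := cexp_2pi R 1; rewrite mulr1; exact.
have N_u : N u = 1.
  by rewrite /u N_cexp /= !mul0r mul1r subr0 expR0.
exists (fun a => u ^+ a); split=> [a|p pJ]; first by rewrite NX N_u expr1n.
have S m : (0 < m < J)%N -> \sum_(a < J) (u ^+ a) ^+ m = 0.
  move=> mJ; have um : u ^+ m != 1 by rewrite uX cexp_2pi_neq1.
  have := subrX1 (u ^+ m) J; rewrite -exprM mulnC exprM uJ expr1n subrr => /esym/eqP.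
  rewrite mulf_eq0 subr_eq0 (negPf um) /= => /eqP h; rewrite -[RHS]h.
  by apply: eq_bigr => a _; rewrite -!exprM mulnC.
have -> : \sum_(a < J) p.[u ^+ a] = \sum_(i < J) p`_i * \sum_(a < J) (u ^+ a) ^+ i.
  under eq_bigr do rewrite (horner_coef_wide _ pJ).
  by rewrite exchange_big /=; apply: eq_bigr => i _; rewrite mulr_sumr.
clear N_u uJ uX; clearbody u; case: J J0 pJ JR JC S => // J _ pJ JR JC S.
rewrite big_ord_recl /= [X in _ + X]big1 => [|i _]; last first.
  by rewrite S ?mulr0// /bump /= add1n ltnS.
rewrite addr0; under eq_bigr do rewrite expr0.
rewrite sumr_const card_ord horner_coef0 mulrC -mulrA; have -> : (1 *+ J.+1 : C) = J.+1%:R by [].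
by rewrite divff// mulr1.
Qed.

Lemma cexp_taylor (z : C) n : N (cexp z - \sum_(k < n) (k`!%:R^-1)%:C * z ^+ k) <=
  N z ^+ n / n`!%:R * expR (N z).
Proof.
pose phi (k : nat) (t : R) := z ^+ k * cexp (t%:C * z).
have dphi k t : cder (phi k : R^o -> _) t (1 : R^o) (phi k.+1 t).
  have H := cderZ (z ^+ k * cexp (t%:C * z)) (cder_cexp z).
  case: H => q [qc q0 H]; exists q; split=> //.
    by rewrite q0 /phi exprS; ring.
  move=> s; have := H s; rewrite add0r /phi => Hs.
  rewrite rmorphD mulrDl cexpD mulrA Hs /= mul0r cexp0 mulr1.
  by [].
have B t : 0 <= t <= 1 -> N (phi n t) <= N z ^+ n * expR (N z).
  move=> /andP[t0 t1]; rewrite /phi NM NX ler_wpM2l ?exprn_ge0 ?N_ge0// N_cexp ler_expR ReM_real.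
  apply: le_trans (_ : t * N z <= _); last by rewrite ler_piMl ?N_ge0.
  rewrite ler_wpM2l//; apply: le_trans (ler_norm _) (Re_le _).
have t1 : 0 <= (1 : R) <= 1 by rewrite ler01 lexx.
have := taylor_seq (fun k t _ => dphi k t) B t1.
rewrite /phi expr0 !mul1r expr1n.
rewrite (eq_bigr (fun k : 'I_n => (k`!%:R^-1)%:C * z ^+ k)) => [|k _].
  by rewrite mul1r mulrCA mulrA.
by rewrite expr1n mul0r cexp0 mulr1 mul1r.
Qed.

Lemma pow_fact_small (A e : R) : 0 < e -> exists2 n, (0 < n)%N & A ^+ n / n`!%:R <= e.
Proof.
move=> e0; have := cvg_series_cvg_0 (@is_cvg_series_exp_coeff R A).
move=> /cvgr0Pnorm_le /(_ _ e0) [n _ /(_ n.+1 (leqnSn _))] h.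
by exists n.+1 => //; apply: le_trans (ler_norm _) h.
Qed.

(* Mean value property of w |-> q(w) exp(w y), whose exponential is replaced by a Taylor polynomial. *)
Lemma circle_mean_exp (B T e : R) (m : nat) : 0 <= B -> 0 <= T -> 0 < e ->
  exists J (ws : 'I_J -> C), [/\ (0 < J)%N, forall a, N (ws a) = 1 &
    forall (q : {poly C}) (y : C), (size q <= m.+1)%N -> (forall w, N w = 1 -> N q.[w] <= B) -> N y <= T ->
     N ((J%:R)^-1 * \sum_a q.[ws a] * cexp (ws a * y) - q.[0]) <= e].
Proof.
move=> B0 T0 e0.
have B1 : 0 < (B + 1) * expR T by rewrite mulr_gt0 ?expR_gt0// ltr_wpDl.
have [n' n'n hn'] := pow_fact_small T (divr_gt0 e0 B1).
(* The number of points exceeds the degree of [q * p], where [p] is the Taylor polynomial with [n']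
   terms replacing the exponential. *)
have [ws [ws1 hws]] := @circle_mean (m + n').+1 isT.
exists (m + n').+1, ws; split=> // q y qm qB yT.
pose p : {poly C} := \poly_(k < n') ((k`!%:R^-1)%:C * y ^+ k).
have pE w : p.[w] = \sum_(k < n') (k`!%:R^-1)%:C * (w * y) ^+ k.
  by rewrite horner_poly; apply: eq_bigr => k _; rewrite exprMn; ring.
have p0 : p.[0] = 1.
  rewrite horner_coef0 coef_poly n'n fact0 invr1 expr0 mulr1 //.
have sz : (size (q * p)%R <= (m + n').+1)%N.
  apply: leq_trans (size_polyMleq _ _) _; have := size_poly n' (fun k => (k`!%:R^-1)%:C * y ^+ k).
  rewrite -/p => sp; move: qm sp; move: (size q) (size p) => a b; lia.
have := hws _ sz; rewrite hornerM p0 mulr1 => <-.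
rewrite -mulrBr -sumrB NM NV N_nat.
have JR : 0 < (m + n').+1%:R :> R by rewrite ltr0n.
rewrite mulrC ler_pdivrMr//; apply: le_trans (N_sum _ _ _) _.
rewrite mulr_natr -[X in _ *+ X]card_ord -sumr_const; apply: ler_sum => a _.
rewrite hornerM -mulrBr NM pE.
have Ny : N (ws a * y) = N y by rewrite NM ws1 mul1r.
apply: le_trans (ler_pM (N_ge0 _) (N_ge0 _) (qB _ (ws1 a)) (cexp_taylor _ _)) _; rewrite Ny.
apply: (@le_trans _ _ (B * (e / ((B + 1) * expR T) * expR T))).
  apply: ler_wpM2l => //; apply: ler_pM; rewrite ?expR_ge0 ?ler_expR//.
    by rewrite mulr_ge0 ?exprn_ge0 ?N_ge0 ?invr_ge0.
  apply: le_trans hn'; apply: ler_wpM2r; first by rewrite invr_ge0.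
  by apply: lerXn2r; rewrite ?nnegrE ?N_ge0.
have -> : B * (e / ((B + 1) * expR T) * expR T) = e * (B / (B + 1)).
  by field; rewrite !lt0r_neq0 ?expR_gt0// ltr_wpDl.
by rewrite ler_piMr ?(ltW e0)// ler_pdivrMr ?mul1r ?lerDl// ltr_wpDl.
Qed.

End RootsOfUnity.

(** * Dividing an exponential by a power of the symbol *)

Section ApproxSolution.
Context (R : realType) (d : nat) (d0 : (0 < d)%N).
Notation V := 'rV[R]_d.
Notation C := R[i].
Implicit Types (L : seq (C * seq 'I_d)) (x : V) (s : seq 'I_d).

Section ExpSums.
Context (I : finType) (c : I -> C) (z : I -> 'I_d -> C).
Definition exsum (c' : I -> C) x := \sum_a c' a * ex (z a) x.

Lemma sm_exsum : smooth_on setT (exsum c).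
Proof. by apply: (sm_sum openT) => a; apply: (smZ openT); exact: sm_ex. Qed.

Lemma partials_exsum s x : partials s (exsum c) x = exsum (fun a => c a * \prod_(i <- s) z a i) x.
Proof.
rewrite /exsum (@partials_sum _ _ setT openT)//; last by move=> a; apply: (smZ openT); exact: sm_ex.
apply: eq_bigr => a _; rewrite (@partialsZ _ _ setT openT _ _ _ _ (sm_ex _))//.
by rewrite partials_ex mulrA.
Qed.

Lemma opL_exsum L x : opL L (exsum c) x = exsum (fun a => c a * sym L (z a)) x.
Proof.
rewrite /opL; under eq_bigr do rewrite partials_exsum /exsum mulr_sumr.
rewrite exchange_big /=; apply: eq_bigr => a _; rewrite /sym mulr_sumr mulr_suml.
by apply: eq_bigr => t _; ring.
Qed.
End ExpSums.

Lemma opL_ex L z x : opL L (ex z) x = sym L z * ex z x.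
Proof. by rewrite /opL /sym mulr_suml; apply: eq_bigr => t _; rewrite partials_ex mulrA. Qed.

Let i0 := Ordinal d0.

(** At bounded real frequencies the symbol may vanish. Shifting by [w * rho] in one coordinate
    direction, with [rho] large, lets the principal part at the shift dominate, uniformly on the
    circle [N w = 1]. *)
Lemma sym_shift k L (R0 : R) : (0 < k)%N -> (forall t, t \in L -> (size t.2 <= k)%N) -> nondeg k L ->
  0 <= R0 -> exists2 rho : R, 1 <= rho & forall (xi : 'I_d -> R) (w : C),
    \sum_i `|xi i| <= R0 -> N w = 1 ->
    1 <= N (sym L (fun i => 'i * (xi i)%:C + w * (if i == i0 then rho%:C else 0))).
Proof.
move=> k0 Lk nd R00; have [A A0 hA] := sym_pert k0 Lk.
have e0 : ee R i0 != 0 by rewrite -normr_eq0 norm_ee oner_neq0.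
pose c1 := N (sym (topL k L) (fun i => (ee R i0 0 i)%:C)).
have c10 : 0 < c1 by rewrite N_gt0; exact: nd.
pose B := A * (1 + R0) ^+ k * 2 ^+ k.-1.
have B0 : 0 <= B by rewrite !mulr_ge0 ?exprn_ge0// addr_ge0.
have q0 : 0 <= (1 + B) / c1 by apply: divr_ge0; [exact: addr_ge0|exact: ltW].
exists (1 + (1 + B) / c1) => [|xi w xi0 w1]; first by rewrite lerDl.
set rho := 1 + _; have rho1 : 1 <= rho by rewrite lerDl.
have rho0 : 0 <= rho by apply: le_trans rho1.
have hr : 1 + B <= rho * c1 by rewrite -ler_pdivrMr// /rho lerDr.
clearbody rho.
have za i : N (w * (if i == i0 then rho%:C else 0)) <= rho.
  by rewrite NM w1 mul1r; case: ifP => _; rewrite ?N_real ?ger0_norm ?N0.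
have wb i : N ('i * (xi i)%:C) <= R0.
  rewrite NM N_i mul1r N_real; apply: le_trans xi0; rewrite (bigD1 i)//= lerDl; exact: sumr_ge0.
have := hA _ _ _ _ rho0 R00 za wb.
have -> : sym (topL k L) (fun i => w * (if i == i0 then rho%:C else 0)) =
   (w * rho%:C) ^+ k * sym (topL k L) (fun i => (ee R i0 0 i)%:C).
  rewrite -topLZ; congr sym; apply/funext => i; rewrite ee_coord -mulrA.
  by case: eqP; rewrite ?mulr1 ?mulr0.
have -> : (fun i => w * (if i == i0 then rho%:C else 0) + 'i * (xi i)%:C) =
   (fun i => 'i * (xi i)%:C + w * (if i == i0 then rho%:C else 0)).
  by apply/funext => i; rewrite addrC.
set S := sym L _; set S' := _ * sym _ _ => h.
have N_S' : N S' = rho ^+ k * c1 by rewrite /S' NM NX NM w1 mul1r N_real ger0_norm.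
have h2 : A * ((1 + R0) ^+ k * (1 + rho) ^+ k.-1) <= B * rho ^+ k.-1.
  rewrite /B -!mulrA; apply: ler_wpM2l => //; apply: ler_wpM2l; first by rewrite exprn_ge0// addr_ge0.
  rewrite -exprMn; apply: lerXn2r; rewrite ?nnegrE ?addr_ge0 ?mulr_ge0//.
  by rewrite mulr_natl mulr2n lerD2r.
have h3 : 1 + B * rho ^+ k.-1 <= rho ^+ k * c1.
  apply: (@le_trans _ _ ((1 + B) * rho ^+ k.-1)).
    by rewrite mulrDl mul1r lerD2r exprn_ege1.
  have -> : rho ^+ k * c1 = (rho * c1) * rho ^+ k.-1 by rewrite -[in LHS](prednK k0) exprS; ring.
  apply: ler_wpM2r; first exact: exprn_ge0.
  exact: hr.
have := le_N S' S; rewrite NBC N_S'; move: h h2 h3.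
by move: (N S) (N (S - S')) (rho ^+ k * c1) (B * _) (A * _); clear; move=> *; lra.
Qed.

Definition iv (xi : 'I_d -> R) : 'I_d -> C := fun i => 'i * (xi i)%:C.

Lemma N_ex_iv xi x : N (ex (iv xi) x) = 1.
Proof.
rewrite N_ex big1 ?expR0// => i _.
by rewrite /iv ['i * _]mulrC ReM_real /= mulr0 mul0r.
Qed.

(** At high frequencies the exponential is divided by the symbol. At low ones an average of shifted
    exponentials, each divided by its own symbol, is used: the operator cancels the denominators,
    and the mean value property returns the unshifted exponential up to [e]. The growth bound is
    independent of [t] and [e], and its decay in [xi] is summable over a lattice because
    [2 * d <= n * k]. *)
Lemma inv_exp_sol k c R1 L n : (0 < k)%N -> 0 < c -> 0 <= R1 -> ellL k c R1 L -> nondeg k L ->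
  (2 * d <= n * k)%N ->
  exists B rho : R, [/\ 0 <= B, 0 <= rho & forall t (e : R), 0 < e -> exists Phi : ('I_d -> R) -> V -> C,
   forall xi, [/\ smooth_on setT (Phi xi),
     forall x, N (Phi xi x) <= B * (\prod_i (1 + `|xi i|) ^+ 2)^-1 * expR (rho * `|x|) &
     forall s x, (size s <= t)%N -> `|x| <= t%:R ->
       N (partials s (opL (powL n L) (Phi xi)) x - partials s (ex (iv xi)) x) <= e]].
Proof.
move=> k0 c0 R10 eL nd nk; pose R0 := Num.max 1 R1; set Q := powL n L.
have R01 : 1 <= R0 by rewrite le_max lexx.
have R00 : 0 <= R0 by apply: le_trans R01.
have [c' c'0 [_ eQ]] := ellL_pow n c0 eL.
have [rho rho1 hrho] := sym_shift k0 eL.1 nd R00.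
have rho0 : 0 <= rho by apply: le_trans rho1.
have symQ z : sym Q z = sym L z ^+ n.
  rewrite /Q /powL; elim: (n) => [|m IH]; first by rewrite /sym big_seq1 big_nil mulr1.
  by rewrite /= sym_comp IH exprS.
pose K := (n * k)%N; pose B := 2 ^+ K / c' + (1 + R0) ^+ K.
have B1 : 0 <= 2 ^+ K / c' by rewrite divr_ge0 ?exprn_ge0// ltW.
have B2 : 0 <= (1 + R0) ^+ K by rewrite exprn_ge0// addr_ge0.
have wt_le (xi : 'I_d -> R) : \prod_i (1 + `|xi i|) ^+ 2 <= (1 + \sum_i `|xi i|) ^+ K.
  apply: (@le_trans _ _ ((1 + \sum_i `|xi i|) ^+ (2 * d))); last first.
    by apply: ler_weXn2l => //; rewrite lerDl sumr_ge0.
  have -> : (1 + \sum_i `|xi i|) ^+ (2 * d) = \prod_(i < d) (1 + \sum_i `|xi i|) ^+ 2.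
    by rewrite prodr_const card_ord exprM.
  apply: ler_prod => i _.
  rewrite exprn_ge0 ?addr_ge0//=; apply: lerXn2r; rewrite ?nnegrE ?addr_ge0 ?sumr_ge0//.
  by rewrite lerD2l (bigD1 i)//= lerDl sumr_ge0.
have wt0 (xi : 'I_d -> R) : 0 < \prod_i (1 + `|xi i|) ^+ 2.
  by apply: prodr_gt0 => i _; rewrite exprn_gt0// ltr_wpDr.
exists B, rho; split; rewrite ?addr_ge0// => t e e0.
pose M := (R0 + rho) ^+ t + (R0 + rho + 1) ^+ t.
have M0 : 0 <= M by rewrite addr_ge0 ?exprn_ge0 ?addr_ge0.
have T0 : 0 <= rho * t%:R by rewrite mulr_ge0.
have [J [ws [J0 ws1 hws]]] := circle_mean_exp t M0 T0 e0.
have JR : 0 < J%:R :> R by rewrite ltr0n.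
pose z (xi : 'I_d -> R) a i := iv xi i + ws a * (if i == i0 then rho%:C else 0).
pose Ph xi := if R0 <= \sum_i `|xi i| then fun x => (sym Q (iv xi))^-1 * ex (iv xi) x
  else exsum (z xi) (fun a => (J%:R)^-1 * (sym Q (z xi a))^-1).
exists Ph => xi; rewrite /Ph; case: ifPn => [hi|]; last rewrite -ltNge => lo.
- have S1 : 1 <= \sum_i `|xi i| by apply: le_trans hi.
  have hQ : c' * (\sum_i `|xi i|) ^+ K <= N (sym Q (iv xi)).
    by apply: eQ; apply: le_trans hi; rewrite le_max lexx orbT.
  have Q0 : 0 < N (sym Q (iv xi)).
    by apply: lt_le_trans hQ; rewrite mulr_gt0// exprn_gt0// (lt_le_trans ltr01).
  split.
  + by apply: (smZ openT); exact: sm_ex.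
  + move=> x; rewrite NM N_ex_iv mulr1 NV.
    apply: (@le_trans _ _ (B * (\prod_i (1 + `|xi i|) ^+ 2)^-1)); last first.
      apply: ler_peMr; first by apply: mulr_ge0; [exact: addr_ge0|rewrite invr_ge0 ltW].
      by apply: le_trans (expR_ge1Dx _); rewrite lerDl mulr_ge0.
    rewrite ler_pdivlMr ?wt0// mulrC ler_pdivrMr//.
    apply: le_trans (wt_le xi) _; apply: (@le_trans _ _ (2 ^+ K / c' * N (sym Q (iv xi)))); last first.
      by rewrite ler_wpM2r ?N_ge0// lerDl.
    rewrite -mulrA -ler_pdivrMl ?exprn_gt0// mulrC; apply: le_trans (_ : (\sum_i `|xi i|) ^+ K <= _); last first.
      by rewrite ler_pdivlMl.
    rewrite ler_pdivrMr ?exprn_gt0// -exprMn; apply: lerXn2r; rewrite ?nnegrE ?addr_ge0 ?mulr_ge0 ?sumr_ge0//.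
    by move: S1; clear; move: (\sum_i _) => u; lra.
  + move=> s x st xt; rewrite (@partials_eq _ _ setT openT s _ (ex (iv xi)) _ x)// ?subrr ?N0 ?(ltW e0)//.
    move=> y _; rewrite /opL; under eq_bigr do rewrite (@partialsZ _ _ setT openT _ _ _ _ (sm_ex _))// mulrCA.
    by rewrite -mulr_sumr -/(opL Q _ y) opL_ex mulrA mulVf ?mul1r// -N_gt0.
- have symz a : 1 <= N (sym Q (z xi a)).
    by rewrite symQ NX exprn_ege1//; apply: hrho; [exact: ltW|exact: ws1].
  have Qz a : sym Q (z xi a) != 0 by rewrite -N_gt0; apply: lt_le_trans (symz a).
  have exz a x : ex (z xi a) x = ex (iv xi) x * cexp (ws a * (rho * x 0 i0)%:C).
    rewrite /z exD; congr (_ * _); rewrite /ex /dotc (bigD1 i0)//= ?eqxx big1 ?addr0 => [|i ne].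
      by rewrite rmorphM /= mulrA.
    by rewrite (negPf ne) mulr0 mul0r.
  split.
  + exact: sm_exsum.
  + move=> x; rewrite /exsum.
    apply: (@le_trans _ _ (expR (rho * `|x|))).
      have -> : expR (rho * `|x|) = \sum_(a < J) J%:R^-1 * expR (rho * `|x|).
        by rewrite sumr_const card_ord -mulrnAl -[X in _ = X * _]mulr_natr mulVf ?mul1r// lt0r_neq0.
      apply: le_trans (N_sum _ _ _) _; apply: ler_sum => a _.
      rewrite (exz a x) NM [N (J%:R^-1 / _)]NM [N (_ * cexp _)]NM !NV N_nat N_ex_iv mul1r N_cexp -mulrA ler_wpM2l ?invr_ge0//.
      apply: le_trans (_ : 1 * expR (rho * `|x|) <= _); last by rewrite mul1r.
      apply: ler_pM; rewrite ?invr_ge0 ?N_ge0 ?expR_ge0//.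
        by rewrite invf_le1// (lt_le_trans ltr01).
      rewrite ler_expR; apply: le_trans (ler_norm _) _; apply: le_trans (Re_le _) _.
      rewrite NM ws1 mul1r N_real normrM ger0_norm// ler_wpM2l//; exact: rv_coord.
    rewrite ler_peMl ?expR_ge0// ler_pdivlMr// mul1r; apply: le_trans (wt_le xi) _.
    apply: (@le_trans _ _ ((1 + R0) ^+ K)); last by rewrite lerDr.
    by apply: lerXn2r; rewrite ?nnegrE ?addr_ge0 ?sumr_ge0// lerD2l ltW.
  + move=> s x st xt.
    have -> : partials s (opL Q (exsum (z xi) (fun a => (J%:R)^-1 * (sym Q (z xi a))^-1))) x =
        partials s (exsum (z xi) (fun a => (J%:R)^-1)) x.
      apply: (@partials_eq _ _ setT openT) => // y _; rewrite opL_exsum; apply: eq_bigr => a _.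
      by rewrite mulfVK.
    rewrite partials_exsum partials_ex /exsum.
    pose q : {poly C} := \prod_(i <- s) ((iv xi i)%:P + (if i == i0 then rho%:C else 0) *: 'X).
    have qE w : q.[w] = \prod_(i <- s) (iv xi i + w * (if i == i0 then rho%:C else 0)).
      by rewrite horner_prod; apply: eq_bigr => i _; rewrite !hornerE mulrC.
    have q0 : q.[0] = \prod_(i <- s) iv xi i.
      by rewrite qE; apply: eq_bigr => i _; rewrite mul0r addr0.
    have qs : (size q <= t.+1)%N.
      by have [h _] := line_prod (iv xi) (fun i => if i == i0 then rho%:C else 0) s; apply: leq_trans h _.
    have y1 : N ((rho * x 0 i0)%:C) <= rho * t%:R.
      by rewrite N_real normrM ger0_norm// ler_wpM2l// (le_trans (rv_coord _ _)).
    have qM w : N w = 1 -> N q.[w] <= M.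
      move=> w1; rewrite qE; apply: le_trans (prod_le s (a := R0 + rho) _) _.
        move=> i; apply: le_trans (ND _ _) _; apply: lerD.
          rewrite NM N_i mul1r N_real; apply: le_trans (ltW lo).
          by rewrite (bigD1 i)//= lerDl sumr_ge0.
        by rewrite NM w1 mul1r; case: ifP => _; rewrite ?N_real ?ger0_norm ?N0.
      apply: (@le_trans _ _ ((R0 + rho) ^+ t)); last by rewrite lerDl exprn_ge0 ?addr_ge0.
      by apply: ler_weXn2l => //; rewrite ler_wpDr.
    apply: le_trans (hws q _ qs qM y1); rewrite le_eqVlt; apply/orP; left; apply/eqP.
    rewrite -[RHS]mulr1 -(N_ex_iv xi x) -NM mulrBl q0; congr (N (_ - _)).
    rewrite -mulrA mulr_suml mulr_sumr; apply: eq_bigr => a _.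
    by rewrite qE exz; ring.
Qed.

End ApproxSolution.

Lemma partials_rcons (R : realType) d s (i : 'I_d) (f : 'rV[R]_d -> R[i]) :
  partials (rcons s i) f = partials s (partial i f).
Proof. by rewrite -cats1 partials_cat. Qed.

(** * Families of smooth functions of polynomial order in a parameter *)

Section Order.
Context (R : realType) (d : nat).
Notation V := 'rV[R]_d.
Notation C := R[i].
Context (X A : set V) (oX : open X) (AX : A `<=` X) (b : nat -> R) (b1 : forall j, 1 <= b j).
Implicit Types (F G : nat -> V -> C) (x : V) (s : seq 'I_d).

(** All derivatives on [A] are O(b_j^c), with constants depending on the derivative only. This
    algebra of orders replaces explicit Leibniz expansions, both for powers of the kernel ([A]
    everything) and for asymptotics at one point. *)
Definition ordO c F := (forall j, smooth_on X (F j)) /\ forall s, exists2 K : R, 0 <= K &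
  forall j x, A x -> N (partials s (F j) x) <= K * b j ^+ c.

Lemma ordO_le c c' F : (c <= c')%N -> ordO c F -> ordO c' F.
Proof.
move=> cc [Fs H]; split=> // s; have [K K0 h] := H s; exists K => // j x Ax.
by apply: le_trans (h j x Ax) _; apply: ler_wpM2l => //; apply: ler_weXn2l.
Qed.

Lemma ordO_partial i c F : ordO c F -> ordO c (fun j => partial i (F j)).
Proof.
move=> [Fs H]; split=> [j|s]; first exact: sm_partial.
by have [K K0 h] := H (rcons s i); exists K => // j x Ax; rewrite -partials_rcons; exact: h.
Qed.

Lemma ordOZ (a : nat -> C) (B : R) p c F : 0 <= B -> (forall j, N (a j) <= B * b j ^+ p) ->
  ordO c F -> ordO (p + c) (fun j x => a j * F j x).
Proof.
move=> B0 aB [Fs H]; split=> [j|s]; first exact: (smZ oX).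
have [K K0 h] := H s; exists (B * K); first exact: mulr_ge0.
move=> j x Ax; rewrite (partialsZ oX s _ (Fs j) (AX Ax)) NM exprD mulrACA.
by apply: ler_pM; rewrite ?N_ge0//; exact: h.
Qed.

Lemma ordOD c F G : ordO c F -> ordO c G -> ordO c (fun j x => F j x + G j x).
Proof.
move=> [Fs H] [Gs H']; split=> [j|s]; first exact: (smD oX).
have [K K0 h] := H s; have [K' K'0 h'] := H' s; exists (K + K'); first exact: addr_ge0.
move=> j x Ax; rewrite (partialsD oX s (Fs j) (Gs j) (AX Ax)).
by apply: le_trans (ND _ _) _; rewrite mulrDl lerD ?h ?h'.
Qed.

Lemma ordOM c c' F G : ordO c F -> ordO c' G -> ordO (c + c') (fun j x => F j x * G j x).
Proof.
move=> tF tG; split=> [j|s]; first by apply: (smM oX); [exact: tF.1|exact: tG.1].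
move: F G tF tG; elim/last_ind: s => [|s i IH] F G tF tG.
  have [K K0 h] := tF.2 [::]; have [K' K'0 h'] := tG.2 [::].
  exists (K * K'); first exact: mulr_ge0.
  by move=> j x Ax; rewrite /= NM exprD mulrACA; apply: ler_pM; rewrite ?N_ge0 ?h ?h'.
have [K K0 h] := IH _ _ (ordO_partial i tF) tG.
have [K' K'0 h'] := IH _ _ tF (ordO_partial i tG).
exists (K + K'); first exact: addr_ge0.
move=> j x Ax; rewrite partials_rcons.
rewrite (partials_eq oX s (g := fun x => partial i (F j) x * G j x + F j x * partial i (G j) x) _ (AX Ax)); last first.
  by move=> y Xy; rewrite (partialM _ (tF.1 j) (tG.1 j)).
have S1 : smooth_on X (fun x => partial i (F j) x * G j x).
  by apply: (smM oX); [apply: sm_partial; exact: tF.1|exact: tG.1].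
have S2 : smooth_on X (fun x => F j x * partial i (G j) x).
  by apply: (smM oX); [exact: tF.1|apply: sm_partial; exact: tG.1].
rewrite (partialsD oX s S1 S2 (AX Ax)).
by apply: le_trans (ND _ _) _; rewrite mulrDl lerD ?h ?h'.
Qed.

End Order.

(** * Decay of the derivatives of the kernel away from the origin *)

Section KernelDecay.
Context (R : realType) (d : nat).
Notation V := 'rV[R]_d.
Notation C := R[i].
Implicit Types (F G : nat -> V -> C) (x : V) (s : seq 'I_d).

Definition lin j : R := 2 * j%:R + 1.
Lemma one_le_lin j : 1 <= lin j.
Proof. by rewrite lerDr mulr_ge0. Qed.
Notation tame := (ordO (d := d) setT setT lin).

Lemma partialX X i (f : V -> C) n x : open X -> smooth_on X f -> X x ->
  partial i (fun x => f x ^+ n.+1) x = n.+1%:R * partial i f x * f x ^+ n.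
Proof.
move=> oX fs Xx; elim: n => [|n IH]; first by rewrite expr0 mulr1 mul1r.
have -> : (fun x => f x ^+ n.+2) = (fun x => f x * f x ^+ n.+1).
  by apply/funext => y; rewrite exprS.
rewrite (partialM _ fs (smX oX n.+1 fs) Xx) IH -[n.+2%:R]natr1 !exprS; ring.
Qed.

Lemma tame_Wf : tame 0 (fun _ => @Wf R d).
Proof.
split=> [j|s]; first exact: sm_Wf.
pose z (g : {ffun 'I_d -> 'I_(2 * 1).+1}) i : C := 'i * ((g i)%:Z - 1%:Z)%:~R.
pose c (g : {ffun 'I_d -> 'I_(2 * 1).+1}) : C := (bkn R 1 ^+ d)^-1%:C * (\prod_i bk R 1 (g i))%:C.
have E x : Wf x = exsum z c x.
  have -> : Wf x = (bkn R 1 ^+ d)^-1%:C * ker 1 x.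
    by rewrite kerE -rmorphM /= /Wf expr1 mulKf// expf_neq0// /bkn !mulf_neq0 ?invr_eq0 ?pnatr_eq0.
  by rewrite /ker /exsum mulr_sumr; apply: eq_bigr => g _; rewrite mulrA.
have zN g x : N (ex (z g) x) = 1 by have := N_en (fun i => (g i)%:Z - 1%:Z) x.
exists (\sum_g N (c g * \prod_(i <- s) z g i)); first by apply: sumr_ge0 => g _; exact: N_ge0.
move=> j x _; rewrite (@partials_eq _ _ setT openT s _ _ (fun y _ => E y) x)// partials_exsum.
rewrite expr0 mulr1; apply: le_trans (N_sum _ _ _) _; apply: ler_sum => g _.
by rewrite NM zN mulr1.
Qed.

(** Each derivative consumes one power of [Wf] and produces a factor of size j, absorbed into the
    order of [G']. The surplus [m] guarantees that at least [j] powers are left. *)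
Lemma tame_pow s G m c : (size s <= m)%N -> tame c G -> exists c' G', tame c' G' /\ forall j x,
  partials s (fun y => G j y * Wf y ^+ (j + m)) x = G' j x * Wf x ^+ (j + (m - size s)).
Proof.
elim/last_ind: s G m c => [|s i IH] G m c; first by exists c, G; split=> // j x; rewrite subn0.
rewrite size_rcons; case: m => // m sm tG.
pose G1 j x := partial i (G j) x * Wf x + (j + m).+1%:R * (G j x * partial i (@Wf R d) x).
have ol := one_le_lin.
have tG1 : tame (1 + (c + 0)) G1.
  apply: (ordOD openT (@subset_refl _ _)).
    apply: (ordO_le ol (leq_addl 1 _)); apply: (ordOM openT (@subset_refl _ _)) tame_Wf.
    exact: ordO_partial.
  apply: (@ordOZ _ _ setT setT openT (@subset_refl _ _) lin _ (m%:R + 1)) => [||].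
  - by rewrite addr_ge0.
  - move=> j; rewrite N_nat expr1 /lin -natr1 natrD; have : (0 : R) <= j%:R by [].
    have : (0 : R) <= m%:R by [].
    move: (j%:R) (m%:R) => a b b0 a0; have : 0 <= b * a by exact: mulr_ge0.
    lra.
  - apply: (ordOM openT (@subset_refl _ _) tG).
    by apply: (@ordO_partial _ _ _ _ _ i 0 (fun=> @Wf R d)); exact: tame_Wf.
have [c' [G' [tG' H]]] := IH G1 m _ sm tG1; exists c', G'; split=> // j x.
rewrite partials_rcons subSS -H; apply: (@partials_eq _ _ setT openT) => // y _.
rewrite (partialM _ (tG.1 j) (smX openT (j + m.+1) (@sm_Wf R d)))//.
rewrite addnS (partialX _ _ openT (@sm_Wf R d))// /G1 !exprS; ring.
Qed.

(** From [Wf ^+ j], t + 1 factors are set aside: one joins the amplitude and [t] serve as reserve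
    for the derivatives. The remaining power is geometrically small off the origin and beats the
    polynomial order of the amplitude. *)
Lemma ker_decay t (r e : R) : 0 < r -> 0 < e -> exists J, forall j, (J <= j)%N ->
  forall s x, (size s <= t)%N -> r <= `|x| -> `|x| <= pi -> N (partials s (@ker R d j) x) <= e.
Proof.
move=> r0 e0; have [th /andP[th0 th1] hth] := @Wr_off R d r r0.
pose a j : C := (bkn R (j + t.+1) ^+ d)%:C.
have ta : tame (d + 0) (fun j x => a j * @Wf R d x).
  apply: (@ordOZ _ _ setT setT openT (@subset_refl _ _) lin _ ((2 * t%:R + 3) ^+ d)); last exact: tame_Wf.
    by rewrite exprn_ge0 ?addr_ge0 ?mulr_ge0.
  move=> j; rewrite N_real ger0_norm ?exprn_ge0 ?bkn_ge0// -exprMn; apply: lerXn2r.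
  - by rewrite nnegrE bkn_ge0.
  - by rewrite nnegrE mulr_ge0 ?addr_ge0 ?mulr_ge0 ?(le_trans ler01 (one_le_lin _)).
  apply: le_trans (bkn_le R _) _; rewrite /lin natrD -[t.+1%:R]natr1.
  have : (0 : R) <= j%:R by []. 
  have : (0 : R) <= t%:R by []. 
  move: (j%:R) (t%:R) => u v v0 u0; have : 0 <= v * u by exact: mulr_ge0.
  lra.
have H1 s : (size s <= t)%N -> exists J, forall j, (J <= j)%N -> forall x,
    r <= `|x| -> `|x| <= pi -> N (partials s (@ker R d j) x) <= e.
  move=> st; have [c [G' [[_ tG'] E]]] := tame_pow st ta.
  have [K K0 h] := tG' [::].
  have [J hJ] := poly_geom c th0 th1 (divr_gt0 e0 (ltr_wpDl K0 ltr01)).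
  exists (J + t.+1)%N => j Jj x rx xp; pose j' := (j - t.+1)%N.
  have jE : j = (j' + t.+1)%N by rewrite /j' subnK// (leq_trans _ Jj)// leq_addl.
  clearbody j'.
  rewrite (@partials_eq _ _ setT openT s _ (fun y => a j' * Wf y * Wf y ^+ (j' + t)) _ x)//; last first.
    by move=> y _; rewrite kerE jE -mulrA -exprS -addnS rmorphM [X in _ * X = _]rmorphXn.
  rewrite E NM NX N_real ger0_norm ?Wr_ge0//.
  have W1 : Wr x ^+ (j' + (t - size s)) <= th ^+ j'.
    rewrite exprD; apply: (@le_trans _ _ (Wr x ^+ j')).
      by rewrite ler_piMr ?exprn_ge0 ?exprn_ile1 ?Wr_ge0// (le_trans (hth _ xp rx))// ltW.
    by apply: lerXn2r; rewrite ?nnegrE ?Wr_ge0//; exact: hth.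
  apply: (@le_trans _ _ (K * (2 * j'%:R + 1) ^+ c * th ^+ j')).
    by apply: ler_pM; rewrite ?N_ge0 ?exprn_ge0 ?Wr_ge0//; exact: (h j' x I).
  have Jj' : (J <= j')%N by rewrite -(leq_add2r t.+1) -jE.
  rewrite -mulrA; apply: le_trans (ler_wpM2l K0 (hJ _ Jj')) _.
  by rewrite mulrCA ler_piMr ?(ltW e0)// ler_pdivrMr ?mul1r ?lerDl// ltr_wpDl.
have /choice[J hJ] : forall s : {bseq t of 'I_d}, exists J, forall j, (J <= j)%N -> forall x,
    r <= `|x| -> `|x| <= pi -> N (partials s (@ker R d j) x) <= e.
  by move=> s; apply: H1; exact: size_bseq.
exists (\max_s J s) => j Jj s x st; have := hJ (Bseq st) j; apply.
by apply: leq_trans Jj; exact: leq_bigmax.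
Qed.

End KernelDecay.

(** * Mass of the stretched kernel in small cubes *)

Section KernelMean.
Context (R : realType) (d : nat) (d0 : (0 < d)%N).
Notation V := 'rV[R]_d.
Notation C := R[i].
Implicit Types (x y : V) (i : 'I_d).

Lemma cder_inv f x i : (forall t : R, f (x + t *: ee R i) = f x) -> cder (f : V -> C) x (ee R i) 0.
Proof.
by move=> H; exists (fun=> 0); split=> [||t]; [exact: cont_cst|by []|rewrite H mulr0 addr0].
Qed.

Lemma cder_coord x i j : cder (fun x : V => (x 0 i)%:C) x (ee R j) ((i == j)%:R).
Proof.
exists (fun=> (i == j)%:R); split=> [||t]; [exact: cont_cst|by []|].
by rewrite !mxE eqxx /= rmorphD rmorphM /= rmorph_nat.
Qed.

Lemma sm_coord i : smooth_on setT (fun x : V => (x 0 i)%:C).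
Proof.
apply/(smoothP openT) => -[|n]; first by move=> x _; exact: cont_coord.
split=> [x _|j]; first exact: cont_coord.
exists (fun=> (i == j)%:R); split; last by move=> x _; exact: cder_coord.
exact: ((smoothP openT _).1 (sm_cst openT _) n).
Qed.

Lemma II_indep a i (Phi G : V -> C) : 0 < a -> smooth_on setT Phi -> smooth_on setT G ->
  (forall x y, x 0 i = a -> y 0 i = - a -> Phi x = Phi y) ->
  (forall x y, (forall k, k != i -> x 0 k = y 0 k) -> G x = G y) ->
  II a (fun x => partial i Phi x * G x) = 0.
Proof.
move=> a0 Ps Gs P1 G1.
have E x : partial i Phi x * G x = partial i (fun x => Phi x * G x) x.
  rewrite (partialM _ Ps Gs)//; have /cder_inv/cder_partial[_ ->] : forall t : R, G (x + t *: ee R i) = G x.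
    move=> t; apply: G1 => k ki; rewrite !mxE eqxx /= (negPf ki) mulr0 addr0 //.
  by rewrite mulr0 addr0.
apply/eqP; rewrite -N_eq0 eq_le N_ge0 andbT.
rewrite (II_eq d0 a0 (fun x _ => E x)).
have := @II_flux _ _ d0 _ a0 setT i _ 0 openT (fun _ _ => I) (@smM _ _ setT openT _ _ Ps Gs).
rewrite mul0r; apply => x y _ _ xa ya xy.
by rewrite (P1 x y)// (G1 x y) ?subrr ?N0// => k ki; exact: xy.
Qed.

Section Primitive.
Context (La : R) (La0 : 0 < La) (j : nat).

Definition k1 (y : R) : R := bkn R j * ((1 + cos y) / 2) ^+ j.
Definition fr (l : 'I_(2 * j).+1) : C := 'i * (l%:Z - j%:Z)%:~R / La%:C.
Definition pcoef (l : 'I_(2 * j).+1) : C := if val l == j then 0 else (bk R j l)%:C / fr l.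
(** A primitive of [k1 (y / La)]: the constant Fourier coefficient integrates to [y], and [pcoef]
    leaves that frequency out to avoid dividing by zero. *)
Definition prim (y : R) : C := y%:C + \sum_l pcoef l * cexp (fr l * y%:C).
Definition primV i x := prim (x 0 i).

Lemma prim_exsum i x : primV i x = (x 0 i)%:C +
  exsum (fun l k => if k == i then fr l else 0) pcoef x.
Proof.
rewrite /primV /prim /exsum; congr (_ + _); apply: eq_bigr => l _; congr (_ * cexp _).
rewrite /dotc (bigD1 i)//= eqxx big1 ?addr0// => k ki.
by rewrite (negPf ki) mul0r.
Qed.

Lemma sm_primV i : smooth_on setT (primV i).
Proof.
apply: (sm_eq openT (fun x _ => esym (prim_exsum i x))).
by apply: (smD openT); [exact: sm_coord|exact: sm_exsum].
Qed.

Lemma partial_primV i x : partial i (primV i) x = (k1 (x 0 i / La))%:C.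
Proof.
rewrite (@partial_eq _ _ setT openT i _ _ (fun x _ => prim_exsum i x))//.
have := @partialsD _ _ setT openT [:: i] _ _ x (sm_coord i)
  (@sm_exsum _ _ _ pcoef (fun l k => if k == i then fr l else 0)) I.
rewrite /= => ->; have /cder_partial[_ ->] := cder_coord x i i; rewrite eqxx.
have := partials_exsum pcoef (fun l k => if k == i then fr l else 0) [:: i] x; rewrite /= => ->.
rewrite /k1 -ker1 /exsum.
have jj : (j < (2 * j).+1)%N by lia.
rewrite (bigD1 (Ordinal jj)) //= [RHS](bigD1 (Ordinal jj)) //=.
rewrite {1}/pcoef eqxx !mul0r add0r bkjj subrr mulr0 mul0r cexp0 mulr1; congr (_ + _).
apply: eq_bigr => l lj; rewrite big_seq1 eqxx.
have lj' : val l == j = false by apply: contraNF lj => /eqP E; apply/eqP/val_inj.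
rewrite /pcoef lj' divfK; last first.
  rewrite /fr !mulf_neq0 ?invr_eq0 //.
  - by rewrite -N_eq0 N_i oner_eq0.
  - by rewrite intr_eq0 subr_eq0 eqz_nat lj'.
  - by rewrite -N_eq0 N_real normr_eq0 lt0r_neq0.
congr (_ * _); rewrite /ex /dotc (bigD1 i)//= eqxx big1 ?addr0 => [|k ki]; last by rewrite (negPf ki) mul0r.
by congr cexp; rewrite /fr -!mulrA; congr (_ * (_ * _)); rewrite rmorphM fmorphV /= mulrC.
Qed.

Lemma prim_period : prim (pi * La) - prim (- (pi * La)) = (2 * pi * La)%:C.
Proof.
rewrite /prim opprD addrACA -sumrB big1 => [|l _].
  by rewrite addr0 -rmorphN -rmorphD /=; congr (_%:C); ring.
have [E|E] := eqVneq (val l) j; first by rewrite /pcoef E eqxx !mul0r subrr.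
apply/eqP; rewrite -mulrBr mulf_eq0; apply/orP; right; rewrite subr_eq0; apply/eqP.
have -> : fr l * (pi * La)%:C = fr l * (- (pi * La))%:C + 'i * (l%:Z - j%:Z)%:~R * (2 * pi)%:C.
  rewrite /fr; have Ln : La%:C != 0 :> C by rewrite -N_eq0 N_real normr_eq0 lt0r_neq0.
  by rewrite !rmorphN !rmorphM /=; field.
by rewrite cexpD cexp_2pi mulr1.
Qed.

(** Fubini for products, one factor at a time. Minus its mean [mu], a factor is the derivative of a
    function with equal values on the two faces, so its product with factors not depending on that
    coordinate has mean zero. *)
Lemma II_prod a (r : seq 'I_d) : 0 < a -> uniq r ->
  II a (fun x => \prod_(i <- r) (k1 (x 0 i / La))%:C) =
  ((prim a - prim (- a)) / (2 * a)%:C) ^+ size r.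
Proof.
move=> a0; set mu := _ / _.
have k1s i : smooth_on setT (fun x : V => (k1 (x 0 i / La))%:C).
  by apply: (sm_eq openT (fun x _ => partial_primV i x)); apply: sm_partial; exact: sm_primV.
elim: r => [|i r IH] /=.
  by move=> _; rewrite (II_eq d0 a0 (G := fun=> 1)) ?II_cst// => x _; rewrite big_nil.
move=> /andP[ir ur]; rewrite exprS -(IH ur).
pose G x := \prod_(k <- r) (k1 (x 0 k / La))%:C.
have Gs : smooth_on setT G by apply: (sm_prod _ openT) => k; exact: k1s.
pose Phi x := primV i x - mu * (x 0 i)%:C.
have Ps : smooth_on setT Phi by apply: (smB openT); [exact: sm_primV|apply: (smZ openT); exact: sm_coord].
have PE x : partial i Phi x = (k1 (x 0 i / La))%:C - mu.
  have := cderB (sm_cder i (sm_primV i) (I : setT x)) (cderZ mu (cder_coord x i i)).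
  by rewrite partial_primV eqxx mulr1 => /cder_partial[].
have Z : II a (fun x => partial i Phi x * G x) = 0.
  apply: II_indep => // [x y xa ya|x y xy].
    have a2 : (2 * a)%:C != 0 :> C by rewrite -N_eq0 N_real normr_eq0 mulf_neq0 ?lt0r_neq0.
    have : mu * (2 * a)%:C = prim a - prim (- a) by rewrite divfK.
    rewrite mulr_natl mulr2n rmorphD /= => h.
    rewrite /Phi /primV xa ya; apply/eqP; rewrite -subr_eq0.
    have -> : prim a - mu * a%:C - (prim (- a) - mu * (- a)%:C) = prim a - prim (- a) - mu * (a%:C + a%:C).
      by rewrite rmorphN /=; ring.
    by rewrite h subrr.
  rewrite /G big_seq [RHS]big_seq; apply: eq_bigr => k kr; rewrite xy//.
  by apply: contraNneq ir => <-.
have [K1 _ B1] : exists2 K, 0 < K & bd a (fun x => partial i Phi x * G x) K.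
  by apply: cube_bounded => x _; apply: (@sm_cont _ _ setT); [apply: (smM openT); [exact: sm_partial|exact: Gs]|by []].
have [K2 _ B2] : exists2 K, 0 < K & bd a G K.
  by apply: cube_bounded => x _; apply: (@sm_cont _ _ setT).
have B3 : bd a (fun x => mu * G x) (N mu * K2).
  by move=> x xa; rewrite NM ler_wpM2l ?N_ge0//; exact: B2.
rewrite -(IIZ d0 a0 _ B2) -[RHS]add0r -Z -(IID d0 a0 B1 B3).
by apply: (II_eq d0 a0) => x _; rewrite big_cons PE -/(G x); ring.
Qed.

(** In one variable the integral over the period [-pi La, pi La] is 2 pi La. Outside [-a, a] the
    kernel is at most 1/2, which removes at most pi La - a, so more than half of the mass lies in
    [-a, a]. *)
Lemma mean_lower a : 0 < a -> a <= pi * La ->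
  (forall y : R, a / La <= `|y| -> `|y| <= pi -> k1 y <= 1 / 2) ->
  ((pi * La) / (2 * a)) ^+ d <= N (II a (fun x : V => ker j (La^-1 *: x))).
Proof.
move=> a0 aL hk; have pL : 0 < pi * La by rewrite mulr_gt0 ?pi_gt0.
have -> : II a (fun x : V => ker j (La^-1 *: x)) = ((prim a - prim (- a)) / (2 * a)%:C) ^+ d.
  rewrite -[X in _ ^+ X](size_enum_ord d) -(II_prod a0 (enum_uniq 'I_d)).
  apply: (II_eq d0 a0) => x _; rewrite kerE big_enum /= -rmorph_prod /=; congr (_%:C).
  rewrite /k1 big_split /= prodr_const card_ord prodrXl /Wr; congr (_ * _ ^+ _).
  by apply: eq_big => // i _; congr ((1 + cos _) / 2); rewrite mxE mulrC.
have pq0 : 0 <= pi * La / (2 * a) by apply: divr_ge0; [exact: ltW|rewrite mulr_ge0// ltW].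
rewrite NX; apply: lerXn2r; rewrite ?nnegrE ?N_ge0//.
rewrite NM NV N_real (ger0_norm (_ : 0 <= 2 * a)); last by rewrite mulr_ge0// ltW.
apply: ler_wpM2r; first by rewrite invr_ge0 mulr_ge0// ltW.
pose i0 := Ordinal d0.
have k1n (y : R) : N ((k1 y)%:C) = k1 y.
  rewrite N_real ger0_norm// /k1 mulr_ge0 ?bkn_ge0// exprn_ge0// divr_ge0//.
have cosn (y : R) : k1 y = k1 `|y| by rewrite /k1; case: (ler0P y); rewrite ?cosN.
have half (u t : R) : a <= `|u| -> a <= `|u + t| -> `|t| <= pi * La - a -> 
    (forall s : R, 0 <= s <= 1 -> a <= `|u + s * t| <= pi * La) ->
    N (prim (u + t) - prim u) <= (pi * La - a) * (1 / 2).
  move=> _ _ tl H.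
  have E (v : R) : prim v = primV i0 (v *: ee R i0) by rewrite /primV !mxE !eqxx mulr1.
  rewrite !E scalerDl; apply: (@le_trans _ _ (`|t| * (1 / 2))); last by apply: ler_wpM2r.
  apply: (@partial_mvt _ _ _ _ _ _ _ setT openT (sm_primV i0)) => s s01; split=> //.
  rewrite partial_primV -scalerDl !mxE !eqxx mulr1 k1n.
  have /andP[h1 h2] := H s s01; apply: hk.
    by rewrite normrM normfV (gtr0_norm La0) ler_pM2r ?invr_gt0.
  by rewrite normrM normfV (gtr0_norm La0) ler_pdivrMr.
have h1 : N (prim (pi * La) - prim a) <= (pi * La - a) * (1 / 2).
  have := half a (pi * La - a); rewrite addrC subrK; apply; rewrite ?(gtr0_norm a0) ?(gtr0_norm pL)//.
    by rewrite ger0_norm ?subr_ge0.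
  move=> s /andP[s0 s1]; have : 0 <= s * (pi * La - a) <= pi * La - a.
    by rewrite mulr_ge0 ?subr_ge0//= ler_piMl ?subr_ge0.
  by move=> /andP[q0 q1]; rewrite ger0_norm ?addr_ge0 ?(ltW a0)// lerDl q0 -lerBrDl.
have h2 : N (prim (- (pi * La)) - prim (- a)) <= (pi * La - a) * (1 / 2).
  have := half (- a) (- (pi * La - a)); rewrite -opprD [a + _]addrC subrK; apply; rewrite ?normrN ?(gtr0_norm a0) ?(gtr0_norm pL)//.
    by rewrite ger0_norm ?subr_ge0.
  move=> s /andP[s0 s1]; have : 0 <= s * (pi * La - a) <= pi * La - a.
    by rewrite mulr_ge0 ?subr_ge0//= ler_piMl ?subr_ge0.
  move=> /andP[q0 q1]; rewrite mulrN -opprD normrN ger0_norm ?addr_ge0 ?(ltW a0)// lerDl q0 -lerBrDl//.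
have h3 : N (prim (pi * La) - prim (- (pi * La))) = 2 * pi * La.
  by rewrite prim_period N_real ger0_norm// -mulrA mulr_ge0// ltW.
have h4 : N (prim (pi * La) - prim (- (pi * La))) <= N (prim a - prim (- a)) +
    (N (prim (pi * La) - prim a) + N (prim (- (pi * La)) - prim (- a))).
  rewrite -[N (prim (- (pi * La)) - _)]NN; apply: le_trans (lerD (lexx _) (ND _ _)).
  apply: le_trans (ND _ _); rewrite le_eqVlt; apply/orP; left; apply/eqP; congr N; ring.
by move: h1 h2 h3 h4 a0; move: (N (prim a - _)) (N (prim (pi * La) - prim a)) (N (prim (- (pi * La)) - _)) (N _); move=> u1 u2 u3 u4 g1 g2 g3 g4 g5; nra.
Qed.

End Primitive.
End KernelMean.

(** * Approximate solutions with concentrated right-hand side *)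

Section ApproxSol.
Context (R : realType) (d : nat) (d0 : (0 < d)%N).
Notation V := 'rV[R]_d.
Notation C := R[i].
Implicit Types (L : seq (C * seq 'I_d)) (x : V) (s : seq 'I_d).

Section Comb.
Context (I : finType) (a : C) (b : I -> C).
Definition comb (F : I -> V -> C) x := a * \sum_g b g * F g x.

Lemma sm_comb F : (forall g, smooth_on setT (F g)) -> smooth_on setT (comb F).
Proof. by move=> Fs; apply: (smZ openT); apply: (sm_sum openT) => g; exact: (smZ openT). Qed.

Lemma partials_comb F s x : (forall g, smooth_on setT (F g)) ->
  partials s (comb F) x = comb (fun g => partials s (F g)) x.
Proof.
move=> Fs; rewrite /comb (@partialsZ _ _ setT openT)//; last first.
  by apply: (sm_sum openT) => g; exact: (smZ openT).
rewrite (@partials_sum _ _ setT openT)//; last by move=> g; exact: (smZ openT).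
by congr (_ * _); apply: eq_bigr => g _; rewrite (@partialsZ _ _ setT openT _ _ _ _ (Fs g)).
Qed.

Lemma opL_comb L F x : (forall g, smooth_on setT (F g)) ->
  opL L (comb F) x = comb (fun g => opL L (F g)) x.
Proof.
move=> Fs; rewrite /opL; under eq_bigr do rewrite (partials_comb _ _ Fs) /comb mulr_sumr mulr_sumr.
rewrite exchange_big /= /comb mulr_sumr; apply: eq_bigr => g _; rewrite !mulr_sumr.
by apply: eq_bigr => t _; ring.
Qed.
End Comb.

(** The right-hand side is close to [ker j (x / La) / La^d], a trigonometric sum with frequencies in
    (1/La)Z^d, and [u] replaces each exponential by its approximate preimage. The bound on [u] is a
    Riemann sum of mesh 1/La, hence uniform in [t]; as [t] grows, the period becomes infinite while
    the right-hand side concentrates at 0 without losing its mass. *)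
Lemma approx_sol k c R1 L n : (0 < k)%N -> 0 < c -> 0 <= R1 -> ellL k c R1 L -> nondeg k L ->
  (2 * d <= n * k)%N ->
  exists B rho : R, [/\ 0 <= B, 0 <= rho & forall t : nat, exists u : V -> C,
   [/\ smooth_on setT u, forall x, N (u x) <= B * expR (rho * `|x|),
     forall s x, (size s <= t)%N -> t.+1%:R^-1 <= `|x| -> `|x| <= t.+1%:R ->
       N (partials s (opL (powL n L) u) x) <= t.+1%:R^-1 &
     forall a : R, t.+1%:R^-1 <= a -> a <= 1 -> (a ^+ d)^-1 / 2 <= N (II a (opL (powL n L) u))]].
Proof.
move=> k0 c0 R10 eL nd nk.
have [B [rho [B0 rho0 H]]] := inv_exp_sol d0 k0 c0 R10 eL nd nk.
exists (B * 3 ^+ d), rho; split; [by rewrite mulr_ge0 ?exprn_ge0|by []|] => t.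
set La : R := t.+1%:R; have La1 : 1 <= La by rewrite ler1n.
have La0 : 0 < La by apply: lt_le_trans La1.
have p1 : 1 <= pi :> R by have := pi_ge2 R; lra.
(* Stretching by [La] turns the radius 1/La in [x] into 1/La^2 in the variable of the kernel. *)
pose r := La^-1 / La; have r0 : 0 < r by rewrite !divr_gt0 ?invr_gt0.
pose e := La^-1 / 2; have e0 : 0 < e by rewrite !divr_gt0 ?invr_gt0.
have [J1 hJ1] := ker_decay d t r0 e0.
have half0 : 0 < 1 / 2 :> R by rewrite divr_gt0.
have [J2 hJ2] := @ker_off R 1 r (1 / 2) r0 half0.
pose j := maxn J1 J2.
pose I := {ffun 'I_d -> 'I_(2 * j).+1}.
pose m : R := #|I|%:R; have m0 : 0 < m by rewrite ltr0n card_ffun !card_ord expn_gt0.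
have [Phi hPhi] := H t.+1 (e / m) (divr_gt0 e0 m0).
pose xi (g : I) i : R := ((g i)%:Z - j%:Z)%:~R / La.
pose b (g : I) : C := (\prod_i bk R j (g i))%:C.
have b1 g : N (b g) <= 1.
  by have /andP[? ?] := prod_bk_bound R g; rewrite N_real ger0_norm.
pose a : C := (La ^+ d)^-1%:C.
have Na : N a = (La ^+ d)^-1 by rewrite N_real ger0_norm// invr_ge0 exprn_ge0// ltW.
have Ld1 : (La ^+ d)^-1 <= 1 by rewrite invf_le1 ?exprn_gt0// exprn_ege1.
have Ps g : smooth_on setT (Phi (xi g)) by case: (hPhi (xi g)).
pose u := comb a b (fun g => Phi (xi g)).
pose G := comb a b (fun g => ex (iv (xi g))).
have Qs g : smooth_on setT (opL (powL n L) (Phi (xi g))) by apply: sm_opL; [exact: openT|exact: Ps].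
have GE x : G x = a * ker j (La^-1 *: x).
  rewrite /G /comb /ker; congr (_ * _); apply: eq_bigr => g _; congr (_ * cexp _).
  rewrite /dotc; apply: eq_bigr => i _; rewrite /iv /xi mxE !rmorphM /= rmorph_int; ring.
have err s x : (size s <= t.+1)%N -> `|x| <= La ->
    N (partials s (opL (powL n L) u) x - partials s G x) <= e.
  move=> st xL; rewrite (@partials_eq _ _ setT openT s _ _ (fun y _ => opL_comb a b _ y Ps))//.
  rewrite (partials_comb _ _ _ _ Qs) (partials_comb _ _ _ _ (fun g => @sm_ex _ _ (iv (xi g)))).
  rewrite /comb -mulrBr -sumrB NM Na; apply: (@le_trans _ _ (1 * (\sum_(g : I) e / m))).
    apply: ler_pM; rewrite ?N_ge0 ?invr_ge0 ?exprn_ge0 ?(ltW La0)//.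
    apply: le_trans (N_sum _ _ _) _; apply: ler_sum => g _; rewrite -mulrBr NM.
    have [_ _ /(_ s x st xL) h] := hPhi (xi g).
    by apply: le_trans h; rewrite ler_piMl ?N_ge0.
  by rewrite mul1r sumr_const -mulr_natr divfK// lt0r_neq0.
exists u; split.
- exact: sm_comb.
- move=> x; rewrite /u /comb NM Na.
  apply: (@le_trans _ _ ((La ^+ d)^-1 * \sum_(g : I) B * (\prod_i (1 + `|xi g i|) ^+ 2)^-1 * expR (rho * `|x|))).
    apply: ler_wpM2l; first by rewrite invr_ge0 exprn_ge0// ltW.
    apply: le_trans (N_sum _ _ _) _; apply: ler_sum => g _; rewrite NM.
    have [_ /(_ x) h _] := hPhi (xi g); apply: le_trans h.
    by rewrite ler_piMl ?N_ge0.
  rewrite -mulr_suml mulrA ler_wpM2r ?expR_ge0// -mulr_sumr mulrCA ler_wpM2l//.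
  rewrite ler_pdivrMl ?exprn_gt0// -exprMn.
  have -> : \sum_(g : I) (\prod_i (1 + `|xi g i|) ^+ 2)^-1 = \prod_(i < d) \sum_(l < (2 * j).+1)
      La ^+ 2 * ((La + `|(l%:Z - j%:Z)%:~R| : R) ^+ 2)^-1.
    rewrite bigA_distr_bigA; apply: eq_bigr => g _; rewrite -prodfV; apply: eq_bigr => i _.
    have -> : La + `|((g i)%:Z - j%:Z)%:~R| = La * (1 + `|xi g i|).
      by rewrite /xi normrM normfV (gtr0_norm La0) mulrDr mulr1 mulrCA divff ?mulr1 ?lt0r_neq0.
    have La2 : La ^+ 2 != 0 by rewrite expf_neq0// lt0r_neq0.
    by rewrite [(La * _) ^+ 2]exprMn [in RHS]invfM [RHS]mulrA [in RHS]divff// mul1r.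
  have -> : (La * 3) ^+ d = \prod_(i < d) (La * 3) by rewrite prodr_const card_ord.
  apply: ler_prod => i _; apply/andP; split.
    have Lag := ltW La0.
    by apply: sumr_ge0 => l _; rewrite mulr_ge0 ?invr_ge0 ?exprn_ge0 ?addr_ge0.
  rewrite -mulr_sumr; apply: le_trans (ler_wpM2l _ (sum_inv_sqr _ _ La1)) _; first by rewrite exprn_ge0// ltW.
  have -> : La ^+ 2 * (3 / La) = La * 3 by field; rewrite lt0r_neq0.
  by [].
- move=> s x st x1 x2; have h1 := err s x (leqW st) x2.
  have h2 : N (partials s G x) <= e.
    rewrite (@partials_eq _ _ setT openT s _ _ (fun y _ => GE y))//.
    have kers : smooth_on setT (@ker R d j).
      apply: (sm_sum openT) => g; apply: (smZ openT); exact: sm_en.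
    have E0 : (fun y : V => a * ker j (La^-1 *: y)) = (fun y : V => a * ker j (0 + La^-1 *: y)).
      by apply/funext => y; rewrite add0r.
    have As : smooth_on setT (fun y : V => ker j (0 + La^-1 *: y)).
      have := @sm_affine _ _ setT _ (0 : V) La^-1 openT kers.
      by rewrite (_ : [set h | _] = setT)// predeqE => y; split.
    rewrite E0 (@partialsZ _ _ setT openT _ _ _ _ As)//.
    rewrite (@partials_affine _ _ setT _ _ _ s x openT kers)// add0r NM Na.
    apply: (@le_trans _ _ (1 * e)); last by rewrite mul1r.
    apply: ler_pM; rewrite ?N_ge0 ?invr_ge0 ?exprn_ge0 ?(ltW La0)//.
    have xL : `|La^-1 *: x| = `|x| / La by rewrite normrZ normfV (gtr0_norm La0) mulrC.
    have xs : N (partials s (@ker R d j) (La^-1 *: x)) <= e.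
      apply: hJ1 => //; first exact: leq_maxl.
        by rewrite xL /r ler_wpM2r// invr_ge0 ltW.
      by rewrite xL ler_pdivrMr//; apply: le_trans x2 _; rewrite ler_peMl ?(ltW La0).
    apply: le_trans xs; rewrite NM NX N_real ger0_norm ?invr_ge0 ?(ltW La0)//.
    by rewrite ler_piMl ?N_ge0// exprn_ile1 ?invr_ge0 ?(ltW La0)// invf_le1.
  have -> : La^-1 = e + e by rewrite /e; field.
  have -> : partials s (opL (powL n L) u) x =
    (partials s (opL (powL n L) u) x - partials s G x) + partials s G x by rewrite subrK.
  by apply: le_trans (ND _ _) _; exact: lerD.
- move=> q q1 q2; have q0 : 0 < q by apply: lt_le_trans q1; rewrite invr_gt0.
  have Gs : smooth_on setT G by apply: sm_comb => g; exact: sm_ex.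
  have us : smooth_on setT (opL (powL n L) u) by apply: sm_opL; [exact: openT|apply: sm_comb; exact: Ps].
  have [K1 _ B1] : exists2 K, 0 < K & bd q (opL (powL n L) u) K.
    by apply: cube_bounded => x _; apply: (sm_cont us).
  have [K2 _ B2] : exists2 K, 0 < K & bd q G K.
    by apply: cube_bounded => x _; apply: (sm_cont Gs).
  have B3 : bd q (fun x => -1 * G x) K2 by move=> x xa; rewrite NM NN N1 mul1r; exact: B2.
  have [K3 _ B4] : exists2 K, 0 < K & bd q (fun x : V => ker j (La^-1 *: x)) K.
    have aV : a != 0 by rewrite -N_eq0 Na invr_eq0 expf_neq0// lt0r_neq0.
    exists (K2 * La ^+ d + 1) => [|x xa].
      rewrite ltr_wpDl// mulr_ge0 ?exprn_ge0 ?(ltW La0)//; apply: le_trans (N_ge0 (G 0)) (B2 _ _).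
      by rewrite normr0 ltW.
    have := B2 _ xa; rewrite GE NM Na mulrC ler_pdivrMr ?exprn_gt0// => h.
    by apply: le_trans h _; rewrite lerDl.
  have hG : (q ^+ d)^-1 <= N (II q G).
    rewrite (II_eq d0 q0 (fun x _ => GE x)) (IIZ d0 q0 _ B4) NM Na mulrC ler_pdivlMr ?exprn_gt0//.
    have qL : q <= pi * La.
      by apply: le_trans q2 _; apply: le_trans La1 _; rewrite ler_peMl ?(ltW La0).
    apply: le_trans (mean_lower d0 La0 q0 qL (j := j) _).
      rewrite -exprVn -exprMn; apply: lerXn2r; rewrite ?nnegrE ?mulr_ge0 ?invr_ge0 ?mulr_ge0 ?pi_ge0 ?(ltW La0) ?(ltW q0)//.
      have -> : pi * La / (2 * q) = (pi / 2) * (q^-1 * La) by field; rewrite lt0r_neq0.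
      by rewrite ler_peMl ?mulr_ge0 ?invr_ge0 ?(ltW La0) ?(ltW q0)// ler_pdivlMr// mul1r; exact: pi_ge2.
    move=> y y1 y2.
    pose yv : 'rV[R]_1 := const_mx y.
    have yvE : `|yv| = `|y|.
      apply/eqP; rewrite eq_le; apply/andP; split; first by apply/rv_leP => // i; rewrite mxE.
      by have := rv_coord yv 0; rewrite mxE.
    have := hJ2 j yv (leq_maxr _ _); rewrite yvE => /(_ y2).
    rewrite kerE /= /Wr big_ord1 mxE expr1; apply; apply: le_trans y1.
    by rewrite /r ler_wpM2r// invr_ge0 ltW.
  have hE : N (II q (fun x => opL (powL n L) u x + -1 * G x)) <= 1 / 2.
    apply: (II_le d0 q0) => x xq.
    have xL : `|x| <= La by apply: le_trans xq (le_trans q2 La1).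
    have := err [::] x isT xL; rewrite mulN1r /= => h; apply: le_trans h _.
    by rewrite /e ler_pM2r ?invr_gt0// invf_le1.
  have E : N (II q G) <= N (II q (opL (powL n L) u)) + N (II q (fun x => opL (powL n L) u x + -1 * G x)).
    rewrite (IID d0 q0 B1 B3) (IIZ d0 q0 _ B2) mulN1r.
    move: (II q G) (II q (opL _ _)) => z1 z2; rewrite -{1}(subKr z2 z1).
    by apply: le_trans (ND _ _) _; rewrite NN.
  have : 1 <= (q ^+ d)^-1 by rewrite invf_ge1 ?exprn_gt0// exprn_ile1// ltW.
  by move: hG hE E; move: (N (II q G)) (N (II q (opL _ _))) (N (II q (fun x => opL _ _ x + _))) (q ^+ d)^-1 => z1 z2 z3 z4; lra.
Qed.

End ApproxSol.

Lemma UU_list (T : eqType) (l : seq T) (P : T -> set nat) :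
  (forall i, i \in l -> UU (P i)) -> UU [set n | forall i, i \in l -> P i n].
Proof.
elim: l => [|i l IH] H; first exact: UU_all.
have IH' := IH (fun j jl => H j (mem_behead (s := i :: l) jl)).
apply: filterS (filterI (H i (mem_head _ _)) IH') => n [h1 h2] j.
by rewrite inE => /predU1P[->//|]; exact: h2.
Qed.

Lemma UU_inv_small (R : realType) (e : R) : 0 < e -> UU [set n | n.+1%:R^-1 <= e].
Proof.
move=> e0; have /archi_boundP : 0 <= e^-1 by rewrite invr_ge0 ltW.
set m := Num.bound _ => hm; apply: filterS (UU_ge m) => n mn.
rewrite /= invf_ple ?posrE// ltW//; apply: lt_trans hm _.
by rewrite ltr_nat ltnS.
Qed.

(** * A solution on the punctured space that is singular at the origin *)

Section Singular.
Context (R : realType) (d : nat) (d2 : (2 <= d)%N).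
Notation V := 'rV[R]_d.
Notation C := R[i].
Implicit Types (L : seq (C * seq 'I_d)) (x y : V) (s : seq 'I_d).

Let d0 : (0 < d)%N. Proof. exact: ltnW. Qed.

Definition punctured : set V := [set x | x != 0].

Lemma open_punctured : open punctured.
Proof.
rewrite openE => x x0; apply/nbhs_ballP; exists `|x| => /=; first by rewrite normr_gt0.
move=> y; rewrite -ball_normE /ball_ /= => h; apply/eqP => y0.
by move: h; rewrite y0 subr0 ltxx.
Qed.

Lemma ul_opL L (u : nat -> V -> C) f x : (forall s, ul (fun j => partials s (u j) x) (partials s f x)) ->
  ul (fun j => opL L (u j) x) (opL L f x).
Proof.
move=> H; rewrite /opL; elim: L => [|t L IH].
  by rewrite big_nil; apply: ul_eq (ul_cst 0); apply: UU_all => j /=; rewrite big_nil.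
rewrite big_cons; apply: ul_eq (ulD (ulZ t.1 (H t.2)) IH).
by apply: UU_all => j /=; rewrite big_cons.
Qed.

(** As no word is empty, every term is a derivative, and [II_flux] bounds its mean by boundary
    values of one derivative less. The result is of order 1/a, to be compared with the mean a^-d of
    a concentrated right-hand side. *)
Lemma flux_bound l (v : V -> C) (a D : R) : 0 < a -> 0 <= D -> smooth_on setT v ->
  (forall t, t \in l -> (0 < size t.2)%N) ->
  (forall t, t \in l -> forall x, `|x| = a -> N (partials (behead t.2) v x) <= D) ->
  N (II a (opL l v)) <= (\sum_(t <- l) N t.1) * (D / a).
Proof.
move=> a0 D0 vs; elim: l => [|t l IH] H1 H2.
  rewrite big_nil mul0r (II_eq d0 a0 (G := fun=> 0)) ?II_cst ?N0// => x _.
  by rewrite /opL big_nil.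
have B (f : V -> C) : smooth_on setT f -> exists K, bd a f K.
  by move=> fs; have [K _ h] := @cube_bounded R d a f (fun x _ => sm_cont fs I); exists K.
have [K1 B1] := B _ (sm_partials t.2 vs).
have [K2 B2] := B _ (sm_opL l openT vs).
have B3 : bd a (fun x => t.1 * partials t.2 v x) (N t.1 * K1).
  by move=> x xa; rewrite NM ler_wpM2l ?N_ge0//; exact: B1.
rewrite (II_eq d0 a0 (G := fun x => t.1 * partials t.2 v x + opL l v x)); last first.
  by move=> x _; rewrite /opL big_cons.
rewrite (IID d0 a0 B3 B2) (IIZ d0 a0 _ B1) big_cons mulrDl; apply: le_trans (ND _ _) _.
apply: lerD; last first.
  apply: IH => u ul; [apply: H1|apply: H2]; by rewrite inE ul orbT.
rewrite NM ler_wpM2l ?N_ge0//.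
have := H2 t (mem_head _ _); have := H1 t (mem_head _ _); case: (t.2) => //= i s _ h.
have := @II_flux _ _ d0 _ a0 setT i _ (D + D) openT (fun _ _ => I) (sm_partials s vs).
have -> : (D + D) / (2 * a) = D / a by field; rewrite lt0r_neq0.
apply => x y xa ya xi yi _; apply: le_trans (ND _ _) _; rewrite NN; apply: lerD; apply: h.
  apply/eqP; rewrite eq_le xa/=; apply: le_trans (rv_coord x i).
  by rewrite xi ler_norm.
apply/eqP; rewrite eq_le ya/=; apply: le_trans (rv_coord y i).
by rewrite yi normrN ler_norm.
Qed.

Context (k : nat) (c R1 : R) (L : seq (C * seq 'I_d)).
Context (k0 : (0 < k)%N) (c0 : 0 < c) (R10 : 0 <= R1) (eL : ellL k c R1 L) (nd : nondeg k L).
Context (L1 : forall t, t \in L -> (0 < size t.2)%N).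

(** [E] is the ultralimit of [v t = opL (powL n L) (u t)]. Off the origin [opL L (v t)] tends to 0,
    so [E] is a solution there. If its derivatives of order at most [k] were bounded near 0,
    [flux_bound] on a small cube around 0 would contradict the lower bound on the mean of
    [opL L (v t)]. *)
Lemma singular_sol : exists2 E : V -> C, sol L punctured E &
  forall r B : R, 0 < r -> exists s x, [/\ (size s <= k)%N, x != 0, `|x| < r & B < N (partials s E x)].
Proof.
(* With the power n + 1 the preimages [u t] are uniformly bounded; n factors of [L] are spent in
   [v t], and the last one is the equation for [E]. *)
pose n := (2 * d)%N; pose Q := powL n.+1 L.
have nk : (2 * d <= n.+1 * k)%N by rewrite /n; nia.
have [B0 [rho [B00 rho0 /choice[u hu]]]] := approx_sol d0 k0 c0 R10 eL nd nk.
have [c' c'0 eQ] := ellL_pow n.+1 c0 eL.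
have K0 : (0 < n.+1 * k)%N by rewrite muln_gt0.
have [G G1 hG] := gradient_est d0 K0 c'0 R10 eQ.
have us t : smooth_on setT (u t) by case: (hu t).
(* The functions [u t] are bounded uniformly in [t]. Derivatives follow by induction from the
   gradient estimate for [Q] on shrinking cubes avoiding 0, where [opL Q (u t)] and its derivatives
   are at most 1 for large [t]. *)
have uB s x (r : R) : 0 <= r -> r < `|x| -> exists B, UU [set t | forall y, `|y - x| <= r ->
    N (partials s (u t) y) <= B].
  elim: s r => [|i s IH] r r0 rx.
    exists (B0 * expR (rho * (2 * `|x|))); apply: UU_all => t y yx.
    have [_ /(_ y) h _ _] := hu t; apply: le_trans h _; apply: ler_wpM2l => //.
    rewrite ler_expR ler_wpM2l//; have : `|y| <= `|x| + `|y - x|.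
      by rewrite -{1}(subrK x y) addrC ler_normD.
    by move: yx rx; lra.
  pose r2 := (r + `|x|) / 2; have r2x : r2 < `|x| by rewrite /r2; lra.
  have r20 : 0 <= r2 by rewrite /r2; have := normr_ge0 x; lra.
  have [B hB] := IH r2 r20 r2x.
  pose r' := Num.min (r2 - r) 1.
  have r'0 : 0 < r' by rewrite lt_min ltr01 andbT /r2; lra.
  have r'1 : r' <= 1 by rewrite ge_min lexx orbT.
  exists (G / r' * Num.max B 1).
  have m0 : 0 < `|x| - r2 by rewrite subr_gt0.
  have /archi_boundP : 0 <= `|x| + r2 by rewrite addr_ge0// /r2; have := normr_ge0 x; lra.
  set m := Num.bound _ => hm.
  apply: filterS (filterI hB (filterI (UU_inv_small m0) (UU_ge (m + (2 * d).+1 + size s)))) => t.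
  move=> [/= h1 [h2 h3]] y yx.
  have zx z : `|z - y| <= r' -> `|z - x| <= r2.
    move=> zy; have -> : z - x = (z - y) + (y - x) by rewrite addrA subrK.
    apply: le_trans (ler_normD _ _) _; have : r' <= r2 - r by rewrite ge_min lexx.
    by move: zy yx; lra.
  apply: (hG setT (partials s (u t)) y r' _ i _ openT) => //.
  - by rewrite r'0 r'1.
  - by apply: sm_partials; exact: us.
  - by move=> z zy; apply: le_trans (h1 z (zx z zy)) _; rewrite le_max lexx.
  - move=> s' z ss zy; have zx' := zx z zy.
    rewrite (@partials_eq _ _ setT openT s' _ _ (fun y _ => esym (opL_partials Q s openT (us t) (I : setT y))))//.
    rewrite -partials_cat; have [_ _ /(_ (s' ++ s) z) h _] := hu t.
    have nz : `|x| <= `|z| + `|z - x| by rewrite distrC -{1}(subrK z x) addrC ler_normD.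
    have nz' : `|z| <= `|x| + `|z - x| by rewrite -{1}(subrK x z) addrC ler_normD.
    apply: le_trans (h _ _ _) _.
    + by rewrite size_cat; apply: leq_trans h3; rewrite leq_add2r (leq_trans ss)// leq_addl.
    + by apply: le_trans h2 _; move: nz zx'; lra.
    + apply: (@le_trans _ _ m%:R); last first.
        by rewrite ler_nat; apply: leqW; apply: leq_trans h3; rewrite -addnA leq_addr.
      by move: hm nz' zx'; lra.
    by rewrite le_max invf_le1 ?ltr0n// ler1n orbT.
pose v t := opL (powL n L) (u t).
have vs t : smooth_on setT (v t) by apply: sm_opL; [exact: openT|exact: us].
have vE s t y : partials s (v t) y = \sum_(a <- powL n L) a.1 * partials (a.2 ++ s) (u t) y.
  rewrite (opL_partials _ s openT (us t))// /opL; apply: eq_bigr => a _.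
  by rewrite partials_cat.
have vB s x (r : R) : 0 <= r -> r < `|x| -> exists B, UU [set t | forall y, `|y - x| <= r ->
    N (partials s (v t) y) <= B].
  move=> r0 rx; elim: (powL n L) (vE s) => [|a l IH] E.
    exists 0; apply: UU_all => t y _; by rewrite E big_nil N0.
  suff : exists B, UU [set t | forall y, `|y - x| <= r -> N (\sum_(a <- a :: l) a.1 * partials (a.2 ++ s) (u t) y) <= B].
    by move=> [B hB]; exists B; apply: filterS hB => t h y yx; rewrite E; exact: h.
  elim: (a :: l) => [|b q [B hB]].
    by exists 0; apply: UU_all => t y _; rewrite big_nil N0.
  have [B' hB'] := uB (b.2 ++ s) x r r0 rx.
  exists (N b.1 * B' + B); apply: filterS (filterI hB hB') => t [/= h1 h2] y yx.
  rewrite big_cons; apply: le_trans (ND _ _) _; rewrite NM lerD ?h1// ler_wpM2l ?N_ge0//.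
  exact: h2.
have vX t : smooth_on punctured (v t) := smS (fun _ _ => I) (vs t).
have ub x : punctured x -> exists2 r : R, 0 < r & (forall y, `|y - x| <= r -> punctured y) /\
    forall s, exists B : R, UU [set j | forall y, `|y - x| <= r -> N (partials s (v j) y) <= B].
  move=> x0; have nx : 0 < `|x| by rewrite normr_gt0.
  exists (`|x| / 2); first by rewrite divr_gt0.
  split=> [y h|s]; last by apply: vB; [rewrite divr_ge0|move: nx; lra].
  by apply/eqP => y0; move: h; rewrite y0 sub0r normrN; move: nx; lra.
pose E := usm v [::].
have Es : smooth_on punctured E by exact: (usm_smooth open_punctured vX ub).
have EE s x : x != 0 -> ul (fun t => partials s (v t) x) (partials s E x).
  move=> x0; rewrite /E (usm_partials open_punctured vX ub)// cats0.
  exact: (usm_ul ub).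
have LE t x : opL L (v t) x = opL Q (u t) x.
  by rewrite /Q /= (opL_comp _ _ openT (us t)).
exists E.
  split=> // x x0; apply/eqP; rewrite -N_eq0 eq_le N_ge0 andbT leNgt; apply/negP => h.
  have nx : 0 < `|x| by rewrite normr_gt0.
  have h2 : 0 < N (opL L E x) / 2 by rewrite divr_gt0.
  suff : N (opL L E x) <= N (opL L E x) / 2 by move: h; lra.
  have := ul_opL L (fun s => EE s x x0) => /ul_le; apply.
  have /archi_boundP := normr_ge0 x; set m := Num.bound _ => hm.
  apply: filterS (filterI (UU_inv_small h2) (filterI (UU_inv_small nx) (UU_ge m))) => t [/= t1 [t2 t3]].
  rewrite LE; have [_ _ /(_ [::] x isT t2) ht _] := hu t; apply: le_trans (ht _) t1.
  by apply: le_trans (ltW hm) _; rewrite ler_nat leqW.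
move=> r B r0; apply: contrapT => nH.
have EB s x : (size s <= k)%N -> x != 0 -> `|x| < r -> N (partials s E x) <= B.
  by move=> sk x0 xr; rewrite leNgt; apply/negP => h; apply: nH; exists s, x.
pose A := \sum_(t <- L) N t.1.
have A0 : 0 <= A by apply: sumr_ge0 => t _; exact: N_ge0.
pose D := `|B| + 1; have D0 : 0 <= D by rewrite addr_ge0.
have AD : 0 <= A * D by exact: mulr_ge0.
(* The second bound gives 1/a >= 2AD + 2, so that a^-d / 2 >= a^-2 / 2 exceeds the flux bound
   AD/a. *)
pose a := Num.min (r / 2) (2 * (A * D) + 2)^-1.
have q0 : 0 < 2 * (A * D) + 2 by rewrite ltr_wpDl// mulr_ge0.
have a0 : 0 < a by rewrite lt_min invr_gt0 q0 divr_gt0.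
have ar : a < r by apply: le_lt_trans (_ : r / 2 < r); [rewrite ge_min lexx|move: r0; lra].
have a2 : a <= (2 * (A * D) + 2)^-1 by rewrite ge_min lexx orbT.
have a1 : a <= 1 by apply: le_trans a2 _; rewrite invf_le1//; move: AD; lra.
(* The limit is only pointwise, while the flux needs a bound on the whole boundary of the cube.
   Violating points would cluster at some [y], where the common Lipschitz bound transports the
   violation to the limit [E]; the slack between [B] and [D] absorbs the errors. *)
have unif s : (size s <= k)%N -> UU [set t | forall x, `|x| = a -> N (partials s (v t) x) <= D].
  move=> sk; apply: contrapT => /UUnot H.
  pose i0 := Ordinal d0.
  have /choice[x hx] : forall t, exists x : V, `|x| = a /\
      (~ (forall x, `|x| = a -> N (partials s (v t) x) <= D) -> D < N (partials s (v t) x)).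
    move=> t; have [hh|/asboolPn] := pselect (forall x : V, `|x| = a -> N (partials s (v t) x) <= D).
      by exists (a *: ee R i0); rewrite normrZ norm_ee mulr1 gtr0_norm.
    move=> /asboolPn /existsNP[x /not_implyP[xa h]]; exists x; split=> // _.
    by rewrite ltNge; exact/negP.
  have [y ya hy] := cube_cluster (fun t => eq_ind_r (fun z => z <= a) (lexx a) (hx t).1).
  have ya' : a <= `|y|.
    rewrite leNgt; apply/negP => h; have h' : 0 < a - `|y| by rewrite subr_gt0.
    have [t /=] := UU_ex (hy _ h'); rewrite ltNge => /negP; apply.
    by rewrite -{1}(hx t).1; exact: lerB_dist.
  have y0 : y != 0 by rewrite -normr_gt0; apply: lt_le_trans ya'.
  have [r' [B' [r'0 _ h1 _]]] := usm_lip open_punctured vX ub s y0.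
  have e0 : 0 < Num.min r' (4 * (`|B'| + 1))^-1.
    by rewrite lt_min r'0 invr_gt0 mulr_gt0// ltr_wpDl.
  have f0 : (0 : R) < 1 / 4 by rewrite divr_gt0.
  have [t [ht1 [ht2 [ht3 ht4]]]] := UU_ex (filterI H (filterI (hy _ e0) (filterI h1 (EE s y y0 _ f0)))).
  move: ht2; rewrite /= lt_min => /andP[b1 b2].
  have := ht3 _ (ltW b1); have := (hx t).2 ht1; have := EB s y sk y0 (le_lt_trans ya ar).
  have g1 : B' * `|x t - y| <= 1 / 4.
    apply: (@le_trans _ _ ((`|B'| + 1) * `|x t - y|)).
      by apply: ler_wpM2r => //; apply: le_trans (ler_norm _) _; rewrite lerDl.
    have -> : 1 / 4 = (`|B'| + 1) * (4 * (`|B'| + 1))^-1.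
      by field; rewrite lt0r_neq0// ltr_wpDl.
    by apply: ler_wpM2l; [rewrite addr_ge0|exact: ltW].
  have := le_N (partials s (v t) (x t)) (partials s (v t) y).
  have := le_N (partials s (v t) y) (partials s E y).
  have BB := ler_norm B; move: ht4 g1 BB; rewrite /= /D.
  move: (N _) (N _) (N (partials s E y)) => z1 z2 z3; move: (N _) (N _) (B' * _) `|B| => z4 z5 z6 z7.
  lra.
have sb t : t \in L -> (size (behead t.2) <= k)%N.
  by move=> tL; rewrite size_behead (leq_trans (leq_pred _))// eL.1.
have := UU_list (fun t (tL : t \in L) => unif (behead t.2) (sb t tL)) => H1.
have [t [/= t1 t2]] := UU_ex (filterI H1 (UU_inv_small a0)).
have [_ _ _ /(_ a t2 a1)] := hu t.
have := flux_bound a0 D0 (vs t) L1 t1.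
rewrite (II_eq d0 a0 (fun x _ => LE t x)) -/A => h1 h2.
have h3 := le_trans h2 h1.
have h4 : (a ^+ d)^-1 >= a^-1 * a^-1.
  rewrite -invfM lef_pV2 ?posrE ?exprn_gt0 ?mulr_gt0// -expr2.
  by apply: ler_wiXn2l => //; exact: ltW.
have h5 : 2 * (A * D) + 2 <= a^-1 by rewrite -[leLHS]invrK lef_pV2 ?posrE ?invr_gt0.
have h6 : 0 < a^-1 by rewrite invr_gt0.
have h7 := ler_wpM2l (ltW h6) h5.
move: h3 h4 h6 h7; rewrite mulrA; move: (a ^+ d)^-1 (A * D) a^-1 => z1 z2 z3.
lra.
Qed.

End Singular.

(** * Points dominated by a compact set *)

Section Compactness.
Context (R : realType) (d : nat).
Notation V := 'rV[R]_d.
Implicit Types (x y z : V) (K X A : set V).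

Lemma compact_dist K X : compact K -> open X -> K `<=` X ->
  exists2 r : R, 0 < r & forall x z, K x -> `|z - x| < r -> X z.
Proof.
move=> cK oX KX; apply: contrapT => H.
have /choice[u hu] : forall n : nat, exists u : V * V, [/\ K u.1, `|u.2 - u.1| < n.+1%:R^-1 & ~ X u.2].
  move=> n; apply: contrapT => nu; apply: H; exists n.+1%:R^-1; first by rewrite invr_gt0.
  by move=> x z Kx xz; apply: contrapT => nX; apply: nu; exists (x, z).
have uK n : K (u n).1 by case: (hu n).
have [p Kp hp] := compact_seq cK uK.
have [r r0 hr] := open_ball oX (KX _ Kp).
have r2 : 0 < r / 2 by rewrite divr_gt0.
have [m /= hm] := UU_ex (UU_inv_small r2).
have [n mn hn] := hp _ m r2; have [_ h1 h2] := hu n; apply: h2; apply: hr.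
have -> : (u n).2 - p = ((u n).2 - (u n).1) + ((u n).1 - p) by rewrite addrA subrK.
apply: le_lt_trans (ler_normD _ _) _.
have h3 : n.+1%:R^-1 <= m.+1%:R^-1 :> R by rewrite lef_pV2 ?posrE ?ltr0n// ler_nat ltnS.
by rewrite [r]splitr; apply: ltrD hn; apply: lt_le_trans h1 (le_trans h3 hm).
Qed.

Lemma compact_of_ball A (r : R) : (forall x, A x -> `|x| <= r) ->
  (forall x, ~ A x -> exists2 e : R, 0 < e & forall y, `|y - x| < e -> ~ A y) -> compact A.
Proof.
move=> Ar Ac; apply: bounded_closed_compact.
  by exists r; split; [exact: num_real|move=> M rM x Ax; apply: le_trans (Ar _ Ax) (ltW rM)].
rewrite -[A]setCK; apply: open_closedC; rewrite openE => x nA.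
by have [e e0 h] := Ac x nA; apply: filterS (nbhs_ball_norm (x : V) e0).
Qed.

Lemma compact_bounded K : compact K -> exists2 M : R, 0 < M & forall x, K x -> `|x| <= M.
Proof.
move=> cK; have [M M0 h] : exists2 M, 0 < M & forall x, K x -> N ((`|x|)%:C : R[i]) <= M.
  apply: compact_bounded_fun => // x _ e e0; exists e => // y h.
  by rewrite -(rmorphB (real_complex R)) N_real; apply: le_lt_trans h; exact: ler_dist_dist.
by exists M => // x /h; rewrite N_real normr_id.
Qed.

Lemma compact_nbhd K (r : R) : compact K -> 0 <= r ->
  compact [set y | exists2 x, K x & `|y - x| <= r].
Proof.
move=> cK r0; have [M M0 hM] := compact_bounded cK.
apply: (@compact_of_ball _ (M + r)) => [y [x Kx yx]|y ny].
  rewrite -(subrK x y) addrC; apply: le_trans (ler_normD _ _) _; apply: lerD => //; exact: hM.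
apply: contrapT => H.
have /choice[u hu] : forall n : nat, exists u : V * V, [/\ K u.1, `|u.2 - u.1| <= r & `|u.2 - y| < n.+1%:R^-1].
  move=> n; apply: contrapT => nu; apply: H; exists n.+1%:R^-1; first by rewrite invr_gt0.
  by move=> z zy [x Kx zx]; apply: nu; exists (x, z).
have uK n : K (u n).1 by case: (hu n).
have [p Kp hp] := compact_seq cK uK; apply: ny; exists p => //.
rewrite leNgt; apply/negP => h; have r2 : 0 < (`|y - p| - r) / 2 by rewrite divr_gt0// subr_gt0.
have [m /= hm] := UU_ex (UU_inv_small r2).
have [n mn hn] := hp _ m r2; have [_ h1 h2] := hu n.
have : `|y - p| <= `|(u n).2 - y| + (`|(u n).2 - (u n).1| + `|(u n).1 - p|).
  rewrite [`|_ - y|]distrC -[y - p](_ : (y - (u n).2) + (((u n).2 - (u n).1) + ((u n).1 - p)) = _).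
    by apply: le_trans (ler_normD _ _) _; rewrite lerD2l; exact: ler_normD.
  by rewrite !addrA !subrK.
have h3 : n.+1%:R^-1 <= m.+1%:R^-1 :> R by rewrite lef_pV2 ?posrE ?ltr0n// ler_nat ltnS.
have := lt_le_trans h2 (le_trans h3 hm); move: h1 hn h.
by move: (`|y - p|) (`|_ - y|) (`|_ - _|) (`|_ - p|) => v1 v2 v3 v4; lra.
Qed.

Lemma annulus_bounded (E : V -> R[i]) (a b : R) : smooth_on (@punctured R d) E -> 0 < a ->
  exists2 M, 0 < M & forall x, a <= `|x| -> `|x| <= b -> N (E x) <= M.
Proof.
move=> Es a0.
have [M M0 h] : exists2 M, 0 < M & forall x, [set x | a <= `|x| /\ `|x| <= b] x -> N (E x) <= M.
  apply: compact_bounded_fun => [|x [ax _]].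
    apply: (@compact_of_ball _ b) => [x [_]//|x nx].
    have [xa|ax] := ltP `|x| a.
      exists (a - `|x|); first by rewrite subr_gt0.
      move=> y h [ay _]; have : `|y| <= `|x| + `|y - x| by rewrite -{1}(subrK x y) addrC ler_normD.
      by move: h ay; lra.
    have bx : b < `|x| by rewrite ltNge; apply/negP => h; apply: nx.
    exists (`|x| - b); first by rewrite subr_gt0.
    move=> y h [_ yb]; have : `|x| <= `|y| + `|y - x| by rewrite distrC -{1}(subrK y x) addrC ler_normD.
    by move: h yb; lra.
  by apply: (sm_cont Es); rewrite /punctured /= -normr_gt0; apply: lt_le_trans ax.
by exists M => // x h1 h2; apply: h.
Qed.

End Compactness.

(** * Derivative growth near a pole and confinement of dominated points *)

Section Hull.
Context (R : realType) (d : nat) (d2 : (2 <= d)%N).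
Notation V := 'rV[R]_d.
Notation C := R[i].
Implicit Types (x y z p : V) (s : seq 'I_d) (K X : set V).

Let d0 : (0 < d)%N. Proof. exact: ltnW. Qed.

Context (k : nat) (c R1 : R) (L : seq (C * seq 'I_d)).
Context (k0 : (0 < k)%N) (c0 : 0 < c) (R10 : 0 <= R1) (eL : ellL k c R1 L) (nd : nondeg k L).
Context (L1 : forall t, t \in L -> (0 < size t.2)%N).

Lemma geo_le (D b1 b2 : R) f x : 0 <= D -> 0 < b2 -> b2 <= b1 -> geo D b1 f x -> geo D b2 f x.
Proof.
move=> D0 b20 b12 H s; apply: le_trans (H s) _; apply: ler_wpM2l; first exact: mulr_ge0.
have b10 : 0 < b1 by apply: lt_le_trans b12.
by rewrite lef_pV2 ?posrE ?exprn_gt0//; apply: lerXn2r => //; rewrite nnegrE ltW.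
Qed.

(** Moving in direction [i] leaves the nonzero coordinate [j] fixed, which keeps the segment away
    from the pole. The loss of radius is [|t|], however small that coordinate is. *)
Lemma geo_seg E p i j (t D beta : R) : sol L (@punctured R d) E -> 0 <= D -> 0 < beta ->
  j != i -> p 0 j != 0 -> `|t| < beta -> geo D beta E p -> geo D (beta - `|t|) E (p + t *: ee R i).
Proof.
move=> Es D0 b0 ji pj tb G; set q := `|p 0 j|; have q0 : 0 < q by rewrite normr_gt0.
pose r := Num.min (q / 2) 1; have r0 : 0 < r by rewrite lt_min ltr01 divr_gt0.
have r1 : r <= 1 by rewrite ge_min lexx orbT.
have rq : r <= q / 2 by rewrite ge_min lexx.
have q2 : 0 < q / 2 by rewrite divr_gt0.
have [M M0 hM] := annulus_bounded (`|p| + `|t| + 1) Es.1 q2.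
apply: (geo_move d0 k0 c0 R10 eL (@open_punctured R d) Es (r := r) (M := M)) => //; first by rewrite r0.
move=> u /andP[u0 u1] y yr.
have yj : q / 2 <= `|y|.
  apply: le_trans (rv_coord y j); have := le_trans (rv_coord _ j) yr; rewrite !mxE eqxx /= (negPf ji) mulr0 addr0.
  have : q <= `|y 0 j| + `|y 0 j - p 0 j| by rewrite distrC /q -{1}(subrK (y 0 j) (p 0 j)) addrC ler_normD.
  by move: rq; lra.
have yb : `|y| <= `|p| + `|t| + 1.
  rewrite -(subrK (p + (u * t) *: ee R i) y) addrC; apply: le_trans (ler_normD _ _) _.
  apply: lerD; last exact: le_trans r1.
  apply: le_trans (ler_normD _ _) _; rewrite lerD2l normrZ norm_ee mulr1 normrM ger0_norm//.
  by rewrite ler_piMl.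
split; last exact: hM.
by rewrite /punctured /= -normr_gt0; apply: lt_le_trans yj.
Qed.

Lemma geo_seq E p x b (D beta w : R) (r : seq 'I_d) : sol L (@punctured R d) E -> 0 <= D -> 0 < w ->
  b \notin r -> p 0 b != 0 -> (forall i, `|x 0 i - p 0 i| <= w) -> (size r)%:R * w < beta ->
  geo D beta E p -> geo D (beta - (size r)%:R * w) E (\row_i if i \in r then x 0 i else p 0 i).
Proof.
move=> Es D0 w0 + pb hw + G; elim: r => [|i r IH] br rb.
  rewrite mul0r subr0; have -> : \row_i (if i \in [::] then x 0 i else p 0 i) = p by apply/rowP => i; rewrite mxE.
  by [].
move: br; rewrite inE negb_or => /andP[bi br].
have rb' : (size r)%:R * w + w < beta by move: rb; rewrite /= -natr1 mulrDl mul1r.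
have h1 : (size r)%:R * w < beta by move: rb'; have := w0; lra.
have G' := IH br h1.
set q := \row_i _ in G'; pose t := x 0 i - q 0 i.
have tw : `|t| <= w.
  by rewrite /t mxE; case: ifP => _; rewrite ?subrr ?normr0 ?(ltW w0).
have b' : 0 < beta - (size r)%:R * w by rewrite subr_gt0.
have qb : q 0 b != 0 by rewrite mxE (negPf br).
have tb : `|t| < beta - (size r)%:R * w by apply: le_lt_trans tw _; move: rb'; lra.
have := geo_seg Es D0 b' bi qb tb G'.
have -> : q + t *: ee R i = \row_k if k \in i :: r then x 0 k else p 0 k.
  apply/rowP => m; rewrite !mxE eqxx /= inE.
  by case: eqP => [->|_] /=; rewrite ?mulr1 ?mulr0 ?addr0// /t mxE addrC subrK.
apply: geo_le => //; rewrite -[(size _)%:R]/((size r).+1%:R) -natr1 mulrDl mul1r.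
  by move: rb'; lra.
by move: tw; lra.
Qed.

(* Any two points near 0 are joined by a short path of axis-parallel segments avoiding 0, because d >= 2. *)
Lemma pole_spread E p x (D beta eta : R) : sol L (@punctured R d) E -> 0 <= D -> 0 < eta ->
  (4 * d.+2%:R) * eta < beta -> p != 0 -> x != 0 -> `|p| <= eta -> `|x| <= eta ->
  geo D beta E p -> geo D (beta / 2) E x.
Proof.
move=> Es D0 e0 eb p0 x0 pe xe G.
have nz (z : V) : z != 0 -> exists i, z 0 i != 0.
  move=> z0; apply: contrapT => H; move: z0; apply/negP; rewrite negbK; apply/eqP/rowP => i.
  by rewrite mxE; apply/eqP; apply: contrapT => /negP h; apply: H; exists i.
have [a pa] := nz p p0.
have [b ab] : exists b : 'I_d, a != b.
  pose i0 := Ordinal d0; pose i1 := Ordinal d2.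
  by have [->|] := eqVneq a i0; [exists i1|exists i0].
(* Coordinate [b] is first moved to the nonzero value [h] while coordinate [a] keeps the path off 0.
   Then [h] protects the change of all other coordinates, and if [x 0 b = 0] another nonzero
   coordinate of [x] protects the final return. The total length stays below half of [beta]. *)
pose h := if x 0 b == 0 then eta else x 0 b.
have h0 : h != 0 by rewrite /h; case: ifPn => // _; rewrite lt0r_neq0.
have he : `|h| <= eta.
  by rewrite /h; case: ifP => _; rewrite ?(gtr0_norm e0)//; exact: le_trans (rv_coord _ _) xe.
have pi_ i : `|p 0 i| <= eta by apply: le_trans (rv_coord _ _) pe.
have xi_ i : `|x 0 i| <= eta by apply: le_trans (rv_coord _ _) xe.
have dR : (d.+2%:R : R) = d%:R + 2 by rewrite -[d.+2]addn2 natrD.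
have dd : (0 : R) <= d%:R * eta by apply: mulr_ge0 => //; exact: ltW.
rewrite dR in eb.
have b0 : 0 < beta by move: eb dd e0; lra.
have tw : `|h - p 0 b| <= 2 * eta.
  by apply: le_trans (ler_normB _ _) _; have := pi_ b; move: he; lra.
have tb : `|h - p 0 b| < beta by apply: le_lt_trans tw _; move: eb dd e0; lra.
have := geo_seg Es D0 b0 ab pa tb G; set q := p + _ => G1.
have qE i : q 0 i = if i == b then h else p 0 i.
  by rewrite !mxE eqxx /=; case: eqP => [->|_]; rewrite ?mulr1 ?mulr0 ?addr0// addrC subrK.
have {}G1 : geo D (beta - 2 * eta) E q.
  by apply: geo_le G1 => //; move: tw eb dd e0; lra.
pose x' : V := \row_i if i == b then h else x 0 i.
pose r := [seq i <- enum 'I_d | i != b].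
have br : b \notin r by rewrite mem_filter eqxx.
have sr : (size r <= d)%N by rewrite -[leqRHS](size_enum_ord d) size_filter count_size.
have srR : (size r)%:R * (2 * eta) <= d%:R * (2 * eta).
  by apply: ler_wpM2r; [rewrite mulr_ge0// ltW|rewrite ler_nat].
have qb : q 0 b != 0 by rewrite qE eqxx.
have hw i : `|x' 0 i - q 0 i| <= 2 * eta.
  rewrite qE mxE; case: eqP => _; first by rewrite subrr normr0 mulr_ge0// ltW.
  by apply: le_trans (ler_normB _ _) _; have := pi_ i; have := xi_ i; lra.
have e2 : 0 < 2 * eta by rewrite mulr_gt0.
have sb : (size r)%:R * (2 * eta) < beta - 2 * eta by move: srR eb dd e0; lra.
have := geo_seq Es D0 e2 br qb hw sb G1.
have -> : \row_i (if i \in r then x' 0 i else q 0 i) = x'.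
  apply/rowP => i; rewrite mxE qE mem_filter mem_enum andbT !mxE.
  by case: eqP.
have [xb|xb] := eqVneq (x 0 b) 0; last first.
  have -> : x' = x.
    apply/rowP => i; rewrite mxE; case: eqP => [->|//]; by rewrite /h (negPf xb).
  apply: geo_le => //; first by rewrite divr_gt0.
  by move: srR eb dd e0; lra.
have [m xm] := nz x x0.
have mb : m != b by apply: contraNneq xm => ->; rewrite xb.
have x'm : x' 0 m != 0 by rewrite mxE (negPf mb).
move=> G2; have b2 : 0 < beta - 2 * eta - (size r)%:R * (2 * eta) by rewrite subr_gt0.
have tb2 : `|- h| < beta - 2 * eta - (size r)%:R * (2 * eta).
  by rewrite normrN; move: he srR eb dd e0; lra.
have := geo_seg Es D0 b2 mb x'm tb2 G2.
have -> : x' + - h *: ee R b = x.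
  apply/rowP => i; rewrite !mxE eqxx /=; case: eqP => [->|_]; rewrite ?mulr0 ?addr0// mulr1 subrr xb//.
apply: geo_le => //; first by rewrite divr_gt0.
by rewrite normrN; move: he srR eb dd e0; lra.
Qed.

(** A bound [geo] at [p] with radius large compared with [|p|] would spread to all points near the
    pole and bound the derivatives of order at most [k] there. The constant [D] is arbitrary: only
    the radius decides, which makes uncontrolled domination constants harmless. *)
Lemma pole_fun : exists2 E : V -> C, sol L (@punctured R d) E &
  forall D beta p, 0 <= D -> 0 < beta -> p != 0 -> (5 * d.+2%:R) * `|p| <= beta -> ~ geo D beta E p.
Proof.
have [E Es H] := singular_sol d2 k0 c0 R10 eL nd L1; exists E => // D beta p D0 b0 p0 pb G.
have np : 0 < `|p| by rewrite normr_gt0.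
pose B := \sum_(m < k.+1) D * m`!%:R / (beta / 2) ^+ m.+1.
have [s [x [sk x0 xp]]] := H `|p| B np; apply/negP; rewrite -leNgt.
have h : (4 * d.+2%:R) * `|p| < beta.
  by apply: lt_le_trans pb; rewrite ltr_pM2r// ltr_pM2r ?ltr0n// ltr_nat.
have G' := pole_spread Es D0 np h p0 x0 (lexx _) (ltW xp) G.
apply: le_trans (G' s) _.
have sk' : (size s < k.+1)%N by rewrite ltnS.
rewrite /B (bigD1 (Ordinal sk'))//= lerDl; apply: sumr_ge0 => m _.
by rewrite divr_ge0 ?mulr_ge0 ?exprn_ge0// divr_ge0// ltW.
Qed.

Lemma sol_ex (z : 'I_d -> C) X : sym L z = 0 -> sol L X (ex z).
Proof.
move=> z0; split; first exact: smS (@subsetT _ _) (@sm_ex _ _ z).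
by move=> x _; rewrite opL_ex z0 mul0r.
Qed.

(** [zero_dir] is used with [v] another basis vector and [n] the [j]-th one: all entries but the
    [j]-th are imaginary, so the modulus of the exponential depends on [x_j] alone. The sign and
    size of [q] choose the direction and the rate of growth. *)
Lemma axis_exp (j : 'I_d) (sg A : R) : `|sg| = 1 -> exists z : 'I_d -> C, [/\ sym L z = 0,
  forall i, i != j -> complex.Re (z i) = 0 & A <= sg * complex.Re (z j)].
Proof.
move=> sg1.
have [l lj] : exists l : 'I_d, l != j.
  pose i0 := Ordinal d0; pose i1 := Ordinal d2.
  by have [->|] := eqVneq j i0; [exists i1|rewrite eq_sym; exists i0].
have ej : ee R j != 0 by rewrite -normr_eq0 norm_ee oner_neq0.
have vn (a : R) : ee R l + a *: ee R j != 0.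
  apply/eqP => /rowP /(_ l); rewrite !mxE !eqxx /= (negPf lj) mulr0 addr0 => /eqP.
  by rewrite oner_eq0.
have [tau [tau0 _ H]] := zero_dir k0 eL.1 nd ej vn.
have e0 : 0 < `|complex.Re tau| / 2 by rewrite divr_gt0 ?normr_gt0.
have [q0 hq] := H _ e0.
have sgt : Num.sg (complex.Re tau) * complex.Re tau = `|complex.Re tau| by rewrite normrEsg.
pose Q := `|q0| + `|A| / (`|complex.Re tau| / 2).
have A0 : 0 <= `|A| / (`|complex.Re tau| / 2) by rewrite divr_ge0// ltW.
have Q0 : 0 <= Q by rewrite addr_ge0.
pose q := sg * Num.sg (complex.Re tau) * Q.
have nq : `|q| = Q.
  by rewrite !normrM sg1 mul1r normr_sg tau0 mul1r (ger0_norm Q0).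
have qq : q0 <= `|q| by rewrite nq; apply: le_trans (ler_norm _) _; rewrite lerDl.
have [rho hr hz] := hq q qq.
exists (fun i => 'i * (q * ee R l 0 i)%:C + rho * (ee R j 0 i)%:C); split=> //.
  move=> i ij; rewrite !mxE eqxx /= (negPf ij) mulr0 addr0 mulrC ReM_real /= mulr0 //.
rewrite !mxE !eqxx /= eq_sym (negPf lj) mulr0 mulr1 mulr0 add0r.
have rr : complex.Re (rho * 1%:C) = complex.Re rho by rewrite mulr1.
have h1 : `|complex.Re (rho - q%:C * tau)| <= `|complex.Re tau| / 2 * Q.
  by apply: le_trans (Re_le _) _; rewrite -nq.
move: h1; rewrite ReD ReN ReM_real => h1.
have sg2 : sg * sg = 1 by rewrite -expr2 -real_normK ?num_real// sg1 expr1n.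
have h2 : sg * (q * complex.Re tau) = `|complex.Re tau| * Q.
  by rewrite /q -sgt; transitivity (sg * sg * (Num.sg (complex.Re tau) * complex.Re tau * Q)); [ring|rewrite sg2 mul1r].
have h3 : sg * (q * complex.Re tau) - sg * complex.Re rho <= `|complex.Re tau| / 2 * Q.
  rewrite -mulrBr; apply: le_trans (ler_norm _) _; rewrite normrM sg1 mul1r distrC //.
have h4 : `|A| <= `|complex.Re tau| / 2 * Q.
  by rewrite /Q mulrDr [X in _ + X]mulrC divfK ?lt0r_neq0// lerDr mulr_ge0// ltW.
have := ler_norm A; move: h2 h3 h4; move: (`|complex.Re tau|) => T; lra.
Qed.

Lemma N_ex_axis (z : 'I_d -> C) j x : (forall i, i != j -> complex.Re (z i) = 0) ->
  N (ex z x) = expR (complex.Re (z j) * x 0 j).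
Proof.
move=> h; rewrite N_ex (bigD1 j)//= big1 ?addr0// => i ij.
by rewrite h// mul0r.
Qed.

(* Exponential solutions bound y; translates of the singular solution, with pole at a point
   outside X, keep y away from the complement of X. *)
Lemma hull K X : compact K -> open X -> K `<=` X -> exists D r : R, 0 < r /\
  forall B y, 0 <= B -> X y -> (forall f M, 0 <= M -> sol L X f -> (forall x, K x -> N (f x) <= M) -> N (f y) <= B * M) ->
   `|y| <= D /\ forall z, `|z - y| < r -> X z.
Proof.
move=> cK oX KX; have [D D0 hD] := compact_bounded cK.
have [e e0 he] := compact_dist cK oX KX.
have [G G1 hG] := analytic_est d0 k0 c0 R10 eL.
have [E Es HE] := pole_fun.
have G0 : 0 < G by apply: lt_le_trans G1.
pose r0 := Num.min (e / 2) 1; have r00 : 0 < r0 by rewrite lt_min ltr01 divr_gt0.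
have r01 : 0 < r0 <= 1 by rewrite r00 ge_min lexx orbT.
(* [beta] is a common radius for the derivative bounds on [K] of all translates with pole outside
   [X]; [r] converts it into the distance at which [pole_fun] applies. Neither involves [B]. *)
pose beta := r0 / G; have b0 : 0 < beta by rewrite divr_gt0.
pose r := beta / (5 * d.+2%:R).
have d5 : 0 < 5 * d.+2%:R :> R by rewrite mulr_gt0// ltr0n.
have rp : 0 < r by rewrite divr_gt0.
exists D, r; split=> // B y B0 Xy dom; split.
  apply/rv_leP => [|j]; first exact: ltW.
  rewrite leNgt; apply/negP => hj; set a := y 0 j in hj.
  have a0 : a != 0 by rewrite -normr_gt0; apply: lt_trans hj.
  pose g := `|a| - D; have g0 : 0 < g by rewrite subr_gt0.
  have sa : `|Num.sg a| = 1 by rewrite normr_sg a0.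
  (* Domination will give exp(|T| g) <= B, whereas this rate makes |T| g at least B + 1. *)
  have [z [z0 zi zj]] := @axis_exp j (Num.sg a) ((B + 1) / g) sa.
  pose T := complex.Re (z j).
  have B1 : 0 < (B + 1) / g by rewrite divr_gt0// ltr_wpDl.
  have TT : Num.sg a * T = `|T|.
    have : 0 < Num.sg a * T by apply: lt_le_trans zj.
    by move=> h; rewrite -(gtr0_norm h) normrM normr_sg a0 mul1r.
  have := dom _ (expR (`|T| * D)) (expR_ge0 _) (@sol_ex z X z0) _; rewrite (N_ex_axis _ zi) -/T -/a => H.
  have {}H : expR (T * a) <= B * expR (`|T| * D).
    apply: H => x Kx; rewrite (N_ex_axis _ zi) ler_expR -/T; apply: le_trans (ler_norm _) _.
    by rewrite normrM ler_wpM2l//; apply: le_trans (rv_coord _ _) (hD x Kx).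
  have E1 : T * a = `|T| * D + `|T| * g.
    by rewrite -mulrDr /g addrC subrK -TT (normrEsg a); have := mulr_sg_norm a; transitivity (T * (Num.sg a * Num.sg a * a)); [rewrite -expr2 sqr_sg a0 mul1r|ring].
  move: H; rewrite E1 expRD mulrC ler_pM2r ?expR_gt0// => H.
  have : 1 + `|T| * g <= B by apply: le_trans H; exact: expR_ge1Dx.
  have : B + 1 <= `|T| * g by rewrite -ler_pdivrMr// -TT.
  by lra.
move=> z zy; apply: contrapT => nX.
(* The translate of [E] with pole at [z], which is a solution on all of [X] as [z] lies outside; the
   affine form makes [sm_affine] and [partials_affine] applicable. *)
pose H x := E (- z + 1 *: x).
have sub x : X x -> [set h | (@punctured R d) (- z + 1 *: h)] x.
  move=> Xx; rewrite /punctured /= scale1r addrC subr_eq0.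
  by apply: contra_notN nX => /eqP <-.
have part s x : X x -> partials s H x = partials s E (x - z).
  move=> /sub Xx; rewrite /H (partials_affine s (@open_punctured R d) Es.1 Xx).
  by rewrite expr1n mul1r scale1r addrC.
have Hs : sol L X H.
  split; first exact: (smS sub (@sm_affine _ _ _ _ (- z) 1 (@open_punctured R d) Es.1)).
  move=> x Xx; rewrite /opL; under eq_bigr do rewrite part//.
  apply: Es.2; have := sub x Xx; by rewrite /= scale1r addrC.
pose Rb := D + `|z| + 1.
have e20 : 0 < e / 2 by rewrite divr_gt0.
have [M M0 hM] := annulus_bounded Rb Es.1 e20.
have est s x : K x -> N (partials s H x) <= (size s)`!%:R * (G / r0) ^+ size s * M.
  move=> Kx; have xe w : `|w - x| <= r0 -> e / 2 <= `|w - z| /\ `|w - z| <= Rb.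
    move=> wx; have r0e : r0 <= e / 2 by rewrite ge_min lexx.
    have r0l : r0 <= 1 by case/andP: r01.
    have zx : e <= `|z - x| by rewrite leNgt; apply/negP => h; apply: nX; apply: he h.
    split.
      have : `|z - x| <= `|w - z| + `|w - x|.
        by rewrite [`|w - z|]distrC -[z - x](_ : (z - w) + (w - x) = _) ?ler_normD// addrA subrK.
      by move: wx zx r0e; lra.
    apply: le_trans (ler_normB _ _) _.
    have : `|w| <= `|x| + `|w - x| by rewrite -{1}(subrK x w) addrC ler_normD.
    by have := hD x Kx; rewrite /Rb; move: wx r0l; lra.
  have Xw w : `|w - x| <= r0 -> X w.
    move=> wx; apply: (he x) => //; apply: le_lt_trans wx _.
    by apply: le_lt_trans (_ : e / 2 < _); [rewrite ge_min lexx|move: e0; lra].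
  apply: (hG X H x r0 M s r01 oX) => // w wx.
  have [h1 h2] := xe w wx; have := hM (w - z) h1 h2; by rewrite /H scale1r addrC.
have p0 : y - z != 0 by have := sub y Xy; rewrite /= scale1r addrC.
have pb : (5 * d.+2%:R) * `|y - z| <= beta.
  by rewrite distrC mulrC -ler_pdivlMr//; exact: ltW.
(* The factor [beta] compensates the additional power of [beta] in the denominator of [geo]. *)
have DD : 0 <= B * M * beta by apply: mulr_ge0; [apply: mulr_ge0 => //; exact: ltW|exact: ltW].
apply: (HE _ beta _ DD b0 p0 pb) => s.
have M1 : 0 <= (size s)`!%:R * (G / r0) ^+ size s * M.
  by rewrite !mulr_ge0 ?exprn_ge0 ?divr_ge0 ?(ltW M0) ?(ltW G0) ?(ltW r00).
rewrite -part//; apply: le_trans (dom _ _ M1 (sol_partials s oX Hs) (est s)) _.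
rewrite le_eqVlt; apply/orP; left; apply/eqP.
have -> : G / r0 = beta^-1 by rewrite /beta invfM invrK mulrC.
rewrite exprVn exprS; have b1 : beta ^+ size s != 0 by rewrite expf_neq0// lt0r_neq0.
by move: (lt0r_neq0 b0) b1; clearbody beta; move: (beta ^+ size s) => bb b2 b3; field; rewrite b2 b3.
Qed.

End Hull.

(** * Regularity of the composition map *)

Section ChainRule.
Context (R : realType) (d : nat) (d0 : (0 < d)%N).
Notation V := 'rV[R]_d.
Notation C := R[i].
Implicit Types (x y z : V) (s : seq 'I_d) (X Y : set V) (g : V -> C).

Lemma common_radius (T : finType) (P : T -> R -> Prop) :
  (forall b, exists2 r : R, 0 < r & P b r) -> (forall b r r', r' <= r -> P b r -> P b r') ->
  exists2 r : R, 0 < r & forall b, P b r.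
Proof.
move=> H mono; have /choice[r hr] : forall b, exists r : R, 0 < r /\ P b r.
  by move=> b; have [r r0 Pr] := H b; exists r.
have i0 b : 0 <= (r b)^-1 by rewrite invr_ge0 ltW// (hr b).1.
have S0 : 0 <= \sum_b (r b)^-1 by apply: sumr_ge0.
exists (1 + \sum_b (r b)^-1)^-1 => [|b]; first by rewrite invr_gt0 ltr_wpDr.
apply: mono (hr b).2; rewrite invf_ple ?posrE ?ltr_wpDr ?(hr b).1//.
by rewrite (bigD1 b)//= addrCA lerDl addr_ge0// sumr_ge0.
Qed.

(** After subtracting the linear part, the gradient is small near [y] by continuity of the partial
    derivatives, and [lip_cube] integrates it along an axis-parallel path of at most [d]
    segments. *)
Lemma total_diff Y g y (e : R) : open Y -> smooth_on Y g -> Y y -> 0 < e ->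
  exists2 r : R, 0 < r & forall z, `|z - y| <= r ->
    N (g z - g y - \sum_b partial b g y * (z 0 b - y 0 b)%:C) <= e * `|z - y|.
Proof.
move=> oY gs Yy e0; have [r0 r00 h0] := open_ball oY Yy.
have dR : 0 < d%:R :> R by rewrite ltr0n.
have ed : 0 < e / d%:R by rewrite divr_gt0.
have [r1 r10 h1] : exists2 r : R, 0 < r & forall b : 'I_d, forall z, `|z - y| < r ->
    N (partial b g z - partial b g y) < e / d%:R.
  apply: common_radius => [b|b r r' rr h z zr]; last by apply: h; exact: lt_le_trans rr.
  exact: (sm_cont (sm_partial b gs) Yy ed).
pose r := Num.min r0 r1 / 2; have m0 : 0 < Num.min r0 r1 by rewrite lt_min r00.
have r2 : 0 < r by rewrite divr_gt0.
have rl : r < r0 /\ r < r1.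
  have : Num.min r0 r1 <= r0 by rewrite ge_min lexx.
  have : Num.min r0 r1 <= r1 by rewrite ge_min lexx orbT.
  by rewrite /r; split; lra.
exists r => // z zr.
pose l (z : V) : C := \sum_b partial b g y * (z 0 b)%:C.
have ls : smooth_on Y l.
  by apply: (sm_sum oY) => b; apply: (smZ oY); apply: smS (@sm_coord R d b).
have Gs : smooth_on Y (fun z => g z - l z) by exact: (smB oY gs ls).
have lE i x : Y x -> partial i l x = partial i g y.
  move=> Yx; have := @cder_sum _ _ _ (index_enum 'I_d) (fun b (z : V) => partial b g y * (z 0 b)%:C)
    (fun b => partial b g y * ((b == i)%:R)) x (ee R i) (fun b => cderZ _ (cder_coord x b i)).
  move=> /cder_partial[_ ->]; rewrite (bigD1 i)//= eqxx mulr1 big1 ?addr0// => b bi.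
  by rewrite (negPf bi) mulr0.
have Yz' x : `|x - y| <= r -> Y x by move=> h; apply: h0; exact: le_lt_trans rl.1.
have := @lip_cube _ _ _ (fun z => g z - l z) y z r (e / d%:R) oY Yz' Gs _ zr.
have -> : d%:R * (e / d%:R) = e by rewrite mulrC divfK// lt0r_neq0.
have -> : g z - l z - (g y - l y) = g z - g y - \sum_b partial b g y * (z 0 b - y 0 b)%:C.
  have -> : \sum_b partial b g y * (z 0 b - y 0 b)%:C = l z - l y.
    by rewrite /l -sumrB; apply: eq_bigr => b _; rewrite rmorphB /= mulrBr.
  by ring.
apply=> i x xr; have Yx := Yz' _ xr.
have := cderB (sm_cder i gs Yx) (sm_cder i ls Yx); rewrite lE// => /cder_partial[_ ->].
by apply: ltW; apply: h1; exact: le_lt_trans rl.2.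
Qed.

Lemma chain_rule Y g (psi : V -> V) x v (m : 'I_d -> C) : open Y -> smooth_on Y g -> Y (psi x) ->
  (forall b, cder (fun x => (psi x 0 b)%:C) x v (m b)) ->
  cder (fun x => g (psi x)) x v (\sum_b partial b g (psi x) * m b).
Proof.
move=> oY gs Yx H; apply/cderP => e e0.
pose B := \sum_b N (partial b g (psi x)); pose K := 1 + \sum_b (N (m b) + 1).
have B0 : 0 <= B by apply: sumr_ge0 => b _; exact: N_ge0.
have K0 : 0 < K by rewrite ltr_wpDr// sumr_ge0// => b _; rewrite addr_ge0 ?N_ge0.
have e1 : 0 < e / (2 * K) by rewrite divr_gt0// mulr_gt0.
have e2 : 0 < e / (2 * (B + 1)) by rewrite divr_gt0// mulr_gt0// ltr_wpDl.
have [r1 r10 h1] := total_diff oY gs Yx e1.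
pose e3 := Num.min 1 (e / (2 * (B + 1))); have e30 : 0 < e3 by rewrite lt_min ltr01.
have [r2 r20 h2] : exists2 r : R, 0 < r & forall b t, `|t| < r ->
   N ((psi (x + t *: v) 0 b)%:C - (psi x 0 b)%:C - t%:C * m b) <= e3 * `|t|.
  apply: common_radius => [b|b r r' rr h t tr]; last by apply: h; exact: lt_le_trans rr.
  by have /cderP := H b; exact.
exists (Num.min r2 (r1 / K)); first by rewrite lt_min r20 divr_gt0.
move=> t; rewrite lt_min ltr_pdivlMr// => /andP[t2 t1].
set z := psi (x + t *: v).
have zb b : `|z 0 b - psi x 0 b| <= K * `|t|.
  have e31 : e3 * `|t| <= 1 * `|t| by apply: ler_wpM2r => //; rewrite ge_min lexx.
  have h := h2 b t t2; rewrite -N_real (rmorphB (real_complex R)).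
  rewrite -[X in N X](subrK (t%:C * m b)); apply: le_trans (ND _ _) _; rewrite NM N_real.
  apply: (@le_trans _ _ ((N (m b) + 1) * `|t|)).
    by rewrite mulrDl addrC lerD// ?(le_trans h)// mulrC.
  apply: ler_wpM2r => //; rewrite /K (bigD1 b)//= addrCA lerDl addr_ge0// sumr_ge0// => b' _.
  by rewrite addr_ge0 ?N_ge0.
have zK : `|z - psi x| <= K * `|t|.
  by apply/rv_leP => [|b]; [rewrite mulr_ge0// ltW|rewrite !mxE].
have T := h1 z (le_trans zK (ltW (_ : K * `|t| < r1))).
have {}T : N (g z - g (psi x) - \sum_b partial b g (psi x) * (z 0 b - psi x 0 b)%:C) <= e / 2 * `|t|.
  apply: le_trans (T _) _; first by rewrite mulrC.
  apply: le_trans (ler_wpM2l (ltW e1) zK) _; rewrite mulrA.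
  by have -> : e / (2 * K) * K = e / 2 by field; rewrite lt0r_neq0.
have S : N (\sum_b partial b g (psi x) * (z 0 b - psi x 0 b)%:C - t%:C * \sum_b partial b g (psi x) * m b) <= e / 2 * `|t|.
  rewrite mulr_sumr -sumrB; apply: le_trans (N_sum _ _ _) _.
  apply: (@le_trans _ _ (\sum_b N (partial b g (psi x)) * (e / (2 * (B + 1)) * `|t|))).
    apply: ler_sum => b _; rewrite mulrCA -mulrBr NM; apply: ler_wpM2l; first exact: N_ge0.
    rewrite rmorphB /=; apply: le_trans (h2 b t t2) _; apply: ler_wpM2r => //.
    by rewrite ge_min lexx orbT.
  rewrite -mulr_suml -/B mulrA; apply: ler_wpM2r => //.
  have -> : B * (e / (2 * (B + 1))) = e / 2 * (B / (B + 1)) by field; rewrite lt0r_neq0// ltr_wpDl.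
  by rewrite ler_piMr ?divr_ge0 ?(ltW e0)// ler_pdivrMr ?mul1r ?lerDl// ltr_wpDl.
rewrite -[X in N X](_ : (g z - g (psi x) - \sum_b partial b g (psi x) * (z 0 b - psi x 0 b)%:C) +
   (\sum_b partial b g (psi x) * (z 0 b - psi x 0 b)%:C - t%:C * \sum_b partial b g (psi x) * m b) = _).
  by apply: le_trans (ND _ _) _; rewrite [e in leRHS]splitr mulrDl lerD.
by rewrite addrA subrK.
Qed.

Lemma sm_of_cder X g (G : 'I_d -> V -> C) : open X -> (forall x, X x -> cont g x) ->
  (forall i x, X x -> cder g x (ee R i) (G i x)) -> (forall i, smooth_on X (G i)) -> smooth_on X g.
Proof.
move=> oX gc dg Gs; apply/(smoothP oX) => -[|n]; first exact: gc.
by split=> // i; exists (G i); split; [exact: ((smoothP oX _).1 (Gs i) n)|exact: dg].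
Qed.

Lemma partial_real (p : V -> R) i x :
  partial i (fun x => (p x)%:C) x = (complex.Re (partial i (fun x => (p x)%:C) x))%:C.
Proof.
apply: eqC => //=; rewrite /partial /=.
by rewrite derive_cst.
Qed.

(** Taking logarithms along each axis gives the derivative of [p] as the real part of that of [g]
    divided by [c * g]. This is smooth, so [p] gains its smoothness from the continuity assumed at
    the start. *)
Lemma sm_ln X (p : V -> R) g (c : R) : open X -> c != 0 -> smooth_on X g ->
  (forall x, X x -> g x = (expR (c * p x))%:C) -> (forall x, X x -> cont (fun x => (p x)%:C) x) ->
  smooth_on X (fun x => (p x)%:C).
Proof.
move=> oX c0 gs gE pc.
have cC : c%:C != 0 :> C by rewrite -N_eq0 N_real normr_eq0.
have g0 x : X x -> g x != 0.
  by move=> Xx; rewrite gE// -N_eq0 N_real normr_eq0 lt0r_neq0// expR_gt0.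
apply: (@sm_of_cder X _ (fun i x => (c%:C)^-1 * ((complex.Re (partial i g x))%:C * (g x)^-1)) oX) => [|i x Xx|i].
- exact: pc.
- have dg := sm_cder i gs Xx.
  rewrite -[x in cder _ x](addr0 x) -(scale0r (ee R i)); apply/cder_line.
  rewrite -{1}[x](addr0 x) -(scale0r (ee R i)) in dg.
  have /cder_ReIm[dR _] := (cder_line _ _ _ _ _).1 dg.
  have [r r0 hr] := open_ball oX Xx.
  have Rg (s : R) : `|s| < r -> complex.Re (g (x + s *: ee R i)) = expR (c * p (x + s *: ee R i)).
    by move=> sr; rewrite gE//; apply: hr; rewrite addrC addKr normrZ norm_ee mulr1.
  have R0 : 0 < complex.Re (g (x + 0 *: ee R i)) by rewrite Rg ?normr0// expR_gt0.
  have := @is_derive1_comp R (@ln R) (fun s : R => complex.Re (g (x + s *: ee R i))) 0 _ _ (is_derive1_ln R0) dR.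
  move=> /cder_real /(cderZ (c%:C)^-1).
  have -> : (c%:C)^-1 * (((complex.Re (g (x + 0 *: ee R i)))^-1 * complex.Re (partial i g x))%:C) =
     (c%:C)^-1 * ((complex.Re (partial i g x))%:C * (g x)^-1).
    by rewrite scale0r addr0 rmorphM fmorphV /= mulrC [in RHS]gE//= gE//= [RHS]mulrC; congr (_ * _); rewrite mulrC.
  apply: cder_near r0 _ => s /=; rewrite subr0 => sr.
  by rewrite Rg// expRK rmorphM /= mulKf.
- apply: (smZ oX); apply: (smM oX); last exact: (smV oX g0 gs).
  by apply: (smRe oX); exact: sm_partial.
Qed.

End ChainRule.

(** * Smoothness and rank of the map where the weight does not vanish *)

Section Symbol.
Context (R : realType) (d : nat) (d2 : (2 <= d)%N).
Notation V := 'rV[R]_d.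
Notation C := R[i].
Implicit Types (x y : V) (s : seq 'I_d) (f g : V -> C).

Let d0 : (0 < d)%N. Proof. exact: ltnW. Qed.

Context (k : nat) (c R1 : R) (L : seq (C * seq 'I_d)).
Context (k0 : (0 < k)%N) (c0 : 0 < c) (R10 : 0 <= R1) (eL : ellL k c R1 L) (nd : nondeg k L).
Context (L1 : forall t, t \in L -> (0 < size t.2)%N).
Context (X : set V) (oX : open X) (w : V -> C) (psi : V -> V).
Context (psiX : forall x, X x -> X (psi x)).
Context (psic : forall x, X x -> forall e : R, 0 < e ->
  exists2 r : R, 0 < r & forall y, `|y - x| < r -> `|psi y - psi x| < e).
Context (wd : forall f, sol L X f -> sol L X (fun x => w x * f (psi x))).

Lemma sol_cst (a : C) : sol L X (fun=> a).
Proof.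
split=> [|x Xx]; first exact: sm_cst.
rewrite /opL big_seq big1// => t /L1; case/lastP: (t.2) => // s i _.
rewrite partials_rcons (partials_eq oX s (g := fun=> 0) _ Xx) ?(partials_cst0 oX s Xx) ?mulr0// => y _.
by have /cder_partial[] := cder_cst a y (ee R i).
Qed.

Lemma sol_weight : sol L X w.
Proof.
have [ws w0] := wd (sol_cst 1); have E x : X x -> w x * 1 = w x by move=> _; rewrite mulr1.
split=> [|x Xx]; first exact: sm_eq E ws.
by rewrite -(w0 x Xx) /opL; apply: eq_bigr => t _; congr (_ * _); exact: esym (partials_eq oX t.2 E Xx).
Qed.

Definition wsupp : set V := [set x | X x /\ w x != 0].

Lemma open_wsupp : open wsupp.
Proof.
rewrite openE => x [Xx wx]; have [r r0 hr] := open_ball oX Xx.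
have w0 : 0 < N (w x) by rewrite N_gt0.
have [r' r'0 hr'] := sm_cont sol_weight.1 Xx w0.
have m0 : 0 < Num.min r r' by rewrite lt_min r0.
apply: filterS (nbhs_ball_norm (x : V) m0) => y /=; rewrite lt_min => /andP[h1 h2].
split; first exact: hr.
apply/eqP => wy; have := hr' _ h2; rewrite wy sub0r NN ltxx//.
Qed.

Lemma wsuppX : wsupp `<=` X. Proof. by move=> x []. Qed.

Definition pc b : V -> C := fun x => (psi x 0 b)%:C.

(** Composing with an exponential solution of modulus exp(T x_b), T >= 1, and dividing by the smooth
    nonzero weight gives a smooth [H] with |H|^2 = exp(2 T psi_b). The squared modulus is formed
    from real parts of [H] and [- 'i * H], and [sm_ln] recovers the coordinate [psi_b]. *)
Lemma sm_psi b : smooth_on wsupp (pc b).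
Proof.
have one : `|1 : R| = 1 by rewrite normr1.
have [z [z0 zi zb]] := axis_exp d2 k0 eL nd b 1 one; rewrite mul1r in zb.
pose F x := w x * ex z (psi x).
have [Fs _] := wd (sol_ex X z0).
pose H x := F x * (w x)^-1.
have Hs : smooth_on wsupp H.
  apply: (smM open_wsupp); first exact: smS wsuppX Fs.
  apply: (smV open_wsupp) => [x []//|]; exact: smS wsuppX sol_weight.1.
have HE x : wsupp x -> H x = ex z (psi x) by case=> _ wx; rewrite /H /F mulrAC divff// mul1r.
pose G x : C := (complex.Re (H x))%:C ^+ 2 + (complex.Re ((- 'i) * H x))%:C ^+ 2.
have Gs : smooth_on wsupp G.
  apply: (smD open_wsupp); apply: (smX open_wsupp); apply: (smRe open_wsupp) => //.
  exact: (smZ open_wsupp).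
apply: (@sm_ln R d wsupp (fun x => psi x 0 b) G (2 * complex.Re (z b)) open_wsupp) => //.
- by rewrite mulf_neq0// lt0r_neq0// (lt_le_trans ltr01).
- move=> x Ux; have -> : G x = (N (H x) ^+ 2)%:C.
    rewrite Nsqr rmorphD !rmorphXn /G; congr (_ + _ ^+ 2); congr (_%:C).
    by case: (H x) => u v /=; rewrite oppr0 mul0r mulN1r opprK add0r.
  by rewrite HE// (N_ex_axis _ zi) -expRM_natl mulrA.
- move=> x [Xx _] e e0; have [r r0 hr] := psic Xx e0; exists r => // y yr.
  rewrite -(rmorphB (real_complex R)) N_real; apply: le_lt_trans (hr y yr).
  by have := rv_coord (psi y - psi x) b; rewrite !mxE.
Qed.

Lemma chain_psi g a x : smooth_on X g -> wsupp x ->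
  cder (fun x => g (psi x)) x (ee R a) (\sum_b partial b g (psi x) * partial a (pc b) x).
Proof.
move=> gs Ux; apply: (chain_rule d0 oX gs (psiX Ux.1)) => b.
exact: sm_cder (sm_psi b) Ux.
Qed.

Section Rank.
Context (x0 : V) (Ux0 : wsupp x0).
Definition jac a b : R := complex.Re (partial a (pc b) x0).

Lemma jacE a b : partial a (pc b) x0 = (jac a b)%:C.
Proof. exact: partial_real. Qed.

Section Sequence.
Context (q : nat -> R) (q1 : forall j, 1 <= q j) (z : nat -> 'I_d -> C).
Context (z0 : forall j, sym L (z j) = 0) (B : R) (B0 : 0 <= B) (zB : forall j b, N (z j b) <= B * q j).
Let A : set V := [set x0].
Let AU : A `<=` wsupp. Proof. by move=> x ->. Qed.
Notation O := (ordO wsupp A q).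

(* ex(z) o psi times the operator d_a + cc j a is d_a acting on the product. *)
Definition cc j a x := \sum_b z j b * partial a (pc b) x.
Definition DD j a f x := partial a f x + cc j a x * f x.
Definition Dw j s := foldr (DD j) w s.

Lemma ordO_cst f : smooth_on wsupp f -> O 0 (fun=> f).
Proof.
move=> fs; split=> // s; exists (N (partials s f x0)); first exact: N_ge0.
by move=> j x ->; rewrite expr0 mulr1.
Qed.

Lemma ordO_cc a : O 1 (fun j => cc j a).
Proof.
have H (r : seq 'I_d) : O 1 (fun j x => \sum_(b <- r) z j b * partial a (pc b) x).
  elim: r => [|b r IH].
    have -> : (fun j (x : V) => \sum_(b <- [::]) z j b * partial a (pc b) x) = (fun _ _ => 0).
      by apply/funext => j; apply/funext => x; rewrite big_nil.
    by apply: (ordO_le q1 (leq0n 1)); apply: ordO_cst; exact: (sm_cst open_wsupp).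
  have -> : (fun j (x : V) => \sum_(b <- b :: r) z j b * partial a (pc b) x) =
    (fun j x => z j b * partial a (pc b) x + \sum_(b <- r) z j b * partial a (pc b) x).
    by apply/funext => j; apply/funext => x; rewrite big_cons.
  apply: (ordOD open_wsupp AU) IH.
  have zB1 j : N (z j b) <= B * q j ^+ 1 by rewrite expr1.
  apply: (ordOZ open_wsupp AU B0 zB1 (c := 0)).
  by apply: ordO_cst; apply: sm_partial; exact: sm_psi.
exact: H.
Qed.

Lemma ordO_Dw s : O (size s) (fun j => Dw j s).
Proof.
elim: s => [|a s IH]; first by apply: ordO_cst; exact: smS wsuppX sol_weight.1.
apply: (ordOD open_wsupp AU); first by apply: (ordO_le q1 (leqnSn _)); exact: ordO_partial.
exact: (ordOM open_wsupp AU (ordO_cc a) IH).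
Qed.

Lemma partials_Dw j s x : wsupp x ->
  partials s (fun x => w x * ex (z j) (psi x)) x = Dw j s x * ex (z j) (psi x).
Proof.
elim: s x => [//|a s IH] x Ux /=; rewrite (partial_eq open_wsupp a IH Ux).
have Ds : smooth_on wsupp (Dw j s) by exact: (ordO_Dw s).1.
have E : \sum_b partial b (ex (z j)) (psi x) * partial a (pc b) x = cc j a x * ex (z j) (psi x).
  rewrite /cc mulr_suml; apply: eq_bigr => b _.
  by have /cder_partial[_ ->] := cder_ex (z j) (psi x) b; rewrite mulrAC.
have := chain_psi a (sol_ex X (z0 j)).1 Ux; rewrite E => dE.
have /cder_partial[_ ->] := cderM (sm_cder a Ds Ux) dE.
by rewrite -/(Dw j s) /DD; ring.
Qed.

(** A derivative falling on [w] or on a factor [cc] does not raise the order in [q], so the term of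
    top order only collects the factors [cc]. Multiplying by [q j] avoids the exponent
    [size s - 1]. *)
Lemma Dw_lead s : exists2 K, 0 <= K & forall j,
  q j * N (Dw j s x0 - w x0 * \prod_(a <- s) cc j a x0) <= K * q j ^+ size s.
Proof.
have qp j : 0 <= q j by apply: le_trans (q1 j).
elim: s => [|a s [K K0 IH]].
  by exists 0 => // j; rewrite big_nil mulr1 subrr N0 mulr0 mul0r.
have [K1 K10 h1] := (ordO_partial a (ordO_Dw s)).2 [::].
have [K2 K20 h2] := (ordO_cc a).2 [::].
exists (K1 + K2 * K) => [|j]; first by rewrite addr_ge0 ?mulr_ge0.
rewrite big_cons -[Dw j (a :: s) x0]/(partial a (Dw j s) x0 + cc j a x0 * Dw j s x0).
have -> : partial a (Dw j s) x0 + cc j a x0 * Dw j s x0 - w x0 * (cc j a x0 * \prod_(a <- s) cc j a x0) =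
  partial a (Dw j s) x0 + cc j a x0 * (Dw j s x0 - w x0 * \prod_(a <- s) cc j a x0) by ring.
apply: le_trans (ler_wpM2l (qp j) (ND _ _)) _; rewrite mulrDr mulrDl; apply: lerD.
  rewrite -[size (a :: s)]/(size s).+1 exprS [leRHS]mulrCA; apply: ler_wpM2l => //; exact: (h1 j x0).
rewrite NM mulrCA -[size (a :: s)]/(size s).+1 exprS mulrACA.
apply: ler_pM; rewrite ?N_ge0 ?mulr_ge0 ?N_ge0//.
by have := h2 j x0 erefl; rewrite expr1.
Qed.

Lemma opL_lead (l : seq (C * seq 'I_d)) : (forall t, t \in l -> (size t.2 <= k)%N) ->
  exists2 K, 0 <= K & forall j, N (\sum_(t <- l) t.1 * Dw j t.2 x0 -
    w x0 * sym (topL k l) (fun a => cc j a x0)) <= K * q j ^+ k.-1.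
Proof.
have qp j : 0 < q j by apply: lt_le_trans (q1 j).
elim: l => [|t l IH] H.
  by exists 0 => // j; rewrite big_nil /sym big_nil mulr0 subrr N0 mul0r.
have [K K0 hK] := IH (fun u ul => H u (mem_behead (s := t :: l) ul)).
have tk : (size t.2 <= k)%N by apply: H; rewrite mem_head.
have [K1 K10 h1] : exists2 K1, 0 <= K1 & forall j, N (t.1 * Dw j t.2 x0 -
   w x0 * (if size t.2 == k then t.1 * \prod_(a <- t.2) cc j a x0 else 0)) <= K1 * q j ^+ k.-1.
  case: eqP => [E|/eqP E].
    have [K1 K10 h] := Dw_lead t.2; exists (N t.1 * K1) => [|j]; first by rewrite mulr_ge0 ?N_ge0.
    rewrite mulrCA -mulrBr NM -mulrA; apply: ler_wpM2l; first exact: N_ge0.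
    rewrite -(ler_pM2l (qp j)); apply: le_trans (h j) _.
    by rewrite E mulrCA -exprS prednK.
  have [K1 K10 h] := (ordO_Dw t.2).2 [::]; exists (N t.1 * K1) => [|j]; first by rewrite mulr_ge0 ?N_ge0.
  rewrite mulr0 subr0 NM -mulrA; apply: ler_wpM2l; first exact: N_ge0.
  apply: le_trans (h j x0 erefl) _; apply: ler_wpM2l => //; apply: ler_weXn2l => //.
  by rewrite -ltnS prednK// ltn_neqAle E.
exists (K1 + K) => [|j]; first exact: addr_ge0.
have -> : sym (topL k (t :: l)) (fun a => cc j a x0) =
   (if size t.2 == k then t.1 * \prod_(a <- t.2) cc j a x0 else 0) + sym (topL k l) (fun a => cc j a x0).
  by rewrite /topL /=; case: eqP; rewrite ?add0r// /sym big_cons.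
rewrite big_cons mulrDr opprD addrACA mulrDl; apply: le_trans (ND _ _) _.
by apply: lerD; [exact: h1|exact: hK].
Qed.

Lemma Dw_eq0 j : \sum_(t <- L) t.1 * Dw j t.2 x0 = 0.
Proof.
have [_ /(_ x0 Ux0.1)] := wd (sol_ex X (z0 j)).
rewrite /opL; under eq_bigr do rewrite partials_Dw// mulrA.
by rewrite -mulr_suml => /eqP; rewrite mulf_eq0 (negPf (cexp_neq0 _)) orbF => /eqP.
Qed.

End Sequence.

(* Along zeros zeta ~ s (i v + tau n) of the symbol, the leading term of
   exp(-zeta.psi) P(d)(w exp(zeta.psi)) is w P_k(zeta^T Dpsi). *)
Lemma jac_kernel (v : V) a0 b0 : jac a0 b0 != 0 -> (forall a, \sum_b jac a b * v 0 b = 0) -> v = 0.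
Proof.
move=> j0 H; apply/eqP; apply: contrapT => /negP v0.
have nb : ee R b0 != 0 by rewrite -normr_eq0 norm_ee oner_neq0.
have sb a : \sum_b jac a b * ee R b0 0 b = jac a b0.
  rewrite (bigD1 b0)//= big1 => [|b bb]; rewrite !mxE eqxx /= ?eqxx ?mulr1 ?addr0// (negPf bb) mulr0//.
have vn (t : R) : v + t *: ee R b0 != 0.
  apply: contraNneq v0 => E; have : \sum_b jac a0 b * (v + t *: ee R b0) 0 b = 0.
    by rewrite E big1// => b _; rewrite mxE mulr0.
  rewrite (eq_bigr (fun b => jac a0 b * v 0 b + t * (jac a0 b * ee R b0 0 b))) => [|b _]; last first.
    by rewrite !mxE; ring.
  rewrite big_split /= H add0r -mulr_sumr sb => /eqP; rewrite mulf_eq0 (negPf j0) orbF => /eqP t0.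
  by move: E; rewrite t0 scale0r addr0 => ->.
(* These zeros of the symbol are i q v + rho e_b0. The Jacobian annihilates [v], so [cc] reduces to
   [rho] times the real column [b0]. *)
have [tau [tau0 _ Z]] := zero_dir k0 eL.1 nd nb vn.
have tN : 0 < N tau.
  by rewrite N_gt0; apply: contraNneq tau0 => ->.
have e0 : 0 < N tau / 2 by rewrite divr_gt0.
have [q0 hq] := Z _ e0.
pose q j : R := `|q0| + 1 + j%:R.
have q1 j : 1 <= q j by rewrite /q addrAC lerDr addr_ge0.
have qp j : 0 < q j by apply: lt_le_trans (q1 j).
have qN j : `|q j| = q j by rewrite gtr0_norm.
have /choice[rho hrho] : forall j, exists rho, N (rho - (q j)%:C * tau) <= N tau / 2 * q j /\
    sym L (fun i => 'i * (q j * v 0 i)%:C + rho * (ee R b0 0 i)%:C) = 0.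
  move=> j; have [|rho h1 h2] := hq (q j).
    by rewrite qN /q -addrA; apply: le_trans (ler_norm _) _; rewrite lerDl addr_ge0.
  by exists rho; rewrite -{2}qN.
pose z j i := 'i * (q j * v 0 i)%:C + rho j * (ee R b0 0 i)%:C.
have rho_le j : N (rho j) <= 2 * N tau * q j.
  rewrite -(subrK ((q j)%:C * tau) (rho j)); apply: le_trans (ND _ _) _.
  rewrite NM N_real qN; have := (hrho j).1; have : 0 <= N tau * q j by rewrite mulr_ge0 ?ltW.
  lra.
have rho_ge j : N tau / 2 * q j <= N (rho j).
  have := le_N ((q j)%:C * tau) (rho j); rewrite NBC NM N_real qN; have := (hrho j).1; lra.
pose B := `|v| + 2 * N tau.
have B0 : 0 <= B by rewrite addr_ge0// mulr_ge0// ltW.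
have zB j b : N (z j b) <= B * q j.
  apply: le_trans (ND _ _) _; rewrite /B [leRHS]mulrDl; apply: lerD.
    rewrite NM N_i mul1r N_real normrM qN mulrC; apply: ler_wpM2r; [exact: ltW|exact: rv_coord].
  rewrite NM N_real; apply: le_trans (rho_le j); rewrite ler_piMr ?N_ge0//.
  by apply: le_trans (rv_coord _ _) _; rewrite norm_ee.
have ccE j a : cc z j a x0 = rho j * (jac a b0)%:C.
  rewrite /cc (eq_bigr (fun b => 'i * (q j)%:C * (jac a b * v 0 b)%:C + rho j * (jac a b * ee R b0 0 b)%:C)) => [|b _].
    by rewrite big_split /= -!mulr_sumr -!rmorph_sum /= H sb mulr0 add0r.
  rewrite jacE /z !rmorphM /=; ring.
have [K K0 hK] := opL_lead q1 B0 zB eL.1.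
(* [mu] is real and nonzero, so by ellipticity the leading term is of exact order q^k, while
   everything else is O(q^(k-1)) and the sum vanishes. *)
pose mu : V := \row_a jac a b0.
have mu0 : mu != 0 by apply: contraNneq j0 => /rowP /(_ a0); rewrite !mxE => ->.
have tmu := nd mu0; set T := sym _ _ in tmu.
have topE j : sym (topL k L) (fun a => cc z j a x0) = rho j ^+ k * T.
  rewrite /T -topLZ; congr sym; apply/funext => a; by rewrite ccE mxE.
have wx : 0 < N (w x0) by rewrite N_gt0; case: Ux0.
have TN : 0 < N T by rewrite N_gt0.
have main j : N (w x0) * ((N tau / 2) ^+ k * N T) * q j <= K.
  have := hK j; rewrite (Dw_eq0 q1 (fun j => (hrho j).2) B0 zB).
  rewrite sub0r NN topE NM NM NX => h.
  have qk : 0 < q j ^+ k.-1 by rewrite exprn_gt0.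
  rewrite -(ler_pM2r qk); apply: le_trans h.
  have -> : N (w x0) * ((N tau / 2) ^+ k * N T) * q j * q j ^+ k.-1 = N (w x0) * ((N tau / 2 * q j) ^+ k * N T).
    have qE : q j ^+ k = q j * q j ^+ k.-1 by rewrite -exprS prednK.
    by rewrite [(_ * q j) ^+ k]exprMn qE; ring.
  apply: ler_wpM2l; first exact: ltW.
  apply: ler_wpM2r; first exact: ltW.
  by apply: lerXn2r; rewrite ?nnegrE ?N_ge0 ?mulr_ge0 ?(ltW (qp j)) ?divr_ge0 ?N_ge0.
set A := N (w x0) * _ in main.
have A0 : 0 < A by rewrite mulr_gt0// mulr_gt0// exprn_gt0.
have /archi_boundP : 0 <= K / A by rewrite divr_ge0// ltW.
set m := Num.bound _ => hm; have := main m; rewrite mulrC -ler_pdivlMr// leNgt => /negP; apply.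
by apply: lt_le_trans hm _; rewrite /q lerDr addr_ge0.
Qed.

End Rank.

Context (winj : forall x, X x -> exists2 r : R, 0 < r & forall y z, X y -> X z ->
  `|y - x| < r -> `|z - x| < r -> psi y = psi z -> y = z).
Context (wnf : forall x, X x -> exists2 y, connected_component X x y & w y != 0).

(* Where w != 0, Dpsi is injective or zero; it is not zero on an open set, psi being locally
   injective.  So if g o psi vanishes there, all derivatives of g vanish at some psi x. *)
Lemma wcomp_nonflat g : sol L X g -> (forall x, X x -> exists s, partials s g x != 0) ->
  forall x, X x -> exists s, partials s (fun x => w x * g (psi x)) x != 0.
Proof.
move=> gs gnf x Xx; apply: contrapT => nf; have wg := wd gs.
have fl s : partials s (fun x => w x * g (psi x)) x = 0.
  by apply/eqP; apply: contrapT => /negP h; apply: nf; exists s.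
have [y xy wy] := wnf Xx.
have Xy : X y by have := connected_component_sub xy.
(* Flatness at [x] spreads over the component and so reaches a point [y] with [w y != 0], near which
   the weight can be divided out. *)
have fly s : partials s (fun x => w x * g (psi x)) y = 0.
  apply: (flat_component d0 k0 c0 R10 eL oX (sol_partials s oX wg) _ xy) => s'.
  by rewrite -partials_cat.
have [e /andP[e0 _] he] := flat_local d0 k0 c0 R10 eL.
have [r r0 hr] := open_ball open_wsupp (conj Xy wy : wsupp y).
have [r1 r10 hinj] := winj Xy.
pose m := Num.min (Num.min r 1) r1 / 2.
have mm : 0 < Num.min (Num.min r 1) r1 by rewrite !lt_min r0 r10 ltr01.
have m0 : 0 < m by rewrite divr_gt0.
have ml : [/\ m < r, m <= 1 & m < r1].
  have h1 : Num.min (Num.min r 1) r1 <= r by rewrite !ge_min lexx.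
  have h2 : Num.min (Num.min r 1) r1 <= 1 by rewrite !ge_min lexx orbT.
  have h3 : Num.min (Num.min r 1) r1 <= r1 by rewrite !ge_min lexx orbT.
  by rewrite /m; split; lra.
case: ml => mr m1 mr1.
have m01 : 0 < m <= 1 by rewrite m0.
have Uball z : `|z - y| <= m -> wsupp z by move=> h; apply: hr; exact: le_lt_trans mr.
pose t := e * m / 2; have t0 : 0 < t by rewrite divr_gt0// mulr_gt0.
have em : 0 < e * m by rewrite mulr_gt0.
pose Bl z := `|z - y| < e * m /\ `|z - y| < m.
have oBl z : Bl z -> exists2 r : R, 0 < r & forall z', `|z' - z| < r -> Bl z'.
  move=> [z1 z2]; exists (Num.min (e * m - `|z - y|) (m - `|z - y|)); first by rewrite lt_min !subr_gt0 z1.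
  move=> z'; rewrite lt_min => /andP[h1 h2].
  have tri : `|z' - y| <= `|z' - z| + `|z - y|.
    by rewrite -[z' - y](_ : (z' - z) + (z - y) = _) ?ler_normD// addrA subrK.
  by split; apply: le_lt_trans tri _; rewrite -ltrBrDr.
have UB z : Bl z -> wsupp z by move=> [_ /ltW]; exact: Uball.
have g0 z : Bl z -> g (psi z) = 0.
  move=> Bz; have [Xz wz] := UB z Bz.
  have := he X _ y m m01 oX (fun z h => (Uball z h).1) wg fly z (ltW Bz.1) [::].
  by move=> /= /eqP; rewrite mulf_eq0 (negPf wz) => /eqP.
(* If the Jacobian vanished on the whole ball, [psi] would take the same value at [y] and at a
   different point nearby, against local injectivity. *)
have [z1 [B1 [a [b jn]]]] : exists z, Bl z /\ exists a b, partial a (pc b) z != 0.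
  apply: contrapT => nz.
  have P0 a b z : Bl z -> partial a (pc b) z = 0.
    by move=> Bz; apply/eqP; apply: contrapT => /negP h; apply: nz; exists z; split=> //; exists a, b.
  have B0 : Bl y by rewrite /Bl subrr normr0.
  have [r2 r20 hr2] := oBl y B0; pose u := Num.min r2 m / 2.
  have um : 0 < Num.min r2 m by rewrite lt_min r20.
  have u0 : 0 < u by rewrite divr_gt0.
  have ul : u < r2 /\ u < m.
    have h1 : Num.min r2 m <= r2 by rewrite ge_min lexx.
    have h2 : Num.min r2 m <= m by rewrite ge_min lexx orbT.
    by rewrite /u; split; lra.
  pose i0 := Ordinal d0; pose y' := y + u *: ee R i0.
  have yu : `|y' - y| = u by rewrite /y' addrC addKr normrZ norm_ee mulr1 gtr0_norm.
  have Bu z : `|z - y| <= u -> Bl z by move=> h; apply: hr2; exact: le_lt_trans ul.1.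
  have E : psi y' = psi y.
    apply/rowP => b; apply/eqP; rewrite -subr_eq0 -normr_eq0 -N_real (rmorphB (real_complex R)).
    have := @lip_cube _ _ _ (pc b) y y' u 0 open_wsupp (fun z h => UB z (Bu z h)) (sm_psi b).
    rewrite mulr0 mul0r eq_le N_ge0 andbT; apply; last by rewrite yu.
    by move=> a z h; rewrite P0 ?N0//; exact: Bu.
  have Xy' : X y' by have [] := UB y' (Bu y' (eq_ind_r (fun v => v <= u) (lexx u) yu)).
  have := hinj y' y Xy' Xy; rewrite yu subrr normr0 => /(_ (lt_trans ul.2 mr1) r10 E) /eqP.
  by rewrite -subr_eq0 => /eqP y0; move: yu u0; rewrite y0 normr0 => <-; rewrite ltxx.
have jN : 0 < N (partial a (pc b) z1) by rewrite N_gt0.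
have [r3 r30 hr3] := oBl z1 B1.
have [r4 r40 hr4] := sm_cont (sm_partial a (sm_psi b)) (UB z1 B1) jN.
pose Sm := [set z | `|z - z1| < Num.min r3 r4].
have r34 : 0 < Num.min r3 r4 by rewrite lt_min r30.
have SmB z : Sm z -> Bl z by rewrite /Sm /= lt_min => /andP[h _]; exact: hr3.
have SmJ z : Sm z -> jac z a b != 0.
  rewrite /Sm /= lt_min => /andP[_ h]; apply/eqP => J0.
  by have := hr4 z h; rewrite jacE J0 sub0r NN ltxx.
have oSm z : Sm z -> exists2 r : R, 0 < r & forall z', `|z' - z| < r -> Sm z'.
  move=> zS; exists (Num.min r3 r4 - `|z - z1|); first by rewrite subr_gt0.
  move=> z' h; rewrite /Sm /=; have tri : `|z' - z1| <= `|z' - z| + `|z - z1|.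
    by rewrite -[z' - z1](_ : (z' - z) + (z - z1) = _) ?ler_normD// addrA subrK.
  by apply: le_lt_trans tri _; rewrite -ltrBrDr.
(* When [partials s g] vanishes along [psi] on [Sm], the chain rule puts its gradient into the
   kernel of the Jacobian, which is trivial there. *)
have all0 s : forall z, Sm z -> partials s g (psi z) = 0.
  elim: s => [|i s IH] z zS; first by apply: g0; exact: SmB.
  have Uz := UB z (SmB z zS).
  have gss : smooth_on X (partials s g) by apply: sm_partials; exact: gs.1.
  have Z a' : \sum_b' partial b' (partials s g) (psi z) * partial a' (pc b') z = 0.
    have D1 := chain_psi a' gss Uz.
    have [r5 r50 hr5] := oSm z zS.
    have D2 : cder (fun x => partials s g (psi x)) z (ee R a') 0.
      apply: (cder_near r50 _ (cder_cst 0 z (ee R a'))) => z' h.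
      by rewrite IH//; exact: hr5.
    exact: cder_uniq D1 D2.
  (* [jac_kernel] concerns real vectors; the Jacobian being real, the real and imaginary parts of
     the gradient can be treated separately. *)
  have RI (pr : C -> R) : (forall u v : C, pr (u + v) = pr u + pr v) -> pr 0 = 0 ->
      (forall (u : R) v, pr (u%:C * v) = u * pr v) -> pr (partial i (partials s g) (psi z)) = 0.
    move=> prD pr0 prZ.
    have := @jac_kernel z Uz (\row_b' pr (partial b' (partials s g) (psi z))) a b (SmJ z zS).
    move=> /(_ _)/rowP/(_ i); rewrite !mxE; apply=> a'.
    have := congr1 pr (Z a'); rewrite (big_morph pr prD pr0) pr0 => E; rewrite -[RHS]E.
    by apply: eq_bigr => b' _; rewrite mxE jacE -prZ [in RHS]mulrC.
  apply: eqC; rewrite [RHS]/=.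
    by apply: RI => // [u v|u v]; [exact: ReD|exact: ReM_real].
  by apply: RI => // [u v|u v]; [exact: ImD|exact: ImM_real].
have z1S : Sm z1 by rewrite /Sm /= subrr normr0.
have [s] := gnf _ (psiX (UB z1 B1).1).
by rewrite all0 ?eqxx.
Qed.

End Symbol.

(** * The topologies of the function spaces *)

Section CompactSup.
Context (R : realType) (d : nat).
Notation V := 'rV[R]_d.
Notation C := R[i].
Implicit Types (f g : V -> C) (K : set V) (x : V).

Definition csup K f : R := sup [set N (f x) | x in K].

Lemma csup_ub K f x : compact K -> (forall x, K x -> cont f x) -> K x -> N (f x) <= csup K f.
Proof.
move=> cK fc Kx; have [M M0 h] := compact_bounded_fun cK fc.
apply: sup_upper_bound; last by exists x.
by split; [exists (N (f x)), x|exists M => _ [y Ky <-]; exact: h].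
Qed.

Lemma csup_le K f (M : R) : 0 <= M -> (forall x, K x -> N (f x) <= M) -> csup K f <= M.
Proof.
move=> M0 h; have [[x Kx]|nK] := pselect (exists x, K x).
  apply: ge_sup; first by exists (N (f x)), x.
  by move=> _ [y Ky <-]; exact: h.
rewrite /csup (_ : [set _ | _ in _] = set0) ?sup0//.
by apply/seteqP; split=> // y [x Kx _]; apply: nK; exists x.
Qed.

Lemma csup_ge0 K f : compact K -> (forall x, K x -> cont f x) -> 0 <= csup K f.
Proof.
move=> cK fc; have [[x Kx]|nK] := pselect (exists x, K x).
  by apply: le_trans (N_ge0 (f x)) _; exact: csup_ub.
rewrite /csup (_ : [set _ | _ in _] = set0) ?sup0//.
by apply/seteqP; split=> // y [x Kx _]; apply: nK; exists x.
Qed.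

End CompactSup.

Section UniformFilter.
Context (R : realType) (d : nat) (X : set 'rV[R]_d).
Notation V := 'rV[R]_d.
Notation C := R[i].
Notation fam := [set K : set V | compact K /\ K `<=` X].

Lemma fam_nbhs_ball (f : {family fam, V -> C^o}) K (e : R) : compact K -> K `<=` X -> 0 < e ->
  nbhs f [set g : {family fam, V -> C^o} | forall x, K x -> N (f x - g x) < e].
Proof.
move=> cK KX e0; have e1 : (0 : C) < e%:C by rewrite ltcR.
have := @fam_nbhs _ _ fam K _ f (entourage_ball (R[i]^o : pseudoMetricType C) (PosNum e1)) (conj cK KX).
apply: filterS => g /= h x Kx; have := h x Kx.
by rewrite /ball /= normE ltcR.
Qed.

Lemma fam_cvg_ball (F : set_system (V -> C^o)) (f : V -> C^o) : Filter F ->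
  (forall K (e : R), compact K -> K `<=` X -> 0 < e -> F [set g | forall x, K x -> N (f x - g x) < e]) ->
  F --> (f : {family fam, V -> C^o}).
Proof.
move=> FF H; rewrite -fam_cvgE; apply/fam_cvgP => K [cK KX] P /uniform_nbhs[E [entE EP]].
have [e /= e0 he] : exists2 e : C, 0 < e & forall a b : C^o, ball a e b -> E (a, b).
  by have := entE; rewrite -entourage_ballE => -[e e0 he]; exists e => // a b ab; apply: he.
have eE : e = (complex.Re e)%:C by case: e e0 {he} => a b /=; rewrite ltcE /= => /andP[/eqP ->].
have e1 : 0 < complex.Re e by rewrite -ltcR -eE.
apply: filterS (H K _ cK KX e1) => g h; apply: EP => x Kx.
by apply: he; rewrite /ball /= normE eE ltcR; exact: h.
Qed.

End UniformFilter.

Section SolutionSpace.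
Context (R : realType) (d : nat) (d0 : (0 < d)%N).
Notation V := 'rV[R]_d.
Notation C := R[i].
Context (P : mpoly d C) (X : set V) (oX : open X).
Notation L := (opP P).
Implicit Types (f g : CP P oX) (K : set V) (x : V) (s : seq 'I_d).

Lemma CP_sol f : sol L X f.
Proof.
by have /asboolP[fs f0 _] := CP_valP f; split=> // x Xx; rewrite -diff_opE f0.
Qed.

Lemma sol_eq (h h' : V -> C) : (forall x, X x -> h x = h' x) -> sol L X h -> sol L X h'.
Proof.
move=> E [hs h0]; split=> [|x Xx]; first exact: sm_eq E hs.
rewrite -(h0 x Xx); apply: eq_bigr => t _; congr (_ * _); exact: esym (partials_eq oX t.2 E Xx).
Qed.

Definition extend0 (h : V -> C) : V -> C := fun x => if x \in X then h x else 0.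

Lemma extend0E h x : X x -> extend0 h x = h x.
Proof. by move=> Xx; rewrite /extend0 mem_set. Qed.

Lemma extend0_in h : sol L X h -> in_CP P X (extend0 h).
Proof.
move=> hs; have [es e0] : sol L X (extend0 h) by apply: sol_eq hs => x Xx; rewrite extend0E.
split=> // [x Xx|x nX]; first by rewrite diff_opE e0.
by rewrite /extend0 memNset.
Qed.

Definition CP_of h (hs : sol L X h) : CP P oX := MkCP (asboolT (extend0_in hs)).

Lemma CP_cont f K x : K `<=` X -> K x -> cont f x.
Proof. by move=> KX /KX Xx; exact: sm_cont (CP_sol f).1 Xx. Qed.

Lemma CP_nbhs f K (e : R) : compact K -> K `<=` X -> 0 < e ->
  nbhs f [set g : CP P oX | forall x, K x -> N (f x - g x) < e].
Proof.
move=> cK KX e0.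
have c1 := @initial_continuous _ _ (@CP_jet R d P X oX) f.
have c2 := @proj_continuous (seq 'I_d) (fun _ => {family [set K : set V | compact K /\ K `<=` X], V -> C^o}) [::] (CP_jet f).
exact: c1 _ (c2 _ (@fam_nbhs_ball R d X (CP_jet f [::]) K e cK KX e0)).
Qed.

(** The sets on the right form a filter base along which the jets tend to the jet of 0, so every
    neighbourhood in the initial topology contains one of them. *)
Lemma CP_nbhs0 (U : set (CP P oX)) : nbhs 0 U -> exists (S : seq (seq 'I_d)) K (e : R),
  [/\ compact K, K `<=` X, 0 < e &
   forall f, (forall s x, s \in S -> K x -> N (partials s f x) < e) -> U f].
Proof.
pose D := [set t : seq (seq 'I_d) * set V * R | [/\ compact t.1.2, t.1.2 `<=` X & 0 < t.2]].
pose B (t : seq (seq 'I_d) * set V * R) : set (CP P oX) :=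
  [set f | forall s x, s \in t.1.1 -> t.1.2 x -> N (partials s f x) < t.2].
have FB : Filter (filter_from D B).
  apply: filter_from_filter; first by exists ([::], set0, 1); split=> //=; exact: compact0.
  move=> [[S K] e] [[S' K'] e'] [/= cK KX e0] [/= cK' KX' e'0].
  exists (S ++ S', K `|` K', Num.min e e').
    split=> /=; [exact: compactU|by move=> x [/KX|/KX']|by rewrite lt_min e0].
  by move=> f h; split=> s x sS Kx; have := h s x; rewrite /= mem_cat sS ?orbT lt_min => /(_ isT);
    [move=> /(_ (or_introl Kx)) /andP[]|move=> /(_ (or_intror Kx)) /andP[]].
have cv : (@CP_jet R d P X oX @ filter_from D B) --> CP_jet (0 : CP P oX).
  apply/cvg_sup => s A /= [_ [[W' oW' <-] W0 WA]].
  have : ((fun f : CP P oX => CP_jet f s) @ filter_from D B) --> CP_jet (0 : CP P oX) s.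
    apply: fam_cvg_ball => K e cK KX e0; exists ([:: s], K, e) => // f /= h x Kx.
    rewrite /CP_jet [X in N (X - _)](_ : _ = 0) ?sub0r ?NN ?h ?mem_head//.
    exact: (partials_cst0 oX s (KX x Kx)).
  have nW : nbhs (CP_jet (0 : CP P oX) s) W' by exact: open_nbhs_nbhs.
  by move=> /(_ _ nW) [t Dt ht]; exists t => // f /ht h; exact: WA.
rewrite nbhsE => -[W [[W' oW' <-] W0] WU].
have nW : nbhs (CP_jet (0 : CP P oX)) W' by exact: open_nbhs_nbhs.
have [[[S K] e] [/= cK KX e0] h] := cv _ nW.
by exists S, K, e; split=> // f hf; apply: WU; exact: h.
Qed.

Lemma csup_seminorm K : compact K -> K `<=` X -> continuous_seminorm (fun f : CP P oX => csup K f).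
Proof.
move=> cK KX; have fc f x : K x -> cont f x by move=> Kx; exact: CP_cont KX Kx.
split=> [f g|a f|f].
- apply: csup_le => [|x Kx]; first by apply: addr_ge0; apply: csup_ge0 => // x; exact: fc.
  apply: le_trans (ND _ _) _; apply: lerD; apply: csup_ub => // y; exact: fc.
- have H (b : C) h : csup K ((b *: h : CP P oX) : V -> C) <= N b * csup K h.
    apply: csup_le => [|x Kx]; first by rewrite mulr_ge0 ?N_ge0// csup_ge0// => x; exact: fc.
    rewrite -[(b *: h : CP P oX) x]/(b * h x) NM ler_wpM2l ?N_ge0//; apply: csup_ub => // y; exact: fc.
  apply/eqP; rewrite eq_le H /=; have [->|a0] := eqVneq a 0.
    by rewrite N0 mul0r; apply: csup_ge0 => // y; exact: (fc (0 *: f : CP P oX)).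
  have := H a^-1 (a *: f); rewrite scalerA mulVf// scale1r NV => h.
  by rewrite -ler_pdivlMl// N_gt0.
- move=> A /nbhs_ballP[r /= r0 hA]; pose e := r / 2; have e0 : 0 < e by rewrite divr_gt0.
  apply: filterS (CP_nbhs f cK KX e0) => g h; apply: hA.
  apply: le_lt_trans (_ : e < r); last by rewrite /e; move: r0; lra.
  have T (u v : CP P oX) : (forall x, K x -> N (u x - v x) < e) -> csup K u <= csup K v + e.
    move=> uv; apply: csup_le => [|x Kx]; first by rewrite addr_ge0 ?(ltW e0)// csup_ge0// => x; exact: fc.
    rewrite -[u x](subrK (v x)) addrC; apply: le_trans (ND _ _) _; apply: lerD; last exact: ltW (uv x Kx).
    by apply: csup_ub => // y; exact: fc.
  rewrite ler_norml; apply/andP; split.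
    rewrite lerNl opprB lerBlDl; apply: T => x Kx; rewrite NBC; exact: h.
  by rewrite lerBlDl; exact: T h.
Qed.

End SolutionSpace.

(** * Seminorms on solutions and bounded sets of continuous functions *)

Section Seminorms.
Context (R : realType) (E : preTopologicalLmodType R[i]).
Implicit Types (p : E -> R).

Lemma seminorm0 p : continuous_seminorm p -> p 0 = 0.
Proof. by move=> [_ pZ _]; rewrite -(scale0r (0 : E)) pZ N0 mul0r. Qed.

Lemma seminormZ p (a : R) : 0 <= a -> continuous_seminorm p -> continuous_seminorm (fun f => a * p f).
Proof.
move=> a0 [pD pZ pc]; split=> [f g|b f|f].
- by rewrite -mulrDr ler_wpM2l.
- by rewrite pZ mulrCA.
- by apply: cvgM; [exact: cvg_cst|exact: pc].
Qed.

End Seminorms.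

Section SeminormBound.
Context (R : realType) (d : nat) (d0 : (0 < d)%N).
Notation V := 'rV[R]_d.
Notation C := R[i].
Context (P : mpoly d C) (X : set V) (oX : open X).
Context (k : nat) (c R0 : R) (k0 : (0 < k)%N) (c0 : 0 < c) (R00 : 0 <= R0) (eL : ellL k c R0 (opP P)).

(** By the analytic estimate, suprema over a slightly larger compact set control all derivatives of
    solutions; thus no derivatives are needed to describe the topology. *)
Lemma partials_csup (S : seq (seq 'I_d)) K : compact K -> K `<=` X ->
  exists K' A, [/\ compact K', K' `<=` X, 0 <= A &
    forall (f : CP P oX) s x, s \in S -> K x -> N (partials s f x) <= A * csup K' f].
Proof.
move=> cK KX; have [G G1 HG] := analytic_est d0 k0 c0 R00 eL.
have [r r0 hr] := compact_dist cK oX KX.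
pose r' := Num.min (r / 2) 1.
have r'0 : 0 < r' by rewrite lt_min divr_gt0/=.
have r'1 : r' <= 1 by rewrite ge_min lexx orbT.
have r'r : r' < r by apply: le_lt_trans (_ : r / 2 < r); [rewrite ge_min lexx|move: r0; lra].
pose K' := [set y | exists2 x, K x & `|y - x| <= r'].
have cK' : compact K' by apply: compact_nbhd => //; exact: ltW.
have K'X : K' `<=` X by move=> y [x Kx yx]; apply: (hr x) => //; exact: le_lt_trans r'r.
have t0 (s : seq 'I_d) : 0 <= (size s)`!%:R * (G / r') ^+ size s :> R.
  by rewrite mulr_ge0// exprn_ge0// divr_ge0 ?(ltW r'0)// (le_trans ler01 G1).
exists K', (\sum_(s <- S) (size s)`!%:R * (G / r') ^+ size s); split=> //.
  by apply: sumr_ge0 => s _; exact: t0.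
move=> f s x sS Kx.
have fc y : K' y -> cont f y by move=> K'y; exact: (@CP_cont R d P X oX f K' y K'X K'y).
have := HG X f x r' (csup K' f) s; rewrite r'0 r'1 => /(_ isT oX) h.
apply: le_trans (h _ (CP_sol f) _) _.
- by move=> y yx; apply: K'X; exists x.
- by move=> y yx; apply: csup_ub => //; exists x.
- rewrite ler_wpM2r ?csup_ge0// (big_rem s)//= lerDl; apply: sumr_ge0 => u _; exact: t0.
Qed.

Lemma seminorm_bound (p : CP P oX -> R) : continuous_seminorm p ->
  exists K A, [/\ compact K, K `<=` X, 0 <= A & forall f, p f <= A * csup K f].
Proof.
move=> ps; have [pD pZ pc] := ps.
have nU : nbhs (0 : CP P oX) [set f | p f < 1].
  have := pc 0 [set a | a < 1]; apply; apply: open_nbhs_nbhs; split; first exact: open_lt.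
  by rewrite /= seminorm0.
have [S [K0 [e [cK0 K0X e0 H]]]] := CP_nbhs0 nU.
have [K [A [cK KX A0 HA]]] := partials_csup S cK0 K0X.
exists K, (A / e); split=> //; first by rewrite divr_ge0// ltW.
move=> f; pose q := A * csup K f.
have q0 : 0 <= q by rewrite mulr_ge0// csup_ge0// => x Kx; exact: (@CP_cont R d P X oX f K x KX Kx).
rewrite mulrAC -/q; apply/ler_addgt0Pr => h h0.
(* The summand with [h] keeps the denominator positive when [q = 0]; it is removed by letting [h]
   tend to 0. *)
pose t := e / (q + e * h).
have qh : 0 < q + e * h by rewrite ltr_wpDl// mulr_gt0.
have t0 : 0 < t by rewrite divr_gt0.
have : p (t%:C *: f) < 1.
  apply: H => s x sS K0x; have Xx := K0X _ K0x.
  rewrite (partialsZ oX s t%:C (CP_sol f).1 Xx) NM N_real gtr0_norm//.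
  apply: le_lt_trans (_ : t * q < e); first by rewrite ler_wpM2l ?(ltW t0)// HA.
  by rewrite /t mulrAC ltr_pdivrMr// ltr_pM2l// ltrDl mulr_gt0.
rewrite pZ N_real gtr0_norm// -ltr_pdivlMl// mulr1 => /ltW /le_trans; apply.
by rewrite /t invf_div mulrDl [e * h]mulrC mulfK ?lt0r_neq0.
Qed.

End SeminormBound.

Section ContinuousFunctions.
Context (R : realType) (d : nat) (X : set 'rV[R]_d).
Notation V := 'rV[R]_d.
Notation C := R[i].
Implicit Types (K : set V) (e : R).

Lemma CX_ball0 K e : compact K -> K `<=` X -> 0 < e ->
  nbhs (0 : CX X) [set g : CX X | forall x, K x -> N (g x) < e].
Proof.
move=> cK KX e0; have c1 := @initial_continuous _ _ (@CX_fun R d X) 0.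
have h0 : nbhs (0 : CX X) [set g : CX X | forall x, K x -> N (CX_fun (0 : CX X) x - g x) < e].
  exact: c1 _ (@fam_nbhs_ball R d X (CX_fun 0) K e cK KX e0).
apply: filterS h0 => g h x Kx.
by have := h x Kx; rewrite /CX_fun /= sub0r NN.
Qed.

Lemma CX_nbhs0 (U : set (CX X)) : nbhs 0 U -> exists K e,
  [/\ compact K, K `<=` X, 0 < e & forall f : CX X, (forall x, K x -> N (f x) < e) -> U f].
Proof.
pose D := [set t : set V * R | [/\ compact t.1, t.1 `<=` X & 0 < t.2]].
pose B (t : set V * R) : set (CX X) := [set f | forall x, t.1 x -> N (f x) < t.2].
have FB : Filter (filter_from D B).
  apply: filter_from_filter; first by exists (set0, 1); split=> //=; exact: compact0.
  move=> [K e] [K' e'] [/= cK KX e0] [/= cK' KX' e'0].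
  exists (K `|` K', Num.min e e').
    split=> /=; [exact: compactU|by move=> x [/KX|/KX']|by rewrite lt_min e0].
  by move=> f h; split=> x Kx; have := h x; rewrite /= lt_min;
    [move=> /(_ (or_introl Kx)) /andP[]|move=> /(_ (or_intror Kx)) /andP[]].
have cv : (@CX_fun R d X @ filter_from D B) --> CX_fun (0 : CX X).
  apply: fam_cvg_ball => K e cK KX e0; exists (K, e) => // f /= h x Kx.
  by rewrite /CX_fun sub0r NN h.
rewrite nbhsE => -[W [[W' oW' <-] W0] WU].
have nW : nbhs (CX_fun (0 : CX X)) W' by exact: open_nbhs_nbhs.
have [[K e] [/= cK KX e0] h] := cv _ nW.
by exists K, e; split=> // f hf; apply: WU; exact: h.
Qed.

Lemma CX_bounded (B : set (CX X)) : tvs_bounded B <->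
  (forall K, compact K -> K `<=` X -> exists M, forall f : CX X, B f -> forall x, K x -> N (f x) <= M).
Proof.
split=> [bB K cK KX|H U /CX_nbhs0[K [e [cK KX e0 hU]]]].
  have [r r0 h] := bB _ (CX_ball0 cK KX ltr01); exists r => f Bf x Kx.
  have Nr : N (r%:C) = r by rewrite N_real gtr0_norm.
  have [|g gU <-] := h r%:C _ f Bf; first by rewrite Nr.
  rewrite -[(r%:C *: g : CX X) x]/(r%:C * g x) NM Nr -[leRHS]mulr1.
  by rewrite ler_wpM2l ?(ltW r0)// ltW// gU.
have [M hM] := H K cK KX; have M1 : 0 < `|M| + 1 by rewrite ltr_wpDl.
exists ((`|M| + 1) / e) => [|a ra f Bf]; first exact: divr_gt0.
have Na : 0 < N a by apply: lt_le_trans ra; exact: divr_gt0.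
have a0 : a != 0 by rewrite -N_gt0.
exists (a^-1 *: f); last by rewrite scalerA mulfV// scale1r.
apply: hU => x Kx; rewrite -[(a^-1 *: f : CX X) x]/(a^-1 * f x) NM NV mulrC ltr_pdivrMr//.
move: ra; rewrite ler_pdivrMr// mulrC; apply: lt_le_trans.
apply: le_lt_trans (hM _ Bf _ Kx) _; apply: le_lt_trans (ler_norm M) _; by rewrite ltrDl.
Qed.

Lemma CX_cont (f : CX X) x : open X -> X x -> cont f x.
Proof.
move=> oX Xx; have /asboolP[/subspace_continuousP fc _] := CX_valP f.
apply/contE => A nA; have h : nbhs x [set y | X y -> A (f y)] := fc x Xx A nA.
by apply: filterS2 h (open_nbhs_nbhs (conj oX Xx)) => y; apply.
Qed.

End ContinuousFunctions.

(** * Iterates of the weighted composition operator *)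

Section Iterates.
Context (R : realType) (d : nat).
Notation V := 'rV[R]_d.
Notation C := R[i].
Context (X : set V) (w : V -> C) (psi : V -> V).
Hypothesis psiX : forall x, X x -> X (psi x).

Fixpoint weight (m : nat) (x : V) : C := if m is m'.+1 then w x * weight m' (psi x) else 1.

Lemma iter_X m x : X x -> X (iter m psi x).
Proof. by move=> Xx; elim: m => //= m; exact: psiX. Qed.

(** Stated for an arbitrary space [E] with evaluation [val], it serves solutions and continuous
    functions alike; the identity is asked on [X] only, elements being extended by 0. *)
Lemma iter_wcomp (E : Type) (val : E -> V -> C) (T : E -> E) f m x :
  (forall f x, X x -> val (T f) x = w x * val f (psi x)) ->
  X x -> val (iter m T f) x = weight m x * val f (iter m psi x).
Proof.
move=> TE; elim: m x => [|m IH] x Xx; first by rewrite mul1r.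
rewrite [LHS](TE _ _ Xx) [X in _ * X](IH _ (psiX Xx)) [RHS]/= -mulrA.
by congr (_ * (_ * val f _)); exact: esym (iterSr m psi x).
Qed.

Lemma weight_le m (L : set V) (M : R) x : 1 <= M -> (forall m, L (iter m psi x)) ->
  (forall y, L y -> N (w y) <= M) -> N (weight m x) <= M ^+ m.
Proof.
move=> M1 Lx wM; elim: m x Lx => [|m IH] x Lx; first by rewrite N1.
rewrite /= NM exprS; apply: ler_pM; rewrite ?N_ge0//; first exact: wM (Lx 0%N).
by apply: IH => n; have := Lx n.+1; rewrite iterSr.
Qed.

Lemma iter_cont : (forall x, X x -> forall e : R, 0 < e ->
    exists2 r : R, 0 < r & forall y, `|y - x| < r -> `|psi y - psi x| < e) ->
  forall m x, X x -> forall e : R, 0 < e ->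
    exists2 r : R, 0 < r & forall y, `|y - x| < r -> `|iter m psi y - iter m psi x| < e.
Proof.
move=> psic; elim=> [|m IH] x Xx e e0; first by exists e.
have [r r0 hr] := psic _ (iter_X m Xx) e e0; have [r' r'0 hr'] := IH x Xx r r0.
by exists r' => // y /hr' /hr.
Qed.

End Iterates.

(** The definition splits off the first factor along the orbit, this form the last; the latter
    identifies the [m]-th iterate applied to [w] with the weight of index m + 1. *)
Lemma weightSr (R : realType) d (w : 'rV[R]_d -> R[i]) psi m x :
  weight w psi m.+1 x = weight w psi m x * w (iter m psi x).
Proof.
elim: m x => [|m IH] x; first by rewrite /= mulr1 mul1r.
by rewrite [LHS]/= -/(weight w psi m.+1 (psi x)) IH mulrA -iterSr.
Qed.

(** * Topologizability, power boundedness and stable orbits *)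

Section WeightedComposition.
Context (R : realType) (d : nat) (hd : (2 <= d)%N) (P : mpoly d R[i]).
Context (P_nonconstant : (1 < msize P)%N) (P_elliptic : elliptic P) (P0 : meval (fun=> 0) P = 0).
Context (X : set 'rV[R]_d) (oX : open X) (w : CX X) (psi : 'rV[R]_d -> 'rV[R]_d).
Context (psiX : forall x, X x -> X (psi x)) (psi_cont : {within X, continuous psi}).
Context (w_nonvanishing : forall x, X x -> exists2 y, connected_component X x y & w y != 0).
Context (psi_inj : locally_injective X psi).
Context (well_defined : forall f, in_CP P X f -> in_CP P X (wcomp X w psi f)).
Notation V := 'rV[R]_d.
Notation C := R[i].
Notation L := (opP P).
Notation k := (msize P).-1.
Notation T := (wcomp_CP well_defined : CP P oX -> CP P oX).
Notation S := (wcomp_CX w psiX psi_cont).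
Notation W := (weight w psi).

Let k0 : (0 < k)%N. Proof. by rewrite -ltnS prednK// ltnW. Qed.
Let d0 : (0 < d)%N. Proof. exact: ltnW. Qed.

Let nd : nondeg k L.
Proof. by move=> x x0; rewrite sym_principal; exact: P_elliptic. Qed.

(** An empty word would carry the constant coefficient of [P], which is P(0) = 0. *)
Let L1 t : t \in L -> (0 < size t.2)%N.
Proof.
case/mapP => al alP -> /=; rewrite size_mono_seq lt0n; apply/eqP => al0.
have {al0} E : al = mnm0 by apply/eqP; rewrite -mdeg_eq0 al0.
have c0 : \sum_(b <- msupp P | b != al) mcoeff b P * \prod_(i < d) (0 : R[i]) ^+ b i = 0.
  rewrite big1_seq// => b /andP[ba _]; suff [i bi] : exists i, b i != 0%N.
    by rewrite (bigD1 i)//= expr0n (negPf bi) mul0r mulr0.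
  apply: contrapT => H; move/eqP: ba; apply; rewrite E; apply/mnmP => i; rewrite mnm0E.
  by apply: contrapT => /eqP bi; apply: H; exists i.
move: P0; rewrite mevalE (bigD1_seq al) ?msupp_uniq//= c0 addr0 big1 ?mulr1 => [/eqP|i _].
  by move: alP; rewrite mcoeff_msupp => /negPf ->.
by rewrite E mnm0E expr0.
Qed.

Let ell : exists c R0, [/\ 0 < c, 0 <= R0 & ellL k c R0 L].
Proof. exact: ellL_ex k0 (@opP_size _ _ P) nd. Qed.

Let wd f : sol L X f -> sol L X (fun x => w x * f (psi x)).
Proof.
move=> fs; have := CP_sol (T (CP_of oX fs)); apply: sol_eq => // x Xx.
by rewrite /= /wcomp mem_set// extend0E//; exact: psiX.
Qed.

Let psic x : X x -> forall e : R, 0 < e ->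
  exists2 r : R, 0 < r & forall y, `|y - x| < r -> `|psi y - psi x| < e.
Proof.
move=> Xx e e0; have /subspace_continuousP pc := psi_cont.
have h : nbhs x [set y | X y -> `|psi y - psi x| < e].
  exact: pc x Xx _ (nbhs_ball_norm (psi x) e0).
have /nbhs_ballP[r /= r0 hr] : nbhs x [set y | `|psi y - psi x| < e].
  by apply: filterS2 h (open_nbhs_nbhs (conj oX Xx)) => y; apply.
by exists r => // y yx; apply: hr; rewrite -ball_normE /= distrC.
Qed.

Let winj x : X x -> exists2 r : R, 0 < r &
  forall y z, X y -> X z -> `|y - x| < r -> `|z - x| < r -> psi y = psi z -> y = z.
Proof.
move=> Xx; have [U /nbhs_ballP[r /= r0 hr] UI] := psi_inj Xx.
have B y : `|y - x| < r -> U y by move=> yx; apply: hr; rewrite -ball_normE /= distrC.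
exists r => // y z Xy Xz yx zx; apply: UI; apply: mem_set; split=> //; exact: B.
Qed.

Lemma T_iterE m (f : CP P oX) x : X x -> iter m T f x = W m x * f (iter m psi x).
Proof.
apply: (iter_wcomp psiX (val := @CP_val R d P X oX)) => g y Xy.
by rewrite /= /wcomp mem_set.
Qed.

Lemma S_iterE m x : X x -> iter m S w x = W m.+1 x.
Proof.
move=> Xx; rewrite weightSr.
apply: (iter_wcomp psiX (val := @CX_val R d X)) => // g y Xy.
by rewrite /= /wcomp mem_set.
Qed.

(** The weight of index [m] is the [m]-th iterate of the operator applied to the constant solution
    1, and each application preserves the absence of flat points. *)
Lemma weight_sol m : sol L X (W m) /\ forall x, X x -> exists s, partials s (W m) x != 0.
Proof.
have [c [R0 [c0 R00 eL]]] := ell; elim: m => [|m [IH IH']].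
  by split=> [|x Xx]; [exact: (sol_cst L1 oX 1)|exists [::]; rewrite /= oner_eq0].
split=> [|x Xx]; first exact: wd.
exact: (wcomp_nonflat hd k0 c0 R00 eL nd L1 oX psiX psic wd winj w_nonvanishing IH IH' Xx).
Qed.

Lemma weight_dense m x (r : R) : X x -> 0 < r -> exists y, [/\ `|y - x| < r, X y & W m y != 0].
Proof.
move=> Xx r0; apply: contrapT => H; have [_ /(_ x Xx)[s]] := weight_sol m.
pose Y := [set y | X y /\ `|y - x| < r].
have oY : open Y.
  rewrite openE => y [Xy yx]; apply: filterS2 (open_nbhs_nbhs (conj oX Xy)) (nbhs_ball_norm y (_ : 0 < r - `|y - x|)).
    by move=> z Xz zy; split=> //; have := ler_distD y z x; move: zy => /=; lra.
  by rewrite subr_gt0.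
have Yx : Y x by split=> //; rewrite subrr normr0.
rewrite (partials_eq oY s (_ : forall y, Y y -> W m y = 0) Yx) ?(partials_cst0 oY)// ?eqxx//.
by move=> y [Xy yx]; apply: contrapT => /eqP W0; apply: H; exists y.
Qed.

(** The operator is tested on a compact neighbourhood [K1] of [K], which leaves room to replace a
    point where the weight vanishes by a nearby one where it does not. *)
Lemma topologizable_stable : topologizable T -> stable_orbits X psi.
Proof.
have [c [R0 [c0 R00 eL]]] := ell; move=> tT K cK KX.
have [r r0 hr] := compact_dist cK oX KX; have r20 : 0 < r / 2 by rewrite divr_gt0.
pose K1 := [set y | exists2 x, K x & `|y - x| <= r / 2].
have cK1 : compact K1 by apply: compact_nbhd => //; exact: ltW.
have K1X : K1 `<=` X by move=> y [x Kx yx]; apply: (hr x) => //; move: r0 yx; lra.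
have [q qs hq] := tT _ (csup_seminorm P oX cK1 K1X).
have [K' [A [cK' K'X A0 hA]]] := seminorm_bound d0 k0 c0 R00 eL qs.
(* [D] and [e] depend on [K'] only and are fixed before [m]; this makes [L'] a common compact set
   for all iterates. *)
have [D [e [e0 hull]]] := hull hd k0 c0 R00 eL nd L1 cK' oX K'X.
pose L' := [set x : V | `|x| <= D /\ forall z, `|z - x| < e -> X z].
have L'c x : ~ L' x -> exists2 h : R, 0 < h & forall y, `|y - x| < h -> ~ L' y.
  have [xD|Dx] := leP `|x| D => nL.
    have [z [zx nXz]] : exists z, `|z - x| < e /\ ~ X z.
      apply: contrapT => H; apply: nL; split=> // z zx; apply: contrapT => nX; apply: H; by exists z.
    exists (e - `|z - x|) => [|y yx [_ /(_ z) Ly]]; first by rewrite subr_gt0.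
    by apply: nXz; apply: Ly; have := ler_distD x z y; rewrite (distrC x y); move: yx; lra.
  exists (`|x| - D) => [|y yx [yD _]]; first by rewrite subr_gt0.
  have := lerB_dist x y; rewrite distrC; move: yx yD Dx; lra.
exists L'; split=> [|x [_ Lx]|m _ [x Kx <-]].
- by apply: (@compact_of_ball _ _ _ D) => // x [].
- by apply: Lx; rewrite subrr normr0.
(* The complement of [L'] is open, so if the iterate at [x] leaves [L'], it does so at all nearby
   points, among them some [y] with nonzero weight; [hull] excludes this for [y]. *)
have Xx := KX _ Kx; apply: contrapT => /L'c[h h0 hL].
have [r' r'0 hr'] := iter_cont psiX psic m Xx h0.
have [y [yx Xy Wy]] : exists y, [/\ `|y - x| < Num.min r' (r / 2), X y & W m y != 0].
  by apply: weight_dense => //; rewrite lt_min r'0.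
move: yx; rewrite lt_min => /andP[yr' yr]; apply: (hL _ (hr' _ yr')).
have K1y : K1 y by exists x => //; exact: ltW.
have [g g0 hg] := hq m; have NW : 0 < N (W m y) by rewrite N_gt0.
apply: (hull (g * A / N (W m y))) => [||f M M0 fs fM].
- by rewrite divr_ge0 ?mulr_ge0 ?(ltW g0) ?N_ge0.
- exact: iter_X.
have Xy' := iter_X psiX m Xy.
rewrite mulrAC ler_pdivlMr// mulrC -(extend0E f Xy').
pose F := CP_of oX fs; rewrite -[extend0 X f _]/(F _) -NM -T_iterE//.
have Fc : forall z, K1 z -> cont (iter m T F) z by move=> z Kz; exact: CP_cont K1X Kz.
apply: le_trans (csup_ub cK1 Fc K1y) _; apply: le_trans (hg F) _.
rewrite -mulrA ler_wpM2l ?(ltW g0)//; apply: le_trans (hA F) _; rewrite ler_wpM2l//.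
by apply: csup_le => // z Kz; rewrite [F z](extend0E f (K'X _ Kz)); exact: fM.
Qed.

(** Both converse implications rest on this estimate: the compact sets and [A] depend on the
    seminorm only, and the iterate enters solely through a bound for its weight on [K]. *)
Lemma stable_bound p : stable_orbits X psi -> continuous_seminorm (p : CP P oX -> R) ->
  exists K L' (A : R), [/\ compact K /\ K `<=` X, compact L' /\ L' `<=` X, 0 <= A,
    forall m x, K x -> L' (iter m psi x) &
    forall m B f, 0 <= B -> (forall x, K x -> N (W m x) <= B) ->
      p (iter m T f) <= B * (A * csup L' f)].
Proof.
have [c [R0 [c0 R00 eL]]] := ell; move=> st ps.
have [K [A [cK KX A0 hA]]] := seminorm_bound d0 k0 c0 R00 eL ps.
have [L' [cL LX hL]] := st K cK KX.
have KL m x : K x -> L' (iter m psi x) by move=> Kx; apply: (hL m); exists x.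
exists K, L', A; split=> // m B f B0 WB.
have fc x : L' x -> cont f x by move=> Lx; exact: CP_cont LX Lx.
apply: le_trans (hA _) _; rewrite mulrCA ler_wpM2l//.
apply: csup_le => [|x Kx]; first by rewrite mulr_ge0// csup_ge0.
rewrite T_iterE ?NM; last exact: KX.
by apply: ler_pM; rewrite ?N_ge0 ?WB//; apply: csup_ub => //; exact: KL.
Qed.

Lemma stable_m_topologizable : stable_orbits X psi -> m_topologizable T.
Proof.
move=> st p ps; have [K [L' [A [[cK KX] [cL LX] A0 KL H]]]] := stable_bound st ps.
have [M M0 hM] := compact_bounded_fun cL (fun x Lx => CX_cont w oX (LX x Lx)).
exists (fun f : CP P oX => A * csup L' f); first exact: seminormZ A0 (csup_seminorm P oX cL LX).
exists (Num.max 1 M) => [|m f]; first by rewrite lt_max ltr01.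
have M1 : 1 <= Num.max 1 M by rewrite le_max lexx.
apply: H => [|x Kx]; first by rewrite exprn_ge0// (le_trans ler01).
apply: (@weight_le _ _ w psi m L') => // [n|y Ly]; first exact: KL.
by rewrite le_max hM ?orbT.
Qed.

Lemma m_topologizable_topologizable : m_topologizable T -> topologizable T.
Proof.
move=> mT p ps; have [q qs [g g0 h]] := mT p ps; exists q => // m.
by exists (g ^+ m) => //; exact: exprn_gt0.
Qed.

Lemma power_bounded_topologizable : power_bounded T -> topologizable T.
Proof.
by move=> pT p ps; have [q qs h] := pT p ps; exists q => // m; exists 1 => // x; rewrite mul1r.
Qed.

(** As [w] is itself a solution, its iterates under both operators agree on [X], and power
    boundedness is applied to this one solution. *)
Lemma power_bounded_orbit : power_bounded T -> tvs_bounded [set iter m S w | m in [set: nat]].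
Proof.
move=> pT; apply/CX_bounded => K cK KX.
have [q qs hq] := pT _ (csup_seminorm P oX cK KX).
have ws : sol L X w by exact: (sol_weight L1 oX wd).
exists (q (CP_of oX ws)) => _ [m _ <-] x Kx; apply: le_trans (hq m _).
have Xx := KX _ Kx; rewrite S_iterE// weightSr -(extend0E w (iter_X psiX m Xx)).
have -> : W m x * extend0 X w (iter m psi x) = iter m T (CP_of oX ws) x by rewrite T_iterE.
by apply: csup_ub => // y Ky; exact: CP_cont KX Ky.
Qed.

Lemma topologizable_power_bounded : topologizable T ->
  tvs_bounded [set iter m S w | m in [set: nat]] -> power_bounded T.
Proof.
move=> tT /CX_bounded bS p ps.
have [K [L' [A [[cK KX] [cL LX] A0 KL H]]]] := stable_bound (topologizable_stable tT) ps.
have [M hM] := bS K cK KX; have B0 : 0 <= Num.max 1 M by rewrite le_max ler01.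
exists (fun f : CP P oX => Num.max 1 M * (A * csup L' f)).
  exact: seminormZ B0 (seminormZ A0 (csup_seminorm P oX cL LX)).
move=> m f; apply: H => // x Kx; rewrite le_max.
(* The orbit of [w] starts with the weight of index 1; index 0 has weight 1, which explains the
   maximum with 1. *)
case: m => [|m]; first by rewrite N1 lexx.
by rewrite -S_iterE; [rewrite hM ?orbT//; exists m|exact: KX].
Qed.

End WeightedComposition.

Theorem theorem4p5 (R : realType) (d : nat) (hd : (2 <= d)%N)
  (P : mpoly d R[i]) (P_nonconstant : (1 < msize P)%N)
  (P_elliptic : elliptic P) (P0 : meval (fun=> 0) P = 0)
  (X : set 'rV[R]_d) (oX : open X)
  (w : CX X) (psi : 'rV[R]_d -> 'rV[R]_d)
  (psiX : forall x, X x -> X (psi x))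
  (psi_cont : {within X, continuous psi})
  (w_nonvanishing : forall x, X x ->
     exists2 y, connected_component X x y & w y != 0)
  (psi_inj : locally_injective X psi)
  (well_defined : forall f, in_CP P X f -> in_CP P X (wcomp X w psi f)) :
  let T : CP P oX -> CP P oX := wcomp_CP well_defined in
  let S : CX X -> CX X := wcomp_CX w psiX psi_cont in
  ((m_topologizable T <-> topologizable T) /\
   (topologizable T <-> stable_orbits X psi)) /\
  (power_bounded T <->
   topologizable T /\ tvs_bounded [set iter m S w | m in [set: nat]]).
Proof.
move=> T S.
have ts : topologizable T -> stable_orbits X psi by exact: topologizable_stable.
have sm : stable_orbits X psi -> m_topologizable T by exact: stable_m_topologizable.
have mt : m_topologizable T -> topologizable T by exact: m_topologizable_topologizable.
split; first by split; split=> //; [move/ts/sm|move/sm/mt].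
split=> [pT|[tT bS]]; last exact: topologizable_power_bounded bS.
by split; [exact: power_bounded_topologizable|exact: power_bounded_orbit pT].
Qed.
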